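(* Let $\mu\in(0,\infty)$ and $\alpha,\beta\in\mathbb{R}$ be such that $\gamma:=1+\alpha+\frac{\beta^2}{2\mu}>0$. Given $u_0\in L_2(\Omega)$ and $K=K(t,z)$ with $K\in L_2(0,t;L_2(\Omega))$ for all $t>0$, there exists a global weak solution $u$ to $$u_t=\mu\Delta u-u\,u_x+u_y\,Tu_x+\alpha u-\beta Tu_x+K\ \text{ in }\Omega,\ t>0,\qquad u=0\ \text{ on }\partial\Omega,\ t>0,\qquad u(0)=u_0,$$ with the following properties: (i) for all $t>0$ we have $u\in L_\infty(0,t;L_2(\Omega))\cap L_2(0,t;H^1(\Omega))$; (ii) for all $t>0$ and all $\phi\in \mathrm{C}^\infty([0,t]\times\overline{\Omega})$ with the property that there exists $M>0$ with $\operatorname{supp}\phi(\tau)\subset(-2^M,2^M)\times(0,1)$ for all $\tau\in[0,t]$, we have $$\int_\Omega u(t)\phi(t)\,\mathrm{d}z-\int_\Omega u_0\,\phi(0)\,\mathrm{d}z-\int_0^t\int_\Omega u\,\partial_t\phi\,\mathrm{d}z\,\mathrm{d}\tau+\int_0^t\int_\Omega \Big[\mu\nabla u\cdot\nabla\phi+u\,T\partial_xu\,\partial_y\phi+\phi\big(2u\,\partial_xu-\alpha u+\beta T\partial_xu-K\big)\Big]\,\mathrm{d}z\,\mathrm{d}\tau=0;$$ (iii) for almost all $t>0$ $$\mathcal{E}(u(t)e^{-\gamma t})+\frac12\int_0^t\int_\Omega e^{-2\gamma\tau}\big(\mu|\nabla u|^2+u^2\big)\,\mathrm{d}z\,\mathrm{d}\tau\le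 \mathcal{E}(u_0)+\frac12\int_0^t\int_\Omega K^2\,\mathrm{d}z\,\mathrm{d}\tau.$$
   Context: $\Omega:=\{z=(x,y)\in\mathbb{R}^2: x\in\mathbb{R},\ 0<y<1\}$. For a function $u$ on $\Omega$, $Tu(x,y):=\int_0^y u(x,s)\,\mathrm{d}s$, and $T\partial_xu=Tu_x:=T(u_x)$. $\mathcal{E}(u):=\frac12\int_\Omega u^2\,\mathrm{d}z$. Functions are real-valued. $\operatorname{supp}\phi(\tau)$ is the closure in $\mathbb{R}^2$ of the set where $\phi(\tau,\cdot)\neq0$. The notion of global weak solution (a function on $[0,\infty)\times\Omega$) is expressed by properties (i) and (ii). *)

(* Defs.v *)
From HB Require Import structures.
From mathcomp Require Import all_boot all_order all_algebra.
From mathcomp Require Import all_classical all_reals all_analysis.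
Import Order.TTheory GRing.Theory Num.Theory numFieldNormedType.Exports.

Set Implicit Arguments.
Unset Strict Implicit.
Unset Printing Implicit Defensive.

Local Open Scope classical_set_scope.
Local Open Scope ring_scope.

Section Smoothness.
Context {R : realType} {V : normedModType R}.

(* [Ck k E f]: [f] is C^k on the interior of [E] and all its directional
   derivatives of order at most [k] extend continuously to [E] (the function
   [g] below is such an extension).  For E the closure of an open set this is
   C^k(E), up to the boundary; for E = setT it is the usual notion.  The values
   of [f] outside [E] are irrelevant. *)
Fixpoint Ck (k : nat) (E : set V) (f : V -> R) : Prop :=
  {within E, continuous f} /\
  match k with
  | 0 => True
  | k'.+1 => forall v : V, exists g : V -> R,
      Ck k' E g /\ forall x, interior E x -> is_derive x v f (g x)
  end.

Definition smooth_on (E : set V) (f : V -> R) : Prop := forall k, Ck k E f.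

Definition Cc_infty (U : set V) (f : V -> R) : Prop :=
  [/\ smooth_on setT f,
      compact (closure [set x | f x != 0]) &
      closure [set x | f x != 0] `<=` U].

End Smoothness.

Section Strip.
Context {R : realType}.

Definition Omega : set (R * R) := [set z | 0 < z.2 < 1].

Definition leb1 : {sigma_finite_measure set (measurableTypeR R) -> \bar R} :=
  lebesgue_measure.

Definition leb2 := (leb1 \x leb1)%E.

HB.instance Definition _ := Measure.on leb2.

Lemma leb2_sigma_finite : sigma_finite setT leb2.
Proof.
have /sigma_finiteP[F [TF ndF Foo]] := sigma_finiteT leb1.
exists (fun n => F n `*` F n).
  rewrite -setXTT [in LHS]TF predeqE => -[x y]; split.
    move=> [/= [n _ Fnx] [k _ Fky]]; exists (maxn n k) => //; split.
    - by move: x Fnx; exact/subsetPset/ndF/leq_maxl.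
    - by move: y Fky; exact/subsetPset/ndF/leq_maxr.
  by move=> [n _ []/= ? ?]; split; exists n.
move=> k; have [? ?] := Foo k.
split; first exact: measurableX.
by rewrite /leb2 product_measure1E// lte_mul_pinfty// ge0_fin_numE.
Qed.

HB.instance Definition _ :=
  Measure_isSigmaFinite.Build _ _ _ leb2 leb2_sigma_finite.

Definition leb3 := (leb1 \x leb2)%E.

HB.instance Definition _ := Measure.on leb3.

(* The values of [f] outside [Omega] are irrelevant. *)
Definition L2norm (f : R * R -> R) : \bar R :=
  'N[leb2]_2%:E[EFin \o (f \_ Omega)].

Definition L2 (f : R * R -> R) : Prop := (f \_ Omega) \in Lfun leb2 2%:E.

(* L_2(0,t;L_2(Omega)), identified with L_2((0,t) x Omega) *)
Definition L2L2 (t : R) (u : R -> R * R -> R) : Prop :=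
  ((fun p : R * (R * R) => u p.1 p.2) \_ (`]0, t[ `*` Omega)) \in Lfun leb3 2%:E.

(* Finiteness of the L_oo(0,t;L_2(Omega)) norm; measurability in time and space
   is part of [L2L2]. *)
Definition LooL2 (t : R) (u : R -> R * R -> R) : Prop :=
  L2L2 t u /\
  ('N[leb1]_+oo[(fun tau => L2norm (u tau)) \_ `]0%R, t[] < +oo)%E.

Definition weak_derivative (v : R * R) (f g : R * R -> R) : Prop :=
  forall psi : R * R -> R, Cc_infty Omega psi ->
    \int[leb2]_(z in Omega) (f z * 'D_v psi z) =
    - \int[leb2]_(z in Omega) (g z * psi z).

(* [H1 f fx fy]: f belongs to H^1(Omega), with weak gradient (fx, fy). *)
Definition H1 (f fx fy : R * R -> R) : Prop :=
  [/\ L2 f, L2 fx, L2 fy,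
      weak_derivative (1, 0) f fx & weak_derivative (0, 1) f fy].

(* Vanishing on the boundary for f in H^1(Omega) with weak gradient (fx, fy):
   f is in the closure of C_c^oo(Omega) for the H^1 norm. *)
Definition H10 (f fx fy : R * R -> R) : Prop :=
  H1 f fx fy /\
  forall e : R, 0 < e -> exists psi : R * R -> R,
    [/\ Cc_infty Omega psi,
        (L2norm (fun z => (psi z - f z)%R) < e%:E)%E,
        (L2norm (fun z => ('D_(1, 0) psi z - fx z)%R) < e%:E)%E &
        (L2norm (fun z => ('D_(0, 1) psi z - fy z)%R) < e%:E)%E].

(* L_2(0,t;H^1(Omega)), with (ux tau, uy tau) the weak gradient of u tau *)
Definition L2H1 (t : R) (u ux uy : R -> R * R -> R) : Prop :=
  [/\ L2L2 t u, L2L2 t ux, L2L2 t uy &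
      {ae leb1, forall tau, 0 < tau < t -> H1 (u tau) (ux tau) (uy tau)}].

Definition T (f : R * R -> R) (z : R * R) : R :=
  \int[leb1]_(s in `]0, z.2[) f (z.1, s).

Definition energy (f : R * R -> R) : R :=
  2^-1 * \int[leb2]_(z in Omega) (f z) ^+ 2.

Definition test_function (t : R) (phi : R * (R * R) -> R) : Prop :=
  smooth_on (`[0, t] `*` closure Omega) phi /\
  exists2 M : R, 0 < M & forall tau, 0 <= tau <= t ->
    closure [set z | closure Omega z /\ phi (tau, z) != 0] `<=`
    `](- (2 `^ M)), (2 `^ M)[ `*` `]0, 1[.

Definition weak_formulation (mu alpha beta : R) (u0 : R * R -> R)
    (K u ux uy : R -> R * R -> R) (t : R) (phi : R * (R * R) -> R) : Prop :=
  \int[leb2]_(z in Omega) (u t z * phi (t, z))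
  - \int[leb2]_(z in Omega) (u0 z * phi (0, z))
  - \int[leb1]_(tau in `]0, t[) \int[leb2]_(z in Omega)
      (u tau z * 'D_(1, (0, 0)) phi (tau, z))
  + \int[leb1]_(tau in `]0, t[) \int[leb2]_(z in Omega)
      (mu * (ux tau z * 'D_(0, (1, 0)) phi (tau, z)
             + uy tau z * 'D_(0, (0, 1)) phi (tau, z))
       + u tau z * T (ux tau) z * 'D_(0, (0, 1)) phi (tau, z)
       + phi (tau, z) * (2 * u tau z * ux tau z - alpha * u tau z
                         + beta * T (ux tau) z - K tau z))
  = 0.

(* Global weak solution u with weak gradient (ux, uy). The requirement that
   u t be in L_2(Omega) for every (not only almost every) t gives a meaning to
   the integral of u(t) phi(t) in the weak formulation. *)
Definition global_weak_solution (mu alpha beta : R) (u0 : R * R -> R)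
    (K u ux uy : R -> R * R -> R) : Prop :=
  [/\ forall t, 0 <= t -> L2 (u t),
      forall t, 0 < t -> LooL2 t u /\ L2H1 t u ux uy,
      forall t phi, 0 < t -> test_function t phi ->
        weak_formulation mu alpha beta u0 K u ux uy t phi,
      {ae leb1, forall tau, 0 < tau -> H10 (u tau) (ux tau) (uy tau)} &
      {ae leb2, forall z, Omega z -> u 0 z = u0 z}].

End Strip.

(* Main.v *)
Require Import Defs.
From mathcomp Require Import all_boot all_order all_algebra.
From mathcomp Require Import all_classical all_reals all_analysis.
From mathcomp Require Import measurable_realfun.
From mathcomp Require Import ring lra.
Import Order.TTheory GRing.Theory Num.Theory numFieldNormedType.Exports.

Set Implicit Arguments.
Unset Strict Implicit.
Unset Printing Implicit Defensive.

Local Open Scope classical_set_scope.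
Local Open Scope ring_scope.

(** Galerkin approximation: explicit Euler steps in the span of the first n
    elements of an orthonormal family of test functions which is dense for the
    C^1 norm.  The field (u, - T u_x) is divergence free, so the transport terms
    do no work, and Young's inequality on beta u T u_x gives the energy
    inequality.  Limits are taken along an ultrafilter on the indices.  The
    coefficients converge locally uniformly in time by Hoelder continuity, the
    gradients converge weakly, and a closed convex property which holds often
    along the ultrafilter survives in the limit because the limit is a norm
    limit of iterated midpoints of approximations (Mazur, by the parallelogram
    identity).  The products u u_x and u T u_x pass to the limit because the
    approximations converge strongly on bounded sets: by the Poincare inequality
    on a grid of small squares the distance is controlled by finitely many
    weighted averages.  For a time-dependent test function, the defect in the
    weak formulation is additive over time intervals and of smaller order than
    their length. *)

(** * Square-integrable functions *)

(** The strip is unbounded, so H^1 does not embed compactly into L_2; the products are tested only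
    against functions supported in a bounded box, for which local strong convergence is enough. The
    constant [gamma] is what the energy estimate leaves: the square of [mu T u_x + beta u] is
    nonnegative and T is a contraction of L_2 because the strip has height 1, so the beta term costs
    at most half of the dissipation plus [beta ^+ 2 / (2 * mu)] times u^2; the summand 1 pays in
    equal parts for Young's inequality on K u and for the term u^2 on the left. An Euler step
    violates this balance by an error quadratic in the step, with a constant depending on n, so the
    step is chosen after n. The ultrafilter gives every bounded sequence a limit at once, hence a
    limit at every time; this is why the energy inequality is obtained for all t > 0. The support of
    a test function at time tau may approach the boundary of the strip as tau varies, so it is never
    approximated as a whole in space and time: it is frozen at interior times, where its slices have
    compact support in the strip. *)

Section SquareIntegrable.
Context d (X : measurableType d) (R : realType).
Variable mu : {measure set X -> \bar R}.
Implicit Types f g h : X -> R.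

Definition intg f := mu.-integrable setT (EFin \o f).
Definition Int f := \int[mu]_x f x.
(** Functions, not classes, over the whole space: functions on the strip are extended by zero, and
    time intervals are imposed by multiplying with windows. Slices and pointwise identities are then
    available directly. *)
Definition sq f := measurable_fun setT f /\ intg (fun x => f x ^+ 2).
Definition ip f g := Int (fun x => f x * g x).

Lemma intg_meas f : intg f -> measurable_fun setT f.
Proof. by move=> /integrableP[/measurable_EFinP]. Qed.

Lemma intgP f : intg f <->
  measurable_fun setT f /\ (\int[mu]_x (`|f x|)%:E < +oo)%E.
Proof.
split; first by move=> /integrableP[/measurable_EFinP mf ?]; split.
by move=> [mf ?]; apply/integrableP; split => //; exact/measurable_EFinP.
Qed.

Lemma intg_le f g : measurable_fun setT f -> intg g ->
  (forall x, `|f x| <= `|g x|) -> intg f.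
Proof.
move=> mf ig fg; apply: (le_integrable measurableT _ _ ig) => //.
  exact/measurable_EFinP.
by move=> x _ /=; rewrite lee_fin.
Qed.

Lemma intgD f g : intg f -> intg g -> intg (fun x => f x + g x).
Proof. by move=> fi gi; have := integrableD measurableT fi gi. Qed.

Lemma intgZ a f : intg f -> intg (fun x => a * f x).
Proof. by move=> fi; have := integrableZl measurableT a fi. Qed.

Lemma intgN f : intg f -> intg (fun x => - f x).
Proof.
by move=> fi; have := intgZ (-1) fi; under eq_fun do rewrite mulN1r.
Qed.

Lemma intgB f g : intg f -> intg g -> intg (fun x => f x - g x).
Proof. by move=> fi gi; exact: intgD fi (intgN gi). Qed.

Lemma intg0 : intg (fun=> 0).
Proof. exact: integrable0. Qed.

Lemma intg_sum n (F : nat -> X -> R) : (forall i, (i < n)%N -> intg (F i)) ->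
  intg (fun x => \sum_(i < n) F i x).
Proof.
elim: n => [|n IH] Fi; first by under eq_fun do rewrite big_ord0; exact: intg0.
under eq_fun do rewrite big_ord_recr /=.
by apply: intgD; [apply: IH => i ?; apply: Fi; exact: ltnW|exact: Fi].
Qed.

Lemma eq_Int f g : (forall x, f x = g x) -> Int f = Int g.
Proof. by move=> fg; apply: eq_Rintegral => x _. Qed.

Lemma IntD f g : intg f -> intg g -> Int (fun x => f x + g x) = Int f + Int g.
Proof. by move=> fi gi; rewrite /Int RintegralD. Qed.

Lemma IntB f g : intg f -> intg g -> Int (fun x => f x - g x) = Int f - Int g.
Proof. by move=> fi gi; rewrite /Int RintegralB. Qed.

Lemma IntZ a f : intg f -> Int (fun x => a * f x) = a * Int f.
Proof. by move=> fi; rewrite /Int RintegralZl. Qed.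

Lemma IntN f : intg f -> Int (fun x => - f x) = - Int f.
Proof.
move=> fi; rewrite -mulN1r -IntZ//; apply: eq_Int => x.
by rewrite mulN1r.
Qed.

Lemma Int0 : Int (fun=> 0) = 0.
Proof. by rewrite /Int /Rintegral integral0. Qed.

Lemma Int_sum n (F : nat -> X -> R) : (forall i, (i < n)%N -> intg (F i)) ->
  Int (fun x => \sum_(i < n) F i x) = \sum_(i < n) Int (F i).
Proof.
elim: n => [|n IH] Fi.
  by rewrite big_ord0 -[RHS]Int0; apply: eq_Int => x; rewrite big_ord0.
rewrite big_ord_recr/= -IH; last by move=> i ?; apply: Fi; exact: ltnW.
rewrite -IntD; last exact: Fi.
  by apply: eq_Int => x; rewrite big_ord_recr.
by apply: intg_sum => i ?; apply: Fi; exact: ltnW.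
Qed.

Lemma Int_ge0 f : (forall x, 0 <= f x) -> 0 <= Int f.
Proof. by move=> f0; exact: Rintegral_ge0. Qed.

Lemma Int_le f g : intg f -> intg g -> (forall x, f x <= g x) -> Int f <= Int g.
Proof. by move=> fi gi fg; apply: le_Rintegral => // x _. Qed.

Lemma Int_norm f : intg f -> `|Int f| <= Int (fun x => `|f x|).
Proof. by move=> fi; exact: le_normr_Rintegral. Qed.

Lemma intg_norm f : intg f -> intg (fun x => `|f x|).
Proof.
move=> fi; apply: (intg_le _ fi) => [|x]; last by rewrite normr_id.
by apply: measurableT_comp => //; exact: intg_meas fi.
Qed.

Lemma IntE f : intg f -> (Int f)%:E = (\int[mu]_x (f x)%:E)%E.
Proof.
by move=> fi; rewrite /Int /Rintegral fineK//; exact: integrable_fin_num.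
Qed.

Lemma intg_ge0P f : measurable_fun setT f -> (forall x, 0 <= f x) ->
  (\int[mu]_x (f x)%:E < +oo)%E -> intg f.
Proof.
move=> mf f0 flt; apply/intgP; split => //.
by under eq_integral do rewrite ger0_norm//.
Qed.

Lemma Int_ae_eq f g : measurable_fun setT f -> measurable_fun setT g ->
  {ae mu, forall x, f x = g x} -> Int f = Int g.
Proof.
move=> mf mg fg; rewrite /Int /Rintegral; congr fine.
apply: ae_eq_integral => //; [exact/measurable_EFinP|exact/measurable_EFinP|].
by apply: filterS fg => x fgx _; rewrite /= fgx.
Qed.

Lemma Int_eq0_ae f : intg f -> (forall x, 0 <= f x) -> Int f = 0 ->
  {ae mu, forall x, f x = 0}.
Proof.
move=> fi f0 If0.
have : ae_eq mu setT (EFin \o f) (cst 0%E).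
  apply/(ae_eq_integral_abs mu measurableT); first by case/integrableP: fi.
  rewrite (_ : (\int[mu]_(x in _) _)%E = (\int[mu]_x (f x)%:E)%E).
    by rewrite -IntE// If0.
  by apply: eq_integral => x _ /=; rewrite ger0_norm.
by apply: filterS => x /(_ Logic.I) [].
Qed.

Lemma sq_meas f : sq f -> measurable_fun setT f. Proof. by case. Qed.
Lemma sq_intg f : sq f -> intg (fun x => f x ^+ 2). Proof. by case. Qed.

Lemma sq_le f g : measurable_fun setT f -> sq g ->
  (forall x, `|f x| <= `|g x|) -> sq f.
Proof.
move=> mf [mg gi] fg; split => //; apply: intg_le gi _.
  exact: measurable_funX.
by move=> x; rewrite !normrX lerXn2r ?nnegrE.
Qed.

Lemma intgM f g : sq f -> sq g -> intg (fun x => f x * g x).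
Proof.
move=> [mf fi] [mg gi]; apply: intg_le (intgD fi gi) _ => [|x].
  exact: measurable_funM.
rewrite (ger0_norm (addr_ge0 (sqr_ge0 (f x)) (sqr_ge0 (g x)))) normrM.
have := sqr_ge0 (`|f x| - `|g x|).
rewrite sqrrB !real_normK ?num_real//.
have : 0 <= `|f x| * `|g x| by rewrite mulr_ge0.
lra.
Qed.

Lemma sqZ a f : sq f -> sq (fun x => a * f x).
Proof.
move=> [mf fi]; split; first exact: measurable_funM.
by under eq_fun do rewrite exprMn; exact: intgZ.
Qed.

Lemma sqN f : sq f -> sq (fun x => - f x).
Proof. by move=> /(sqZ (-1)); under eq_fun do rewrite mulN1r. Qed.

Lemma sqD f g : sq f -> sq g -> sq (fun x => f x + g x).
Proof.
move=> sf sg; split; first by apply: measurable_funD; [case: sf|case: sg].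
under eq_fun do rewrite sqrrD -mulr_natl.
apply: intgD; last by case: sg.
by apply: intgD; [case: sf|apply: intgZ; exact: intgM].
Qed.

Lemma sqB f g : sq f -> sq g -> sq (fun x => f x - g x).
Proof. by move=> sf sg; exact: sqD sf (sqN sg). Qed.

Lemma sq0 : sq (fun=> 0).
Proof.
split; first exact: measurable_cst.
by under eq_fun do rewrite expr0n; exact: intg0.
Qed.

Lemma sq_sum n (F : nat -> X -> R) : (forall i, (i < n)%N -> sq (F i)) ->
  sq (fun x => \sum_(i < n) F i x).
Proof.
elim: n => [|n IH] Fi; first by under eq_fun do rewrite big_ord0; exact: sq0.
under eq_fun do rewrite big_ord_recr /=.
by apply: sqD; [apply: IH => i ?; apply: Fi; exact: ltnW|exact: Fi].
Qed.

Lemma sqM_bounded M f g : measurable_fun setT g -> sq f ->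
  (forall x, `|g x| <= M) -> sq (fun x => f x * g x).
Proof.
move=> mg sf gM; apply: (sq_le _ (sqZ M sf)).
  by apply: measurable_funM => //; exact: sq_meas.
move=> x; rewrite !normrM mulrC ler_wpM2r//.
by rewrite (le_trans (gM x))// ler_norm.
Qed.

Lemma ipC f g : ip f g = ip g f.
Proof. by apply: eq_Int => x; rewrite mulrC. Qed.

Lemma ipDl f g h : sq f -> sq g -> sq h ->
  ip (fun x => f x + g x) h = ip f h + ip g h.
Proof.
move=> sf sg sh; rewrite -IntD; [|exact: intgM..].
by apply: eq_Int => x; rewrite mulrDl.
Qed.

Lemma ipZl a f h : sq f -> sq h -> ip (fun x => a * f x) h = a * ip f h.
Proof.
move=> sf sh; rewrite -IntZ; last exact: intgM.
by apply: eq_Int => x; rewrite mulrA.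
Qed.

Lemma ipZr a f h : sq f -> sq h -> ip h (fun x => a * f x) = a * ip h f.
Proof. by move=> sf sh; rewrite ipC ipZl// ipC. Qed.

Lemma ipBl f g h : sq f -> sq g -> sq h ->
  ip (fun x => f x - g x) h = ip f h - ip g h.
Proof.
move=> sf sg sh; rewrite -IntB; [|exact: intgM..].
by apply: eq_Int => x; rewrite mulrBl.
Qed.

Lemma ip_suml n (F : nat -> X -> R) h :
  (forall i, (i < n)%N -> sq (F i)) -> sq h ->
  ip (fun x => \sum_(i < n) F i x) h = \sum_(i < n) ip (F i) h.
Proof.
move=> sF sh; rewrite -(@Int_sum n (fun i x => F i x * h x)); last first.
  by move=> i ?; apply: intgM => //; exact: sF.
by apply: eq_Int => x; rewrite mulr_suml.
Qed.

Lemma ipE f : ip f f = Int (fun x => f x ^+ 2).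
Proof. by apply: eq_Int => x; rewrite expr2. Qed.

Lemma ip_ge0 f : 0 <= ip f f.
Proof. by apply: Int_ge0 => x; rewrite -expr2 sqr_ge0. Qed.

Lemma ipDD f g : sq f -> sq g ->
  ip (fun x => f x + g x) (fun x => f x + g x)
  = ip f f + 2 * ip f g + ip g g.
Proof.
move=> sf sg; rewrite ipDl//; last exact: sqD.
rewrite ![ip _ (fun x => _ + _)]ipC !ipDl// (ipC g f); ring.
Qed.

Lemma ipBB f g : sq f -> sq g ->
  ip (fun x => f x - g x) (fun x => f x - g x)
  = ip f f - 2 * ip f g + ip g g.
Proof.
move=> sf sg; rewrite ipBl//; last exact: sqB.
rewrite ![ip _ (fun x => _ - _)]ipC !ipBl// (ipC g f); ring.
Qed.

Lemma cauchy_schwarz f g : sq f -> sq g -> ip f g ^+ 2 <= ip f f * ip g g.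
Proof.
move=> sf sg.
(* The squared norm of [f - a g], a polynomial in [a] without negative values. *)
have key (a : R) : 0 <= ip f f - 2 * a * ip f g + a ^+ 2 * ip g g.
  have := ip_ge0 (fun x => f x - a * g x).
  rewrite ipBB//; last exact: sqZ.
  rewrite !ipZr//; last exact: sqZ.
  by rewrite ipZl// !mulrA -expr2.
have := ip_ge0 g; rewrite le_eqVlt => /predU1P[/esym g0|g0].
  rewrite g0 mulr0; have [//|/negPf fg0] := eqVneq (ip f g) 0.
    by move=> ->; rewrite expr0n.
  (* With [ip g g = 0] the polynomial is affine in [a]; at this value of [a] it would equal -1. *)
  have := key ((ip f f + 1) / (2 * ip f g)).
  rewrite g0 mulr0 addr0.
  have -> : 2 * ((ip f f + 1) / (2 * ip f g)) * ip f g = ip f f + 1.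
    by field; rewrite fg0.
  by lra.
have := key (ip f g / ip g g).
have -> : ip f f - 2 * (ip f g / ip g g) * ip f g + (ip f g / ip g g) ^+ 2 * ip g g
  = ip f f - ip f g ^+ 2 / ip g g by field; rewrite gt_eqF.
by rewrite subr_ge0 ler_pdivrMr.
Qed.

Lemma ip_le_half f g e : 0 < e -> sq f -> sq g ->
  2 * `|ip f g| <= e * ip f f + e^-1 * ip g g.
Proof.
move=> e0 sf sg.
have key (s : R) : s ^+ 2 = 1 -> 2 * (s * ip f g) <= e * ip f f + e^-1 * ip g g.
  move=> s1; have := ip_ge0 (fun x => e * f x - s * g x).
  rewrite ipBB; [|exact: sqZ..].
  rewrite !ipZr//; [|exact: sqZ..].
  rewrite !ipZl// => h.
  have {h} : 0 <= e^-1 * (e * (e * ip f f) - 2 * (s * (e * ip f g)) + s * (s * ip g g)).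
    by apply: mulr_ge0 h; rewrite invr_ge0 ltW.
  have -> : e^-1 * (e * (e * ip f f) - 2 * (s * (e * ip f g)) + s * (s * ip g g))
   = e * ip f f - 2 * (s * ip f g) + e^-1 * (s ^+ 2 * ip g g).
    by field; rewrite gt_eqF.
  rewrite s1 mul1r; lra.
have [h|h] := leP 0 (ip f g).
  by have := key 1; rewrite mul1r ger0_norm//; apply; rewrite expr1n.
by have := key (-1); rewrite mulN1r ltr0_norm//; apply; rewrite sqrrN expr1n.
Qed.

Lemma ipD_le2 f g : sq f -> sq g ->
  ip (fun x => f x + g x) (fun x => f x + g x) <= 2 * ip f f + 2 * ip g g.
Proof.
move=> sf sg; have := ip_ge0 (fun x => f x - g x).
by rewrite ipBB// ipDD//; lra.
Qed.

Lemma ip_le f g : sq f -> sq g -> (forall x, `|f x| <= `|g x|) ->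
  ip f f <= ip g g.
Proof.
move=> sf sg fg; apply: Int_le; [exact: intgM|exact: intgM|] => x.
by rewrite -!expr2 -[leLHS]real_normK ?num_real// -[leRHS]real_normK ?num_real//
  lerXn2r ?nnegrE.
Qed.

End SquareIntegrable.

Lemma sum_half_pow (R : realType) n :
  \sum_(i < n) (2^-1 : R) ^+ i = 2 - 2 * 2^-1 ^+ n.
Proof.
elim: n => [|n IH]; first by rewrite big_ord0 expr0 mulr1 subrr.
by rewrite big_ord_recr/= IH exprS; field.
Qed.

Lemma sum_half_le (R : realType) n : \sum_(i < n) (2^-1 : R) ^+ i <= 2.
Proof. by rewrite sum_half_pow gerDl oppr_le0 mulr_ge0// exprn_ge0. Qed.

(** * Completeness of L_2 with explicit rates *)

Section Completeness.
Context d (X : measurableType d) (R : realType).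
Variable mu : {measure set X -> \bar R}.
Implicit Types f g h : X -> R.

(** A limit superior is measurable for every sequence of measurable functions and equals the limit
    wherever there is one. This names limits, including almost everywhere limits, by a formula that
    stays jointly measurable in parameters. *)
Definition esup_lim (f : nat -> X -> R) (x : X) : R :=
  fine (limn_esup (fun n => (f n x)%:E)).

Lemma esup_lim_cvg (f : nat -> X -> R) x l :
  f n x @[n --> \oo] --> l -> esup_lim f x = l.
Proof.
move=> fl; rewrite /esup_lim.
have : (fun n => (f n x)%:E) @ \oo --> l%:E by apply: cvg_EFin fl; exact: nearW.
by move=> /cvg_limn_einf_sup[_ ->].
Qed.

Lemma measurable_esup_lim (f : nat -> X -> R) :
  (forall n, measurable_fun setT (f n)) -> measurable_fun setT (esup_lim f).
Proof.
move=> mf; apply: (@measurableT_comp _ _ _ _ _ _ fine).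
  exact: fine_measurable.
by apply: measurable_fun_limn_esup => n; exact/measurable_EFinP.
Qed.

Lemma limn_einf_le_near (u : nat -> \bar R) (c : \bar R) :
  (\forall n \near \oo, (u n <= c)%E) -> (limn_einf u <= c)%E.
Proof.
move=> uc; apply: (le_trans (limn_einf_sup u)).
rewrite limn_esup_lim; apply: lime_le; first exact: is_cvg_esups.
case: uc => N _ uc; exists N => // n /= Nn.
by apply: ge_ereal_sup => _ [m /= nm <-]; exact/uc/(leq_trans Nn).
Qed.

Lemma fatou_le (h : nat -> X -> R) g (c : R) :
  (forall n, intg mu (h n)) -> (forall n x, 0 <= h n x) ->
  measurable_fun setT g -> (forall x, 0 <= g x) ->
  {ae mu, forall x, h n x @[n --> \oo] --> g x} ->
  (\forall n \near \oo, Int mu (h n) <= c) ->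
  intg mu g /\ Int mu g <= c.
Proof.
move=> hi h0 mg g0 hg hc.
have mh n : measurable_fun setT (h n) by exact: intg_meas (hi n).
have key : (\int[mu]_x (g x)%:E <= c%:E)%E.
  have -> : (\int[mu]_x (g x)%:E = \int[mu]_x limn_einf (fun n => (h n x)%:E))%E.
    apply: ae_eq_integral => //; first exact/measurable_EFinP.
      apply: (@measurableT_comp _ _ _ _ _ _ (fun t : \bar R => - t)%E) => //.
        exact: oppe_measurable.
      apply: (@measurable_fun_limn_esup _ _ _ _ (fun n x => - (h n x)%:E)%E) => n.
      apply: (@measurableT_comp _ _ _ _ _ _ (fun t : \bar R => - t)%E).
        exact: oppe_measurable.
      exact/measurable_EFinP.
    apply: filterS hg => x hgx _.
    have : (fun n => (h n x)%:E) @ \oo --> (g x)%:E.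
      by apply: cvg_EFin hgx; exact: nearW.
    by move=> /cvg_limn_einf_sup[-> _].
  apply: (le_trans (fatou mu measurableT _ _)).
  - by move=> n; exact/measurable_EFinP.
  - by move=> n x _; rewrite lee_fin.
  - apply: limn_einf_le_near; apply: filterS hc => n.
    by rewrite -IntE// lee_fin.
have gi : intg mu g.
  by apply: intg_ge0P => //; apply: le_lt_trans key _; rewrite ltry.
by split => //; rewrite -lee_fin IntE.
Qed.

(** By monotone convergence the sum of the series has integral at most [C], so it is finite almost
    everywhere. *)
Lemma ae_series_bounded (h : nat -> X -> R) (a : nat -> R) (C : R) :
  (forall n, intg mu (h n)) -> (forall n x, 0 <= h n x) ->
  (forall n, Int mu (h n) <= a n) -> (forall n, \sum_(i < n) a i <= C) ->
  {ae mu, forall x, exists M : R, forall n, \sum_(i < n) h i x <= M}.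
Proof.
move=> hi h0 ha aC.
pose S x := (\sum_(0 <= i <oo) (h i x)%:E)%E.
have mh n : measurable_fun setT (EFin \o h n).
  by apply/measurable_EFinP; exact: intg_meas (hi n).
have S0 x : (0 <= S x)%E by apply: nneseries_ge0 => i _ _; rewrite lee_fin.
have mS : measurable_fun setT S.
  apply: (@ge0_emeasurable_sum _ _ _ setT (fun i => EFin \o h i) predT) => // i x _ _.
  by rewrite /= lee_fin.
have Sfin : mu.-integrable setT S.
  apply/integrableP; split => //.
  under eq_integral do rewrite gee0_abs//.
  rewrite (@integral_nneseries _ _ _ mu _ measurableT (fun n => EFin \o h n))//; last first.
    by move=> n x _; rewrite lee_fin.
  apply: (@le_lt_trans _ _ C%:E); last by rewrite ltry.
  apply: lime_le.
    by apply: is_cvg_nneseries => n _ _; apply: integral_ge0 => x _; rewrite lee_fin.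
  apply: nearW => n; apply: (@le_trans _ _ (\sum_(0 <= i < n) (a i)%:E)%E).
    by apply: lee_sum => i _; rewrite -IntE// lee_fin.
  by rewrite sumEFin lee_fin big_mkord.
have := integrable_ae measurableT Sfin.
apply: filterS => x /(_ Logic.I) Sx; exists (fine (S x)) => n.
rewrite -lee_fin fineK// -sumEFin -(big_mkord predT (fun i => (h i x)%:E)).
by apply: nneseries_lim_ge => i _ _; rewrite lee_fin.
Qed.

(** The weights [2 ^+ i] make the increments absolutely summable: completing a square bounds the
    modulus of an increment by its weighted square plus a term of a geometric series. *)
Lemma bounded_geo_cvg (f : nat -> R) (M : R) :
  (forall n, \sum_(i < n) 2 ^+ i * (f i.+1 - f i) ^+ 2 <= M) -> cvgn f.
Proof.
move=> fM; pose dd i := f i.+1 - f i.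
have key i : `|dd i| <= 2^-1 ^+ i.+1 + 2 ^+ i * dd i ^+ 2.
  have p0 : (0 : R) < 2 ^+ i by rewrite exprn_gt0.
  rewrite -(real_normK (num_real (dd i))) exprS exprVn.
  set p := 2 ^+ i in p0 *; set t := `|dd i|.
  have : 0 <= p * (t - (2 * p)^-1) ^+ 2 by rewrite mulr_ge0 ?sqr_ge0// ltW.
  have -> : p * (t - (2 * p)^-1) ^+ 2 = p * t ^+ 2 - t + 4^-1 * p^-1.
    by field; rewrite gt_eqF.
  have : 0 < p^-1 by rewrite invr_gt0.
  lra.
have cd : cvgn [normed series dd].
  apply: nondecreasing_is_cvgn.
    apply/nondecreasing_seqP => n.
    by rewrite -subr_ge0 /= -/(series _ _) -/(series _ _.+1) seriesSB.
  exists (1 + M) => _ [n _ <-]; rewrite /= /series/= big_mkord.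
  apply: (@le_trans _ _ (\sum_(i < n) (2^-1 ^+ i.+1 + 2 ^+ i * dd i ^+ 2))).
    by apply: ler_sum => i _; exact: key.
  rewrite big_split/= lerD//; last exact: fM.
  under eq_bigr do rewrite exprS.
  by rewrite -mulr_sumr; have := sum_half_le R n; lra.
have := normed_cvg cd => /cvg_ex[l sl].
apply/cvg_ex; exists (f 0%N + l).
rewrite [X in X @ _](_ : _ = (fun n => f 0%N + series dd n)); last first.
  by apply/funext => n; rewrite /series/= telescope_sumr// addrC subrK.
by apply: (@cvgD _ R^o _ _ _ (fun=> f 0%N) (series dd)) => //; exact: cvg_cst.
Qed.

(** Squared distances of order [4^-1 ^+ n], weighted by [2 ^+ n], still have a convergent sum. Hence
    the sequence converges almost everywhere, and Fatou's lemma returns the same rate for the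
    distance to the limit. *)
Lemma L2_complete (f : nat -> X -> R) :
  (forall n, sq mu (f n)) ->
  (forall n m, (n <= m)%N ->
    ip mu (fun x => f m x - f n x) (fun x => f m x - f n x) <= 4^-1 ^+ n) ->
  sq mu (esup_lim f) /\
  forall n, ip mu (fun x => f n x - esup_lim f x)
                  (fun x => f n x - esup_lim f x) <= 4^-1 ^+ n.
Proof.
move=> sf fC; set g := esup_lim f.
have mf n := sq_meas (sf n).
have mg : measurable_fun setT g by exact: measurable_esup_lim.
have sfB n m : sq mu (fun x => f m x - f n x) by exact: sqB.
have cvf : {ae mu, forall x, f n x @[n --> \oo] --> g x}.
  have : {ae mu, forall x, exists M : R, forall n,
      \sum_(i < n) 2 ^+ i * (f i.+1 x - f i x) ^+ 2 <= M}.
    apply: (@ae_series_bounded (fun i x => 2 ^+ i * (f i.+1 x - f i x) ^+ 2)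
      (fun i => 2^-1 ^+ i) 2).
    - by move=> n; apply: intgZ; exact: sq_intg (sfB _ _).
    - by move=> n x; rewrite mulr_ge0 ?sqr_ge0// exprn_ge0.
    - move=> n; rewrite IntZ; last exact: sq_intg (sfB _ _).
      have := fC n n.+1 (leqnSn n); rewrite ipE => h.
      have {1}-> : (2^-1 : R) = 2 * 4^-1 by field.
      rewrite exprMn ler_wpM2l ?exprn_ge0//.
    - by move=> n; exact: sum_half_le.
  apply: filterS => x [M fM].
  have /cvg_ex[l fl] := @bounded_geo_cvg (f^~ x) M fM.
  by rewrite /g (esup_lim_cvg fl).
have main n : intg mu (fun x => (f n x - g x) ^+ 2) /\
    Int mu (fun x => (f n x - g x) ^+ 2) <= 4^-1 ^+ n.
  apply: (@fatou_le (fun m x => (f m x - f n x) ^+ 2)).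
  - by move=> m; exact: sq_intg (sfB _ _).
  - by move=> m x; exact: sqr_ge0.
  - by apply: measurable_funX; exact: measurable_funB.
  - by move=> x; exact: sqr_ge0.
  - apply: filterS cvf => x fx.
    have -> : (f n x - g x) ^+ 2 = (g x - f n x) ^+ 2 by rewrite -sqrrN opprB.
    rewrite expr2; under eq_fun do rewrite expr2.
    by apply: cvgM; apply: cvgB => //; exact: cvg_cst.
  - by exists n => // m /= nm; rewrite -ipE; exact: fC.
split; last first.
  by move=> n; rewrite ipE; exact: (main n).2.
have -> : g = (fun x => f 0%N x - (f 0%N x - g x)).
  by apply/funext => x; rewrite opprB addrC subrK.
apply: sqB => //; split; first exact: measurable_funB.
by have [] := main 0%N.
Qed.

End Completeness.

(** * Limits of bounded sequences along an ultrafilter *)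

Section UltrafilterLimits.
Context (R : realType) (F : set_system nat) (UF : UltraFilter F).

(** The image of an ultrafilter is an ultrafilter, and it contains the compact interval
    [[-M, M]]. *)
Lemma ultra_lim (u : nat -> R) (M : R) :
  F [set n | `|u n| <= M] -> exists l : R, u n @[n --> F] --> l.
Proof.
move=> uM.
pose G := [set A : set R | F (u @^-1` A)].
have PG : ProperFilter G.
  split; first by rewrite /G/= preimage_set0; exact: filter_not_empty.
  split => [|P Q|P Q PQ]; rewrite /G/=.
  - by rewrite preimage_setT; exact: filterT.
  - by rewrite preimage_setI; exact: filterI.
  - by apply: filterS => x; exact: PQ.
have UG : UltraFilter G.
  split => // H PH GH; apply/seteqP; split => [A HA|]; last exact: GH.
  have [//|nA] := in_ultra_setVsetC (u @^-1` A) UF.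
  have : H (A `&` ~` A) by apply: filterI => //; exact: GH.
  by rewrite setICr => /filter_not_empty.
have := @segment_compact R (- M) M; rewrite compact_ultra => /(_ G UG).
case.
  by rewrite /G/=; apply: filterS uM => n /=; rewrite in_itv/= ler_norml.
by move=> l [_ Gl]; exists l.
Qed.

Lemma ultra_cvg_le (u : nat -> R) (l M : R) : u n @[n --> F] --> l ->
  F [set n | u n <= M] -> l <= M.
Proof.
move=> ul uM.
have PF : ProperFilter F by exact: ultra_proper.
by apply: (@closed_cvg _ _ F _ u [set x : R | x <= M]) => //; exact: closed_le.
Qed.

Lemma ultra_near (u : nat -> R) (l e : R) : u n @[n --> F] --> l -> 0 < e ->
  F [set n | `|l - u n| <= e].
Proof. by move=> /cvgrPdist_le ul e0; exact: ul. Qed.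

(** The condition does not depend on [n], and members of a proper filter are nonempty. In this form
    an identity between limits follows from estimates at one suitable index of the approximation. *)
Lemma ultra_eq (a b : R) : (forall e : R, 0 < e ->
   F [set n : nat | `|a - b| <= e]) -> a = b.
Proof.
move=> H; apply/eqP; rewrite -subr_eq0 -normr_le0; apply/ler_addgt0Pl => e e0.
rewrite addr0; have PF : ProperFilter F by exact: ultra_proper.
by have /filter_ex[n] := H e e0.
Qed.

End UltrafilterLimits.

(** * Mazur's lemma through iterated midpoints *)

Section MidpointHull.
Context (R : realType) (E : Type) (mid : E -> E -> E) (N : E -> R).
Hypothesis N_ge0 : forall x, 0 <= N x.

(** Iterated midpoints replace convex combinations: the parallelogram identity only needs midpoints,
    and a property stable under midpoints passes to the hull by a plain induction. *)
Inductive hull (P : set E) : E -> Prop :=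
| hull_in x : P x -> hull P x
| hull_mid x y : hull P x -> hull P y -> hull P (mid x y).

Lemma hull_sub (P Q : set E) : P `<=` Q ->
  (forall x y, Q x -> Q y -> Q (mid x y)) -> hull P `<=` Q.
Proof. by move=> PQ Qm x; elim=> [y /PQ//|y z _ + _]; exact: Qm. Qed.

Lemma hullS (P Q : set E) : P `<=` Q -> hull P `<=` hull Q.
Proof.
by move=> PQ; apply: hull_sub => [x /PQ|]; [exact: hull_in|exact: hull_mid].
Qed.

(** When [N] is a squared Hilbert norm, this is the squared distance by the parallelogram identity.
    Written with [N] and [mid] alone, the argument requires no vector space structure on [E]. *)
Definition dist2 x y := 2 * N x + 2 * N y - 4 * N (mid x y).

Context (F : set_system nat) (PF : ProperFilter F) (u : nat -> E) (C : R).
Hypothesis uC : forall n, N (u n) <= C.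

(* Elements of [hull (u @` A)] whose norm is nearly minimal are close to each
   other by the parallelogram identity. *)
Lemma hull_cauchy : exists (A : nat -> set nat) (g : nat -> E),
  [/\ forall k, F (A k), forall k, hull (u @` A k) (g k),
      forall k l, (k <= l)%N -> dist2 (g l) (g k) <= 4^-1 ^+ k &
      forall B, F B -> forall k, exists2 x, hull (u @` B) x &
        dist2 (g k) x <= 4^-1 ^+ k].
Proof.
(* [s A] grows when [A] shrinks and is bounded by [C]. Its supremum [S] over the filter is therefore
   almost attained, and beyond such a set all hulls have nearly the same least norm. *)
pose s A := inf (N @` hull (u @` A)).
have hne A : F A -> N @` hull (u @` A) !=set0.
  move=> /filter_ex[n An]; exists (N (u n)), (u n) => //.
  by apply: hull_in; exists n.
have hlb A : has_lbound (N @` hull (u @` A)) by exists 0 => _ [x _ <-].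
have sle A x : hull (u @` A) x -> s A <= N x.
  by move=> hx; apply: ge_inf => //; exists x.
have sC A : F A -> s A <= C.
  move=> /filter_ex[n An]; apply: le_trans (uC n); apply: sle.
  by apply: hull_in; exists n.
pose S := sup (s @` F).
have supF : has_sup (s @` F).
  split; first by exists (s setT), setT => //; exact: filterT.
  by exists C => _ [A FA <-]; exact: sC.
have sS A : F A -> s A <= S.
  by move=> FA; apply: (ub_le_sup supF.2); exists A.
(* Two elements with [N] at most [S + eta k] whose midpoint has [N] at least [S - eta k] satisfy
   [dist2 <= 8 * eta k], which is the required rate. *)
pose eta k : R := 4^-1 ^+ k / 8.
have eta0 k : 0 < eta k by rewrite divr_gt0// exprn_gt0.
have /choice[B HB] : forall k, exists A, F A /\ S - eta k < s A.
  by move=> k; have [_ [A FA <-] ?] := sup_adherent (eta0 k) supF; exists A.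
pose A := fix A k := if k is k'.+1 then A k' `&` B k else B 0%N.
have FA k : F (A k).
  elim: k => [|k IH]; first exact: (HB 0%N).1.
  by apply: filterI => //; exact: (HB _).1.
have AB k : A k `<=` B k by case: k => [|k] //=; exact: subIsetr.
have AA k l : (k <= l)%N -> A l `<=` A k.
  elim: l => [|l IH]; first by rewrite leqn0 => /eqP ->.
  rewrite leq_eqVlt => /predU1P[->//|/IH h]; exact: subset_trans (@subIsetl _ _ _) h.
have lowA k x : hull (u @` A k) x -> S - eta k <= N x.
  move=> hx; apply: (le_trans (ltW (HB k).2)); apply: sle.
  by apply: hullS hx => _ [n /AB ? <-]; exists n.
have exq D k : F D -> exists2 x, hull (u @` D) x & N x <= S + eta k.
  move=> FD; have hi : has_inf (N @` hull (u @` D)) by split; [exact: hne|].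
  have [_ [x hx <-] xs] := inf_adherent (eta0 k) hi.
  by exists x => //; apply: (le_trans (ltW xs)); rewrite lerD2r; exact: sS.
have /choice[g Hg] : forall k, exists x, hull (u @` A k) x /\ N x <= S + eta k.
  by move=> k; have [x ? ?] := exq _ k (FA k); exists x.
have keyd k x y : hull (u @` A k) x -> hull (u @` A k) y ->
    N x <= S + eta k -> N y <= S + eta k -> dist2 x y <= 4^-1 ^+ k.
  move=> hx hy Nx Ny; have := lowA k _ (hull_mid hx hy).
  have : eta k * 8 = 4^-1 ^+ k by rewrite /eta divfK.
  rewrite /dist2; lra.
have etaS k l : (k <= l)%N -> eta l <= eta k.
  by move=> kl; rewrite ler_wpM2r// ler_wiXn2l//; lra.
exists A, g; split => //.
- by move=> k; exact: (Hg k).1.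
- move=> k l kl; apply: keyd.
  + by apply: hullS (Hg l).1 => _ [n /(AA _ _ kl) ? <-]; exists n.
  + exact: (Hg k).1.
  + by apply: (le_trans (Hg l).2); rewrite lerD2l etaS.
  + exact: (Hg k).2.
- move=> D FD k; have [x hx Nx] := exq _ k (filterI FD (FA k)).
  exists x; first by apply: hullS hx => _ [n [? _] <-]; exists n.
  apply: keyd => //; [exact: (Hg k).1| |exact: (Hg k).2].
  by apply: hullS hx => _ [n [_ ?] <-]; exists n.
Qed.

End MidpointHull.

Section AlmostEverywhere.
Context d (X : measurableType d) (R : realType) (mu : {measure set X -> \bar R}).

Lemma ae_and (P Q : X -> Prop) : {ae mu, forall x, P x} -> {ae mu, forall x, Q x} ->
  {ae mu, forall x, P x /\ Q x}.
Proof. by apply: filterS2 => x Px Qx; split. Qed.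

Lemma ae_imp (P Q : X -> Prop) : (forall x, P x -> Q x) ->
  {ae mu, forall x, P x} -> {ae mu, forall x, Q x}.
Proof. by move=> PQ; apply: filterS. Qed.

Lemma ae_countable (P : nat -> X -> Prop) :
  (forall n, {ae mu, forall x, P n x}) -> {ae mu, forall x, forall n, P n x}.
Proof. by move=> H; exact/ae_foralln. Qed.

End AlmostEverywhere.

Lemma measurable_indic_comp d (X : measurableType d) (R : realType) (A : set R)
    (g : X -> R) : measurable A -> measurable_fun setT g ->
  measurable_fun setT (fun x => (\1_A (g x) : R)).
Proof.
move=> mA mg; apply: (@measurableT_comp _ _ _ X R R (\1_A) setT g) => //.
Qed.

(** * Calculus and Fubini theorems on the plane *)

(** A countable base consisting of measurable sets. It puts every open set into the given
    sigma-algebra, here a product sigma-algebra, and it is inherited by products. *)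
Definition has_mbase (T : topologicalType) (mT : set (set T)) :=
  exists B : nat -> set T, (forall i, mT (B i)) /\
    forall (p : T) (U : set T), nbhs p U -> exists i, B i p /\ B i `<=` U.

Section OpenMeasurable.
Context (R : realType).

Lemma has_mbase_R : has_mbase (fun A : set R => measurable A).
Proof.
pose B (i : nat) : set R := if unpickle i is Some (q, r) then
  ball (ratr q : R) (ratr r) else set0.
exists B; split => [i|p U].
  by rewrite /B; case: (unpickle i) => [[q r]|]//; exact: measurable_ball.
move=> /nbhs_ballP[e /= e0 eU].
have [r re] := @rat_in_itvoo R 0 (e / 2) ltac:(by rewrite divr_gt0).
have r0 : 0 < (ratr r : R) by move: re; rewrite in_itv/= => /andP[].
have r2 : (ratr r : R) < e / 2 by move: re; rewrite in_itv/= => /andP[].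
have [q qe] := @rat_in_itvoo R (p - ratr r) (p + ratr r) ltac:(by rewrite ltrD2l; lra).
move: qe; rewrite in_itv/= => /andP[q1 q2].
exists (pickle (q, r)); rewrite /B pickleK; split.
  by rewrite /ball/= ltr_distl; apply/andP; split; lra.
move=> y; rewrite /ball/= ltr_distl => /andP[y1 y2]; apply: eU.
by rewrite /ball/= ltr_distl; apply/andP; split; lra.
Qed.

Lemma mbase_prod (T1 T2 : topologicalType) (m1 : set (set T1)) (m2 : set (set T2))
    (m : set (set (T1 * T2))) :
  (forall A B, m1 A -> m2 B -> m (A `*` B)) ->
  has_mbase m1 -> has_mbase m2 -> has_mbase m.
Proof.
move=> mX [B1 [mB1 H1]] [B2 [mB2 H2]].
exists (fun i => if unpickle i is Some (j, k) then B1 j `*` B2 k else B1 0%N `*` B2 0%N).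
split => [i|[p q] U [[A B] /= [nA nB] AB]].
  by case: (unpickle i) => [[j k]|]; exact: mX.
have [j [jp jA]] := H1 _ _ nA; have [k [kq kB]] := H2 _ _ nB.
exists (pickle (j, k)); rewrite pickleK; split => // -[y z] [/= /jA ? /kB ?].
exact: AB.
Qed.

Lemma mbase_measurable (T : topologicalType) (m : set (set T)) :
  (forall F : nat -> set T, (forall i, m (F i)) -> m (\bigcup_i F i)) ->
  m set0 -> has_mbase m -> forall U, open U -> m U.
Proof.
move=> mU m0 [B [mB H]] U oU.
have -> : U = \bigcup_i (if `[< B i `<=` U >] then B i else set0).
  apply/seteqP; split => [p Up|p [i _]]; last by case: asboolP => // h /h.
  have [i [ip iU]] := H p U (open_nbhs_nbhs (conj oU Up)).
  by exists i => //; case: asboolP.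
by apply: mU => i; case: ifP.
Qed.

Lemma has_mbase_R2 : has_mbase (fun A : set (R * R) => measurable A).
Proof.
apply: mbase_prod has_mbase_R has_mbase_R => A B mA mB; exact: measurableX.
Qed.

Lemma open_measurable2 (U : set (R * R)) : open U -> measurable U.
Proof.
move=> oU; apply: (@mbase_measurable _ (fun A : set (R * R) => measurable A)) => //.
- by move=> F mF; apply: bigcupT_measurable.
- exact: has_mbase_R2.
Qed.

Lemma open_measurable3 (U : set (R * (R * R))) : open U -> measurable U.
Proof.
move=> oU; apply: (@mbase_measurable _ (fun A : set (R * (R * R)) => measurable A)) => //.
- by move=> F mF; apply: bigcupT_measurable.
- apply: mbase_prod has_mbase_R has_mbase_R2 => A B mA mB; exact: measurableX.
Qed.

Lemma continuous_measurable2 (f : R * R -> R) :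
  continuous f -> measurable_fun setT f.
Proof.
move=> cf; apply: (measurability _ (RGenOpens.measurableE R)).
move=> _ [_ [a [b ->] <-]]; rewrite setTI; apply: open_measurable2.
by apply: open_comp => //; exact: interval_open.
Qed.

End OpenMeasurable.

Section Calculus.
Context (R : realType).

Lemma is_derive_line (V : normedModType R) (f : V -> R) (a w : V) (s df : R) :
  is_derive (a + s *: w) w f df -> is_derive s 1 (fun r : R => f (a + r *: w)) df.
Proof.
move=> [fd fE].
have E : (fun h : R => h^-1 *: (((fun r : R => f (a + r *: w)) \o shift s) (h *: (1 : R)) - f (a + s *: w)))
       = (fun h : R => h^-1 *: ((f \o shift (a + s *: w)) (h *: w) - f (a + s *: w))).
  apply/funext => h /=; congr (_ *: (f _ - _)).
  by rewrite -[h *: 1]/(h * 1) mulr1 scalerDl addrCA addrA.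
split.
  by move: fd; rewrite /derivable E.
by rewrite -fE /derive E.
Qed.

Lemma is_derive_slice_x (f : R * R -> R) (x y df : R) :
  is_derive (x, y) (1, 0) f df -> is_derive x 1 (fun r => f (r, y)) df.
Proof.
move=> fd; have := @is_derive_line _ f (0, y) (1, 0) x df.
have h (r : R) : (0, y) + r *: ((1, 0) : R * R) = (r, y).
  by rewrite [LHS](_ : _ = (0 + r * 1, y + r * 0))// add0r mulr1 mulr0 addr0.
by rewrite h; under eq_fun do rewrite h; apply.
Qed.

Lemma is_derive_slice_y (f : R * R -> R) (x y df : R) :
  is_derive (x, y) (0, 1) f df -> is_derive y 1 (fun r => f (x, r)) df.
Proof.
move=> fd; have := @is_derive_line _ f (x, 0) (0, 1) y df.
have h (r : R) : (x, 0) + r *: ((0, 1) : R * R) = (x, r).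
  by rewrite [LHS](_ : _ = (x + r * 0, 0 + r * 1))// add0r mulr1 mulr0 addr0.
by rewrite h; under eq_fun do rewrite h; apply.
Qed.

Lemma is_derive_cont (f : R -> R) (x df : R) :
  is_derive x 1 f df -> {for x, continuous f}.
Proof. by move=> [fd _]; apply: differentiable_continuous; apply/derivable1_diffP. Qed.

Lemma FTC (g dg : R -> R) (a b : R) : a <= b ->
  (forall x : R, x \in `]a, b[ -> is_derive x 1 g (dg x)) ->
  {within `[a, b], continuous g} -> {within `[a, b], continuous dg} ->
  \int[leb1]_(x in `[a, b]) dg x = g b - g a.
Proof.
rewrite le_eqVlt => /predU1P[<- _ _ _|ab gd cg cd].
  by rewrite subrr set_itv1 Rintegral_set1.
rewrite /Rintegral (@continuous_FTC2 _ dg g _ _ ab cd).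
- by [].
- have [_ ga gb] := (continuous_within_itvP _ ab).1 cg.
  by split => // x xab; have [] := gd _ xab.
- by move=> x xab; have [_ h] := gd _ xab; rewrite derive1E.
Qed.

Lemma within_cont (A : set R) (g : R -> R) : continuous g -> {within A, continuous g}.
Proof. by move=> cg; apply: continuous_subspaceT. Qed.

Lemma Int_setT_itv (g : R -> R) (a b : R) :
  (forall x, x \notin `[a, b] -> g x = 0) ->
  Int leb1 g = \int[leb1]_(x in `[a, b]) g x.
Proof.
move=> g0; rewrite Rintegral_mkcond; apply: eq_Int => x.
rewrite patchE; case: ifPn => // xab; apply: g0.
by apply: contra xab => h; rewrite inE.
Qed.

Lemma Int_derive_compact (g dg : R -> R) (M : R) :
  (forall x : R, is_derive x 1 g (dg x)) -> continuous dg ->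
  (forall x, M < `|x| -> g x = 0 /\ dg x = 0) -> Int leb1 dg = 0.
Proof.
move=> gd cd g0; pose N : R := `|M| + 1.
have N0 : 0 < N by rewrite /N addrC ltr_pwDl.
have MN : M < N by rewrite (le_lt_trans (ler_norm M))// /N ltrDl.
rewrite (@Int_setT_itv _ (- N) N); last first.
  move=> x; rewrite in_itv/= -ler_norml -ltNge => xN.
  by have [] := g0 x (lt_trans MN xN).
rewrite (FTC _ (fun x _ => gd x)); [|lra|..].
- have [-> _] : g N = 0 /\ dg N = 0 by apply: g0; rewrite gtr0_norm.
  have [-> _] : g (- N) = 0 /\ dg (- N) = 0.
    by apply: g0; rewrite normrN gtr0_norm.
  by rewrite subrr.
- by apply: within_cont => x; exact: is_derive_cont (gd x).
- exact: within_cont.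
Qed.

End Calculus.

(** * Fubini and Tonelli for real-valued integrals *)

Section Fubini.
Context d1 d2 (X1 : measurableType d1) (X2 : measurableType d2) (R : realType).
Variables (m1 : {sigma_finite_measure set X1 -> \bar R})
          (m2 : {sigma_finite_measure set X2 -> \bar R}).
Implicit Types f : X1 * X2 -> R.

Lemma fubini_ae f : intg (m1 \x m2)%E f ->
  {ae m1, forall x, intg m2 (fun y => f (x, y))}.
Proof. by move=> /ae_integrable1. Qed.

Lemma intg_fubini f : intg (m1 \x m2)%E f ->
  intg m1 (fun x => Int m2 (fun y => f (x, y))).
Proof.
move=> fi; have Fi := integrable_fubini_F fi.
apply/integrableP; split.
  apply/measurable_EFinP; rewrite /Int /Rintegral.
  apply: (@measurableT_comp _ _ _ _ _ _ fine); first exact: fine_measurable.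
  by case/integrableP: Fi.
case/integrableP: Fi => mF; apply: le_lt_trans.
apply: ge0_le_integral => //.
- apply/measurableT_comp => //; apply/measurable_EFinP.
  by apply: (@measurableT_comp _ _ _ _ _ _ fine); first exact: fine_measurable.
- exact/measurableT_comp.
(* [fine] sends an infinite inner integral to 0, which can only decrease the modulus. *)
- move=> x _ /=; rewrite /Int /Rintegral -/(fubini_F m2 (EFin \o f) x).
  by case: (fubini_F _ _ _) => [r| |] //=; rewrite ?normr0 ?leey.
Qed.

Lemma Int_fubini f : intg (m1 \x m2)%E f ->
  Int (m1 \x m2)%E f = Int m1 (fun x => Int m2 (fun y => f (x, y))).
Proof.
move=> fi; rewrite {1}/Int /Rintegral -(integral12_prod_meas1 fi).
rewrite {1}/Int /Rintegral; congr fine.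
have Fi := integrable_fubini_F fi.
apply: ae_eq_integral => //; first by case/integrableP: Fi.
  by have /integrableP[] := intg_fubini fi.
have := fubini_ae fi; apply: filterS => x fx _.
by rewrite /fubini_F -IntE.
Qed.

Lemma intg_tonelli f : measurable_fun setT f -> (forall z, 0 <= f z) ->
  {ae m1, forall x, intg m2 (fun y => f (x, y))} ->
  intg m1 (fun x => Int m2 (fun y => f (x, y))) -> intg (m1 \x m2)%E f.
Proof.
move=> mf f0 fi Fi; apply: intg_ge0P => //.
rewrite fubini_tonelli1; [|exact/measurable_EFinP|by move=> z; rewrite lee_fin].
have /intgP[_] := Fi; apply: le_lt_trans.
apply: ae_ge0_le_integral => //.
- move=> x _; apply: integral_ge0 => y _; rewrite lee_fin//.
- apply: measurable_fun_fubini_tonelli_F; first exact/measurable_EFinP.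
  by move=> z; rewrite lee_fin.
- have /integrableP[+ _] := Fi => /measurable_EFinP mF.
  by apply/measurable_EFinP; exact: measurableT_comp.
- apply: filterS fi => x fx _; rewrite /fubini_F /= -IntE// lee_fin.
  exact: ler_norm.
Qed.

Lemma Int_fubini2 f : intg (m1 \x m2)%E f ->
  Int (m1 \x m2)%E f = Int m2 (fun y => Int m1 (fun x => f (x, y))).
Proof.
move=> fi; rewrite {1}/Int /Rintegral -(integral21_prod_meas1 fi).
rewrite {1}/Int /Rintegral; congr fine.
have mGe := measurable_fubini_G fi.
have mG : measurable_fun setT (fine \o fubini_G m1 (EFin \o f)).
  apply: (@measurableT_comp _ _ _ _ _ _ fine); first exact: fine_measurable.
  exact: mGe.
apply: ae_eq_integral => //; first exact/measurable_EFinP.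
have := ae_integrable2 fi; apply: filterS => x fx _.
by rewrite /fubini_G -IntE.
Qed.

Lemma measurable_Int_slice f : measurable_fun setT f -> (forall z, 0 <= f z) ->
  measurable_fun setT (fun x => Int m2 (fun y => f (x, y))).
Proof.
move=> mf f0; apply: (@measurableT_comp _ _ _ _ _ _ fine).
  exact: fine_measurable.
have mf' : measurable_fun setT (EFin \o f) by exact/measurable_EFinP.
have f0' z : (0 <= (EFin \o f) z)%E by rewrite lee_fin.
exact: (@measurable_fun_fubini_tonelli_F _ _ _ _ _ m2 _ mf' f0').
Qed.

Lemma sq_slice f : sq (m1 \x m2)%E f ->
  {ae m1, forall x, sq m2 (fun y => f (x, y))}.
Proof.
move=> [mf fi]; apply: ae_imp (fubini_ae fi) => x fx; split => //.
by apply: (@measurableT_comp _ _ _ _ _ _ f) => //; exact: pair1_measurable.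
Qed.

Lemma ip_fubini f g : sq (m1 \x m2)%E f -> sq (m1 \x m2)%E g ->
  ip (m1 \x m2)%E f g =
  Int m1 (fun x => ip m2 (fun y => f (x, y)) (fun y => g (x, y))).
Proof. by move=> sf sg; rewrite /ip (Int_fubini (intgM sf sg)). Qed.

(** Tonelli carries an inequality between L_2 norms on almost every slice to the product. It is
    applied twice: from vertical lines to the plane, and from the plane to space-time. *)
Lemma sq_fubini_le (h k : X1 * X2 -> R) : measurable_fun setT h ->
  sq (m1 \x m2)%E k ->
  {ae m1, forall x, sq m2 (fun y => h (x, y)) /\
    ip m2 (fun y => h (x, y)) (fun y => h (x, y)) <=
    ip m2 (fun y => k (x, y)) (fun y => k (x, y))} ->
  sq (m1 \x m2)%E h /\ ip (m1 \x m2)%E h h <= ip (m1 \x m2)%E k k.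
Proof.
move=> mh sk hk.
pose a x := Int m2 (fun y => k (x, y) ^+ 2).
have ia : intg m1 a := intg_fubini (sq_intg sk).
have a0 x : 0 <= a x by apply: Int_ge0 => s; exact: sqr_ge0.
have h0 x : 0 <= Int m2 (fun y => h (x, y) ^+ 2).
  by apply: Int_ge0 => s; exact: sqr_ge0.
have mF : measurable_fun setT (fun x => Int m2 (fun y => h (x, y) ^+ 2)).
  apply: (@measurable_Int_slice (fun z => h z ^+ 2)) => [|z].
    exact: measurable_funX.
  exact: sqr_ge0.
have i2 : intg (m1 \x m2)%E (fun z => h z ^+ 2).
  apply: intg_tonelli.
  - exact: measurable_funX.
  - by move=> z; exact: sqr_ge0.
  - by apply: ae_imp hk => x [[]].
  - apply/intgP; split => //.
    have [_] := (intgP m1 a).1 ia; apply: le_lt_trans.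
    apply: ae_ge0_le_integral => //.
    + by apply/measurable_EFinP/measurableT_comp.
    + by apply/measurable_EFinP/measurableT_comp => //; exact: intg_meas ia.
    + apply: ae_imp hk => x [_]; rewrite !ipE => hx _.
      by rewrite lee_fin !ger0_norm.
split; first by split.
rewrite ipE [leRHS]ipE (Int_fubini i2) (Int_fubini (sq_intg sk)) -lee_fin.
have ig2 := intg_fubini i2.
rewrite !IntE//; apply: ae_ge0_le_integral => //.
- by move=> x _; rewrite lee_fin.
- exact/measurable_EFinP.
- by move=> x _; rewrite lee_fin; exact: a0.
- by apply/measurable_EFinP; exact: intg_meas ia.
- by apply: ae_imp hk => x [_]; rewrite !ipE => hx _; rewrite lee_fin.
Qed.

End Fubini.

(** * Uniform continuity and bounds on compact sets *)

Section Compactness.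
Context (R : realType).

(** Heine's theorem for continuity relative to [A]. Compactness is used as a near-covering property,
    the second filter being that of positive radii tending to 0. *)
Lemma uniformly_continuous_on (V : pseudoMetricType R) (A : set V) (f : V -> R) :
  compact A -> {within A, continuous f} -> forall e : R, 0 < e ->
  exists2 dl : R, 0 < dl &
    forall p q, A p -> A q -> ball p dl q -> `|f p - f q| < e.
Proof.
move=> cA cf e e0.
have /compact_near_coveringP/near_covering_withinP := cA.
move=> /(_ R (0 : R)^'+ (fun dl p => forall q, A q -> ball p dl q -> `|f p - f q| < e)).
case=> [|_ /posnumP[r] /= H].
  move=> x Ax.
  have : within A (nbhs x) [set q | `|f x - f q| < e / 2].
    have /= h := (@subspace_continuousP _ A _ f).1 cf x Ax.
    by move/cvgrPdist_lt : h; apply; rewrite divr_gt0.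
  move=> /nbhs_ballP[_ /posnumP[d] xd].
  exists (ball x (d%:num / 2), [set dl : R | dl < d%:num / 2]) => /=.
    split; first by apply: nbhsx_ballx; rewrite divr_gt0.
    exact: nbhs_right_lt.
  move=> [y dl] /= [xy dld] Ay q Aq yq.
  have h1 : `|f x - f y| < e / 2.
    by apply: xd => //; apply: le_ball xy; rewrite ler_pdivrMr// ler_pMr ?ler1n.
  have h2 : `|f x - f q| < e / 2.
    apply: xd => //; rewrite (splitr d%:num); apply: ball_triangle xy _.
    by apply: le_ball yq; exact: ltW.
  rewrite (_ : f y - f q = (f x - f q) - (f x - f y)); last by ring.
  by rewrite (le_lt_trans (ler_normB _ _))// (splitr e) ltrD.
exists (r%:num / 2); first by rewrite divr_gt0.
move=> p q Ap Aq pq; apply: (H (r%:num / 2)) => //=.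
by rewrite sub0r normrN gtr0_norm ?divr_gt0// ltr_pdivrMr// ltr_pMr// ltr1n.
Qed.

Lemma bounded_on_compact (V : topologicalType) (A : set V) (f : V -> R) :
  compact A -> {within A, continuous f} ->
  exists2 B : R, 0 < B & forall p, A p -> `|f p| <= B.
Proof.
move=> cA cf; have := continuous_compact cf cA.
move=> /compact_bounded; rewrite /bounded_near => /pinfty_ex_gt0[B B0 H].
by exists B => // p Ap; apply: H; exists p.
Qed.

Lemma near_zero_derive (V : normedModType R) (f : V -> R) (x w : V) (df : R) :
  (\forall y \near x, f y = 0) -> is_derive x w f df -> df = 0.
Proof.
move=> f0 [_ <-].
by rewrite (@near_eq_derive _ _ _ f (cst 0)) ?derive_cst.
Qed.

End Compactness.

(** * Functions supported in a box of the strip *)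

Section CompactlySupported.
Context (R : realType).
Implicit Types (f g v vx vy : R * R -> R).

(** Open in the vertical direction: a function that vanishes off the box vanishes on the boundary
    lines of the strip. *)
Definition inbox (M : R) (z : R * R) : bool := (`|z.1| <= M) && (0 < z.2 < 1).

Definition bsupp (M : R) f := [/\ measurable_fun setT f,
  exists B : R, forall z, `|f z| <= B & forall z, ~~ inbox M z -> f z = 0].

(** Less than compact support in the strip: the function and its gradient may be nonzero arbitrarily
    near the boundary lines. This is enough for integration by parts. *)
Definition C1c (M : R) v vx vy := [/\ continuous v, continuous vx,
  continuous vy, forall z : R * R, is_derive z (1, 0) v (vx z) /\
    is_derive z (0, 1) v (vy z) &
  forall z, ~~ inbox M z -> [/\ v z = 0, vx z = 0 & vy z = 0]].

Lemma inboxS M N z : M <= N -> inbox M z -> inbox N z.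
Proof. by move=> MN /andP[zM z2]; rewrite /inbox z2 (le_trans zM). Qed.

Lemma inbox_set M : [set z | inbox M z] = `[- M, M]%classic `*` `]0, 1[%classic.
Proof.
apply/seteqP; split => -[x y]; rewrite /inbox/= !in_itv/= ler_norml.
  by move=> /andP[].
by move=> [-> ->].
Qed.

Lemma measurable_inbox M : measurable [set z : R * R | inbox M z].
Proof. by rewrite inbox_set; exact: measurableX. Qed.

Lemma leb2_inbox M : (leb2 [set z : R * R | inbox M z] < +oo)%E.
Proof.
rewrite inbox_set /leb2 product_measure1E//.
by rewrite /leb1/= !lebesgue_measure_itv/=; do !case: ifP => _;
  rewrite ?mule0 ?mul0e// -?EFinB -?EFinM ltry.
Qed.

Lemma bsupp_intg M f : bsupp M f -> intg leb2 f.
Proof.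
move=> [mf [B fB] f0].
apply: (@intg_le _ _ _ leb2 f (fun z => B * \1_[set z | inbox M z] z)) => //.
  have mI := measurable_inbox M.
  apply: intgZ; apply: intg_ge0P => [|z|]; last 2 first.
  - by rewrite indicE ler0n.
  - by rewrite integral_indic//= setIT; exact: leb2_inbox.
  - exact: measurable_indic.
move=> z; rewrite indicE; have [zM|zM] := boolP (inbox M z).
  by rewrite mem_set//= mulr1 (le_trans (fB z))// ler_norm.
by rewrite f0// normr0 normr_ge0.
Qed.

Lemma bsuppM M f g : bsupp M f -> measurable_fun setT g ->
  (exists B : R, forall z, `|g z| <= B) -> bsupp M (fun z => f z * g z).
Proof.
move=> [mf [B fB] f0] mg [B' gB]; split; first exact: measurable_funM.
  by exists (B * B') => z; rewrite normrM ler_pM.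
by move=> z /f0 ->; rewrite mul0r.
Qed.

Lemma bsupp_sq M f : bsupp M f -> sq leb2 f.
Proof.
move=> bf; have [mf Bf f0] := bf; split => //.
by under eq_fun do rewrite expr2; apply: bsupp_intg (bsuppM bf mf Bf).
Qed.

Lemma compact_box (M : R) :
  compact ((`[- M, M]%classic `*` `[0, 1]%classic) : set (R * R)).
Proof. by apply: compact_setX; exact: segment_compact. Qed.

Lemma continuous_bsupp M f : continuous f -> (forall z, ~~ inbox M z -> f z = 0) ->
  bsupp M f.
Proof.
move=> cf f0; split => //; first exact: continuous_measurable2.
have [B B0 fB] := bounded_on_compact (@compact_box M) (continuous_subspaceT cf).
exists B => z; have [zM|/f0 ->] := boolP (inbox M z); last by rewrite normr0 ltW.
apply: fB; move: zM; rewrite /inbox ler_norml => /andP[zM /andP[/ltW ? /ltW ?]].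
by split; rewrite /= in_itv/= ?zM//; apply/andP.
Qed.

Lemma C1c_bsupp M v vx vy : C1c M v vx vy ->
  [/\ bsupp M v, bsupp M vx & bsupp M vy].
Proof.
by move=> [? ? ? _ v0]; split; apply: continuous_bsupp => // z /v0 [].
Qed.

Lemma C1c_le M N v vx vy : M <= N -> C1c M v vx vy -> C1c N v vx vy.
Proof.
move=> MN [? ? ? ? v0]; split => // z zN; apply: v0.
by apply: contra zN; exact: inboxS.
Qed.

Lemma Cc_C1c v : Cc_infty Omega v -> exists M, C1c M v ('D_(1, 0) v) ('D_(0, 1) v).
Proof.
move=> [vs vK vO].
have [/= cv _] := vs 1%N.
have {}cv : continuous v by apply/continuous_subspace_setT.
have D w : continuous ('D_w v) /\ forall z, is_derive z w v ('D_w v z).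
  have [_ /(_ w)[g [[cg _] gd]]] := vs 1%N.
  have gd' z : is_derive z w v (g z) by apply: gd; rewrite interiorT.
  have -> : 'D_w v = g by apply/funext => z; have [] := gd' z.
  by split => //; apply/continuous_subspace_setT.
have [c10 d10] := D (1, 0); have [c01 d01] := D (0, 1).
have := compact_bounded vK; rewrite /bounded_near => /pinfty_ex_gt0[M M0 HM].
exists M; split; [exact: cv|exact: c10|exact: c01|by move=> z; split|move=> z zM].
have nz : ~ closure [set x | v x != 0] z.
  move=> cz; have := HM _ cz; have := vO _ cz; rewrite /Omega/= => z2 zn.
  move: zM; rewrite /inbox z2 andbT => /negP; apply.
  by rewrite (le_trans _ zn)// prod_normE le_max lexx.
have nv : \forall y \near z, v y = 0.
  have : open (~` closure [set x | v x != 0]) by apply: closed_openC; exact: closed_closure.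
  rewrite openE => /(_ z nz); apply: filterS => y; apply: contra_notP => vy.
  by apply: subset_closure; apply/eqP.
split; first exact: nbhs_singleton nv.
  exact: near_zero_derive nv (d10 z).
exact: near_zero_derive nv (d01 z).
Qed.

Lemma is_derive_prod (V : normedModType R) (f g : V -> R) x w df dg :
  is_derive x w f df -> is_derive x w g dg ->
  is_derive x w (fun y => f y * g y) (f x * dg + df * g x).
Proof.
move=> fd gd; have := is_deriveM fd gd.
by rewrite /GRing.scale/= [g x * df]mulrC.
Qed.

Lemma is_derive_add (V : normedModType R) (f g : V -> R) x w df dg :
  is_derive x w f df -> is_derive x w g dg ->
  is_derive x w (fun y => f y + g y) (df + dg).
Proof. by move=> fd gd; have := is_deriveD fd gd. Qed.

Lemma is_derive_scale (V : normedModType R) (f : V -> R) (k : R) x w df :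
  is_derive x w f df -> is_derive x w (fun y => k * f y) (k * df).
Proof. by move=> fd; have := is_deriveZ k fd. Qed.

Lemma continuousM2 (V : topologicalType) (f g : V -> R) :
  continuous f -> continuous g -> continuous (fun x => f x * g x).
Proof. by move=> cf cg x; apply: cvgM; [exact: cf|exact: cg]. Qed.

Lemma continuousD2 (V : topologicalType) (f g : V -> R) :
  continuous f -> continuous g -> continuous (fun x => f x + g x).
Proof. by move=> cf cg x; apply: cvgD; [exact: cf|exact: cg]. Qed.

Lemma continuous_pairl (U V : topologicalType) (y : V) :
  continuous (fun x : U => (x, y)).
Proof. by move=> x; apply: cvg_pair; [exact: cvg_id|exact: cvg_cst]. Qed.

Lemma continuous_pairr (U V : topologicalType) (x : U) :
  continuous (fun y : V => (x, y)).
Proof. by move=> y; apply: cvg_pair; [exact: cvg_cst|exact: cvg_id]. Qed.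

Lemma C1cM M N v vx vy w wx wy : C1c M v vx vy -> C1c N w wx wy ->
  C1c M (fun z => v z * w z) (fun z => v z * wx z + vx z * w z)
        (fun z => v z * wy z + vy z * w z).
Proof.
move=> [cv cvx cvy dv v0] [cw cwx cwy dw _]; split.
- exact: continuousM2.
- by apply: continuousD2; exact: continuousM2.
- by apply: continuousD2; exact: continuousM2.
- by move=> z; have [a b] := dv z; have [c d] := dw z; split; exact: is_derive_prod.
- by move=> z /v0[-> -> ->]; rewrite !mul0r addr0.
Qed.

Lemma C1cD M v vx vy w wx wy : C1c M v vx vy -> C1c M w wx wy ->
  C1c M (fun z => v z + w z) (fun z => vx z + wx z) (fun z => vy z + wy z).
Proof.
move=> [cv cvx cvy dv v0] [cw cwx cwy dw w0]; split.
- exact: continuousD2.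
- exact: continuousD2.
- exact: continuousD2.
- by move=> z; have [a b] := dv z; have [c d] := dw z; split; exact: is_derive_add.
- by move=> z zM; have [-> -> ->] := v0 z zM; have [-> -> ->] := w0 z zM; rewrite addr0.
Qed.

Lemma C1cZ M k v vx vy : C1c M v vx vy ->
  C1c M (fun z => k * v z) (fun z => k * vx z) (fun z => k * vy z).
Proof.
move=> [cv cvx cvy dv v0]; split.
- by apply: continuousM2 => // x; exact: cvg_cst.
- by apply: continuousM2 => // x; exact: cvg_cst.
- by apply: continuousM2 => // x; exact: cvg_cst.
- by move=> z; have [a b] := dv z; split; exact: is_derive_scale.
- by move=> z /v0[-> -> ->]; rewrite mulr0.
Qed.

Lemma Int_C1c_x M v vx vy : C1c M v vx vy -> Int leb2 vx = 0.
Proof.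
move=> vC; have [_ bvx _] := C1c_bsupp vC; have [cv cvx cvy dv v0] := vC.
rewrite (Int_fubini2 (bsupp_intg bvx)) -[RHS](Int0 leb1); apply: eq_Int => y.
apply: (@Int_derive_compact _ (fun x => v (x, y)) _ M).
- by move=> x; apply: is_derive_slice_x; exact: (dv (x, y)).1.
- move=> x; apply: (@continuous_comp _ _ _ (fun x => (x, y)) vx); last exact: cvx.
  exact: continuous_pairl.
- move=> x xM; have [] // := v0 (x, y) _.
  by rewrite /inbox/= leNgt xM.
Qed.

Lemma Int_C1c_y M v vx vy : C1c M v vx vy -> Int leb2 vy = 0.
Proof.
move=> vC; have [_ _ bvy] := C1c_bsupp vC; have [cv cvx cvy dv v0] := vC.
rewrite (Int_fubini (bsupp_intg bvy)) -[RHS](Int0 leb1); apply: eq_Int => x.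
apply: (@Int_derive_compact _ (fun y => v (x, y)) _ 1).
- by move=> y; apply: is_derive_slice_y; exact: (dv (x, y)).2.
- move=> y; apply: (@continuous_comp _ _ _ (fun y => (x, y)) vy); last exact: cvy.
  exact: continuous_pairr.
- move=> y yM; have [] // := v0 (x, y) _.
  apply/negP; rewrite /inbox/= => /and3P[_ y0 y1]; move: yM.
  by rewrite gtr0_norm// ltNge (ltW y1).
Qed.

End CompactlySupported.

(** * The vertical primitive *)

Section VerticalPrimitive.
Context (R : realType).
Implicit Types (f g v vx vy : R * R -> R).

(** [T f] need not vanish above the strip; the cut-off brings it into L_2 of the whole plane. *)
Definition TO f (z : R * R) : R := if 0 < z.2 < 1 then T f z else 0.

Lemma T_ind f z : T f z = Int leb1 (fun s => \1_(`]0, z.2[%classic : set R) s * f (z.1, s)).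
Proof.
rewrite /T Rintegral_mkcond; apply: eq_Int => s.
by rewrite patchE indicE; case: (s \in _); rewrite ?mul1r ?mul0r.
Qed.

(** The variable end point of the integral is moved into the integrand as the two conditions [0 < s]
    and [0 < y - s], which are jointly measurable. The integrals of the positive and negative parts
    are then measurable in the parameters by Tonelli. *)
Lemma measurable_T3 (f : R * (R * R) -> R) : measurable_fun setT f ->
  measurable_fun setT (fun p => T (fun z => f (p.1, z)) p.2).
Proof.
move=> mf.
pose h (q : (R * (R * R)) * R) : \bar R :=
  ((\1_(`]0, +oo[%classic : set R) q.2 * \1_(`]0, +oo[%classic : set R) (q.1.2.2 - q.2)) *
   f (q.1.1, (q.1.2.1, q.2)))%:E.
have mh : measurable_fun setT h.
  apply/measurable_EFinP; apply: measurable_funM.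
    have m2 : measurable_fun setT (fun q : R * (R * R) * R => q.2).
      exact: measurable_snd.
    have m1 : measurable_fun setT (fun q : R * (R * R) * R => q.1.2.2).
      by apply: measurableT_comp => //; apply: measurableT_comp.
    apply: measurable_funM; apply: measurable_indic_comp => //.
    exact: measurable_funB.
  apply: (@measurableT_comp _ _ _ _ _ _ f) => //.
  apply/measurable_fun_pair => //=.
    by apply: measurableT_comp.
  apply/measurable_fun_pair => //=.
  by apply: measurableT_comp => //; apply: measurableT_comp.
have mF (k : (R * (R * R)) * R -> \bar R) : measurable_fun setT k -> (forall q, 0 <= k q)%E ->
    measurable_fun setT (fun p => \int[leb1]_s k (p, s))%E.
  by move=> mk k0; exact: (@measurable_fun_fubini_tonelli_F _ _ _ _ _ leb1 k mk k0).
rewrite (_ : (fun p => _) = (fun p => fine (\int[leb1]_s h (p, s))%E)); last first.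
  apply/funext => p; rewrite T_ind /Int /Rintegral; congr fine.
  apply: eq_integral => s _; rewrite /h /=; congr (_ * _)%:E.
  rewrite !indicE -natrM mulnb; congr ((nat_of_bool _)%:R).
  by apply/idP/andP; rewrite !inE /= !in_itv/= ?andbT subr_gt0; [move=> /andP[]|case=> -> ->].
apply: (@measurableT_comp _ _ _ _ _ _ fine); first exact: fine_measurable.
rewrite (_ : (fun p => _) = (fun p => (\int[leb1]_s (h^\+)%E (p, s) - \int[leb1]_s (h^\-)%E (p, s))%E)).
  apply: emeasurable_funB; apply: mF.
  - exact: measurable_funepos.
  - by move=> q; exact: funepos_ge0.
  - exact: measurable_funeneg.
  - by move=> q; exact: funeneg_ge0.
apply/funext => p; rewrite integralE; congr (_ - _)%E;
  by apply: eq_integral => s _; rewrite ?funeposE ?funenegE.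
Qed.

Lemma measurable_TO3 (f : R * (R * R) -> R) : measurable_fun setT f ->
  measurable_fun setT (fun p => TO (fun z => f (p.1, z)) p.2).
Proof.
move=> mf.
rewrite (_ : (fun p => _) = (fun p : R * (R * R) =>
   \1_(`]0, 1[%classic : set R) p.2.2 * T (fun z => f (p.1, z)) p.2)).
  apply: measurable_funM; last exact: measurable_T3.
  by apply: measurable_indic_comp => //; exact: measurableT_comp.
apply/funext => p; rewrite /TO indicE; case: ifPn => h.
  by rewrite mem_set ?mul1r//= in_itv.
by rewrite memNset ?mul0r//= in_itv; exact/negP.
Qed.

Lemma measurable_TO f : measurable_fun setT f -> measurable_fun setT (TO f).
Proof.
move=> mf.
have m3 : measurable_fun setT (fun p : R * (R * R) => f p.2).
  exact: measurableT_comp.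
have := measurable_TO3 m3 => /= h.
rewrite (_ : TO f = (fun p : R * (R * R) => TO (fun z => f z) p.2) \o pair 0) //.
by apply: measurableT_comp => //; exact: pair1_measurable.
Qed.

Lemma sq_indic1 (y : R) : sq leb1 (\1_(`]0, y[%classic : set R)).
Proof.
split; first exact: measurable_indic.
rewrite (_ : (fun x : R => _) = \1_(`]0, y[%classic : set R)).
  apply: intg_ge0P => [|z|]; first exact: measurable_indic.
    by rewrite indicE.
  rewrite integral_indic//= setIT lebesgue_measure_itv/=.
  by case: ifP => _; rewrite -?EFinB ltry.
by apply/funext => x; rewrite indicE; case: (x \in _); rewrite ?expr1n ?expr0n.
Qed.

Lemma ip_indic1 (y : R) : 0 < y -> ip leb1 (\1_(`]0, y[%classic : set R)) (\1_(`]0, y[%classic : set R)) = y.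
Proof.
move=> y0; rewrite /ip.
rewrite (_ : Int _ _ = Int leb1 (\1_(`]0, y[%classic : set R))).
  rewrite /Int /Rintegral integral_indic//= setIT lebesgue_measure_itv/= lte_fin y0.
  by rewrite -EFinB subr0.
by apply: eq_Int => x; rewrite indicE; case: (x \in _); rewrite ?mulr1 ?mulr0.
Qed.

(* Cauchy-Schwarz on the vertical segment ]0, y[, whose length is at most 1. *)
Lemma TO_diff f g : sq leb2 f -> sq leb2 g ->
  let h z := TO f z - TO g z in let k z := f z - g z in
  sq leb2 h /\ ip leb2 h h <= ip leb2 k k.
Proof.
move=> sf sg h k.
have sk : sq leb2 k := sqB sf sg.
have mh : measurable_fun setT h.
  by apply: measurable_funB; apply: measurable_TO; [exact: sq_meas sf|exact: sq_meas sg].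
apply: sq_fubini_le => //.
apply: ae_imp (ae_and (sq_slice sf) (sq_slice sg)) => x [sfx sgx].
have skx := sqB sfx sgx.
pose a := ip leb1 (fun s => k (x, s)) (fun s => k (x, s)).
have a0 : 0 <= a := ip_ge0 _ _.
have hx y : h (x, y) ^+ 2 <= a * \1_(`]0, 1[%classic : set R) y ^+ 2.
  rewrite /h /TO /= indicE; case: ifPn => [|yN]; last first.
    rewrite memNset ?expr0n/= ?mulr0 ?subrr ?expr0n//= in_itv; exact/negP.
  move=> /andP[y0 y1]; rewrite mem_set/= ?in_itv/= ?y0// expr1n mulr1.
  rewrite !T_ind /= -IntB; [|exact: intgM (sq_indic1 y) _..].
  rewrite (_ : Int _ _ = ip leb1 (\1_(`]0, y[%classic : set R)) (fun s => k (x, s))); last first.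
    by apply: eq_Int => s; rewrite -mulrBr.
  apply: le_trans (cauchy_schwarz (sq_indic1 y) skx) _.
  by rewrite ip_indic1//; apply: ler_piMl => //; exact: ltW.
have i1 := sq_intg (sq_indic1 1).
have i2 : intg leb1 (fun y => h (x, y) ^+ 2).
  apply: (intg_le _ (intgZ a i1)).
    apply: measurable_funX; exact: (@measurableT_comp _ _ _ _ _ _ h).
  by move=> y; rewrite ger0_norm ?sqr_ge0// (le_trans (hx y))// ler_norm.
split; first by split => //; exact: (@measurableT_comp _ _ _ _ _ _ h).
rewrite ipE; apply: le_trans (Int_le i2 (intgZ a i1) hx) _.
by rewrite IntZ// -ipE ip_indic1// mulr1.
Qed.

Lemma TO0 z : TO (fun=> 0) z = 0.
Proof.
rewrite /TO; case: ifP => // _; rewrite T_ind -[RHS](Int0 leb1).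
by apply: eq_Int => s; rewrite mulr0.
Qed.

Lemma TO_sq f : sq leb2 f -> sq leb2 (TO f) /\ ip leb2 (TO f) (TO f) <= ip leb2 f f.
Proof.
move=> sf; have [] := TO_diff sf (sq0 leb2).
have e1 : (fun z => TO f z - TO (fun=> 0) z) = TO f.
  by apply/funext => z; rewrite TO0 subr0.
have e2 : (fun z => f z - 0) = f by apply/funext => z; rewrite subr0.
by rewrite e1 e2.
Qed.

Definition TO3 (f : R * (R * R) -> R) (p : R * (R * R)) : R :=
  TO (fun z => f (p.1, z)) p.2.

Lemma TO3_diff (f g : R * (R * R) -> R) : sq leb3 f -> sq leb3 g ->
  let h z := TO3 f z - TO3 g z in let k z := f z - g z in
  sq leb3 h /\ ip leb3 h h <= ip leb3 k k.
Proof.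
move=> sf sg h k.
have sk : sq leb3 k := sqB sf sg.
have mh : measurable_fun setT h.
  by apply: measurable_funB; apply: measurable_TO3; [exact: sq_meas sf|exact: sq_meas sg].
apply: sq_fubini_le => //.
apply: ae_imp (ae_and (sq_slice sf) (sq_slice sg)) => x [sfx sgx].
exact: TO_diff sfx sgx.
Qed.

Lemma TO3_sq (f : R * (R * R) -> R) : sq leb3 f -> sq leb3 (TO3 f) /\ ip leb3 (TO3 f) (TO3 f) <= ip leb3 f f.
Proof.
move=> sf; have [] := TO3_diff sf (sq0 leb3).
have e1 : (fun z => TO3 f z - TO3 (fun=> 0) z) = TO3 f.
  by apply/funext => z; rewrite /TO3 TO0 subr0.
have e2 : (fun z => f z - 0) = f by apply/funext => z; rewrite subr0.
by rewrite e1 e2.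
Qed.

Lemma bsupp_slice M f x : bsupp M f -> intg leb1 (fun y => f (x, y)).
Proof.
move=> [mf [B fB] f0].
have i1 := sq_intg (sq_indic1 1).
apply: (intg_le _ (intgZ B i1)).
  exact: (@measurableT_comp _ _ _ _ _ _ f).
move=> y; rewrite indicE; have [yM|yM] := boolP (inbox M (x, y)).
  rewrite mem_set ?expr1n ?mulr1.
    by rewrite (le_trans (fB _))// ler_norm.
  by move: yM => /andP[_]; rewrite /= in_itv.
by rewrite f0// normr0.
Qed.

Lemma TO_lin M f g a b z : bsupp M f -> bsupp M g ->
  TO (fun z => a * f z + b * g z) z = a * TO f z + b * TO g z.
Proof.
move=> bf bg; rewrite /TO; case: ifP => _; last by rewrite !mulr0 addr0.
have h k x : bsupp M k ->
    intg leb1 (fun s => \1_(`]0, z.2[%classic : set R) s * k (x, s)).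
  move=> bk; have ik := bsupp_slice x bk.
  apply: (intg_le _ ik) => [|s].
    by apply: measurable_funM; [exact: measurable_indic|exact: intg_meas ik].
  rewrite indicE; case: (s \in _); rewrite ?mul1r// mul0r normr0//.
rewrite !T_ind -!IntZ; [|exact: h..].
rewrite -IntD; [|by apply: intgZ; exact: h..].
by apply: eq_Int => s; ring.
Qed.

(** [f] vanishes at nonpositive heights, so the lower limit may be moved to minus infinity, the form
    in which the fundamental theorem of calculus is applied; the end point [y] is a null set. *)
Lemma T_primitive M f x y : bsupp M f ->
  T f (x, y) = \int[leb1]_(s in `]-oo, y]) f (x, s).
Proof.
move=> bf; rewrite T_ind [RHS]Rintegral_mkcond; apply: Int_ae_eq.
- apply: measurable_funM; first exact: measurable_indic.
  by have /intg_meas := bsupp_slice x bf.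
- apply/(measurable_restrictT _ _).1 => //.
  by apply: measurable_funTS; have /intg_meas := bsupp_slice x bf.
have : {ae leb1, forall s : R, s <> y}.
  exists [set y]; split => //; first exact: lebesgue_measure_set1.
  by move=> s /= /contrapT.
apply: ae_imp => s sy; rewrite patchE indicE /=.
have [_ _ f0] := bf.
have [s0|s0] := leP s 0.
  rewrite (f0 (x, s)) ?mulr0 ?if_same//.
  by rewrite /inbox/= ltNge s0 andbF.
have -> : (s \in (`]0, y[%classic : set R)) = (s \in (`]-oo, y]%classic : set R)).
  apply/idP/idP; rewrite !inE/= !in_itv/= s0/=; first exact: ltW.
  by rewrite lt_neqAle => ->; rewrite andbT; apply/eqP.
by case: ifP; rewrite ?mul1r ?mul0r.
Qed.

Lemma is_derive_T M f (x y : R) : bsupp M f -> continuous f ->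
  is_derive y 1 (fun y => T f (x, y)) (f (x, y)).
Proof.
move=> bf cf; under eq_fun do rewrite (T_primitive x _ bf).
have ifx := bsupp_slice x bf.
have := @continuous_FTC1 R (fun s => f (x, s)) -oo%O y (y + 1).
case.
- by rewrite ltrDl.
- exact: integrableS ifx.
- by rewrite ltNyr.
- apply: (@continuous_comp _ _ _ (fun s => (x, s)) f); last exact: cf.
  exact: continuous_pairr.
- move=> d1 d2; split; first exact: d1.
  by rewrite -d2 derive1E.
Qed.

(* The transport term does no work: the field (v, - T v_x) is divergence free
   and v vanishes on the boundary. *)
Lemma transport_skew M v vx vy : C1c M v vx vy ->
  Int leb2 (fun z => v z * v z * vx z) = 0 /\
  Int leb2 (fun z => v z * TO vx z * vy z) = 0.
Proof.
move=> vC; have [bv bvx bvy] := C1c_bsupp vC; have [cv cvx cvy dv v0] := vC.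
have c3 := C1cM vC (C1cM vC vC).
have e1 : Int leb2 (fun z => v z * v z * vx z) = 0.
  have := Int_C1c_x c3.
  rewrite (_ : Int _ _ = 3 * Int leb2 (fun z => v z * v z * vx z)); last first.
    rewrite -IntZ; last first.
      have [mvx Bvx _] := bvx; have [mv Bv _] := bv.
      by apply: (@bsupp_intg _ M); apply: bsuppM => //; apply: bsuppM.
    by apply: eq_Int => z; ring.
  by move/eqP; rewrite mulf_eq0 pnatr_eq0/= => /eqP.
split => //.
have sTO := (TO_sq (bsupp_sq bvx)).1.
have bvvy : bsupp M (fun z => v z * vy z) by have [? ? _] := bvy; exact: bsuppM.
have iT : intg leb2 (fun z => v z * TO vx z * vy z).
  have := intgM sTO (bsupp_sq bvvy); congr intg; apply/funext => z; ring.
have ivv : intg leb2 (fun z => v z * v z * vx z).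
  have [? ? _] := bvx; have [? ? _] := bv.
  by apply: (@bsupp_intg _ M); apply: bsuppM => //; apply: bsuppM.
(* The y-derivative of [T vx] is [vx], so on each vertical line the integrand of this sum is the
   y-derivative of [T vx * v ^+ 2 / 2], a function vanishing outside the strip. *)
suff : Int leb2 (fun z => v z * TO vx z * vy z) + 2^-1 * Int leb2 (fun z => v z * v z * vx z) = 0.
  by rewrite e1 mulr0 addr0.
rewrite -IntZ// -IntD//; last exact: intgZ.
rewrite Int_fubini; last by apply: intgD => //; exact: intgZ.
rewrite -[RHS](Int0 leb1); apply: eq_Int => x.
have cs (f : R * R -> R) : continuous f -> continuous (fun y : R => f (x, y)).
  move=> cf y; apply: (@continuous_comp _ _ _ (fun s => (x, s)) f); last exact: cf.
  exact: continuous_pairr.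
have cT : continuous (fun y => T vx (x, y)).
  by move=> y; apply: is_derive_cont (is_derive_T x y bvx cvx).
transitivity (Int leb1 (fun y =>
   2^-1 * (T vx (x, y) * (v (x, y) * vy (x, y) + vy (x, y) * v (x, y))
     + vx (x, y) * (v (x, y) * v (x, y))))).
  apply: eq_Int => y; rewrite /TO /=; case: ifPn => h; first by field.
  by have [-> _ _] := v0 (x, y) ltac:(by rewrite /inbox /= (negbTE h) andbF); rewrite !(mulr0, mul0r, addr0).
apply: (@Int_derive_compact _ (fun y => 2^-1 * (T vx (x, y) * (v (x, y) * v (x, y)))) _ 1).
- move=> y; apply: is_derive_scale; apply: is_derive_prod.
    exact: is_derive_T bvx cvx.
  have dy := is_derive_slice_y (dv (x, y)).2.
  exact: is_derive_prod.
- apply: continuousM2; first by move=> ?; exact: cvg_cst.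
  apply: continuousD2; apply: continuousM2 => //.
  + by apply: continuousD2; apply: continuousM2; apply: cs.
  + exact: cs.
  + by apply: continuousM2; apply: cs.
- move=> y y1; suff: ~~ inbox M (x, y).
    by move=> /v0[-> _ _]; rewrite !(mulr0, mul0r, addr0).
  apply/negP; rewrite /inbox/= => /and3P[_ y0 yl]; move: y1.
  by rewrite gtr0_norm// ltNge (ltW yl).
Qed.

End VerticalPrimitive.

(** * Smooth bumps and the Poincare inequality on squares *)

Section SmoothAlgebra.
Context (R : realType) (V : normedModType R).
Implicit Types (f g : V -> R).

Lemma Ck_weaken k f : Ck k.+1 (setT : set V) f -> Ck k setT f.
Proof.
elim: k f => [|k IH] f [cf fd]; first by split.
by split => // w; have [g [gk gd]] := fd w; exists g; split => //; exact: IH.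
Qed.

Lemma Ck_cont k f : Ck k (setT : set V) f -> continuous f.
Proof. by case: k => [|k] [cf _]; apply/continuous_subspace_setT. Qed.

Lemma CkD k f g : Ck k (setT : set V) f -> Ck k setT g ->
  Ck k setT (fun x => f x + g x).
Proof.
elim: k f g => [|k IH] f g fk gk; split.
- by apply: continuous_subspaceT; apply: continuousD2; [exact: Ck_cont fk|exact: Ck_cont gk].
- by [].
- by apply: continuous_subspaceT; apply: continuousD2; [exact: Ck_cont fk|exact: Ck_cont gk].
case: fk gk => [_ fd] [_ gd] w; have [f' [fk' fd']] := fd w; have [g' [gk' gd']] := gd w.
exists (fun x => f' x + g' x); split; first exact: IH.
by move=> x xE; exact: (is_derive_add (fd' x xE) (gd' x xE)).
Qed.

Lemma CkZ k (a : R) f : Ck k (setT : set V) f -> Ck k setT (fun x => a * f x).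
Proof.
have c (h : V -> R) : continuous h -> continuous (fun x => a * h x).
  by move=> ch; apply: continuousM2 => // x; exact: cvg_cst.
elim: k f => [|k IH] f fk; split.
- by apply: continuous_subspaceT; apply: c; exact: Ck_cont fk.
- by [].
- by apply: continuous_subspaceT; apply: c; exact: Ck_cont fk.
case: fk => [_ fd] w; have [f' [fk' fd']] := fd w.
exists (fun x => a * f' x); split; first exact: IH.
by move=> x xE; apply: is_derive_scale; exact: fd'.
Qed.

Lemma CkM k f g : Ck k (setT : set V) f -> Ck k setT g ->
  Ck k setT (fun x => f x * g x).
Proof.
elim: k f g => [|k IH] f g fk gk; split.
- by apply: continuous_subspaceT; apply: continuousM2; [exact: Ck_cont fk|exact: Ck_cont gk].
- by [].
- by apply: continuous_subspaceT; apply: continuousM2; [exact: Ck_cont fk|exact: Ck_cont gk].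
have [fk0 gk0] := (Ck_weaken fk, Ck_weaken gk).
case: fk gk => [_ fd] [_ gd] w; have [f' [fk' fd']] := fd w; have [g' [gk' gd']] := gd w.
exists (fun x => f x * g' x + f' x * g x); split; first by apply: CkD; exact: IH.
by move=> x xE; apply: is_derive_prod; [exact: fd'|exact: gd'].
Qed.

Lemma Cc_inftyD (U : set V) f g : Cc_infty U f -> Cc_infty U g ->
  Cc_infty U (fun x => f x + g x).
Proof.
move=> [sf kf fU] [sg kg gU].
have sub : closure [set x | f x + g x != 0] `<=`
    closure [set x | f x != 0] `|` closure [set x | g x != 0].
  rewrite -closureU; apply: closure_subset => x /= fg.
  have [f0|] := eqVneq (f x) 0; last by left.
  by right; move: fg; rewrite f0 add0r.
split.
- by move=> k; apply: CkD.
- apply: subclosed_compact (compactU kf kg) sub; exact: closed_closure.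
- by apply: subset_trans sub _ => x [/fU|/gU].
Qed.

Lemma Cc_inftyZ (U : set V) a f : Cc_infty U f -> Cc_infty U (fun x => a * f x).
Proof.
move=> [sf kf fU].
have sub : closure [set x | a * f x != 0] `<=` closure [set x | f x != 0].
  by apply: closure_subset => x /=; apply: contraNneq => ->; rewrite mulr0.
split.
- by move=> k; apply: CkZ.
- apply: subclosed_compact kf sub; exact: closed_closure.
- exact: subset_trans sub fU.
Qed.

Lemma Cc_infty0 (U : set V) : Cc_infty U (fun=> 0 : R).
Proof.
have e : [set x : V | (0 : R) != 0] = set0.
  by apply/seteqP; split => x //=; rewrite eqxx.
split.
- elim=> [|k IH]; split => //; try by apply: continuous_subspaceT => x; exact: cvg_cst.
  by move=> w; exists (fun=> 0); split => // x _; exact: is_derive_cst.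
- by rewrite e closure0; exact: compact0.
- by rewrite e closure0.
Qed.

Lemma Cc_infty_supp (U K : set V) f : smooth_on setT f -> compact K -> K `<=` U ->
  (forall x, ~ K x -> f x = 0) -> Cc_infty U f.
Proof.
move=> sf cK KU f0.
have sub : closure [set x | f x != 0] `<=` K.
  have := compact_closed (@norm_hausdorff R V) cK.
  move=> /closure_id KE; rewrite [X in _ `<=` X]KE; apply: closure_subset => x /=.
  by apply: contraNP => /f0 ->.
split => //; last exact: subset_trans sub KU.
by apply: subclosed_compact cK sub; exact: closed_closure.
Qed.

Lemma is_derive_quot f x w (c : R) :
  (forall h : R, h != 0 -> h^-1 *: (f (h *: w + x) - f x) = c) -> is_derive x w f c.
Proof.
move=> H.
have key : (fun h : R => h^-1 *: ((f \o shift x) (h *: w) - f x)) @ (0 : R)^' --> c.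
  apply/cvgrPdist_le => e e0; near=> h.
  rewrite /= H ?subrr ?normr0 ?ltW//; near: h; exact: nbhs_dnbhs_neq.
split; first by apply/cvg_ex; exists c.
exact: cvg_lim key.
Unshelve. all: by end_near. Qed.

Lemma is_derive_pow f n x w (df : R) : is_derive x w f df ->
  is_derive x w (fun y => f y ^+ n) (n%:R * f x ^+ n.-1 * df).
Proof.
move=> fd; elim: n => [|n IH].
  under eq_fun do rewrite expr0; rewrite mul0r mul0r; exact: is_derive_cst.
under eq_fun do rewrite exprS.
apply: is_derive_eq (is_derive_prod fd IH) _.
case: n {IH} => [|n]; first by rewrite !mul0r mulr0 expr0; ring.
by rewrite /= -natr1 exprS; ring.
Qed.

End SmoothAlgebra.

Lemma continuous_comp2 (R : realType) (V : topologicalType) (f : R -> R) (g : V -> R) :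
  continuous f -> continuous g -> continuous (fun x => f (g x)).
Proof. by move=> cf cg x; apply: (@continuous_comp _ _ _ g f); [exact: cg|exact: cf]. Qed.

(** * A flat function and a one-dimensional bump *)

Section Flat.
Context (R : realType).

(* [flat k] is the k-fold x^-1 multiple of exp (- x^-1); the family is stable
   under differentiation. *)
Definition flat (k : nat) (x : R) : R := if 0 < x then x^-1 ^+ k * expR (- x^-1) else 0.

(** A single term of the exponential series, the one of order k + 1, bounds exp (x^-1) from below;
    one power of x remains. *)
Lemma flat_le k (x : R) : 0 < x -> 0 <= flat k x <= (k.+1)`!%:R * x.
Proof.
move=> x0; rewrite /flat x0; have x10 : 0 < x^-1 by rewrite invr_gt0.
apply/andP; split; first by rewrite mulr_ge0 ?expR_ge0// exprn_ge0// ltW.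
rewrite expRN -ler_pdivlMr ?invr_gt0 ?expR_gt0// invrK.
have := @expR_ge1Dxn R x^-1 k (ltW x10) => h.
have : x^-1 ^+ k.+1 / (k.+1)`!%:R <= expR x^-1 by lra.
rewrite ler_pdivrMr ?ltr0n ?fact_gt0// exprS => h2.
have : x * (x^-1 * x^-1 ^+ k) <= x * (expR x^-1 * (k.+1)`!%:R) by rewrite ler_pM2l.
rewrite [x * (x^-1 * _)]mulrA mulfV ?gt_eqF// mul1r => h3.
by apply: le_trans h3 _; rewrite le_eqVlt; apply/orP; left; apply/eqP; ring.
Qed.

Lemma flat_ge0 k x : 0 <= flat k x.
Proof. by have [/(flat_le k)/andP[]//|x0] := ltP 0 x; rewrite /flat ltNge x0. Qed.

Lemma flat_neg k x : x <= 0 -> flat k x = 0.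
Proof. by move=> x0; rewrite /flat ltNge x0. Qed.

Lemma flat_gt0 k x : 0 < x -> 0 < flat k x.
Proof.
by move=> x0; rewrite /flat x0 mulr_gt0 ?expR_gt0// exprn_gt0// invr_gt0.
Qed.

Lemma flat_cvg0 k : flat k x @[x --> (0 : R)] --> (0 : R).
Proof.
apply/cvgrPdist_le => e e0; near=> x; rewrite sub0r normrN ger0_norm ?flat_ge0//.
have [x0|x0] := ltP 0 x; last by rewrite flat_neg// ltW.
have /andP[_ h] := flat_le k x0; apply: le_trans h _.
have F0 : (0 : R) < (k.+1)`!%:R by rewrite ltr0n fact_gt0.
rewrite mulrC -ler_pdivlMr//.
have : `|x| <= e / (k.+1)`!%:R; last by apply: le_trans; exact: ler_norm.
near: x; apply: (@nbhs0_le _ R) ; exact: divr_gt0.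
Unshelve. all: by end_near. Qed.

Lemma is_derive_flat k (x : R) :
  is_derive x 1 (flat k) (flat k.+2 x - k%:R * flat k.+1 x).
Proof.
have [x0|x0|->] := ltgtP x 0.
- rewrite !flat_neg ?(ltW x0)// mulr0 subr0.
  apply: (@near_eq_is_derive _ _ _ (cst 0)).
  by near=> y; rewrite flat_neg//; apply/ltW; near: y; exact: lt_nbhsl.
- have e : \forall y \near x, (fun y : R => y^-1 ^+ k * expR (- y^-1)) y = flat k y.
    by near=> y; rewrite /flat ifT//; near: y; exact: lt_nbhsr.
  apply: (near_eq_is_derive e).
  have xn0 : x != 0 by rewrite gt_eqF.
  have dV : is_derive x 1 (fun y : R => y^-1) (- x ^- 2).
    have di : derivable (id : R -> R) x 1 by exact: derivable_id.
    split; first exact: derivableV xn0 di.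
    by rewrite (deriveV xn0 di) derive_id /GRing.scale/= mulr1.
  have dE : is_derive x 1 (fun y : R => expR (- y^-1)) (expR (- x^-1) * (x ^- 2)).
    apply: (@is_derive1_comp _ expR (fun y => - y^-1)).
    by rewrite -[x ^- 2]opprK; have := is_deriveN dV.
  have dX : is_derive x 1 (fun y : R => y^-1 ^+ k) (k%:R * x^-1 ^+ k.-1 * (- x ^- 2)).
    exact: is_derive_pow.
  have := is_derive_prod dX dE => H.
  apply: is_derive_eq H _; rewrite /flat x0.
  rewrite -exprVn; set t := x^-1; case: (k) => [|j] /=.
    by rewrite !mul0r subr0 addr0 expr0 mul1r mulrC.
  by rewrite !exprS; ring.
- rewrite !flat_neg// mulr0 subr0.
  (* At 0 the difference quotient of [flat k] is [flat k.+1] itself, so the derivative there is the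
     limit given by [flat_cvg0]. *)
  have key : (fun h : R => h^-1 *: ((flat k \o shift (0 : R)) (h *: (1 : R)) - flat k 0))
      @ (0 : R)^' --> (0 : R).
    rewrite (_ : (fun h : R => _) = flat k.+1).
      exact: cvg_within_filter (flat_cvg0 k.+1).
    apply/funext => h; rewrite /= addr0 [h *: 1]mulr1 (flat_neg k (lexx 0)) subr0.
    rewrite /flat; case: ifP => // _; last by rewrite scaler0.
    by rewrite /GRing.scale/= exprS mulrA.
  split; first by apply/cvg_ex; exists 0.
  exact: cvg_lim key.
Unshelve. all: by end_near. Qed.

Lemma is_derive_affine (V : normedModType R) (l : V -> R) (x w : V) (c d : R) (f : R -> R) :
  is_derive x w l c -> is_derive (l x) 1 f d -> is_derive x w (fun y => f (l y)) (d * c).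
Proof.
move=> ld fd.
have ld' : is_derive (0 : R) 1 (fun r : R => l (x + r *: w)) c.
  by apply: is_derive_line; rewrite scale0r addr0.
have fd' : is_derive (0 : R) 1 (f \o (fun r : R => l (x + r *: w))) (d * c).
  by apply: is_derive1_comp => //; rewrite scale0r addr0.
have E : (fun h : R => h^-1 *: (((fun y => f (l y)) \o shift x) (h *: w) - f (l x)))
  = (fun h : R => h^-1 *: (((f \o (fun r : R => l (x + r *: w))) \o shift (0 : R)) (h *: (1 : R)) - (f \o (fun r : R => l (x + r *: w))) 0)).
  apply/funext => h /=; rewrite addr0 scale0r addr0 [h *: 1]mulr1.
  by rewrite [x + _]addrC.
case: fd' => fa fb; split.
  by rewrite /derivable E.
by rewrite -fb /derive E.
Qed.

Lemma flat_smooth (V : normedModType R) (l : V -> R) (k n : nat) :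
  continuous l -> (forall w, exists c : R, forall x, is_derive x w l c) ->
  Ck n setT (fun x => flat k (l x)).
Proof.
move=> cl dl.
have cf j : continuous (fun x => flat j (l x)).
  move=> x; apply: (@continuous_comp _ _ _ l (flat j)); first exact: cl.
  exact: is_derive_cont (is_derive_flat j (l x)).
elim: n k => [|n IH] k; split => //; try exact: continuous_subspaceT.
move=> w; have [c dc] := dl w.
exists (fun x => c * flat k.+2 (l x) + - c * k%:R * flat k.+1 (l x)); split.
  by apply: CkD; apply: CkZ; exact: IH.
move=> x _; apply: is_derive_eq (is_derive_affine (dc x) (is_derive_flat k (l x))) _.
by ring.
Qed.

(** The bump lives on [[1/4, 3/4]] to leave a margin inside the unit interval: rescaled to a cell
    that touches the boundary of the strip, it still has compact support in the open strip. *)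
Definition bump1 (x : R) : R := flat 0 (x - 4^-1) * flat 0 (3 / 4 - x).

Lemma bump1_ge0 x : 0 <= bump1 x. Proof. by rewrite mulr_ge0// flat_ge0. Qed.

Lemma bump1_eq0 x : ~~ (4^-1 < x < 3 / 4) -> bump1 x = 0.
Proof.
rewrite negb_and -!leNgt => /orP[h|h]; rewrite /bump1.
  by rewrite flat_neg ?mul0r// subr_le0.
by rewrite [X in _ * X]flat_neg ?mulr0// subr_le0.
Qed.

Lemma bump1_cont : continuous bump1.
Proof.
have cflat : continuous (flat 0).
  by move=> x; exact: is_derive_cont (is_derive_flat 0 x).
apply: continuousM2; apply: continuous_comp2 => // x.
  by apply: cvgB; [exact: cvg_id|exact: cvg_cst].
by apply: cvgB; [exact: cvg_cst|exact: cvg_id].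
Qed.

Lemma bump1_bounds : exists B m : R, [/\ 0 < m, 0 < B, forall x, bump1 x <= B &
  forall x, 3 / 8 <= x <= 5 / 8 -> m <= bump1 x].
Proof.
have [B B0 HB] := bounded_on_compact (@segment_compact R 0 1)
  (continuous_subspaceT bump1_cont).
have s38 : (`[3 / 8, 5 / 8]%classic : set R) !=set0.
  by exists (3 / 8); rewrite /= in_itv/=; apply/andP; split; lra.
have [c cI Hc] := compact_EVT_min s38 (@segment_compact R (3 / 8) (5 / 8))
  (continuous_subspaceT bump1_cont).
exists B, (bump1 c); split => //.
- move: cI; rewrite inE/= in_itv/= => /andP[c1 c2].
  by rewrite /bump1 mulr_gt0// flat_gt0//; lra.
- move=> x; have [h|h] := boolP (4^-1 < x < 3 / 4); last by rewrite bump1_eq0// ltW.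
  apply: le_trans (ler_norm _) _; apply: HB; rewrite /= in_itv/=.
  by move: h => /andP[? ?]; apply/andP; split; lra.
- by move=> x h; apply: Hc; rewrite inE/= in_itv.
Qed.

End Flat.

(** * Normalised smooth weights on squares *)

Section SquareBump.
Context (R : realType).
Implicit Types (a b dl : R).

Definition sbump a dl (x : R) : R := bump1 ((x - a) / dl).

Definition mass a dl : R := Int leb1 (sbump a dl).

Definition wbump a dl (x : R) : R := (mass a dl)^-1 * sbump a dl x.

Lemma sbump_eq0 a dl x : 0 < dl -> ~~ (a < x < a + dl) -> sbump a dl x = 0.
Proof.
move=> d0 h; apply: bump1_eq0; apply: contra h => /andP[].
rewrite ltr_pdivlMr// ltr_pdivrMr// => h1 h2; apply/andP; split; lra.
Qed.

Lemma sbump_cont a dl : continuous (sbump a dl).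
Proof.
apply: continuous_comp2; first exact: bump1_cont.
by move=> x; apply: cvgMl; apply: cvgB; [exact: cvg_id|exact: cvg_cst].
Qed.

Lemma Int_indic_cc a dl : 0 < dl ->
  intg leb1 (\1_(`[a, a + dl]%classic : set R)) /\
  Int leb1 (\1_(`[a, a + dl]%classic : set R)) = dl.
Proof.
move=> d0.
have E : (\int[leb1]_x (\1_(`[a, a + dl]%classic : set R) x)%:E = dl%:E)%E.
  rewrite integral_indic//= setIT lebesgue_measure_itv/= lte_fin ltrDl d0.
  by rewrite -EFinB addrAC subrr add0r.
split; last by rewrite /Int /Rintegral E.
apply: intg_ge0P => [|z|]; first exact: measurable_indic.
  by rewrite indicE.
by rewrite E ltry.
Qed.

Lemma sbump_intg a dl : 0 < dl -> intg leb1 (sbump a dl).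
Proof.
move=> d0; have [B [m [m0 B0 HB Hm]]] := @bump1_bounds R.
have [i1 _] := Int_indic_cc a d0.
apply: (intg_le _ (intgZ B i1)).
  exact: continuous_measurable_fun (@sbump_cont a dl).
move=> x; rewrite indicE; case: (boolP (a < x < a + dl)) => h.
  rewrite mem_set ?mulr1.
    by rewrite ger0_norm ?bump1_ge0// (le_trans (HB _))// ler_norm.
  by rewrite /= in_itv/=; move: h => /andP[/ltW -> /ltW ->].
by rewrite sbump_eq0// normr0.
Qed.

Lemma mass_ge : exists2 c : R, 0 < c & forall a dl, 0 < dl -> c * dl <= mass a dl.
Proof.
have [B [m [m0 B0 HB Hm]]] := @bump1_bounds R.
exists (m / 4); first by rewrite divr_gt0.
move=> a dl d0; have d4 : 0 < dl / 4 by rewrite divr_gt0.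
have [i1 e1] := Int_indic_cc (a + 3 / 8 * dl) d4.
have <- : Int leb1 (fun x => m * \1_(`[a + 3 / 8 * dl, a + 3 / 8 * dl + dl / 4]%classic : set R) x) = m / 4 * dl.
  by rewrite IntZ// e1; field.
apply: Int_le; [exact: intgZ|exact: sbump_intg|] => x.
rewrite indicE; have [h|h] := boolP (x \in _); last by rewrite mulr0 bump1_ge0.
rewrite mulr1; apply: Hm; move: h; rewrite inE/= in_itv/= => /andP[h1 h2].
by rewrite ler_pdivlMr// ler_pdivrMr//; apply/andP; split; lra.
Qed.

Lemma mass_gt0 a dl : 0 < dl -> 0 < mass a dl.
Proof.
by move=> d0; have [c c0 /(_ a dl d0)] := mass_ge; apply: lt_le_trans; rewrite mulr_gt0.
Qed.

Lemma wbump_prop a dl : 0 < dl -> [/\ forall x, 0 <= wbump a dl x,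
  intg leb1 (wbump a dl), Int leb1 (wbump a dl) = 1,
  continuous (wbump a dl) &
  forall x, ~~ (a < x < a + dl) -> wbump a dl x = 0].
Proof.
move=> d0; have m0 := mass_gt0 a d0; split.
- by move=> x; rewrite mulr_ge0 ?bump1_ge0// invr_ge0 ltW.
- by apply: intgZ; exact: sbump_intg.
- by rewrite IntZ ?mulVf ?gt_eqF//; exact: sbump_intg.
- by apply: continuousM2 => [x|]; [exact: cvg_cst|exact: sbump_cont].
- by move=> x xa; rewrite /wbump sbump_eq0// mulr0.
Qed.

(** The bump is bounded and its mass is at least a multiple of [dl]. The constant depends neither on
    the place nor on the size of the cell, and so neither does the one in [poincare_square]. *)
Lemma wbump_le : exists2 c0 : R, 0 < c0 & forall a dl x, 0 < dl -> wbump a dl x <= c0 / dl.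
Proof.
have [B [m [m0 B0 HB Hm]]] := @bump1_bounds R.
have [c c0 Hc] := mass_ge; exists (B / c); first by rewrite divr_gt0.
move=> a dl x d0; rewrite /wbump ler_pdivrMl ?mass_gt0//.
apply: (le_trans (HB _)).
have p0 : 0 < B / c / dl by rewrite !divr_gt0.
have := Hc a dl d0; rewrite -(ler_pM2r p0).
by apply: le_trans; rewrite le_eqVlt; apply/orP; left; apply/eqP; field; rewrite !gt_eqF.
Qed.

Definition omega a b dl (z : R * R) : R := wbump a dl z.1 * wbump b dl z.2.

Lemma omega_Cc a b dl : 0 < dl -> 0 <= b -> b + dl <= 1 ->
  Cc_infty Omega (omega a b dl).
Proof.
move=> d0 b0 b1.
have sl (i : bool) (c : R) (e : R) n : Ck n setT (fun z : R * R =>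
    flat 0 (c + e * (if i then z.1 else z.2))).
  apply: flat_smooth.
    move=> z; apply: cvgD; first exact: cvg_cst.
    by apply: cvgMr; case: i; [exact: cvg_fst|exact: cvg_snd].
  move=> w; exists (e * (if i then w.1 else w.2)) => x.
  have dc : is_derive x w (fun=> c) 0 by exact: is_derive_cst.
  have dz : is_derive x w (fun z : R * R => if i then z.1 else z.2) (if i then w.1 else w.2).
    apply: is_derive_quot => h h0; case: i => /=; rewrite addrK;
      by rewrite [h *: _]/(h * _) [_ *: _]mulrA mulVf// mul1r.
  have := is_derive_add dc (is_derive_scale e dz).
  by rewrite add0r.
pose K : set (R * R) := `[a + dl / 4, a + 3 / 4 * dl]%classic `*` `[b + dl / 4, b + 3 / 4 * dl]%classic.
have sb c x : ~ (c + dl / 4 <= x <= c + 3 / 4 * dl) -> wbump c dl x = 0.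
  move=> h; rewrite /wbump /sbump bump1_eq0 ?mulr0//; apply/negP => /andP[].
  by rewrite ltr_pdivlMr// ltr_pdivrMr// => h1 h2; apply: h; apply/andP; split; lra.
apply: (@Cc_infty_supp _ _ _ K).
- move=> k.
  have wk (i : bool) c : Ck k setT (fun z : R * R => wbump c dl (if i then z.1 else z.2)).
    rewrite (_ : (fun z => _) = (fun z : R * R => (mass c dl)^-1 *
      (flat 0 (- (c / dl) - 4^-1 + dl^-1 * (if i then z.1 else z.2)) *
       flat 0 (3 / 4 + c / dl + - dl^-1 * (if i then z.1 else z.2))))).
      by apply: CkZ; apply: CkM; exact: sl.
    apply/funext => z; rewrite /wbump /sbump /bump1; congr (_ * (flat _ _ * flat _ _)); ring.
  by apply: CkM; [exact: (wk true a)|exact: (wk false b)].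
- by apply: compact_setX; exact: segment_compact.
- move=> [x y] [_] /=; rewrite in_itv/= /Omega/= => /andP[y1 y2].
  by apply/andP; split; lra.
- move=> [x y] nK; rewrite /omega/=.
  have [xK|xK] := boolP (a + dl / 4 <= x <= a + 3 / 4 * dl); last first.
    by rewrite sb ?mul0r//; exact/negP.
  rewrite [X in _ * X]sb ?mulr0// => yK; apply: nK; split; by rewrite /= in_itv.
Qed.

End SquareBump.

Lemma sqr_bound_chain (R : realType) (X m P a b : R) : (X - P) ^+ 2 <= a -> (P - m) ^+ 2 <= b ->
  X ^+ 2 <= 2 * m ^+ 2 + 4 * a + 4 * b.
Proof.
by move=> h1 h2; have := sqr_ge0 (X - 2 * m); have := sqr_ge0 (X - P - (P - m)); lra.
Qed.

(** * Poincare inequality on a square with a smooth weight *)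

Section Poincare.
Context (R : realType).
Implicit Types (a b dl : R).

Notation chi a dl := (\1_(`[a, a + dl]%classic : set R)).

Lemma chi_sqr a dl (s : R) : chi a dl s ^+ 2 = chi a dl s :> R.
Proof. by rewrite indicE; case: (s \in _); rewrite ?expr1n ?expr0n. Qed.

Lemma chi01 a dl (s : R) : 0 <= (chi a dl s : R) <= 1.
Proof. by rewrite indicE; case: (s \in _); rewrite /= ?lexx ?ler01. Qed.

Lemma chi1 a dl s : a <= s <= a + dl -> chi a dl s = 1 :> R.
Proof. by move=> h; rewrite indicE mem_set//= in_itv. Qed.

Lemma sq_chi_cont a dl (g : R -> R) : 0 < dl -> continuous g ->
  sq leb1 (fun s => chi a dl s * g s).
Proof.
move=> d0 cg; have [i1 _] := Int_indic_cc a d0.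
have [B B0 HB] := bounded_on_compact (@segment_compact R a (a + dl)) (continuous_subspaceT cg).
have m1 : measurable_fun setT (fun s => chi a dl s * g s).
  by apply: measurable_funM; [exact: measurable_indic|exact: continuous_measurable_fun].
split => //; apply: (intg_le _ (intgZ (B ^+ 2) i1)); first exact: measurable_funX.
move=> s; rewrite indicE; have [h|h] := boolP (s \in _); last by rewrite mul0r expr0n normr0.
rewrite mul1r mulr1 !normrX lerXn2r ?nnegrE//.
by rewrite (le_trans (HB s _)) ?ler_norm//; rewrite inE in h.
Qed.

(** The fundamental theorem of calculus, then Cauchy-Schwarz on an interval of length at most
    [dl]. *)
Lemma oscillation a dl (g dg : R -> R) x x' : 0 < dl ->
  (forall s : R, is_derive s 1 g (dg s)) -> continuous dg ->
  a <= x <= a + dl -> a <= x' <= a + dl ->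
  (g x - g x') ^+ 2 <= dl * Int leb1 (fun s => chi a dl s * dg s ^+ 2).
Proof.
move=> d0; wlog xx : x x' / x' <= x => [H gd cd xa xa'|].
  have [h|/ltW h] := leP x' x; first exact: H.
  by rewrite -opprB sqrrN; exact: H.
move=> gd cd /andP[x1 x2] /andP[y1 y2].
have cg : continuous g by move=> s; exact: is_derive_cont (gd s).
have cg' : {within `[x', x], continuous g} by exact: within_cont.
have cd' : {within `[x', x], continuous dg} by exact: within_cont.
have <- := FTC xx (fun s _ => gd s) cg' cd'.
have sI : sq leb1 (\1_(`[x', x]%classic : set R)).
  have m : measurable_fun setT (\1_(`[x', x]%classic : set R) : R -> R).
    exact: measurable_indic.
  have [i1 _] := Int_indic_cc a d0.
  split => //; apply: (intg_le _ i1); first exact: measurable_funX.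
  move=> s; rewrite !indicE; have [h|_] := boolP (s \in `[x', x]%classic); last by rewrite expr0n normr0.
  rewrite mem_set ?expr1n//=; move: h; rewrite inE/= !in_itv/= => /andP[h1 h2].
  by rewrite (le_trans y1)// (le_trans h2).
have sD := sq_chi_cont a d0 cd.
have -> : \int[leb1]_(s in `[x', x]) dg s = ip leb1 (\1_(`[x', x]%classic : set R)) (fun s => chi a dl s * dg s).
  rewrite Rintegral_mkcond; apply: eq_Int => s; rewrite patchE !indicE.
  have [h|h] := boolP (s \in `[x', x]%classic); last by rewrite mul0r.
  rewrite mem_set ?mul1r//=; move: h; rewrite inE/= !in_itv/= => /andP[h1 h2].
  by rewrite (le_trans y1)// (le_trans h2).
apply: (le_trans (cauchy_schwarz sI sD)).
have -> : ip leb1 (fun s => chi a dl s * dg s) (fun s => chi a dl s * dg s)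
   = Int leb1 (fun s => chi a dl s * dg s ^+ 2).
  by rewrite ipE; apply: eq_Int => s; rewrite exprMn chi_sqr.
rewrite ler_wpM2r//.
  by apply: Int_ge0 => s; rewrite mulr_ge0 ?sqr_ge0//; have /andP[] := chi01 a dl s.
have -> : ip leb1 (\1_(`[x', x]%classic : set R)) (\1_(`[x', x]%classic : set R)) = x - x'.
  rewrite ipE (_ : Int _ _ = Int leb1 (\1_(`[x', x]%classic : set R))).
    rewrite /Int /Rintegral integral_indic//= setIT lebesgue_measure_itv/= lte_fin.
    by case: ltgtP xx => // ->; rewrite subrr.
  by apply: eq_Int => s; rewrite indicE; case: (s \in _); rewrite ?expr1n ?expr0n.
lra.
Qed.

Section WithWeight.
Variables (a dl : R) (psi : R -> R).
Hypotheses (d0 : 0 < dl) (psi0 : forall x, 0 <= psi x) (psii : intg leb1 psi)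
  (psi1 : Int leb1 psi = 1) (psic : continuous psi)
  (psis : forall x, ~~ (a < x < a + dl) -> psi x = 0).

Lemma psi_cont_intg (g : R -> R) : continuous g -> intg leb1 (fun s => psi s * g s).
Proof.
move=> cg; have := intgM (sq_chi_cont a d0 psic) (sq_chi_cont a d0 cg).
congr intg; apply/funext => s; rewrite indicE.
have [h|h] := boolP (s \in _); first by rewrite !mul1r.
rewrite !mul0r psis ?mul0r//; apply: contra h => /andP[/ltW h1 /ltW h2].
by rewrite mem_set//= in_itv/= h1.
Qed.

Lemma mean_oscillation (g dg : R -> R) x :
  (forall s : R, is_derive s 1 g (dg s)) -> continuous dg -> a <= x <= a + dl ->
  (g x - Int leb1 (fun s => psi s * g s)) ^+ 2
    <= dl * Int leb1 (fun s => chi a dl s * dg s ^+ 2).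
Proof.
move=> gd cd xa; set E := dl * _.
have cg : continuous g by move=> s; exact: is_derive_cont (gd s).
have E0 : 0 <= E.
  apply: mulr_ge0; first exact: ltW.
  apply: Int_ge0 => s; apply: mulr_ge0; last exact: sqr_ge0.
  by have /andP[] := chi01 a dl s.
have ig := psi_cont_intg cg.
have -> : g x - Int leb1 (fun s => psi s * g s) = Int leb1 (fun s => psi s * (g x - g s)).
  under [RHS]eq_Int do rewrite mulrBr mulrC.
  by rewrite IntB ?IntZ ?psi1 ?mulr1//; exact: intgZ.
have i2 : intg leb1 (fun s => psi s * (g x - g s)).
  apply: psi_cont_intg => s; apply: cvgB; first exact: cvg_cst.
  exact: cg.
have key : `|Int leb1 (fun s => psi s * (g x - g s))| <= Num.sqrt E.
  apply: (le_trans (Int_norm i2)).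
  rewrite -[leRHS]mulr1 -psi1 -IntZ//; apply: Int_le; [exact: intg_norm|exact: intgZ|].
  move=> s; rewrite normrM (ger0_norm (psi0 s)) mulrC.
  have [sa|sa] := boolP (a < s < a + dl); last by rewrite psis ?mulr0// mulr0.
  rewrite ler_wpM2r// -sqrtr_sqr ler_wsqrtr//; apply: oscillation => //.
  by move: sa => /andP[/ltW -> /ltW ->].
rewrite -[leLHS]real_normK ?num_real// -[leRHS](sqr_sqrtr E0).
by rewrite lerXn2r ?nnegrE// sqrtr_ge0.
Qed.

(** The variance of [F] under the probability density [psi] is nonnegative. *)
Lemma jensen_sqr (F : R -> R) : intg leb1 (fun s => psi s * F s) ->
  intg leb1 (fun s => psi s * F s ^+ 2) ->
  Int leb1 (fun s => psi s * F s) ^+ 2 <= Int leb1 (fun s => psi s * F s ^+ 2).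
Proof.
move=> i1 i2; set t := Int leb1 (fun s => psi s * F s).
have : 0 <= Int leb1 (fun s => psi s * F s ^+ 2 + (- 2 * t * (psi s * F s) + t ^+ 2 * psi s)).
  apply: Int_ge0 => s.
  rewrite (_ : _ + _ = psi s * (F s - t) ^+ 2); last by ring.
  by rewrite mulr_ge0 ?sqr_ge0.
rewrite IntD//; last by apply: intgD; exact: intgZ.
rewrite IntD; [|exact: intgZ..].
by rewrite !IntZ// psi1 -/t; lra.
Qed.

End WithWeight.

Lemma slice_cont_x (f : R * R -> R) y : continuous f -> continuous (fun x => f (x, y)).
Proof.
move=> cf x; apply: (@continuous_comp _ _ _ (fun x => (x, y)) f); last exact: cf.
exact: continuous_pairl.
Qed.

Lemma slice_cont_y (f : R * R -> R) x : continuous f -> continuous (fun y => f (x, y)).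
Proof.
move=> cf y; apply: (@continuous_comp _ _ _ (fun y => (x, y)) f); last exact: cf.
exact: continuous_pairr.
Qed.

Definition chi2 a b dl (z : R * R) : R := chi a dl z.1 * chi b dl z.2.

(** Two one-dimensional comparisons: of [v (x, y)] with a weighted mean along its horizontal line,
    and of that mean with the weighted mean over the square, by vertical oscillation. The weight is
    smooth so that the mean over the square is a pairing with a test function; such pairings
    converge for the approximations. *)
Lemma poincare_square : exists2 C : R, 0 < C & forall a b dl M v vx vy,
  0 < dl -> C1c M v vx vy ->
  Int leb2 (fun z => chi2 a b dl z * v z ^+ 2) <=
   2 * dl ^+ 2 * ip leb2 v (omega a b dl) ^+ 2
   + C * dl ^+ 2 * Int leb2 (fun z => chi2 a b dl z * (vx z ^+ 2 + vy z ^+ 2)).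
Proof.
have [c0 c00 Hc0] := @wbump_le R.
exists (4 + 4 * c0); first by lra.
move=> a b dl M v vx vy d0 vC.
have [bv bvx bvy] := C1c_bsupp vC; have [cv cvx cvy dv v0] := vC.
have [p0 pi p1 pc ps] := wbump_prop a d0; have [q0 qi q1 qc qs] := wbump_prop b d0.
have mchi c : measurable_fun setT (chi c dl : R -> R) by exact: measurable_indic.
have mchi2 : measurable_fun setT (chi2 a b dl : R * R -> R).
  by apply: measurable_funM; apply: measurable_indic_comp.
have bchi2 : exists B : R, forall z, `|chi2 a b dl z| <= B.
  exists 1 => z; rewrite /chi2 ger0_norm.
    by have /andP[? ?] := chi01 a dl z.1; have /andP[? ?] := chi01 b dl z.2; rewrite mulr_ile1.
  by have /andP[? ?] := chi01 a dl z.1; have /andP[? ?] := chi01 b dl z.2; rewrite mulr_ge0.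
have bsq f : bsupp M f -> bsupp M (fun z => f z ^+ 2).
  by move=> bf; have [? ? _] := bf; under eq_fun do rewrite expr2; exact: bsuppM.
have bchi f : bsupp M f -> bsupp M (fun z => chi2 a b dl z * f z).
  by move=> bf; under eq_fun do rewrite mulrC; exact: bsuppM.
have ichi f : bsupp M f -> intg leb2 (fun z => chi2 a b dl z * f z ^+ 2).
  by move=> bf; exact: bsupp_intg (bchi _ (bsq _ bf)).
have ic1 c (g : R -> R) : continuous g -> intg leb1 (fun s => chi c dl s * g s ^+ 2).
  move=> cg; have /sq_intg := @sq_chi_cont c dl g d0 cg.
  by congr intg; apply/funext => r; rewrite exprMn chi_sqr.
have icx y : intg leb1 (fun s => chi a dl s * vx (s, y) ^+ 2).
  by apply: ic1; exact: slice_cont_x.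
have icy s : intg leb1 (fun r => chi b dl r * vy (s, r) ^+ 2).
  by apply: ic1; exact: slice_cont_y.
pose m := ip leb2 v (omega a b dl).
pose A y := Int leb1 (fun s => chi a dl s * vx (s, y) ^+ 2).
pose B := Int leb2 (fun z => chi2 a b dl z * vy z ^+ 2).
have chi0 c s : 0 <= (chi c dl s : R) by have /andP[] := chi01 c dl s.
have B0 : 0 <= B by apply: Int_ge0 => z; rewrite mulr_ge0 ?sqr_ge0// mulr_ge0.
have mE : m = Int leb1 (fun s => wbump a dl s * Int leb1 (fun r => wbump b dl r * v (s, r))).
  rewrite /m /ip Int_fubini; last first.
    apply: bsupp_intg (bsuppM bv _ _).
      by apply: measurable_funM; apply: continuous_measurable2; apply: continuous_comp2 => // z; [exact: cvg_fst|exact: cvg_snd].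
    exists (c0 / dl * (c0 / dl)) => z; rewrite ger0_norm; last exact: mulr_ge0.
    by apply: ler_pM => //; exact: Hc0.
  apply: eq_Int => s; rewrite -IntZ; last by apply: (psi_cont_intg d0 qc qs); exact: slice_cont_y.
  by apply: eq_Int => r; rewrite /omega/=; ring.
(* Integration over the square turns the constant terms into multiples of its area [dl ^+ 2], and
   gives the term with [A y] a second factor [dl] from the horizontal direction. *)
have main x y : a <= x <= a + dl -> b <= y <= b + dl ->
    v (x, y) ^+ 2 <= 2 * m ^+ 2 + 4 * dl * A y + 4 * c0 * B.
  move=> xa yb.
  pose P1 := Int leb1 (fun s => wbump a dl s * v (s, y)).
  have h1 : (v (x, y) - P1) ^+ 2 <= dl * A y.
    apply: (@mean_oscillation a dl _ d0 p0 pi p1 pc ps (fun s => v (s, y)) (fun s => vx (s, y))) => //.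
      by move=> s; exact: is_derive_slice_x (dv (s, y)).1.
    exact: slice_cont_x.
  pose F s := v (s, y) - Int leb1 (fun r => wbump b dl r * v (s, r)).
  have e1 s : F s ^+ 2 <= dl * Int leb1 (fun r => chi b dl r * vy (s, r) ^+ 2).
    apply: (@mean_oscillation b dl _ d0 q0 qi q1 qc qs (fun r => v (s, r)) (fun r => vy (s, r))) => //.
      by move=> r; exact: is_derive_slice_y (dv (s, r)).2.
    exact: slice_cont_y.
  have bwv : bsupp M (fun z => v z * wbump b dl z.2).
    apply: bsuppM => //.
      by apply: continuous_measurable2; apply: continuous_comp2 => // z; exact: cvg_snd.
    by exists (c0 / dl) => z; rewrite ger0_norm// Hc0.
  have iG : intg leb1 (fun s => Int leb1 (fun r => wbump b dl r * v (s, r))).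
    have := intg_fubini (bsupp_intg bwv); congr intg; apply/funext => s.
    by apply: eq_Int => r; rewrite mulrC.
  have mF : measurable_fun setT F.
    apply: measurable_funB; last exact: intg_meas iG.
    by apply: continuous_measurable_fun; exact: slice_cont_x.
  have [_ [V hV] _] := bv.
  have FB s : `|F s| <= 2 * V.
    rewrite (le_trans (ler_normB _ _))// mulr2n mulrDl mul1r lerD//.
    have ii : intg leb1 (fun r => wbump b dl r * v (s, r)).
      by apply: (psi_cont_intg d0 qc qs); exact: slice_cont_y.
    apply: (le_trans (Int_norm ii)); rewrite -[leRHS]mulr1 -q1 -IntZ//.
    apply: Int_le; [exact: intg_norm|exact: intgZ|] => r.
    by rewrite normrM ger0_norm// mulrC ler_wpM2r.
  have mp : measurable_fun setT (wbump a dl) by exact: continuous_measurable_fun.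
  have iF : intg leb1 (fun s => wbump a dl s * F s).
    apply: (intg_le _ (intgZ (2 * V) pi)); first exact: measurable_funM.
    move=> s; rewrite normrM [leRHS]normrM mulrC; apply: ler_wpM2r => //.
    exact: le_trans (FB s) (ler_norm _).
  have iF2 : intg leb1 (fun s => wbump a dl s * F s ^+ 2).
    apply: (intg_le _ (intgZ ((2 * V) ^+ 2) pi)).
      by apply: measurable_funM => //; exact: measurable_funX.
    move=> s; rewrite normrM [leRHS]normrM mulrC; apply: ler_wpM2r => //.
    rewrite !normrX lerXn2r ?nnegrE//; exact: le_trans (FB s) (ler_norm _).
  (* Jensen's inequality moves the square inside the horizontal mean; the bound [c0 / dl] on the
     weight then cancels the factor [dl] in [e1]. *)
  have h2 : (P1 - m) ^+ 2 <= c0 * B.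
    have -> : P1 - m = Int leb1 (fun s => wbump a dl s * F s).
      rewrite mE /P1 -IntB.
      - by apply: eq_Int => s; rewrite -mulrBr.
      - by apply: (psi_cont_intg d0 pc ps); exact: slice_cont_x.
      - have : intg leb1 (fun s => wbump a dl s * v (s, y)).
          by apply: (psi_cont_intg d0 pc ps); exact: slice_cont_x.
        move=> /intgB /(_ iF); congr intg; apply/funext => s; rewrite /F; ring.
    apply: (le_trans (jensen_sqr p0 pi p1 iF iF2)).
    rewrite /B Int_fubini; last exact: ichi.
    have i3 : intg leb1 (fun s => Int leb1 (fun r => chi2 a b dl (s, r) * vy (s, r) ^+ 2)).
      exact: intg_fubini (ichi _ bvy).
    rewrite -IntZ//; apply: Int_le; [exact: iF2|exact: intgZ|] => s.
    have -> : Int leb1 (fun r => chi2 a b dl (s, r) * vy (s, r) ^+ 2)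
        = chi a dl s * Int leb1 (fun r => chi b dl r * vy (s, r) ^+ 2).
      rewrite -IntZ; first by apply: eq_Int => r; rewrite /chi2/=; ring.
      exact: icy.
    have i0 : 0 <= Int leb1 (fun r => chi b dl r * vy (s, r) ^+ 2).
      by apply: Int_ge0 => r; rewrite mulr_ge0 ?sqr_ge0.
    have [sa|sa] := boolP (a < s < a + dl); last first.
      by rewrite ps// mul0r !mulr_ge0// ltW.
    rewrite chi1; last by move: sa => /andP[/ltW -> /ltW ->].
    rewrite mul1r; apply: (@le_trans _ _ (c0 / dl * F s ^+ 2)).
      by rewrite ler_wpM2r ?sqr_ge0// Hc0.
    apply: (@le_trans _ _ (c0 / dl * (dl * Int leb1 (fun r => chi b dl r * vy (s, r) ^+ 2)))).
      by rewrite ler_wpM2l ?e1// divr_ge0// ltW.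
    by rewrite mulrA divfK ?gt_eqF.
  by have := sqr_bound_chain h1 h2; rewrite !mulrA.
have [iA eA] := Int_indic_cc a d0; have [iB eB] := Int_indic_cc b d0.
have Ai : intg leb1 (fun y => chi b dl y * A y) /\
    Int leb1 (fun y => chi b dl y * A y) = Int leb2 (fun z => chi2 a b dl z * vx z ^+ 2).
  have e y : Int leb1 (fun x => chi2 a b dl (x, y) * vx (x, y) ^+ 2) = chi b dl y * A y.
    rewrite -IntZ; first by apply: eq_Int => x; rewrite /chi2/=; ring.
    exact: icx.
  split; last by rewrite (Int_fubini2 (ichi _ bvx)); apply: eq_Int => y; rewrite e.
  have mA : measurable_fun setT (fun y => chi b dl y * A y).
    have -> : (fun y => chi b dl y * A y) = (fun y => Int leb1 (fun x => chi2 a b dl (x, y) * vx (x, y) ^+ 2)).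
      by apply/funext => y; rewrite e.
    have ms : measurable_fun setT (fun z : R * R => chi2 a b dl (z.2, z.1) * vx (z.2, z.1) ^+ 2).
      have := (bchi _ (bsq _ bvx)); case=> + _ _ => mm.
      by apply: (@measurableT_comp _ _ _ _ _ _ _ setT (fun z : R * R => (z.2, z.1)) mm); apply/measurable_fun_pair.
    have := @measurable_Int_slice _ _ _ _ _ leb1 _ ms.
    by apply=> z; rewrite mulr_ge0 ?sqr_ge0// mulr_ge0.
  have [_ [X hX] _] := bvx.
  apply: (intg_le _ (intgZ (X ^+ 2 * dl) iB)) => [|y]; first exact: mA.
  rewrite normrM ger0_norm// mulrC normrM (ger0_norm (chi0 b y)) ler_wpM2r//.
  rewrite ger0_norm; last by apply: Int_ge0 => s; rewrite mulr_ge0 ?sqr_ge0.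
  apply: le_trans (ler_norm _); rewrite -eA -IntZ//; apply: Int_le.
  - exact: icx.
  - exact: intgZ.
  - move=> s; rewrite mulrC ler_wpM2r// -real_normK ?num_real// lerXn2r ?nnegrE//.
    by rewrite (le_trans _ (hX (s, y))).
have Iv := ichi _ bv.
have cst_box : intg leb2 (chi2 a b dl : R * R -> R) /\ Int leb2 (chi2 a b dl) = dl ^+ 2.
  have i : intg leb2 (chi2 a b dl : R * R -> R).
    apply: intg_tonelli => //.
    - by move=> z; rewrite mulr_ge0.
    - by apply: aeW => x; exact: (intgZ (chi a dl x) iB).
    - have -> : (fun x => Int leb1 (fun y => chi2 a b dl (x, y))) = (fun x => dl * chi a dl x).
        by apply/funext => x; rewrite /chi2/= IntZ// eB mulrC.
      exact: intgZ.
  split => //; rewrite Int_fubini//.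
  transitivity (Int leb1 (fun x => dl * chi a dl x)); last by rewrite IntZ// eA.
  by apply: eq_Int => x; rewrite /chi2/= IntZ// eB mulrC.
have [ic ec] := cst_box.
rewrite (_ : Int leb2 (fun z => chi2 a b dl z * (vx z ^+ 2 + vy z ^+ 2)) =
   Int leb2 (fun z => chi2 a b dl z * vx z ^+ 2) + B); last first.
  by rewrite -IntD; [|exact: ichi..]; apply: eq_Int => z; rewrite mulrDr.
have iR : intg leb2 (fun z => chi a dl z.1 * (chi b dl z.2 * A z.2)).
  have [iA' _] := Ai; apply: intg_tonelli => //.
  - apply: measurable_funM; first exact: measurable_indic_comp.
    apply: (@measurableT_comp _ _ _ _ _ _ (fun y => chi b dl y * A y)) => //.
    exact: intg_meas iA'.
  - move=> z; rewrite !mulr_ge0//; apply: Int_ge0 => s; rewrite mulr_ge0 ?sqr_ge0//.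
  - by apply: aeW => x; exact: (intgZ (chi a dl x) iA').
  - have -> : (fun x => Int leb1 (fun y => chi a dl x * (chi b dl y * A y))) =
      (fun x => Int leb1 (fun y => chi b dl y * A y) * chi a dl x).
      by apply/funext => x; rewrite IntZ// mulrC.
    exact: intgZ.
have eR : Int leb2 (fun z => chi a dl z.1 * (chi b dl z.2 * A z.2)) =
    dl * Int leb2 (fun z => chi2 a b dl z * vx z ^+ 2).
  have [iA' <-] := Ai; rewrite Int_fubini//.
  transitivity (Int leb1 (fun x => Int leb1 (fun y => chi b dl y * A y) * chi a dl x)).
    by apply: eq_Int => x; rewrite /= IntZ// mulrC.
  by rewrite IntZ// eA mulrC.
have := @Int_le _ _ _ leb2 (fun z => chi2 a b dl z * v z ^+ 2)
  (fun z => (2 * m ^+ 2 + 4 * c0 * B) * chi2 a b dl z + 4 * dl * (chi a dl z.1 * (chi b dl z.2 * A z.2)))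
  Iv (intgD (intgZ _ ic) (intgZ _ iR)).
rewrite IntD; [|exact: intgZ..]; rewrite !IntZ// ec eR.
have H : forall z, chi2 a b dl z * v z ^+ 2 <=
    (2 * m ^+ 2 + 4 * c0 * B) * chi2 a b dl z + 4 * dl * (chi a dl z.1 * (chi b dl z.2 * A z.2)).
  move=> [x y]; rewrite /chi2/= !indicE.
  have [xa|_] := boolP (x \in _); last by rewrite !(mul0r, mulr0) addr0.
  have [yb|_] := boolP (y \in _); last by rewrite !(mul0r, mulr0) addr0.
  rewrite !mul1r !mulr1.
  have := main x y; move: xa yb; rewrite !inE/= !in_itv/= => xa yb /(_ xa yb) h.
  by apply: (le_trans h); rewrite le_eqVlt; apply/orP; left; apply/eqP; ring.
move=> /(_ H) /le_trans; apply; rewrite -/m.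
set I1 := Int leb2 (fun z => chi2 a b dl z * vx z ^+ 2).
have I10 : 0 <= I1 by apply: Int_ge0 => z; rewrite mulr_ge0 ?sqr_ge0// mulr_ge0.
have d2 : 0 <= dl ^+ 2 by exact: sqr_ge0.
have := mulr_ge0 d2 B0; have := mulr_ge0 (ltW c00) (mulr_ge0 d2 I10).
rewrite !expr2; lra.
Qed.

End Poincare.

(** * A dense orthonormal family of test functions *)

Section Separability.
Context (R : realType).
Implicit Types (v w : R * R -> R).

Definition dx v : R * R -> R := 'D_(1, 0) v.
Definition dy v : R * R -> R := 'D_(0, 1) v.

Definition grid (M m : nat) : seq (R * R) :=
  [seq ((i%:R - (M * m.+1)%:R) / m.+1%:R, j%:R / m.+1%:R)
    | i <- iota 0 (2 * M * m.+1).+1, j <- iota 0 m.+2].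

Lemma floor_iota (a : R) (N : nat) : 0 <= a <= N%:R ->
  exists2 i : nat, (i < N.+1)%N & 0 <= a - i%:R <= 1.
Proof.
move=> /andP[a0 aN]; have /trunc_itv/andP[h1 h2] := a0.
exists (Num.trunc a); last by apply/andP; split; rewrite -?natr1 in h2 *; lra.
by rewrite ltnS -(ler_nat R) (le_trans h1).
Qed.

Lemma gridP M m (z : R * R) : inbox M%:R z -> exists2 p, p \in grid M m &
  `|z.1 - p.1| <= m.+1%:R^-1 /\ `|z.2 - p.2| <= m.+1%:R^-1.
Proof.
case: z => x y; rewrite /inbox/= ler_norml => /andP[/andP[x1 x2] /andP[y1 y2]].
have m0 : (0 : R) < m.+1%:R by rewrite ltr0n.
have h (c t : R) : 0 <= c * m.+1%:R - t <= 1 -> `|c - t / m.+1%:R| <= m.+1%:R^-1.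
  move=> /andP[h1 h2]; have -> : c - t / m.+1%:R = (c * m.+1%:R - t) / m.+1%:R.
    by field; rewrite gt_eqF.
  by rewrite normrM ger0_norm// gtr0_norm ?invr_gt0// ler_pdivrMr// mulVf ?gt_eqF.
have [i iN hi] : exists2 i : nat, (i < (2 * M * m.+1).+1)%N &
    0 <= x * m.+1%:R + (M * m.+1)%:R - i%:R <= 1.
  apply: floor_iota; rewrite !natrM -!mulrA.
  move: x1 x2; move: (M%:R : R) => N x1 x2.
  have : 0 <= (x + N) * m.+1%:R by apply: mulr_ge0; [lra|exact: ltW].
  have : 0 <= (N - x) * m.+1%:R by apply: mulr_ge0; [lra|exact: ltW].
  by move=> ? ?; apply/andP; split; lra.
have [j jN hj] : exists2 j : nat, (j < m.+2)%N & 0 <= y * m.+1%:R - j%:R <= 1.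
  apply: floor_iota; apply/andP; split; first by apply: mulr_ge0; exact: ltW.
  by apply: ler_piMl; exact: ltW.
exists ((i%:R - (M * m.+1)%:R) / m.+1%:R, j%:R / m.+1%:R).
  by apply/allpairsP; exists (i, j); rewrite !mem_iota.
split => /=; apply: h => //.
by move: hi => /andP[? ?]; apply/andP; split; lra.
Qed.

Definition bigbox (M : nat) : set (R * R) :=
  `[- (M%:R + 1), M%:R + 1]%classic `*` `[-1, 2]%classic.

Lemma grid_bigbox M m p : p \in grid M m -> bigbox M p.
Proof.
move=> /allpairsP[[i j] [iN jN ->]]; move: iN jN.
rewrite !mem_iota /= !add0n !ltnS => iN jN.
have m0 : (0 : R) < m.+1%:R by rewrite ltr0n.
move: iN jN; rewrite -!(ler_nat R) !natrM => iN jN.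
have m1 : (1 : R) <= m.+1%:R by rewrite ler1n.
have i0 : (0 : R) <= i%:R by [].
have j0 : (0 : R) <= j%:R by [].
split => /=; rewrite in_itv/=; apply/andP; split.
- rewrite ler_pdivlMr//; move: (M%:R : R) iN => N iN; nra.
- rewrite ler_pdivrMr//; move: (M%:R : R) iN => N iN; nra.
- by rewrite (le_trans (lerN10 R))// divr_ge0// ltW.
- rewrite ler_pdivrMr//; nra.
Qed.

Lemma inbox_bigbox (M : nat) z : inbox M%:R z -> bigbox M z.
Proof.
case: z => x y; rewrite /inbox/= ler_norml => /andP[/andP[? ?] /andP[? ?]].
by split => /=; rewrite in_itv/=; apply/andP; split; lra.
Qed.

Definition modulus (M m k : nat) (f : R * R -> R) := forall p q, bigbox M p -> bigbox M q ->
  `|p.1 - q.1| <= m.+1%:R^-1 -> `|p.2 - q.2| <= m.+1%:R^-1 ->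
  `|f p - f q| <= k.+1%:R^-1.

Lemma modulus_ex (M k : nat) f : continuous f -> exists m, forall m', (m <= m')%N -> modulus M m' k f.
Proof.
move=> cf.
have cB : compact (bigbox M) by apply: compact_setX; exact: segment_compact.
have k0 : (0 : R) < k.+1%:R^-1 by rewrite invr_gt0 ltr0n.
have [dl d0 H] := uniformly_continuous_on cB (continuous_subspaceT cf) k0.
have [m mP] : exists m : nat, m.+1%:R^-1 < dl.
  exists (Num.trunc dl^-1); rewrite -[ltRHS]invrK ltf_pV2 ?posrE ?invr_gt0// ?ltr0n//.
  have /trunc_itv/andP[_] : 0 <= dl^-1 by rewrite invr_ge0 ltW.
  by [].
exists m => m' mm' p q bp bq h1 h2; apply/ltW/H => //.
have h : m'.+1%:R^-1 < dl.
  by apply: le_lt_trans mP; rewrite lef_pV2 ?posrE ?ltr0n// ler_nat ltnS.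
by split; rewrite /ball/= (le_lt_trans _ h).
Qed.

(** A finite list of integers, hence an element of a countable type. Together with the moduli of
    continuity in [tame] it determines a function and its gradient up to [3 / k.+1] everywhere. *)
Definition samples (M m k : nat) v : seq (int * int * int) :=
  [seq (Num.floor (k.+1%:R * v p), Num.floor (k.+1%:R * dx v p), Num.floor (k.+1%:R * dy v p))
     | p <- grid M m].

Definition tame (M m k : nat) v := [/\ Cc_infty Omega v, C1c M%:R v (dx v) (dy v) &
  [/\ modulus M m k v, modulus M m k (dx v) & modulus M m k (dy v)]].

Lemma floor_close (a b : R) (k : nat) :
  Num.floor (k.+1%:R * a) = Num.floor (k.+1%:R * b) -> `|a - b| <= k.+1%:R^-1.
Proof.
move=> e; have k0 : (0 : R) < k.+1%:R by rewrite ltr0n.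
have h1 := floor_le_tmp (k.+1%:R * a); have h2 := floorD1_gt (k.+1%:R * a).
have h3 := floor_le_tmp (k.+1%:R * b); have h4 := floorD1_gt (k.+1%:R * b).
have : `|k.+1%:R * (a - b)| <= 1.
  by move: h1 h2; rewrite e intrD1 => h1 h2; rewrite intrD1 in h4; rewrite ler_norml mulrBr; apply/andP; split; lra.
by rewrite normrM gtr0_norm// mulrC -ler_pdivlMr// div1r.
Qed.

Lemma samples_close M m k v w : tame M m k v -> tame M m k w ->
  samples M m k v = samples M m k w -> forall z,
  [/\ `|v z - w z| <= 3 * k.+1%:R^-1, `|dx v z - dx w z| <= 3 * k.+1%:R^-1 &
      `|dy v z - dy w z| <= 3 * k.+1%:R^-1].
Proof.
move=> [_ vC [mv mvx mvy]] [_ wC [mw mwx mwy]] /eq_in_map E z.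
have k0 : (0 : R) < k.+1%:R^-1 by rewrite invr_gt0 ltr0n.
have [zM|zM] := boolP (inbox M%:R z); last first.
  have [_ _ _ _ /(_ z zM)[-> -> ->]] := vC; have [_ _ _ _ /(_ z zM)[-> -> ->]] := wC.
  by rewrite subrr normr0 mulr_ge0// ltW.
have [p pg [p1 p2]] := gridP m zM.
have [/floor_close e1 /floor_close e2 /floor_close e3] := E p pg.
have zb := inbox_bigbox zM; have pb := grid_bigbox pg.
have tri (f g : R * R -> R) : modulus M m k f -> modulus M m k g -> `|f p - g p| <= k.+1%:R^-1 ->
    `|f z - g z| <= 3 * k.+1%:R^-1.
  move=> mf mg fg; have := mf z p zb pb p1 p2; have := mg z p zb pb p1 p2.
  rewrite (_ : f z - g z = (f z - f p) + (f p - g p) - (g z - g p)); last by ring.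
  move: (k.+1%:R^-1) fg => K fg.
  have := ler_normB (f z - f p + (f p - g p)) (g z - g p).
  have := ler_normD (f z - f p) (f p - g p); lra.
by split; apply: tri.
Qed.

Definition coded (c : nat * nat * nat * seq (int * int * int)) v :=
  tame c.1.1.1 c.1.1.2 c.1.2 v /\ samples c.1.1.1 c.1.1.2 c.1.2 v = c.2.

(** Separability by choice: every code that is realised receives one function realising it, and the
    zero function stands for the other codes. Density follows because functions with the same code
    are close in the C^1 norm. *)
Definition dense_seq (j : nat) : R * R -> R :=
  if unpickle j is Some c then
    if pselect (exists v, coded c v) is left h then sval (cid h) else fun=> 0
  else fun=> 0.

Lemma dense_seq_Cc j : Cc_infty Omega (dense_seq j).
Proof.
rewrite /dense_seq; case: (unpickle j) => [c|]; last exact: Cc_infty0.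
case: pselect => [h|_]; last exact: Cc_infty0.
by case: (cid h) => v [[]].
Qed.

(** The box [M] is fixed before the accuracy [e], so that later limits only involve integrals over
    one bounded set. *)
Lemma dense_seqP v : Cc_infty Omega v -> exists M, C1c M v (dx v) (dy v) /\
  forall e, 0 < e -> exists j, C1c M (dense_seq j) (dx (dense_seq j)) (dy (dense_seq j)) /\
   forall z, [/\ `|v z - dense_seq j z| <= e, `|dx v z - dx (dense_seq j) z| <= e &
      `|dy v z - dy (dense_seq j) z| <= e].
Proof.
move=> vD; have [M0 vC0] := Cc_C1c vD.
have [M MM] : exists M : nat, M0 <= M%:R.
  exists (Num.trunc `|M0|).+1; rewrite (le_trans (ler_norm _))// ltW//.
  by have /trunc_itv/andP[_] := normr_ge0 M0.
have vC : C1c M%:R v (dx v) (dy v) := C1c_le MM vC0.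
exists M%:R; split => // e e0.
have [k kP] : exists k : nat, 3 * k.+1%:R^-1 <= e.
  exists (Num.trunc (3 / e)); rewrite ler_pdivrMr ?ltr0n// mulrC -ler_pdivrMr//.
  by have /trunc_itv/andP[_ /ltW] : 0 <= 3 / e by rewrite divr_ge0// ltW.
have [cv cvx cvy _ _] := vC.
have [m1 H1] := modulus_ex M k cv; have [m2 H2] := modulus_ex M k cvx.
have [m3 H3] := modulus_ex M k cvy.
pose m := maxn m1 (maxn m2 m3).
have tv : tame M m k v.
  split => //; split; [apply: H1|apply: H2|apply: H3].
  - exact: leq_maxl.
  - by rewrite /m maxnCA leq_maxl.
  - by rewrite /m maxnC maxnAC leq_max leqnn orbT.
exists (pickle (M, m, k, samples M m k v)); rewrite /dense_seq pickleK.
case: pselect => [h|[]]; last by exists v.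
case: (cid h) => w /= [tw /= sw]; split; first by case: tw.
move=> z; have [a b c] := samples_close tv tw (esym sw) z.
by split; apply: le_trans kP.
Qed.

End Separability.

(** * Gram-Schmidt orthonormalisation *)

Section GramSchmidt.
Context (R : realType).
Implicit Types (v w : R * R -> R).

Lemma C1c_dx M v vx vy : C1c M v vx vy -> vx = dx v /\ vy = dy v.
Proof.
by move=> [_ _ _ dv _]; split; apply/funext => z; have [[_ h] [_ h']] := dv z.
Qed.

Lemma Cc_dxy v : Cc_infty Omega v -> exists M, C1c M v (dx v) (dy v).
Proof. exact: Cc_C1c. Qed.

Lemma Cc_sq v : Cc_infty Omega v -> [/\ sq leb2 v, sq leb2 (dx v) & sq leb2 (dy v)].
Proof.
by move=> /Cc_dxy[M /C1c_bsupp[bv bx bY]]; split; apply: (@bsupp_sq _ M).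
Qed.

Definition lin (n : nat) (c : nat -> R) (f : nat -> R * R -> R) (z : R * R) : R :=
  \sum_(i < n) c i * f i z.

Lemma lin_Cc n c (f : nat -> R * R -> R) : (forall i, Cc_infty Omega (f i)) ->
  Cc_infty Omega (lin n c f).
Proof.
move=> fD; elim: n => [|n IH].
  by rewrite /lin; under eq_fun do rewrite big_ord0; exact: Cc_infty0.
rewrite /lin; under eq_fun do rewrite big_ord_recr /=.
by apply: Cc_inftyD => //; exact: Cc_inftyZ.
Qed.

Lemma dx_lin n c (f : nat -> R * R -> R) : (forall i, Cc_infty Omega (f i)) ->
  dx (lin n c f) = lin n c (fun i => dx (f i)) /\
  dy (lin n c f) = lin n c (fun i => dy (f i)).
Proof.
move=> fD.
have H : forall z : R * R, is_derive z (1, 0) (lin n c f) (lin n c (fun i => dx (f i)) z) /\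
    is_derive z (0, 1) (lin n c f) (lin n c (fun i => dy (f i)) z).
  move=> z; rewrite /lin; elim: n => [|n IH].
    by rewrite !big_ord0; split; under eq_fun do rewrite big_ord0; exact: is_derive_cst.
  rewrite !big_ord_recr /=; have [M [_ _ _ /(_ z)[d1 d2] _]] := Cc_dxy (fD n).
  split; under eq_fun do rewrite big_ord_recr /=; apply: is_derive_add;
    by [exact: IH.1|exact: IH.2|exact: is_derive_scale].
by split; apply/funext => z; have [[_ h] [_ h']] := H z.
Qed.

(** Around a point where [g] is nonzero there is a square of positive measure on which it is
    nonzero. *)
Lemma continuous_ip_eq0 M (g : R * R -> R) : continuous g -> bsupp M g ->
  ip leb2 g g = 0 -> g = fun=> 0.
Proof.
move=> cg bg; rewrite ipE => g0.
have := Int_eq0_ae (sq_intg (bsupp_sq bg)) (fun z => sqr_ge0 (g z)) g0 => ae0.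
apply/funext => -[x y]; apply/eqP; apply/negPn/negP => gn0.
have : \forall q \near (x, y), g q != 0.
  have := cg (x, y); move=> /(_ [set t | t != 0]) /=; apply.
  exact: (@open_neq R 0 (g (x, y)) gn0).
move=> /nbhs_ballP[e /= e0 H].
have [N [mN N0 HN]] := ae0.
have sub : (`]x - e, x + e[%classic : set R) `*` (`]y - e, y + e[%classic : set R) `<=` N.
  move=> [a b] [/=]; rewrite !in_itv/= => /andP[a1 a2] /andP[b1 b2].
  apply: HN => /= /eqP; rewrite sqrf_eq0; apply/negP; apply: H.
  by split; rewrite /ball/= ltr_distlC; apply/andP; split.
pose B : set (measurableTypeR R * measurableTypeR R) :=
  (`]x - e, x + e[%classic : set R) `*` (`]y - e, y + e[%classic : set R).
have mB : measurable B by exact: measurableX.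
have : (leb2 B <= 0)%E.
  apply: (le_trans (@le_measure _ _ _ leb2 B N (mem_set mB) (mem_set mN) sub)).
  by rewrite le_eqVlt; apply/orP; left; apply/eqP; exact: N0.
rewrite /leb2 product_measure1E//.
rewrite /leb1/= !lebesgue_measure_itv/= !lte_fin.
have -> : x - e < x + e by lra.
have -> : y - e < y + e by lra.
rewrite -!EFinB -EFinM lee_fin leNgt; apply/negP/negPn.
by rewrite mulr_gt0//; lra.
Qed.

(** If the residual has norm zero, the convention [0^-1 = 0] makes the new element the zero
    function. The indexing is kept, and the family is orthonormal up to zero elements. *)
Definition gs_step (F : seq (R * R -> R)) v : R * R -> R :=
  let g z := v z - \sum_(i < size F) ip leb2 v (nth (fun=> 0) F i) * nth (fun=> 0) F i z in
  fun z => (Num.sqrt (ip leb2 g g))^-1 * g z.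

Fixpoint gs_seq (e : nat -> R * R -> R) (n : nat) : seq (R * R -> R) :=
  if n is n'.+1 then rcons (gs_seq e n') (gs_step (gs_seq e n') (e n')) else [::].

Definition gs e (i : nat) : R * R -> R := nth (fun=> 0) (gs_seq e i.+1) i.

Lemma size_gs_seq e n : size (gs_seq e n) = n.
Proof. by elim: n => [|n IH] //=; rewrite size_rcons IH. Qed.

Lemma nth_gs_seq e n i : (i < n)%N -> nth (fun=> 0) (gs_seq e n) i = gs e i.
Proof.
elim: n => [|n IH]; first by rewrite ltn0.
rewrite ltnS leq_eqVlt => /predU1P[->//|iN].
by rewrite /= nth_rcons size_gs_seq iN IH.
Qed.

Definition gs_res e n (z : R * R) : R :=
  e n z - \sum_(i < n) ip leb2 (e n) (gs e i) * gs e i z.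

Lemma gsE e n : gs e n = fun z => (Num.sqrt (ip leb2 (gs_res e n) (gs_res e n)))^-1 * gs_res e n z.
Proof.
rewrite {1}/gs /= nth_rcons size_gs_seq ltnn eqxx /gs_step size_gs_seq.
set g1 := (fun z => e n z - _).
have E : g1 = gs_res e n.
  by apply/funext => z; congr (_ - _); apply: eq_bigr => i _; rewrite nth_gs_seq.
by rewrite E; apply/funext => z; rewrite -E.
Qed.

Variable e : nat -> R * R -> R.
Hypothesis eD : forall j, Cc_infty Omega (e j).

Lemma gs_res_Cc n : (forall i, (i < n)%N -> Cc_infty Omega (gs e i)) -> Cc_infty Omega (gs_res e n).
Proof.
move=> H.
have -> : gs_res e n = (fun z => e n z + lin n (fun i => - ip leb2 (e n) (gs e i))
    (fun i => if (i < n)%N then gs e i else fun=> 0) z).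
  apply/funext => z; rewrite /gs_res /lin -sumrN; congr (_ + _).
  by apply: eq_bigr => i _; rewrite ltn_ord mulNr.
apply: Cc_inftyD => //; apply: lin_Cc => i; case: ifP => [/H//|_].
exact: Cc_infty0.
Qed.

Lemma gs_Cc i : Cc_infty Omega (gs e i).
Proof.
have : forall n, (forall i, (i < n)%N -> Cc_infty Omega (gs e i)).
  elim=> [//|n IH] j; rewrite ltnS leq_eqVlt => /predU1P[->|/IH//].
  by rewrite gsE; apply: Cc_inftyZ; exact: gs_res_Cc.
by apply; exact: ltnSn.
Qed.

Lemma gs_resD n : Cc_infty Omega (gs_res e n).
Proof. by apply: gs_res_Cc => i _; exact: gs_Cc. Qed.

Lemma gs_norm n : (ip leb2 (gs e n) (gs e n) = 1) \/ (gs e n = fun=> 0).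
Proof.
have rD := gs_resD n; have [sr _ _] := Cc_sq rD.
have := ip_ge0 leb2 (gs_res e n); rewrite le_eqVlt => /predU1P[/esym r0|r0]; [right|left].
  by rewrite gsE r0 sqrtr0 invr0; apply/funext => z; rewrite mul0r.
rewrite gsE ipZl//; last exact: sqZ.
rewrite ipZr// mulrA -expr2 exprVn sqr_sqrtr ?ltW// mulVf// gt_eqF//.
Qed.

(** True at every point, not just almost everywhere, because a residual of norm zero vanishes
    identically by continuity. Density in the C^1 norm therefore passes to the orthonormal
    family. *)
Lemma gs_span n z : e n z = lin n.+1 (fun i => if i == n then
    Num.sqrt (ip leb2 (gs_res e n) (gs_res e n)) else ip leb2 (e n) (gs e i)) (gs e) z.
Proof.
have rD := gs_resD n.
rewrite /lin big_ord_recr /= eqxx gsE.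
under eq_bigr => i _ do rewrite (ltn_eqF (ltn_ord i)).
have h : gs_res e n z = Num.sqrt (ip leb2 (gs_res e n) (gs_res e n)) *
   ((Num.sqrt (ip leb2 (gs_res e n) (gs_res e n)))^-1 * gs_res e n z).
  have := ip_ge0 leb2 (gs_res e n); rewrite le_eqVlt => /predU1P[/esym r0|r0].
    have [M rC] := Cc_dxy rD; have [br _ _] := C1c_bsupp rC.
    have [cr _ _ _ _] := rC.
    by have /(congr1 (fun f => f z)) -> := continuous_ip_eq0 cr br r0; rewrite !mulr0.
  by rewrite mulrA mulfV ?mul1r// gt_eqF// sqrtr_gt0.
by rewrite -h /gs_res addrC subrK.
Qed.

Lemma gs_orth i j : (i < j)%N -> ip leb2 (gs e j) (gs e i) = 0.
Proof.
have : forall n i j, (j < n)%N -> (i < j)%N -> ip leb2 (gs e j) (gs e i) = 0.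
  elim=> [//|n IH] {}i {}j; rewrite ltnS leq_eqVlt => /predU1P[->|/IH]; last exact.
  move=> iN.
  have s k : sq leb2 (gs e k) by have [] := Cc_sq (gs_Cc k).
  have se : sq leb2 (e n) by have [] := Cc_sq (eD n).
  have [sr _ _] := Cc_sq (gs_resD n).
  rewrite gsE ipZl//; apply/eqP; rewrite mulf_eq0; apply/orP; right; apply/eqP.
  have sS : sq leb2 (fun z => \sum_(k < n) ip leb2 (e n) (gs e k) * gs e k z).
    by apply: (@sq_sum _ _ _ leb2 n (fun k z => ip leb2 (e n) (gs e k) * gs e k z)) => k _; exact: sqZ.
  rewrite ipBl//.
  rewrite (@ip_suml _ _ _ leb2 n (fun k z => ip leb2 (e n) (gs e k) * gs e k z))//; last first.
    by move=> k _; exact: sqZ.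
  rewrite (bigD1 (Ordinal iN))//= big1 ?addr0; last first.
    move=> k ki; rewrite ipZl//.
    have [ik|ki'|E] := ltngtP i k; last by move: ki; rewrite -val_eqE/= E eqxx.
      by rewrite (IH i k) ?mulr0.
    by rewrite [ip leb2 (gs e k) _]ipC (IH k i) ?mulr0.
  rewrite ipZl//; have [->|->] := gs_norm i; first by rewrite mulr1 subrr.
  by rewrite (_ : ip leb2 (e n) _ = 0) ?mul0r ?subrr// /ip -[RHS](Int0 leb2); apply: eq_Int => z; rewrite mulr0.
by move=> H ij; exact: (H j.+1).
Qed.

End GramSchmidt.

Lemma orthonormal_basis (R : realType) : exists f : nat -> R * R -> R,
  [/\ forall i, Cc_infty Omega (f i),
      forall i j, i != j -> ip leb2 (f i) (f j) = 0,
      forall i, (ip leb2 (f i) (f i) = 1) \/ (f i = fun=> 0) &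
      forall v : R * R -> R, Cc_infty Omega v -> exists M, C1c M v (dx v) (dy v) /\
        forall eps, 0 < eps -> exists n c, C1c M (lin n c f) (dx (lin n c f)) (dy (lin n c f)) /\
        forall z, [/\ `|v z - lin n c f z| <= eps, `|dx v z - dx (lin n c f) z| <= eps &
                      `|dy v z - dy (lin n c f) z| <= eps]].
Proof.
have eD := @dense_seq_Cc R.
exists (gs (@dense_seq R)); split.
- exact: gs_Cc.
- move=> i j; rewrite neq_ltn => /orP[ij|ij]; first by rewrite ipC gs_orth.
  exact: gs_orth.
- exact: gs_norm.
- move=> v /dense_seqP[M [vC H]]; exists M; split => // eps /H[j [jC hj]].
  set c := (fun i => if i == j then Num.sqrt (ip leb2 (gs_res (@dense_seq R) j) (gs_res (@dense_seq R) j))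
    else ip leb2 (@dense_seq R j) (gs (@dense_seq R) i)).
  have E : @dense_seq R j = lin j.+1 c (gs (@dense_seq R)) by apply/funext => z; exact: gs_span.
  by exists j.+1, c; rewrite -E.
Qed.

(** * The Galerkin-Euler scheme *)

Lemma tensor_sq d1 d2 (X1 : measurableType d1) (X2 : measurableType d2) (R : realType)
    (m1 : {sigma_finite_measure set X1 -> \bar R})
    (m2 : {sigma_finite_measure set X2 -> \bar R}) (g : X1 -> R) (v : X2 -> R) :
  sq m1 g -> sq m2 v -> sq (m1 \x m2)%E (fun p => g p.1 * v p.2).
Proof.
move=> sg sv.
have mg : measurable_fun setT (fun p : X1 * X2 => g p.1).
  by apply: measurableT_comp; [case: sg|exact: measurable_fst].
have mv : measurable_fun setT (fun p : X1 * X2 => v p.2).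
  by apply: measurableT_comp; [case: sv|exact: measurable_snd].
split; first exact: measurable_funM.
apply: intg_tonelli => [||/=|/=].
- by apply: measurable_funX; exact: measurable_funM.
- by move=> p; exact: sqr_ge0.
- apply: aeW => x; have := intgZ (g x ^+ 2) (sq_intg sv).
  by congr intg; apply/funext => y; rewrite exprMn.
- have := intgZ (Int m2 (fun y => v y ^+ 2)) (sq_intg sg); congr intg; apply/funext => x.
  rewrite mulrC -(IntZ _ (sq_intg sv)).
  by apply: eq_Int => y; rewrite exprMn.
Qed.

Lemma tensor_ip d1 d2 (X1 : measurableType d1) (X2 : measurableType d2) (R : realType)
    (m1 : {sigma_finite_measure set X1 -> \bar R})
    (m2 : {sigma_finite_measure set X2 -> \bar R}) (g g' : X1 -> R) (v v' : X2 -> R) :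
  sq m1 g -> sq m2 v -> sq m1 g' -> sq m2 v' ->
  ip (m1 \x m2)%E (fun p => g p.1 * v p.2) (fun p => g' p.1 * v' p.2)
  = ip m1 g g' * ip m2 v v'.
Proof.
move=> sg sv sg' sv'; rewrite ip_fubini; [|exact: tensor_sq..].
rewrite mulrC -IntZ; last exact: intgM.
apply: eq_Int => x /=; rewrite mulrC -IntZ; last exact: intgM.
by apply: eq_Int => y /=; ring.
Qed.

(** * Time windows *)

Section Windows.
Context (R : realType).

(** Half-open, so that the windows of consecutive intervals add up at every point. *)
Definition win1 (a b s : R) : R := \1_(`[a, b[%classic : set R) s.

Lemma win1E a b s : win1 a b s = if a <= s < b then 1 else 0.
Proof. by rewrite /win1 indicE mem_setE in_itv /=; case: ifP. Qed.

Lemma win1_sqr a b s : win1 a b s * win1 a b s = win1 a b s.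
Proof. by rewrite !win1E; case: ifP; rewrite ?mulr1 ?mulr0. Qed.

Lemma win1_meas a b : measurable_fun setT (win1 a b).
Proof. exact: measurable_indic. Qed.

Lemma win1_le1 a b s : `|win1 a b s| <= 1.
Proof. by rewrite win1E; case: ifP; rewrite ?normr1 ?normr0. Qed.

Lemma win1D a b c s : a <= b -> b <= c -> win1 a c s = win1 a b s + win1 b c s.
Proof.
move=> ab bc; rewrite !win1E; case: (leP a s) => sa; case: (ltP s b) => sb /=.
- by rewrite (lt_le_trans sb bc) addr0.
- by rewrite add0r.
- by rewrite addr0.
- by move: (lt_le_trans sa (le_trans ab sb)); rewrite ltxx.
Qed.

Lemma win1_out a b c d s : a <= c -> d <= b -> win1 c d s = win1 a b s * win1 c d s.
Proof.
move=> ac db; rewrite !win1E; case: (boolP (c <= s < d)); last by rewrite mulr0.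
by move=> /andP[cs sd]; rewrite (le_trans ac cs) (lt_le_trans sd db) mulr1.
Qed.

Lemma Int_win1 a b : a <= b -> Int leb1 (win1 a b) = b - a.
Proof.
move=> ab; rewrite /Int /Rintegral integral_indic//= setIT lebesgue_measure_itv/= lte_fin.
by move: ab; rewrite le_eqVlt => /predU1P[->|->]; rewrite ?ltxx ?subrr.
Qed.

Lemma intg_win1 a b : intg leb1 (win1 a b).
Proof.
apply: intg_ge0P => [|z|]; first exact: win1_meas.
  by rewrite win1E; case: ifP.
rewrite integral_indic//= setIT lebesgue_measure_itv/=.
by case: ifP => _; rewrite -?EFinB ltry.
Qed.

Lemma sq_win1 a b : sq leb1 (win1 a b).
Proof.
split; first exact: win1_meas.
by have := intg_win1 a b; congr intg; apply/funext => s; rewrite expr2 win1_sqr.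
Qed.

Lemma ip_win1 a b : a <= b -> ip leb1 (win1 a b) (win1 a b) = b - a.
Proof. by move=> ab; rewrite -(Int_win1 ab); apply: eq_Int => s; rewrite win1_sqr. Qed.

Definition win a b (p : R * (R * R)) : R := win1 a b p.1.

Lemma win_meas a b : measurable_fun setT (win a b).
Proof. by apply: measurableT_comp; [exact: win1_meas|exact: measurable_fst]. Qed.

Lemma sq_win a b (f : R * (R * R) -> R) : sq leb3 f -> sq leb3 (fun p => win a b p * f p).
Proof.
move=> sf; under eq_fun do rewrite mulrC.
exact: (@sqM_bounded _ _ _ leb3 1 f (win a b) (win_meas a b) sf (fun p => win1_le1 a b p.1)).
Qed.

End Windows.

(** * The weak right-hand side and its energy estimate *)

Section Scheme.
Context (R : realType) (mu alpha beta gamma : R).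
Hypotheses (hmu : 0 < mu) (gammaE : gamma = 1 + alpha + beta ^+ 2 / (2 * mu))
  (hgamma : 0 < gamma).
Implicit Types (v w : R * R -> R).

Definition E0 w := ip leb2 w w.
Definition E1 w := ip leb2 (dx w) (dx w) + ip leb2 (dy w) (dy w).

(** The weak form of [w w_x - w_y T w_x]: the y-derivative is moved to the other factors, and as the
    y-derivative of [T w_x] is [w_x], a second copy of [w w_x] appears. This is the form of the weak
    formulation in the theorem. *)
Definition Btri w v := Int leb2 (fun z => 2 * (w z * dx w z) * v z)
  + Int leb2 (fun z => w z * TO (dx w) z * dy v z).

Definition F0 w v := - mu * (ip leb2 (dx w) (dx v) + ip leb2 (dy w) (dy v))
  - Btri w v + alpha * ip leb2 w v - beta * ip leb2 (TO (dx w)) v.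

Lemma Cc_facts v : Cc_infty Omega v -> exists M, [/\ C1c M v (dx v) (dy v),
  bsupp M v, bsupp M (dx v) & bsupp M (dy v)].
Proof. by move=> /Cc_dxy[M vC]; exists M; have [? ? ?] := C1c_bsupp vC. Qed.

Lemma Cc_TO v : Cc_infty Omega v -> sq leb2 (TO (dx v)) /\
  ip leb2 (TO (dx v)) (TO (dx v)) <= ip leb2 (dx v) (dx v).
Proof. by move=> /Cc_sq[_ sx _]; exact: TO_sq. Qed.

Lemma Btri_intg w v : Cc_infty Omega w -> Cc_infty Omega v ->
  intg leb2 (fun z => 2 * (w z * dx w z) * v z) /\
  intg leb2 (fun z => w z * TO (dx w) z * dy v z).
Proof.
move=> wD vD; have [M [wC bw bwx bwy]] := Cc_facts wD.
have [N [vC [mv Bv v0] bvx [mvy Bvy _]]] := Cc_facts vD.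
have [sT _] := Cc_TO wD; have [mw Bw _] := bw; split.
  have : bsupp M (fun z => dx w z * (w z * v z)).
    apply: bsuppM => //; first exact: measurable_funM.
    by case: Bw Bv => B HB [B' HB']; exists (B * B') => z; rewrite normrM ler_pM.
  by move=> /bsupp_intg /(intgZ 2); congr intg; apply/funext => z; ring.
have : bsupp M (fun z => w z * dy v z) by exact: bsuppM.
by move=> /bsupp_sq /(intgM sT); congr intg; apply/funext => z; ring.
Qed.

Lemma F0_self w : Cc_infty Omega w ->
  2 * F0 w w <= - mu * E1 w + (2 * gamma - 2) * E0 w.
Proof.
move=> wD; have [M [wC bw bwx bwy]] := Cc_facts wD.
have [sw sx sy] := Cc_sq wD; have [sT Tle] := Cc_TO wD.
have [t1 t2] := transport_skew wC.
have B0 : Btri w w = 0.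
  rewrite /Btri t2 addr0 -[RHS](mulr0 2) -t1 -IntZ.
    by apply: eq_Int => z; ring.
  have [[mw Bw _] [mwx Bwx _]] := (bw, bwx).
  by apply: (@bsupp_intg _ M); apply: bsuppM => //; apply: bsuppM.
rewrite /F0 B0 subr0.
(* Divided by [2 * mu], this square bounds [- beta * ip (T w_x) w] by [mu / 2] times the squared
   norm of [T w_x] plus [beta ^+ 2 / (2 * mu)] times that of [w]; this is the origin of the last
   summand of [gamma]. *)
have h0 := ip_ge0 leb2 (fun z => mu * TO (dx w) z + beta * w z).
rewrite ipDD in h0; [|exact: sqZ..].
rewrite !ipZr// in h0; [|exact: sqZ..].
rewrite !ipZl// in h0.
have y0 := ip_ge0 leb2 (dy w).
rewrite -/(E0 w) /E1 gammaE in h0 *; move: h0 y0 Tle.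
set A := ip leb2 (TO _) (TO _); set B := ip leb2 (TO _) w; set X := ip leb2 (dx w) _.
set Y := ip leb2 (dy w) _; set E := E0 w.
clearbody A B X Y E; move: A B X Y E; clear - hmu => A B X Y E h0 y0 AX.
have e : - beta * B = (2 * mu)^-1 * (mu * mu * A + beta ^+ 2 * E
   - (mu * (mu * A) + beta * (mu * B) * 2 + beta * (beta * E))).
  by field; rewrite gt_eqF.
have : - beta * B <= (2 * mu)^-1 * (mu * mu * A + beta ^+ 2 * E).
  rewrite e; apply: ler_wpM2l; last by clear e; lra.
  by rewrite invr_ge0 ltW// mulr_gt0.
have -> : (2 * mu)^-1 * (mu * mu * A + beta ^+ 2 * E) =
  mu / 2 * A + beta ^+ 2 / (2 * mu) * E by field; rewrite gt_eqF.
have : mu / 2 * A <= mu / 2 * X by rewrite ler_wpM2l// divr_ge0// ltW.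
have : 0 <= mu * Y by apply: mulr_ge0 => //; exact: ltW.
set b := beta ^+ 2 / _; lra.
Qed.

Lemma Int_mul_le (g h : R * R -> R) (k : R * R -> R) (V : R) : measurable_fun setT k ->
  (forall z, `|k z| <= V) -> sq leb2 g -> sq leb2 h ->
  Int leb2 (fun z => g z * h z * k z) ^+ 2 <= V ^+ 2 * (ip leb2 g g * ip leb2 h h).
Proof.
move=> mk kV sg sh.
have sk : sq leb2 (fun z => h z * k z) by exact: (@sqM_bounded _ _ _ leb2 V h k mk sh kV).
have -> : Int leb2 (fun z => g z * h z * k z) = ip leb2 g (fun z => h z * k z).
  by apply: eq_Int => z; rewrite mulrA.
apply: (le_trans (cauchy_schwarz sg sk)).
rewrite mulrCA ler_wpM2l ?ip_ge0//.
have -> : V ^+ 2 * ip leb2 h h = ip leb2 (fun z => V * h z) (fun z => V * h z).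
  by rewrite ipZr ?ipZl//; [rewrite expr2 mulrA|exact: sqZ].
apply: ip_le => //; first exact: sqZ.
by move=> z; rewrite mulrC !normrM ler_wpM2r// (le_trans (kV z))// ler_norm.
Qed.

Lemma sqr_add5 (a b c d e : R) : (a + b + c + d + e) ^+ 2 <=
  5 * (a ^+ 2 + b ^+ 2 + c ^+ 2 + d ^+ 2 + e ^+ 2).
Proof.
have := sqr_ge0 (a - b); have := sqr_ge0 (a - c); have := sqr_ge0 (a - d).
have := sqr_ge0 (a - e); have := sqr_ge0 (b - c); have := sqr_ge0 (b - d).
have := sqr_ge0 (b - e); have := sqr_ge0 (c - d); have := sqr_ge0 (c - e).
have := sqr_ge0 (d - e); lra.
Qed.

Lemma sqrD_le4 (a b t : R) : a ^+ 2 <= t -> b ^+ 2 <= t -> (a + b) ^+ 2 <= 4 * t.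
Proof. by move=> ha hb; have := sqr_ge0 (a - b); lra. Qed.

Lemma quad_facts (E X Y : R) : 0 <= E -> 0 <= X -> 0 <= Y ->
  let S := (1 + E) * (E + (X + Y)) in [/\ X <= S, E <= S, Y <= S & E * X <= S].
Proof.
move=> E_ge0 X0 Y0 S; rewrite /S.
have := mulr_ge0 E_ge0 X0; have := mulr_ge0 E_ge0 Y0; have := mulr_ge0 E_ge0 E_ge0.
by split; rewrite mulrDl mul1r !mulrDr; lra.
Qed.

Lemma lin_facts (X Y Z : R) : 0 <= X -> 0 <= Y -> 0 <= Z ->
  [/\ X <= Z + (X + Y), Y <= Z + (X + Y) & Z <= Z + (X + Y)].
Proof. by split; lra. Qed.

(** The bound is affine in [E1], the quadratic terms being split as one factor [E0] times one factor
    [E1]. Along the approximations [E0] is bounded and [E1] is integrable in time, so [F0] is square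
    integrable in time and the coefficients are Hoelder continuous with exponent 1/2. *)
Lemma F0_bound v : Cc_infty Omega v -> exists2 C, 0 <= C & forall w, Cc_infty Omega w ->
  F0 w v ^+ 2 <= C * ((1 + E0 w) * (E0 w + E1 w)).
Proof.
move=> vD; have [N [vC [mv [V hV] v0] bvx [mvy [W hW] _]]] := Cc_facts vD.
have [sv svx svy] := Cc_sq vD.
pose v2 := E0 v + E1 v.
have e0 w : 0 <= E0 w by exact: ip_ge0.
have e1 w : 0 <= E1 w by rewrite addr_ge0// ip_ge0.
have v20 : 0 <= v2 by rewrite addr_ge0.
exists (5 * (4 * mu ^+ 2 * v2 + 4 * V ^+ 2 + W ^+ 2 + alpha ^+ 2 * v2 + beta ^+ 2 * v2)).
  have h (x : R) : 0 <= x ^+ 2 * v2 by rewrite mulr_ge0// sqr_ge0.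
  have := h mu; have := h alpha; have := h beta; have := sqr_ge0 V; have := sqr_ge0 W; lra.
move=> w wD; have [sw swx swy] := Cc_sq wD; have [sT Tle] := Cc_TO wD.
have [i1 i2] := Btri_intg wD vD.
set S := (1 + E0 w) * (E0 w + E1 w).
have [[[a0 b0] c0] t0] := (e0 w, ip_ge0 leb2 (dx w), ip_ge0 leb2 (dy w), ip_ge0 leb2 (TO (dx w))).
have [x1 w1 y1 wx1] : [/\ ip leb2 (dx w) (dx w) <= S, E0 w <= S,
    ip leb2 (dy w) (dy w) <= S & E0 w * ip leb2 (dx w) (dx w) <= S].
  exact: (quad_facts a0 b0 c0).
have vv : [/\ ip leb2 (dx v) (dx v) <= v2, ip leb2 (dy v) (dy v) <= v2 & ip leb2 v v <= v2].
  exact: (lin_facts (ip_ge0 leb2 (dx v)) (ip_ge0 leb2 (dy v)) (e0 v)).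
have [vv1 vv2 vv3] := vv.
have S0 : 0 <= S := le_trans a0 w1.
have csb f g X : sq leb2 f -> sq leb2 g -> ip leb2 f f <= S -> ip leb2 g g <= X ->
    ip leb2 f g ^+ 2 <= X * S.
  move=> sf sg fS gX; apply: (le_trans (cauchy_schwarz sf sg)).
  by rewrite mulrC ler_pM ?ip_ge0.
have c1 := csb _ _ _ swx svx x1 vv1; have c2 := csb _ _ _ swy svy y1 vv2.
have c3 := csb _ _ _ sw sv w1 vv3; have c4 := csb _ _ _ sT sv (le_trans Tle x1) vv3.
have b1 : Int leb2 (fun z => 2 * (w z * dx w z) * v z) ^+ 2 <= 4 * V ^+ 2 * S.
  rewrite (_ : Int _ _ = 2 * Int leb2 (fun z => w z * dx w z * v z)); last first.
    rewrite -IntZ; first by apply: eq_Int => z; ring.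
    by move: i1 => /(intgZ 2^-1); congr intg; apply/funext => z; field.
  rewrite exprMn (_ : 2 ^+ 2 = 4) -?natrX// -mulrA ler_wpM2l//.
  apply: (le_trans (Int_mul_le mv hV sw swx)).
  by rewrite ler_wpM2l ?sqr_ge0.
have b2 : Int leb2 (fun z => w z * TO (dx w) z * dy v z) ^+ 2 <= W ^+ 2 * S.
  apply: (le_trans (Int_mul_le mvy hW sw sT)).
  rewrite ler_wpM2l ?sqr_ge0//; apply: le_trans wx1.
  exact: (ler_wpM2l a0 Tle).
rewrite /F0 /Btri.
set X1 := ip leb2 (dx w) (dx v) in c1 *; set X2 := ip leb2 (dy w) (dy v) in c2 *.
set X3 := Int leb2 _ in b1 *; set X4 := Int leb2 _ in b2 *.
set X5 := ip leb2 w v in c3 *; set X6 := ip leb2 _ v in c4 *.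
have := sqr_add5 (- mu * (X1 + X2)) (- X3) (- X4) (alpha * X5) (- (beta * X6)).
rewrite (_ : - mu * (X1 + X2) - (X3 + X4) + alpha * X5 - beta * X6 =
  - mu * (X1 + X2) - X3 - X4 + alpha * X5 - beta * X6); last by ring.
move=> /le_trans; apply.
rewrite -[leRHS]mulrA ler_wpM2l// !sqrrN !exprMn sqrrN.
have m1 : mu ^+ 2 * (X1 + X2) ^+ 2 <= 4 * mu ^+ 2 * v2 * S.
  have := ler_wpM2l (sqr_ge0 mu) (sqrD_le4 c1 c2).
  by rewrite [leRHS]mulrCA !mulrA.
have m2 := ler_wpM2l (sqr_ge0 alpha) c3; have m3 := ler_wpM2l (sqr_ge0 beta) c4.
rewrite [leRHS]mulrA in m2; rewrite [leRHS]mulrA in m3.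
by rewrite 4!mulrDl; apply: (lerD _ m3); apply: (lerD _ m2); apply: (lerD _ b2); apply: (lerD _ b1).
Qed.

End Scheme.

(** The usual projection argument, but with coefficients divided by the common bound [H] instead of
    the individual squared norms, some of which may be zero. *)
Lemma bessel d (X : measurableType d) (R : realType) (mu : {measure set X -> \bar R})
    (n : nat) (e : nat -> X -> R) (g : X -> R) (H : R) :
  0 < H -> (forall i, sq mu (e i)) -> sq mu g ->
  (forall i j, i != j -> ip mu (e i) (e j) = 0) -> (forall i, ip mu (e i) (e i) <= H) ->
  \sum_(i < n) ip mu g (e i) ^+ 2 <= H * ip mu g g.
Proof.
move=> H0 se sg orth eH.
pose a i := H^-1 * ip mu g (e i).
pose p x := \sum_(i < n) a i * e i x.
have sae i : (i < n)%N -> sq mu (fun x => a i * e i x) by move=> _; exact: sqZ.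
have sp : sq mu p by exact: (@sq_sum _ _ _ mu n (fun i x => a i * e i x)).
have pg : ip mu g p = \sum_(i < n) H^-1 * ip mu g (e i) ^+ 2.
  rewrite ipC (@ip_suml _ _ _ mu n (fun i x => a i * e i x))//; apply: eq_bigr => i _.
  by rewrite ipZl// ipC /a expr2 mulrA.
have pp : ip mu p p <= \sum_(i < n) H^-1 * ip mu g (e i) ^+ 2.
  rewrite {1}/p (@ip_suml _ _ _ mu n (fun i x => a i * e i x))//; apply: ler_sum => i _.
  rewrite ipZl// ipC (@ip_suml _ _ _ mu n (fun i x => a i * e i x))//.
  rewrite (bigD1 i)//= big1 ?addr0.
    rewrite ipZl// /a; set x := ip mu g (e i).
    rewrite (_ : _ * (_ * _) = H^-1 * x ^+ 2 * (H^-1 * ip mu (e i) (e i))); last by ring.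
    apply: ler_piMr; first by apply: mulr_ge0; [rewrite invr_ge0 ltW|exact: sqr_ge0].
    by rewrite mulrC ler_pdivrMr// mul1r; exact: eH.
  by move=> j ji; rewrite ipZl// orth ?mulr0.
have := ip_ge0 mu (fun x => g x - p x); rewrite ipBB// pg.
have -> : \sum_(i < n) H^-1 * ip mu g (e i) ^+ 2 = H^-1 * \sum_(i < n) ip mu g (e i) ^+ 2.
  by rewrite mulr_sumr.
move: pp; rewrite -mulr_sumr; set S := \sum_(i < n) _ => h1 h2.
have : H^-1 * S <= ip mu g g by lra.
by rewrite mulrC ler_pdivrMr// mulrC.
Qed.

(** [q] is the forcing and [e] the error of the explicit step, known to be small only while [a]
    stays below [B]. The induction closes because the inequality at [m] implies [a m <= B], which
    makes the error of the next step admissible. *)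
Lemma discrete_gronwall (R : realType) (a b q e : nat -> R) (h g S Q dl B : R) :
  0 < h -> 0 < g -> (forall k, 0 <= a k) -> (forall k, 0 <= b k) -> (forall k, 0 <= q k) ->
  (forall k, 0 <= e k) ->
  (forall k, a k.+1 + h * b k <= (1 + g * h) * a k + q k + e k) ->
  (forall m : nat, m%:R * h <= S -> \sum_(k < m) q k <= Q) ->
  expR (g * S) * (a 0%N + Q + S * dl) <= B -> 0 <= dl ->
  (forall k, a k <= B -> e k <= h * dl) ->
  forall m : nat, m%:R * h <= S ->
  expR (- (g * (m%:R * h))) * a m
    + \sum_(k < m) expR (- (g * (k.+1%:R * h))) * (h * b k)
  <= a 0%N + \sum_(k < m) q k + m%:R * h * dl.
Proof.
move=> h0 g0 a0 b0 q0 e0 step qQ hB dl0 eB; elim=> [|m IH] mS.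
  by rewrite !big_ord0 !mul0r mulr0 oppr0 expR0 mul1r !addr0.
have mS' : m%:R * h <= S.
  by apply: le_trans mS; rewrite ler_wpM2r ?ler_nat// ltW.
have {}IH := IH mS'.
have amB : a m <= B.
  apply: le_trans hB.
  have gS : expR (g * (m%:R * h)) <= expR (g * S) by rewrite ler_expR ler_wpM2l// ltW.
  have s0 : 0 <= \sum_(k < m) expR (- (g * (k.+1%:R * h))) * (h * b k).
    by apply: sumr_ge0 => k _; rewrite mulr_ge0 ?expR_ge0// mulr_ge0// ltW.
  have h1 : expR (- (g * (m%:R * h))) * a m <= a 0%N + Q + S * dl.
    have := qQ _ mS'; have : m%:R * h * dl <= S * dl by rewrite ler_wpM2r.
    by move: IH s0; lra.
  have -> : a m = expR (g * (m%:R * h)) * (expR (- (g * (m%:R * h))) * a m).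
    by rewrite mulrA -expRD subrr expR0 mul1r.
  apply: ler_pM => //; first by rewrite mulr_ge0.
have em := eB _ amB.
have E : g * (m.+1%:R * h) = g * (m%:R * h) + g * h by rewrite -natr1; ring.
rewrite !big_ord_recr /= addrA; set s1 := \sum_(k < m) _ in IH *; set s2 := \sum_(k < m) _ in IH *.
have r1 : 1 + g * h <= expR (g * h) by exact: expR_ge1Dx.
(* The weight at the end of the step absorbs the growth factor, since [1 + g * h <= expR (g * h)];
   the other two terms only need that the weight is at most 1. *)
have key : expR (- (g * (m.+1%:R * h))) * (a m.+1 + h * b m)
    <= expR (- (g * (m%:R * h))) * a m + q m + h * dl.
  apply: (le_trans (ler_wpM2l (expR_ge0 _) (step m))).
  have qe : 0 <= q m + e m by rewrite addr_ge0.
  have x1 : expR (- (g * (m.+1%:R * h))) <= 1.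
    by rewrite -expR0 ler_expR oppr_le0 !mulr_ge0// ltW.
  rewrite -addrA mulrDr -addrA; apply: lerD.
    rewrite E opprD expRD -mulrA ler_wpM2l ?expR_ge0//.
    rewrite mulrA ler_piMl// expRN mulrC ler_pdivrMr ?expR_gt0// mul1r//.
  apply: (@le_trans _ _ (q m + e m)); first by rewrite ler_piMl.
  by rewrite lerD2l.
move: key IH; rewrite mulrDr -natr1 mulrDl mul1r mulrDl; clear.
set x1 := expR _ * a m.+1; set x2 := expR _ * (h * b m); set x3 := expR _ * a m.
lra.
Qed.

(** * Euler steps in the finite-dimensional spans *)

Section Galerkin.
Context (R : realType) (mu alpha beta gamma : R).
Hypotheses (hmu : 0 < mu) (gammaE : gamma = 1 + alpha + beta ^+ 2 / (2 * mu))
  (hgamma : 0 < gamma).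
Variable f : nat -> R * R -> R.
Hypotheses (fD : forall i, Cc_infty Omega (f i))
  (f_orth : forall i j, i != j -> ip leb2 (f i) (f j) = 0)
  (f_norm : forall i, (ip leb2 (f i) (f i) = 1) \/ (f i = fun=> 0)).

Notation F := (F0 mu alpha beta).

Lemma f_sq i : sq leb2 (f i). Proof. by have [] := Cc_sq (fD i). Qed.

(** The family may contain zero functions. Their coefficients are required to vanish, and this
    condition accompanies every coefficient vector from here on. *)
Lemma ip_f i j (c : R) : (f i = (fun=> 0) -> c = 0) ->
  c * ip leb2 (f i) (f j) = if i == j then c else 0.
Proof.
move=> c0; case: eqP => [<-|/eqP ij]; last by rewrite f_orth// mulr0.
by case: (f_norm i) => [->|/c0->]; rewrite ?mulr1 ?mul0r.
Qed.

Lemma ip_lin n c i : (forall i, f i = (fun=> 0) -> c i = 0) -> (i < n)%N ->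
  ip leb2 (lin n c f) (f i) = c i.
Proof.
move=> c0 iN; rewrite /lin (@ip_suml _ _ _ leb2 n (fun i z => c i * f i z))//; last first.
- by exact: f_sq.
- by move=> j _; apply: sqZ; exact: f_sq.
under eq_bigr => j _ do rewrite (ipZl _ (f_sq j) (f_sq i)) (ip_f _ (c0 j)).
by rewrite (bigD1 (Ordinal iN))//= eqxx big1 ?addr0// => j /eqP ji; case: eqP => // e; case: ji; exact: val_inj.
Qed.

Lemma E0_lin n c : (forall i, f i = (fun=> 0) -> c i = 0) ->
  E0 (lin n c f) = \sum_(i < n) c i ^+ 2.
Proof.
move=> c0; rewrite /E0 {1}/lin (@ip_suml _ _ _ leb2 n (fun i z => c i * f i z))//; last first.
- by have [] := Cc_sq (lin_Cc n c fD).
- by move=> j _; apply: sqZ; exact: f_sq.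
apply: eq_bigr => i _; rewrite ipZl; first by rewrite ipC ip_lin// expr2.
  exact: f_sq.
by have [] := Cc_sq (lin_Cc n c fD).
Qed.

Lemma sqr_sum_le n (a : nat -> R) :
  (\sum_(i < n) a i) ^+ 2 <= n%:R * \sum_(i < n) a i ^+ 2.
Proof.
elim: n => [|n IH]; first by rewrite !big_ord0 expr0n mul0r.
rewrite !big_ord_recr /=.
have [->|n0] := eqVneq n 0%N; first by rewrite !big_ord0 !add0r mul1r.
have np : (0 : R) < n%:R by rewrite ltr0n lt0n.
set s := \sum_(i < n) a i in IH *; set q := \sum_(i < n) _ in IH *; set x := a n.
have q_ge : n%:R^-1 * s ^+ 2 <= q by rewrite mulrC ler_pdivrMr// mulrC.
have : 0 <= n%:R^-1 * (s - n%:R * x) ^+ 2 by rewrite mulr_ge0 ?sqr_ge0// invr_ge0 ltW.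
have -> : n%:R^-1 * (s - n%:R * x) ^+ 2 = n%:R^-1 * s ^+ 2 - 2 * (s * x) + n%:R * x ^+ 2.
  by field; rewrite gt_eqF.
have E : n.+1%:R = n%:R + 1 :> R by rewrite natr1.
rewrite E mulrDr !mulrDl !mul1r; move: IH q_ge; set t := n%:R^-1 * s ^+ 2; set N := n%:R.
move: (N * q) (N * x ^+ 2) => Nq Nx; lra.
Qed.

(** In the span of finitely many functions the gradient is bounded by the L_2 norm. The constant
    depends on [n], which is why the time step is chosen only after [n]. *)
Lemma E1_lin n : exists2 L : R, 0 <= L & forall c, E1 (lin n c f) <= L * \sum_(i < n) c i ^+ 2.
Proof.
have H (g : nat -> R * R -> R) : (forall i, sq leb2 (g i)) -> exists2 L : R, 0 <= L &
    forall c, ip leb2 (lin n c g) (lin n c g) <= L * \sum_(i < n) c i ^+ 2.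
  move=> gs; exists (n%:R * \sum_(i < n) ip leb2 (g i) (g i)).
    by rewrite mulr_ge0// sumr_ge0// => i _; exact: ip_ge0.
  move=> c; set G := \sum_(i < n) ip leb2 _ _.
  have scg i : (i < n)%N -> sq leb2 (fun z => c i * g i z) by move=> _; exact: sqZ.
  have i2 i : intg leb2 (fun z => (c i * g i z) ^+ 2).
    exact: (sq_intg (sqZ (c i) (gs i))).
  apply: (@le_trans _ _ (n%:R * \sum_(i < n) (c i ^+ 2 * ip leb2 (g i) (g i)))).
    rewrite ipE.
    have -> : n%:R * \sum_(i < n) (c i ^+ 2 * ip leb2 (g i) (g i)) =
        Int leb2 (fun z => n%:R * \sum_(i < n) (c i * g i z) ^+ 2).
      rewrite IntZ; last by apply: (@intg_sum _ _ _ leb2 n (fun i z => (c i * g i z) ^+ 2)).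
      congr (_ * _); rewrite (@Int_sum _ _ _ leb2 n (fun i z => (c i * g i z) ^+ 2))//.
      apply: eq_bigr => i _; rewrite ipE -IntZ; last exact: (sq_intg (gs i)).
      by apply: eq_Int => z; rewrite exprMn.
    apply: (@Int_le _ _ _ leb2).
    - by apply: sq_intg; exact: (@sq_sum _ _ _ leb2 n (fun i z => c i * g i z)).
    - by apply: intgZ; apply: (@intg_sum _ _ _ leb2 n (fun i z => (c i * g i z) ^+ 2)).
    - by move=> z; exact: (sqr_sum_le n (fun i => c i * g i z)).
  rewrite -mulrA ler_wpM2l// mulr_sumr ler_sum// => i _.
  rewrite mulrC ler_wpM2r ?sqr_ge0// /G (bigD1 i)//= lerDl sumr_ge0// => j _.
  exact: ip_ge0.
have [L1 L10 H1] := H (fun i => dx (f i)) (fun i => let: And3 _ sx _ := Cc_sq (fD i) in sx).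
have [L2 L20 H2] := H (fun i => dy (f i)) (fun i => let: And3 _ _ sy := Cc_sq (fD i) in sy).
exists (L1 + L2); first exact: addr_ge0.
move=> c; have [ex ey] := dx_lin n c fD; rewrite /E1 ex ey mulrDl; exact: lerD.
Qed.

Lemma F0_0 w : F w (fun=> 0) = 0.
Proof.
have z0 (g : R * R -> R) : ip leb2 g (fun=> 0) = 0.
  by rewrite -[RHS](Int0 leb2); apply: eq_Int => z; rewrite mulr0.
have dz (d : R * R) (z : R * R) : 'D_d (fun=> (0 : R)) z = 0.
  by rewrite derive_cst.
have dx0 : dx (fun=> (0 : R)) = fun=> 0 by apply/funext => z; exact: dz.
have dy0 : dy (fun=> (0 : R)) = fun=> 0 by apply/funext => z; exact: dz.
rewrite /F0 /Btri dx0 dy0 !z0.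
have -> : Int leb2 (fun z => 2 * (w z * dx w z) * 0) = 0.
  by rewrite -[RHS](Int0 leb2); apply: eq_Int => z; rewrite mulr0.
have -> : Int leb2 (fun z => w z * TO (dx w) z * 0) = 0.
  by rewrite -[RHS](Int0 leb2); apply: eq_Int => z; rewrite mulr0.
by rewrite !addr0 !mulr0 !subr0 addr0.
Qed.

Lemma F0_comb (c X X1 X2 Y Y1 Y2 B B1 B2 W W1 W2 T T1 T2 : R) :
  X = X1 + c * X2 -> Y = Y1 + c * Y2 -> B = B1 + c * B2 -> W = W1 + c * W2 ->
  T = T1 + c * T2 -> - mu * (X + Y) - B + alpha * W - beta * T =
  - mu * (X1 + Y1) - B1 + alpha * W1 - beta * T1 +
  c * (- mu * (X2 + Y2) - B2 + alpha * W2 - beta * T2).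
Proof. by move=> -> -> -> -> ->; ring. Qed.

Lemma F0_lin w n c : Cc_infty Omega w -> F w (lin n c f) = \sum_(i < n) c i * F w (f i).
Proof.
move=> wD; have [sw sx sy] := Cc_sq wD; have [sT _] := Cc_TO wD.
elim: n => [|n IH].
  rewrite big_ord0 -[RHS](F0_0 w); congr F; apply/funext => z.
  by rewrite /lin big_ord0.
have D : forall z, lin n.+1 c f z = lin n c f z + c n * f n z.
  by move=> z; rewrite /lin big_ord_recr.
have lD := lin_Cc n c fD; have [sl slx sly] := Cc_sq lD; have [sf sfx sfy] := Cc_sq (fD n).
have [ex ey] := dx_lin n c fD; have [ex' ey'] := dx_lin n.+1 c fD.
have Dx z : dx (lin n.+1 c f) z = dx (lin n c f) z + c n * dx (f n) z.
  by rewrite ex ex' /lin big_ord_recr.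
have Dy z : dy (lin n.+1 c f) z = dy (lin n c f) z + c n * dy (f n) z.
  by rewrite ey ey' /lin big_ord_recr.
have ipD (g k1 k2 k3 : R * R -> R) : sq leb2 g -> sq leb2 k2 -> sq leb2 k3 ->
    (forall z, k1 z = k2 z + c n * k3 z) -> ip leb2 g k1 = ip leb2 g k2 + c n * ip leb2 g k3.
  move=> sg s2 s3 E; have -> : k1 = fun z => k2 z + c n * k3 z by apply/funext.
  rewrite ipC ipDl//; last exact: sqZ.
  by rewrite ipZl// (ipC leb2 k2 g) (ipC leb2 k3 g).
have [i1 i2] := Btri_intg wD lD; have [j1 j2] := Btri_intg wD (fD n).
have Bt : Btri w (lin n.+1 c f) = Btri w (lin n c f) + c n * Btri w (f n).
  rewrite /Btri mulrDr addrACA; congr (_ + _).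
    rewrite -IntZ// -IntD//; last exact: intgZ.
    by apply: eq_Int => z; rewrite D; ring.
  rewrite -IntZ// -IntD//; last exact: intgZ.
  by apply: eq_Int => z; rewrite Dy; ring.
rewrite big_ord_recr /= -IH.
exact: (F0_comb (ipD _ _ _ _ sx slx sfx Dx) (ipD _ _ _ _ sy sly sfy Dy) Bt
  (ipD _ _ _ _ sw sl sf D) (ipD _ _ _ _ sT sl sf D)).
Qed.

Variable K : R * (R * R) -> R.
Hypothesis sK : forall b, sq leb3 (fun p => win 0 b p * K p).

Definition kap (a b : R) (v : R * R -> R) : R := Int leb3 (fun p => win a b p * K p * v p.2).
Definition kh (a b : R) : R := Int leb3 (fun p => win a b p * K p ^+ 2).

Lemma sqK a b : 0 <= a -> sq leb3 (fun p => win a b p * K p).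
Proof.
move=> a0; have := sq_win a b (sK b); congr sq; apply/funext => p.
by rewrite mulrA [_ * win 0 b p]mulrC -win1_out.
Qed.

Lemma kh_intg a b : 0 <= a -> intg leb3 (fun p => win a b p * K p ^+ 2).
Proof.
move=> /(sqK b)/sq_intg; congr intg; apply/funext => p.
by rewrite exprMn expr2 win1_sqr.
Qed.

Lemma khE a b : kh a b = ip leb3 (fun p => win a b p * K p) (fun p => win a b p * K p).
Proof. by apply: eq_Int => p; rewrite mulrACA win1_sqr expr2. Qed.

Lemma kh_ge0 a b : 0 <= kh a b. Proof. by rewrite khE ip_ge0. Qed.

Lemma khD a b c : 0 <= a -> a <= b -> b <= c -> kh a c = kh a b + kh b c.
Proof.
move=> a0 ab bc; rewrite -IntD; [|exact: kh_intg|exact/kh_intg/(le_trans a0)].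
by apply: eq_Int => p; rewrite /win (win1D _ ab bc) mulrDl.
Qed.

Lemma kh_sum h m : 0 <= h -> \sum_(k < m) kh (k%:R * h) (k.+1%:R * h) = kh 0 (m%:R * h).
Proof.
move=> h0; elim: m => [|m IH].
  rewrite big_ord0 mul0r /kh -[LHS](Int0 leb3); apply: eq_Int => p.
  by rewrite /win win1E; case: ifP => [/andP[/le_lt_trans h1 /h1]|]; rewrite ?ltxx ?mul0r.
rewrite big_ord_recr/= IH -khD// ?mulr_ge0//.
by rewrite ler_wpM2r// ler_nat.
Qed.

Lemma sq_winv (a b : R) (v : R * R -> R) : sq leb2 v -> sq leb3 (fun p => win a b p * v p.2).
Proof. by move=> sv; exact: (tensor_sq (sq_win1 a b) sv). Qed.

Lemma kapE a b v : kap a b v = ip leb3 (fun p => win a b p * K p) (fun p => win a b p * v p.2).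
Proof. by apply: eq_Int => p; rewrite mulrACA win1_sqr !mulrA. Qed.

(** The products of the window with the [f i] are orthogonal in space-time and have squared norm
    [b - a] or 0, so Bessel's inequality gains the factor [b - a]. *)
Lemma kap_bessel n a b : 0 <= a -> a < b ->
  \sum_(i < n) kap a b (f i) ^+ 2 <= (b - a) * kh a b.
Proof.
move=> a0 ab; rewrite khE; under eq_bigr => i _ do rewrite kapE.
have e i j : ip leb3 (fun p => win a b p * f i p.2) (fun p => win a b p * f j p.2) =
    (b - a) * ip leb2 (f i) (f j).
  have := tensor_ip (sq_win1 a b) (f_sq i) (sq_win1 a b) (f_sq j).
  by rewrite (ip_win1 (ltW ab)).
apply: (@bessel _ _ _ leb3 n (fun i p => win a b p * f i p.2)).
- by rewrite subr_gt0.
- by move=> i; exact: sq_winv (f_sq i).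
- exact: sqK.
- by move=> i j ij; rewrite e f_orth// mulr0.
- move=> i; rewrite e; case: (f_norm i) => [->|->]; first by rewrite mulr1.
  rewrite (_ : ip _ _ _ = 0) ?mulr0 ?subr_ge0 ?ltW//.
  by rewrite -[RHS](Int0 leb2); apply: eq_Int => z; rewrite mulr0.
Qed.

Lemma kap0 a b : kap a b (fun=> 0) = 0.
Proof. by rewrite -[RHS](Int0 leb3); apply: eq_Int => p; rewrite mulr0. Qed.

(** The forcing is integrated exactly over each step because [K] is only square integrable in time;
    only the remaining terms are frozen at the start of the step. *)
Fixpoint euler (n : nat) (u0 : R * R -> R) (h : R) (k i : nat) : R :=
  if k is k'.+1 then euler n u0 h k' i + h * F (lin n (euler n u0 h k') f) (f i)
    + kap (k'%:R * h) (k'.+1%:R * h) (f i)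
  else ip leb2 u0 (f i).

Lemma F_sum_bound n B : 0 <= B -> exists2 D : R, 0 <= D & forall c,
  (forall i, f i = (fun=> 0) -> c i = 0) -> \sum_(i < n) c i ^+ 2 <= B ->
  \sum_(i < n) F (lin n c f) (f i) ^+ 2 <= D.
Proof.
move=> B0; have [L L0 EL] := E1_lin n.
have H i : exists C : R, 0 <= C /\ forall w, Cc_infty Omega w ->
    F w (f i) ^+ 2 <= C * ((1 + E0 w) * (E0 w + E1 w)).
  by have [C C0 HC] := F0_bound mu alpha beta (fD i); exists C.
pose C i := sval (cid (H i)).
have C0 i : 0 <= C i by rewrite /C; case: (cid (H i)) => x [].
have CH i w : Cc_infty Omega w -> F w (f i) ^+ 2 <= C i * ((1 + E0 w) * (E0 w + E1 w)).
  by rewrite /C; case: (cid (H i)) => x /= [_ Hx] wD; exact: Hx.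
exists (\sum_(i < n) C i * ((1 + B) * (B + L * B))).
  by apply: sumr_ge0 => i _; rewrite !(mulr_ge0, addr_ge0).
move=> c c0 cB; apply: ler_sum => i _; have wD := lin_Cc n c fD.
apply: (le_trans (CH i _ wD)); apply: ler_wpM2l => //.
have e0 : 0 <= E0 (lin n c f) by exact: ip_ge0.
have e1 : 0 <= E1 (lin n c f) by apply: addr_ge0; exact: ip_ge0.
have eB : E0 (lin n c f) <= B by rewrite E0_lin.
have e2 : E1 (lin n c f) <= L * B.
  by apply: (le_trans (EL c)); apply: ler_wpM2l.
have p1 : 0 <= 1 + E0 (lin n c f) := addr_ge0 ler01 e0.
have p2 : 0 <= E0 (lin n c f) + E1 (lin n c f) := addr_ge0 e0 e1.
have p3 : 1 + E0 (lin n c f) <= 1 + B by rewrite lerD2l.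
exact: (ler_pM p1 p2 p3 (lerD eB e2)).
Qed.

(** Young's inequality on the cross terms. In the product of [c] and [y] the square of [c] gets the
    weight [h] and that of [y] the weight [h^-1]; the latter is affordable because the squared
    forcing coefficients gain a factor [h] by [kap_bessel]. *)
Lemma euler_pt (h c x y : R) : 0 < h -> (c + h * x + y) ^+ 2 <=
  (1 + h) * c ^+ 2 + 2 * h * (c * x) + (2 + h^-1) * y ^+ 2 + 2 * h ^+ 2 * x ^+ 2.
Proof.
move=> h0; have : 0 <= h^-1 * (h * c - y) ^+ 2.
  by apply: mulr_ge0; [rewrite invr_ge0 ltW|exact: sqr_ge0].
have -> : h^-1 * (h * c - y) ^+ 2 = h * c ^+ 2 - 2 * (c * y) + h^-1 * y ^+ 2.
  by field; rewrite gt_eqF.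
rewrite [(2 + _) * _]mulrDl; have := sqr_ge0 (h * x - y); set t := h^-1 * y ^+ 2; lra.
Qed.

(** Here the summand 1 of [gamma] is spent: [2 * gamma - 2] comes from [F0_self], one unit from
    Young's inequality on the forcing, and one unit is the term [E0] added on the left. *)
Lemma euler_step n u0 h k : 0 < h -> (forall i, f i = (fun=> 0) -> euler n u0 h k i = 0) ->
  forall w, w = lin n (euler n u0 h k) f ->
  \sum_(i < n) euler n u0 h k.+1 i ^+ 2 + h * (mu * E1 w + E0 w) <=
  (1 + 2 * gamma * h) * \sum_(i < n) euler n u0 h k i ^+ 2
  + (1 + 2 * h) * kh (k%:R * h) (k.+1%:R * h) + 2 * h ^+ 2 * \sum_(i < n) F w (f i) ^+ 2.
Proof.
move=> h0 c0 w wE; have wD : Cc_infty Omega w by rewrite wE; exact: lin_Cc.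
rewrite -(E0_lin n c0) -wE.
have kk : k.+1%:R * h - k%:R * h = h by rewrite -natr1; ring.
have kb : \sum_(i < n) kap (k%:R * h) (k.+1%:R * h) (f i) ^+ 2 <= h * kh (k%:R * h) (k.+1%:R * h).
  rewrite -{3}kk; apply: kap_bessel; first by rewrite mulr_ge0// ltW.
  by rewrite -subr_gt0 kk.
have fs := F0_self hmu gammaE wD.
have fl : F w w = \sum_(i < n) euler n u0 h k i * F w (f i) by rewrite {2}wE F0_lin.
rewrite [in X in X + _]/=.
have pt (i : 'I_n) : (euler n u0 h k i + h * F w (f i) + kap (k%:R * h) (k.+1%:R * h) (f i)) ^+ 2
  <= (1 + h) * euler n u0 h k i ^+ 2 + 2 * h * (euler n u0 h k i * F w (f i)) +
   (2 + h^-1) * kap (k%:R * h) (k.+1%:R * h) (f i) ^+ 2 + 2 * h ^+ 2 * F w (f i) ^+ 2.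
  exact: euler_pt.
apply: (@le_trans _ _ (\sum_(i < n) ((1 + h) * euler n u0 h k i ^+ 2 + 2 * h * (euler n u0 h k i * F w (f i)) +
   (2 + h^-1) * kap (k%:R * h) (k.+1%:R * h) (f i) ^+ 2 + 2 * h ^+ 2 * F w (f i) ^+ 2) + h * (mu * E1 w + E0 w))).
  by rewrite lerD2r -wE; apply: ler_sum => i _; exact: pt.
rewrite !big_split /= -!mulr_sumr -fl -(E0_lin n c0) -wE.
have : (2 + h^-1) * \sum_(i < n) kap (k%:R * h) (k.+1%:R * h) (f i) ^+ 2 <=
   (1 + 2 * h) * kh (k%:R * h) (k.+1%:R * h).
  have -> : (1 + 2 * h) * kh (k%:R * h) (k.+1%:R * h) = (2 + h^-1) * (h * kh (k%:R * h) (k.+1%:R * h)).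
    by field; rewrite gt_eqF.
  by rewrite ler_wpM2l// addr_ge0// invr_ge0 ltW.
have := ler_wpM2l (ltW h0) fs; set SK := (2 + h^-1) * _; set SF := 2 * h ^+ 2 * _.
set KK := (1 + 2 * h) * _; move: (E0 w) (E1 w) (F w w) => X Y Z.
by clear -h0; lra.
Qed.

Lemma euler_eq0 n u0 h k i : f i = (fun=> 0) -> euler n u0 h k i = 0.
Proof.
move=> fi0; elim: k => [|k IH] /=.
  by rewrite fi0 -[RHS](Int0 leb2); apply: eq_Int => z; rewrite mulr0.
by rewrite IH fi0 F0_0 kap0 mulr0 !addr0.
Qed.

Theorem galerkin u0 n : sq leb2 u0 -> exists (h : R) (c : nat -> nat -> R),
  [/\ 0 < h <= n.+1%:R^-1,
   forall i, c 0%N i = ip leb2 u0 (f i),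
   forall k i, c k.+1 i = c k i + h * F (lin n (c k) f) (f i) + kap (k%:R * h) (k.+1%:R * h) (f i),
   forall k i, f i = (fun=> 0) -> c k i = 0 &
   forall m, m%:R * h <= n.+1%:R ->
    expR (- (2 * gamma * (m%:R * h))) * E0 (lin n (c m) f)
    + \sum_(k < m) expR (- (2 * gamma * (k.+1%:R * h))) *
         (h * (mu * E1 (lin n (c k) f) + E0 (lin n (c k) f)))
    <= E0 u0 + (1 + 2 * h) * kh 0 (m%:R * h) + n.+1%:R^-1].
Proof.
move=> su0; pose S : R := n.+1%:R.
have S1 : 1 <= S by rewrite ler1n.
have S0 : 0 < S by rewrite ltr0n.
(* The admissible error per unit of time: over a total time [S] the errors add up to
   [S * dl = n.+1%:R^-1]. *)
pose dl : R := S^-1 ^+ 2.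
have dl0 : 0 < dl by rewrite exprn_gt0// invr_gt0.
have Sdl : S * dl = S^-1 by rewrite /dl; field; rewrite gt_eqF.
have Si1 : S^-1 <= 1 by rewrite invf_le1.
(* The a priori bound on [[0, S]] that the bootstrap has to preserve; the factor 3 majorises
   [1 + 2 * h], and 1 majorises the accumulated error. *)
pose B := expR (2 * gamma * S) * (E0 u0 + 3 * kh 0 S + 1).
have B0 : 0 <= B.
  by rewrite mulr_ge0 ?expR_ge0// !addr_ge0 ?mulr_ge0 ?kh_ge0// ip_ge0.
have [D D0 HD] := F_sum_bound n B0.
(* Small enough for both [h <= n.+1%:R^-1] and [2 * h * D <= dl], where [D] bounds the squares of
   the right-hand side on the ball of squared radius [B] in the span. *)
pose h : R := S^-1 * dl * (2 * D + 1)^-1.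
have D1 : 0 < 2 * D + 1 by rewrite ltr_wpDl// mulr_ge0.
have h0 : 0 < h by rewrite !mulr_gt0// invr_gt0.
have hS : h <= S^-1.
  rewrite /h -mulrA; apply: ler_piMr; first by rewrite invr_ge0 ltW.
  apply: mulr_ile1; [exact: ltW|by rewrite invr_ge0 ltW| |].
    by rewrite /dl exprn_ile1// invr_ge0 ltW.
  by rewrite invf_le1//; lra.
have hD : 2 * h * D <= dl.
  have -> : 2 * h * D = S^-1 * (2 * D / (2 * D + 1)) * dl.
    by rewrite /h; field; rewrite !gt_eqF.
  apply: ler_piMl; first exact: ltW.
  apply: mulr_ile1 => //; [by rewrite invr_ge0 ltW|by rewrite !mulr_ge0// invr_ge0 ltW|].
  by rewrite ler_pdivrMr// mul1r; lra.
exists h, (euler n u0 h); split => //; first by rewrite h0.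
  by move=> k i; exact: euler_eq0.
move=> m mS; rewrite E0_lin; last by move=> i; exact: euler_eq0.
have a0E : \sum_(i < n) euler n u0 h 0 i ^+ 2 <= E0 u0.
  rewrite -[leRHS]mul1r; apply: (@bessel _ _ _ leb2) => //; first exact: f_sq.
  move=> i; case: (f_norm i) => [->//|->].
  rewrite (_ : ip _ _ _ = 0)//.
  by rewrite -[RHS](Int0 leb2); apply: eq_Int => z; rewrite mulr0.
have khS (x : R) : 0 <= x -> x <= S -> kh 0 x <= kh 0 S.
  by move=> x0 xS; rewrite (khD _ x0 xS)// lerDl kh_ge0.
have h1 : h <= 1 := le_trans hS Si1.
have sqE m' : \sum_(k < m') ((1 + 2 * h) * kh (k%:R * h) (k.+1%:R * h)) = (1 + 2 * h) * kh 0 (m'%:R * h).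
  by rewrite -mulr_sumr kh_sum// ltW.
apply: le_trans (_ : _ <= \sum_(i < n) euler n u0 h 0 i ^+ 2 + (1 + 2 * h) * kh 0 (m%:R * h) + m%:R * h * dl) _.
  rewrite -sqE.
  apply: (@discrete_gronwall R (fun k => \sum_(i < n) euler n u0 h k i ^+ 2)
    (fun k => mu * E1 (lin n (euler n u0 h k) f) + E0 (lin n (euler n u0 h k) f))
    (fun k => (1 + 2 * h) * kh (k%:R * h) (k.+1%:R * h))
    (fun k => 2 * h ^+ 2 * \sum_(i < n) F (lin n (euler n u0 h k) f) (f i) ^+ 2)
    h (2 * gamma) S (3 * kh 0 S) dl B) => //.
  - by rewrite mulr_gt0.
  - by move=> k; apply: sumr_ge0 => i _; exact: sqr_ge0.
  - by move=> k; rewrite addr_ge0 ?mulr_ge0 ?(ltW hmu) ?addr_ge0 ?ip_ge0.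
  - by move=> k; apply: mulr_ge0; [lra|exact: kh_ge0].
  - move=> k; apply: mulr_ge0; first by rewrite mulr_ge0// sqr_ge0.
    by apply: sumr_ge0 => i _; exact: sqr_ge0.
  - by move=> k; apply: euler_step => // i; exact: euler_eq0.
  - move=> m' m'S; rewrite sqE; apply: ler_pM; rewrite ?kh_ge0//; [lra|lra|].
    by apply: khS => //; rewrite mulr_ge0// ltW.
  - rewrite Sdl; apply: ler_wpM2l; first exact: expR_ge0.
    by apply: lerD => //; rewrite lerD2r.
  - by rewrite ltW.
  - move=> k kB; set X := \sum_(i < n) _; have -> : 2 * h ^+ 2 * X = h * (2 * h * X) by ring.
    apply: ler_wpM2l; first exact: ltW.
    apply: le_trans hD; apply: ler_wpM2l; first by apply: mulr_ge0 => //; exact: ltW.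
    by apply: HD => // i; exact: euler_eq0.
have : m%:R * h * dl <= S^-1 by rewrite -Sdl ler_wpM2r ?(ltW dl0).
by move=> h2; apply: (lerD _ h2); rewrite lerD2r.
Qed.

End Galerkin.

(** * Piecewise constant paths *)

Section Steps.
Context (R : realType) (h : R) (n : nat) (c : nat -> nat -> R).
Hypothesis h0 : 0 < h.

Definition step_idx (s : R) : nat := Num.trunc (s / h).

(** The path is cut off at time [n], so that it takes finitely many values. Every functional of it
    is then a finite combination of windows, hence bounded and measurable in time. *)
Definition step_fun (s : R) : nat -> R := if 0 <= s < n%:R then c (step_idx s) else fun=> 0.

Lemma step_idxP s : 0 <= s -> (step_idx s)%:R * h <= s < (step_idx s).+1%:R * h.
Proof.
move=> s0; have : 0 <= s / h by rewrite divr_ge0// ltW.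
by move=> /trunc_itv; rewrite ler_pdivlMr// ltr_pdivrMr.
Qed.

Lemma step_idx_eq k s : k%:R * h <= s < k.+1%:R * h -> step_idx s = k.
Proof.
move=> /andP[h1 h2]; have s0 : 0 <= s by apply: le_trans h1; rewrite mulr_ge0// ltW.
have /andP[h3 h4] := step_idxP s0; apply/eqP; rewrite eqn_leq -[X in X && _]ltnS -[X in _ && X]ltnS; apply/andP; split.
  by rewrite -(ltr_nat R) -(ltr_pM2r h0) (le_lt_trans h3).
by rewrite -(ltr_nat R) -(ltr_pM2r h0) (le_lt_trans h1).
Qed.

Lemma step_fun_in k s : k%:R * h <= s < k.+1%:R * h -> s < n%:R -> step_fun s = c k.
Proof.
move=> hk sn; have s0 : 0 <= s by case/andP: hk => h1 _; apply: le_trans h1; rewrite mulr_ge0// ltW.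
by rewrite /step_fun s0 sn (step_idx_eq hk).
Qed.

Let M := (step_idx n%:R).+1.

Lemma step_fun_split (G : (nat -> R) -> R) s : G (step_fun s) =
  G (fun=> 0) - G (fun=> 0) * win1 0 n%:R s +
  \sum_(k < M) G (c k) * (win1 0 n%:R s * win1 (k%:R * h) (k.+1%:R * h) s).
Proof.
rewrite /step_fun (win1E 0); case: ifP => [/andP[s0 sn]|_]; last first.
  by rewrite mulr0 subr0 big1 ?addr0// => k _; rewrite mul0r mulr0.
rewrite mulr1 subrr add0r; have hk := step_idxP s0.
have kM : (step_idx s < M)%N.
  have /andP[_ h2] : (step_idx n%:R)%:R * h <= n%:R < M%:R * h by apply: step_idxP.
  rewrite -(ltr_nat R) -(ltr_pM2r h0); case/andP: hk => h1 _.
  by rewrite (le_lt_trans h1)// (lt_trans sn).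
rewrite (bigD1 (Ordinal kM))//= big1 ?addr0 => [|j /eqP jk].
  by rewrite win1E hk !mulr1.
rewrite [in X in _ * (_ * X)]win1E; case: ifP => [/step_idx_eq e|]; last by rewrite !mulr0.
by case: jk; apply/val_inj; rewrite /= e.
Qed.

Lemma step_fun_meas (G : (nat -> R) -> R) : measurable_fun setT (fun s => G (step_fun s)).
Proof.
under eq_fun do rewrite step_fun_split.
apply: measurable_funD.
  apply: measurable_funB; first exact: measurable_cst.
  by apply: measurable_funM; [exact: measurable_cst|exact: win1_meas].
apply: measurable_sum => k; apply: measurable_funM; first exact: measurable_cst.
by apply: measurable_funM; exact: win1_meas.
Qed.

Lemma step_fun_bound (G : (nat -> R) -> R) : exists B : R, forall s, `|G (step_fun s)| <= B.
Proof.
exists (`|G (fun=> 0)| + \sum_(k < M) `|G (c k)|) => s.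
rewrite step_fun_split; apply: (le_trans (ler_normD _ _)); apply: lerD.
  rewrite -[X in X - _]mulr1 -mulrBr normrM ler_piMr//.
  by rewrite win1E; case: ifP; rewrite ?subrr ?subr0 ?normr0 ?normr1.
apply: (le_trans (ler_norm_sum _ _ _)); apply: ler_sum => k _.
rewrite normrM ler_piMr// !win1E.
by do 2!case: ifP; rewrite ?mulr1 ?mulr0 ?normr0 ?normr1.
Qed.

Lemma step_fun_sq (a b : R) (G : (nat -> R) -> R) : sq leb1 (fun s => win1 a b s * G (step_fun s)).
Proof.
have [B HB] := step_fun_bound G.
exact: (@sqM_bounded _ _ _ leb1 B (win1 a b) _ (step_fun_meas G) (sq_win1 a b) HB).
Qed.

Lemma step_fun_intg (a b : R) (G : (nat -> R) -> R) : intg leb1 (fun s => win1 a b s * G (step_fun s)).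
Proof.
have := intgM (sq_win1 a b) (step_fun_sq a b G); congr intg; apply/funext => s.
by rewrite mulrA win1_sqr.
Qed.

Lemma step_fun_Int (G : (nat -> R) -> R) m : m%:R * h <= n%:R ->
  Int leb1 (fun s => win1 0 (m%:R * h) s * G (step_fun s)) = \sum_(k < m) h * G (c k).
Proof.
elim: m => [|m IH] mn.
  rewrite big_ord0 -[RHS](Int0 leb1); apply: eq_Int => s; rewrite mul0r win1E.
  by case: ifP => [/andP[/le_lt_trans h1 /h1]|]; rewrite ?ltxx ?mul0r.
have mm : m%:R * h <= m.+1%:R * h by rewrite ler_wpM2r ?ler_nat// ltW.
have m0 : 0 <= m%:R * h by rewrite mulr_ge0// ltW.
rewrite big_ord_recr/= -IH ?(le_trans mm)//.
have -> : h * G (c m) = Int leb1 (fun s => win1 (m%:R * h) (m.+1%:R * h) s * G (step_fun s)).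
  rewrite mulrC -[h in LHS](_ : m.+1%:R * h - m%:R * h = h); last by rewrite -natr1; ring.
  rewrite -(Int_win1 mm) -IntZ; last exact: intg_win1.
  apply: eq_Int => s; rewrite win1E; case: ifP => [sm|]; last by rewrite mulr0 mul0r.
  by rewrite mulr1 mul1r (step_fun_in sm)//; case/andP: sm => _ /lt_le_trans; exact.
rewrite -IntD; [|exact: step_fun_intg..].
by apply: eq_Int => s; rewrite (win1D s m0 mm) mulrDl.
Qed.

(** On one step the weight [expR (- (g * t))] exceeds its value at the right end by at most the
    factor [expR (g * h)]. This compares the weighted integral with the sum produced by
    [discrete_gronwall]. *)
Lemma step_fun_weight (G : (nat -> R) -> R) (g : R) m (s : R) : 0 < g -> (forall c, 0 <= G c) ->
  s <= n%:R -> s <= m%:R * h ->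
  let w := fun t => win1 0 s t * (expR (- (g * t)) * G (step_fun t)) in
  intg leb1 w /\
  expR (- (g * h)) * Int leb1 w <= \sum_(k < m) expR (- (g * (k.+1%:R * h))) * (h * G (c k)).
Proof.
move=> g0 G0 sn sm w.
have mexp : measurable_fun setT (fun t : R => expR (- (g * t))).
  by apply: measurableT_comp => //; apply: measurableT_comp => //; exact: measurable_funM.
have iw : intg leb1 w.
  apply: (@intg_le _ _ _ leb1 w (fun t => win1 0 s t * G (step_fun t))).
  - apply: measurable_funM; first exact: win1_meas.
    by apply: measurable_funM => //; exact: step_fun_meas.
  - exact: step_fun_intg.
  - move=> t; rewrite /w !win1E; case: ifP => [/andP[t0 _]|]; last by rewrite !mul0r.
    rewrite !mul1r normrM ler_piMl// ger0_norm ?expR_ge0//.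
    by rewrite -expR0 ler_expR oppr_le0 mulr_ge0// ltW.
split => //.
pose v k := expR (- (g * (k.+1%:R * h))) * G (c k).
have -> : \sum_(k < m) expR (- (g * (k.+1%:R * h))) * (h * G (c k)) =
    Int leb1 (fun t => \sum_(k < m) v k * win1 (k%:R * h) (k.+1%:R * h) t).
  rewrite (@Int_sum _ _ _ leb1 m (fun k t => v k * win1 (k%:R * h) (k.+1%:R * h) t)); last first.
    by move=> k _; apply: intgZ; exact: intg_win1.
  apply: eq_bigr => k _; rewrite IntZ; last exact: intg_win1.
  have kk : k%:R * h <= k.+1%:R * h by rewrite ler_wpM2r ?ler_nat// ltW.
  by rewrite Int_win1// /v -natr1; ring.
rewrite -IntZ//; apply: (@Int_le _ _ _ leb1).
- exact: intgZ.
- apply: (@intg_sum _ _ _ leb1 m (fun k t => v k * win1 (k%:R * h) (k.+1%:R * h) t)).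
  by move=> k _; apply: intgZ; exact: intg_win1.
have s0 t : 0 <= \sum_(k < m) v k * win1 (k%:R * h) (k.+1%:R * h) t.
  apply: sumr_ge0 => k _; apply: mulr_ge0; first by apply: mulr_ge0 => //; exact: expR_ge0.
  by rewrite win1E; case: ifP.
move=> t; rewrite /w {1}win1E; case: ifP => [/andP[t0 ts]|_]; last by rewrite mul0r mulr0.
have ht := step_idxP t0; have /andP[h1 h2] := ht.
have km : (step_idx t < m)%N.
  by rewrite -(ltr_nat R) -(ltr_pM2r h0) (le_lt_trans h1)// (lt_le_trans ts).
rewrite (bigD1 (Ordinal km))//= [X in _ <= _ + X]big1 ?addr0 => [|j /eqP jk]; last first.
  rewrite win1E; case: ifP => [/step_idx_eq e|]; last by rewrite !mulr0.
  by case: jk; apply/val_inj; rewrite /= e.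
rewrite win1E ht mulr1 mul1r (step_fun_in ht) ?(lt_le_trans ts)// mulrA /v.
apply: ler_wpM2r => //; rewrite -expRD ler_expR -natr1.
by rewrite mulrDl mul1r mulrDr; have := ler_wpM2l (ltW g0) h1; lra.
Qed.

End Steps.

Lemma norm_le_sqr (R : realType) (x a : R) : 0 <= a -> x ^+ 2 <= a ^+ 2 -> `|x| <= a.
Proof. by move=> a0; rewrite -[leLHS]real_normK ?num_real// ler_sqr ?nnegrE. Qed.

Lemma near_harmonic (R : realType) (e : R) : 0 < e -> \forall n \near \oo, (n.+1%:R^-1 : R) <= e.
Proof.
by have /cvgr_le H := @cvg_harmonic R; exact: H.
Qed.

Lemma near_continuous (R : realType) (phi : R -> R) (a : R) : continuous phi ->
  phi 0 < a -> \forall n \near \oo, phi n.+1%:R^-1 <= a.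
Proof.
move=> cphi pa; have /cvgr_le H : (phi \o @harmonic R) n @[n --> \oo] --> phi 0.
  exact: cvg_comp (@cvg_harmonic R) (cphi 0).
exact: H.
Qed.

(** * Uniform bounds for the approximations and limits of their coefficients *)

Section Family.
Context (R : realType) (mu alpha beta gamma : R).
Hypotheses (hmu : 0 < mu) (gammaE : gamma = 1 + alpha + beta ^+ 2 / (2 * mu))
  (hgamma : 0 < gamma).
Variable f : nat -> R * R -> R.
Hypotheses (fD : forall i, Cc_infty Omega (f i))
  (f_orth : forall i j, i != j -> ip leb2 (f i) (f j) = 0)
  (f_norm : forall i, (ip leb2 (f i) (f i) = 1) \/ (f i = fun=> 0)).
Variable K : R * (R * R) -> R.
Hypothesis sK : forall b, sq leb3 (fun p => win 0 b p * K p).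
Variable u0 : R * R -> R.
Hypothesis su0 : sq leb2 u0.

Notation F := (F0 mu alpha beta).
Notation kap := (kap K).
Notation kh := (kh K).

Section Level.
Variables (n : nat) (h : R) (c : nat -> nat -> R).
Hypotheses (h01 : 0 < h <= n.+1%:R^-1) (c0 : forall i, c 0%N i = ip leb2 u0 (f i))
  (cS : forall k i, c k.+1 i = c k i + h * F (lin n (c k) f) (f i)
     + kap (k%:R * h) (k.+1%:R * h) (f i))
  (cz : forall k i, f i = (fun=> 0) -> c k i = 0)
  (cE : forall m, m%:R * h <= n.+1%:R ->
    expR (- (2 * gamma * (m%:R * h))) * E0 (lin n (c m) f)
    + \sum_(k < m) expR (- (2 * gamma * (k.+1%:R * h))) *
         (h * (mu * E1 (lin n (c k) f) + E0 (lin n (c k) f)))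
    <= E0 u0 + (1 + 2 * h) * kh 0 (m%:R * h) + n.+1%:R^-1).

Let cc := step_fun h n c.
Definition Us (t : R) := lin n (cc t) f.

Let h0 : 0 < h. Proof. by case/andP: h01. Qed.
Let hn : h <= n.+1%:R^-1. Proof. by case/andP: h01. Qed.
Let h1 : h <= 1. Proof. by apply: (le_trans hn); rewrite invf_le1// ler1n. Qed.

Let ni1 : (n.+1%:R : R)^-1 <= 1. Proof. by rewrite invf_le1// ler1n. Qed.

Lemma E0_ge0 w : 0 <= E0 w :> R. Proof. exact: ip_ge0. Qed.
Lemma E1_ge0 w : 0 <= E1 w :> R. Proof. by apply: addr_ge0; exact: ip_ge0. Qed.
Lemma E10_ge0 w : 0 <= mu * E1 w + E0 w.
Proof. by apply: addr_ge0; [apply: mulr_ge0; [exact: ltW|exact: E1_ge0]|exact: E0_ge0]. Qed.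

Lemma E_zero : E0 (lin n (fun=> 0) f) = 0 /\ E1 (lin n (fun=> 0) f) = 0.
Proof.
have s0 : \sum_(i < n) (0 : R) ^+ 2 = 0 by rewrite big1// => i _; rewrite expr0n.
split; first by rewrite E0_lin.
have [L L0 HL] := E1_lin fD n; have := HL (fun=> 0); rewrite s0 mulr0 => e.
by apply/eqP; rewrite eq_le e E1_ge0.
Qed.

Lemma kh_mono a b : 0 <= a -> a <= b -> kh 0 a <= kh 0 b.
Proof. by move=> a0 ab; rewrite (khD sK (lexx 0) a0 ab) lerDl kh_ge0. Qed.

Lemma level_energy m s : m%:R * h <= n.+1%:R -> s <= n%:R -> s <= m%:R * h ->
  expR (- (2 * gamma * (m%:R * h))) * E0 (lin n (c m) f)
  + expR (- (2 * gamma * h)) * Int leb1 (fun t => win1 0 s t *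
      (expR (- (2 * gamma * t)) * (mu * E1 (Us t) + E0 (Us t))))
  <= E0 u0 + (1 + 2 * h) * kh 0 (m%:R * h) + n.+1%:R^-1.
Proof.
move=> mn sn sm; apply: le_trans (cE mn); rewrite lerD2l.
have g0 : 0 < 2 * gamma by rewrite mulr_gt0.
by have [_] := @step_fun_weight R h n c h0 (fun c => mu * E1 (lin n c f) + E0 (lin n c f))
  (2 * gamma) m s g0 (fun c => E10_ge0 _) sn sm.
Qed.

(** [T + 1] because the step containing [T] may end after [T], and the factor 3 because
    [1 + 2 * h <= 3]. *)
Definition bound0 (T : R) := expR (2 * gamma * (T + 1)) * (E0 u0 + 3 * kh 0 (T + 1) + 1).

Lemma bound0_ge0 T : 0 <= bound0 T.
Proof.
apply: mulr_ge0; first exact: expR_ge0.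
by apply: addr_ge0 => //; apply: addr_ge0; [exact: E0_ge0|apply: mulr_ge0 => //; exact: kh_ge0].
Qed.

Lemma rhs_le m T : 0 <= T -> m%:R * h <= T + 1 ->
  E0 u0 + (1 + 2 * h) * kh 0 (m%:R * h) + n.+1%:R^-1 <= E0 u0 + 3 * kh 0 (T + 1) + 1.
Proof.
move=> T0 mT; apply: lerD => //; rewrite lerD2l.
apply: ler_pM; [|exact: kh_ge0| |].
- by apply: addr_ge0 => //; apply: mulr_ge0 => //; exact: ltW.
- by move: h1; lra.
- by apply: kh_mono => //; rewrite mulr_ge0// ltW.
Qed.

Lemma level_E0 t T : 0 <= t -> t <= T -> E0 (Us t) <= bound0 T.
Proof.
move=> t0 tT; rewrite /Us /cc /step_fun t0 /=; case: ltP => tn; last first.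
  by have [-> _] := E_zero; exact: bound0_ge0.
have /andP[m1 m2] := step_idxP h0 t0; set m := step_idx h t in m1 m2 *.
have T0 := le_trans t0 tT.
have mT : m%:R * h <= T := le_trans m1 tT.
have mn : m%:R * h <= n.+1%:R.
  by rewrite (le_trans m1)// (le_trans (ltW tn))// ler_nat.
have mT1 : m%:R * h <= T + 1 by rewrite (le_trans mT)// lerDl.
have := le_trans (cE mn) (rhs_le T0 mT1).
set s := \sum_(k < m) _ => H.
have s0 : 0 <= s.
  apply: sumr_ge0 => k _; apply: mulr_ge0; first exact: expR_ge0.
  by apply: mulr_ge0; [exact: ltW|exact: E10_ge0].
have {}H : expR (- (2 * gamma * (m%:R * h))) * E0 (lin n (c m) f) <=
    E0 u0 + 3 * kh 0 (T + 1) + 1 by apply: le_trans H; rewrite lerDl.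
have -> : E0 (lin n (c m) f) = expR (2 * gamma * (m%:R * h)) *
    (expR (- (2 * gamma * (m%:R * h))) * E0 (lin n (c m) f)).
  by rewrite mulrA -expRD subrr expR0 mul1r.
apply: ler_pM; [exact: expR_ge0| | |exact: H].
  by apply: mulr_ge0; [exact: expR_ge0|exact: E0_ge0].
by rewrite ler_expR; apply: ler_wpM2l => //; rewrite mulr_ge0// ltW.
Qed.

Lemma Us_intg a b (G : (R * R -> R) -> R) : intg leb1 (fun t => win1 a b t * G (Us t)).
Proof. exact: (step_fun_intg n c h0 a b (fun c => G (lin n c f))). Qed.

Lemma Us_sq1 a b (G : (R * R -> R) -> R) : sq leb1 (fun t => win1 a b t * G (Us t)).
Proof. exact: (step_fun_sq n c h0 a b (fun c => G (lin n c f))). Qed.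

Lemma level_E1 T : 0 <= T -> Int leb1 (fun t => win1 0 T t * (E0 (Us t) + E1 (Us t))) <=
  (1 + mu^-1) * (expR (2 * gamma * (T + 1)) * bound0 T).
Proof.
move=> T0; pose s := Num.min T n%:R.
have s0 : 0 <= s by rewrite le_min T0 ler0n.
have sT : s <= T by rewrite ge_min lexx.
have sn : s <= n%:R by rewrite ge_min lexx orbT.
have g0 : 0 < 2 * gamma by rewrite mulr_gt0.
have -> : Int leb1 (fun t => win1 0 T t * (E0 (Us t) + E1 (Us t))) =
    Int leb1 (fun t => win1 0 s t * (E0 (Us t) + E1 (Us t))).
  apply: eq_Int => t; rewrite !win1E lt_min.
  case: (leP 0 t) => t0 /=; last by rewrite !mul0r.
  case: (ltP t T) => tT /=; last by rewrite !mul0r.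
  case: ifP => // tn; rewrite /Us /cc /step_fun tn andbF.
  by have [-> ->] := E_zero; rewrite addr0 !mulr0.
have /andP[m1 m2] := step_idxP h0 s0; set m := (step_idx h s).+1 in m1 m2 *.
have mE : m%:R * h <= s + h by rewrite /m -natr1 mulrDl mul1r lerD2r.
have mn : m%:R * h <= n.+1%:R by rewrite (le_trans mE)// -natr1 lerD.
have mT : m%:R * h <= T + 1 by rewrite (le_trans mE)// lerD.
have H := le_trans (level_energy mn sn (ltW m2)) (rhs_le T0 mT).
have [iw _] := @step_fun_weight R h n c h0 (fun c => mu * E1 (lin n c f) + E0 (lin n c f))
  (2 * gamma) m s g0 (fun c => E10_ge0 _) sn (ltW m2).
set J := Int leb1 _ in H.
have J0 : 0 <= J.
  apply: Int_ge0 => t; rewrite win1E; case: ifP => _; rewrite ?mul0r// mul1r.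
  by apply: mulr_ge0; [exact: expR_ge0|exact: E10_ge0].
have HJ : J <= bound0 T.
  have {}H : expR (- (2 * gamma * h)) * J <= E0 u0 + 3 * kh 0 (T + 1) + 1.
    by apply: le_trans H; rewrite lerDr mulr_ge0 ?expR_ge0 ?E0_ge0.
  have -> : J = expR (2 * gamma * h) * (expR (- (2 * gamma * h)) * J).
    by rewrite mulrA -expRD subrr expR0 mul1r.
  apply: ler_pM; [exact: expR_ge0| | |exact: H]; first by rewrite mulr_ge0 ?expR_ge0.
  by rewrite ler_expR; apply: ler_wpM2l; [exact: ltW|move: h1; lra].
have mi : 0 < mu^-1 by rewrite invr_gt0.
apply: (@le_trans _ _ (((1 + mu^-1) * expR (2 * gamma * (T + 1))) * J)); last first.
  rewrite mulrA; apply: ler_wpM2l => //; apply: mulr_ge0; last exact: expR_ge0.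
  by apply: addr_ge0 => //; exact: ltW.
rewrite /J -IntZ//; apply: (@Int_le _ _ _ leb1).
- exact: (Us_intg 0 s (fun w => E0 w + E1 w)).
- exact: intgZ.
move=> t /=; rewrite win1E; case: ifP => [/andP[t0 ts]|_]; last by rewrite !mul0r mulr0.
rewrite !mul1r; set x := E0 _; set y := E1 _.
have x0 : 0 <= x by exact: E0_ge0.
have y0 : 0 <= y by exact: E1_ge0.
have -> : (1 + mu^-1) * expR (2 * gamma * (T + 1)) * (expR (- (2 * gamma * t)) * (mu * y + x)) =
    expR (2 * gamma * (T + 1) - 2 * gamma * t) * ((1 + mu^-1) * (mu * y + x)).
  by rewrite expRD; ring.
have e1 : 1 <= expR (2 * gamma * (T + 1) - 2 * gamma * t).
  rewrite -[leLHS]expR0 ler_expR subr_ge0; apply: ler_wpM2l; first exact: ltW.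
  by rewrite (le_trans (ltW ts))// (le_trans sT)// lerDl.
have xy : x + y <= (1 + mu^-1) * (mu * y + x).
  have -> : (1 + mu^-1) * (mu * y + x) = mu * y + x + (y + mu^-1 * x).
    by field; rewrite gt_eqF.
  have := mulr_ge0 (ltW hmu) y0; have := mulr_ge0 (ltW mi) x0.
  by set z1 := mu * y; set z2 := mu^-1 * x; lra.
apply: (le_trans xy); rewrite -[leLHS]mul1r; apply: ler_wpM2r => //.
by apply: le_trans xy; apply: addr_ge0.
Qed.

(** The paths [Us] jump. [Y i] is a continuous interpolation that agrees with their coefficient at
    the multiples of [h]; it carries the Hoelder estimate and satisfies the integrated equation
    exactly. *)
Definition Y i (r : R) := ip leb2 u0 (f i)
  + Int leb1 (fun t => win1 0 r t * F (Us t) (f i)) + kap 0 r (f i).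

Lemma kapD a b d v : 0 <= a -> a <= b -> b <= d -> sq leb2 v ->
  kap a d v = kap a b v + kap b d v.
Proof.
move=> a0 ab bd sv; have b0 := le_trans a0 ab.
have i (x y : R) : 0 <= x -> intg leb3 (fun p => win x y p * K p * v p.2).
  move=> x0; have := intgM (sqK sK y x0) (sq_winv x y sv); congr intg; apply/funext => p.
  by rewrite mulrACA win1_sqr mulrA.
rewrite -IntD; [|exact: i..].
by apply: eq_Int => p; rewrite /win (win1D _ ab bd) !mulrDl.
Qed.

Lemma U_Y t i : 0 <= t -> t < n%:R -> (i < n)%N ->
  ip leb2 (Us t) (f i) = Y i ((step_idx h t)%:R * h).
Proof.
move=> t0 tn iN; have := step_idxP h0 t0; set m := step_idx h t => /andP[m1 m2].
have mn : m%:R * h <= n%:R by rewrite (le_trans m1)// ltW.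
rewrite /Us /cc (@step_fun_in R h n c h0 m)// ?m1// ip_lin//; last first.
  by move=> j; exact: cz.
rewrite /Y (step_fun_Int c h0 (fun c => F (lin n c f) (f i)) mn).
have kap00 : kap 0 (0%:R * h) (f i) = 0.
  rewrite -[RHS](Int0 leb3); apply: eq_Int => p; rewrite mul0r /win win1E.
  by case: ifP => [/andP[/le_lt_trans x1 /x1]|]; rewrite ?ltxx ?mul0r.
elim: m {m1 m2 mn} => [|m IH]; first by rewrite big_ord0 c0 kap00 !addr0.
have mm : m%:R * h <= m.+1%:R * h by rewrite ler_wpM2r ?ler_nat// ltW.
have m0 : 0 <= m%:R * h by rewrite mulr_ge0// ltW.
have sfi : sq leb2 (f i) by exact: f_sq.
by rewrite cS IH big_ord_recr /= (kapD (lexx 0) m0 mm sfi); ring.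
Qed.

(** Cauchy-Schwarz in time, both for the right-hand side, whose square is integrable by the
    hypothesis [HC], and for the forcing. The constant contains neither [n] nor [h]. *)
Lemma Y_holder i T C : 0 <= T -> (forall w, Cc_infty Omega w ->
    F w (f i) ^+ 2 <= C * ((1 + E0 w) * (E0 w + E1 w))) -> 0 <= C ->
  forall r r', 0 <= r -> r <= r' -> r' <= T -> (Y i r' - Y i r) ^+ 2 <=
  2 * (C * ((1 + bound0 T) * ((1 + mu^-1) * (expR (2 * gamma * (T + 1)) * bound0 T)))
   + kh 0 T * E0 (f i)) * (r' - r).
Proof.
move=> T0 HC C0 r r' r0 rr rT; set B := bound0 T; set D := _ * (_ * B).
have sfi : sq leb2 (f i) by exact: f_sq.
pose I := Int leb1 (fun t => win1 r r' t * F (Us t) (f i)).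
have -> : Y i r' - Y i r = I + kap r r' (f i).
  rewrite /Y (kapD (lexx 0) r0 rr sfi).
  rewrite (_ : Int leb1 (fun t => win1 0 r' t * _) =
    Int leb1 (fun t => win1 0 r t * F (Us t) (f i)) + I); first ring.
  rewrite -IntD; [|exact: (Us_intg _ _ (fun w => F w (f i)))..].
  by apply: eq_Int => t; rewrite (win1D t r0 rr) mulrDl.
have hI : I ^+ 2 <= (r' - r) * (C * ((1 + B) * D)).
  have -> : I = ip leb1 (win1 r r') (fun t => win1 r r' t * F (Us t) (f i)).
    by apply: eq_Int => t; rewrite mulrA win1_sqr.
  apply: (le_trans (cauchy_schwarz (sq_win1 r r') (Us_sq1 r r' (fun w => F w (f i))))).
  rewrite ip_win1//; apply: ler_wpM2l; first by rewrite subr_ge0.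
  apply: (@le_trans _ _ ((C * (1 + B)) * Int leb1 (fun t => win1 0 T t * (E0 (Us t) + E1 (Us t))))).
    have iE := Us_intg 0 T (fun w => E0 w + E1 w).
    rewrite -IntZ//; apply: (@Int_le _ _ _ leb1).
    - exact: (intgM (Us_sq1 r r' (fun w => F w (f i))) (Us_sq1 r r' (fun w => F w (f i)))).
    - exact: intgZ.
    move=> t /=; rewrite (win1_out t r0 rT) mulrACA [X in X * _ <= _](_ : _ = win1 r r' t); last first.
      by rewrite -(win1_out t r0 rT) win1_sqr.
    rewrite !win1E; case: (boolP (r <= t < r')) => [/andP[rt tr]|_]; last first.
      rewrite mul0r; apply: mulr_ge0; first by rewrite mulr_ge0// addr_ge0// bound0_ge0.
      by case: ifP => _; rewrite ?mul0r// mul1r addr_ge0 ?E0_ge0 ?E1_ge0.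
    have t0 := le_trans r0 rt; have tT := lt_le_trans tr rT.
    rewrite t0 tT /= !mul1r -expr2 -mulrA.
    apply: (le_trans (HC _ (lin_Cc n _ fD))); apply: ler_wpM2l => //.
    apply: ler_wpM2r; first by rewrite addr_ge0 ?E0_ge0 ?E1_ge0.
    by rewrite lerD2l; exact: level_E0 (ltW tT).
  rewrite -mulrA; apply: ler_wpM2l => //; apply: ler_wpM2l; first by rewrite addr_ge0// bound0_ge0.
  exact: level_E1.
have hk : kap r r' (f i) ^+ 2 <= (r' - r) * (kh 0 T * E0 (f i)).
  rewrite kapE; apply: (le_trans (cauchy_schwarz (sqK sK r' r0) (sq_winv r r' sfi))).
  rewrite -khE (_ : ip leb3 (fun p => win r r' p * f i p.2) _ = (r' - r) * E0 (f i)).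
    rewrite mulrCA; apply: ler_wpM2l; first by rewrite subr_ge0.
    apply: ler_wpM2r; first exact: E0_ge0.
    rewrite (khD sK (lexx 0) (le_trans r0 rr) rT) (khD sK (lexx 0) r0 rr).
    by have := kh_ge0 K 0 r; have := kh_ge0 K r' T; lra.
  have := tensor_ip (sq_win1 r r') sfi (sq_win1 r r') sfi.
  by rewrite (ip_win1 rr).
have := sqr_ge0 (I - kap r r' (f i)).
have -> : 2 * (C * ((1 + B) * D) + kh 0 T * E0 (f i)) * (r' - r) =
  2 * ((r' - r) * (C * ((1 + B) * D))) + 2 * ((r' - r) * (kh 0 T * E0 (f i))) by ring.
move: hI hk; set a := kap r r' _; set b1 := (r' - r) * _; set b2 := (r' - r) * _.
lra.
Qed.

End Level.

Variables (FF : set_system nat) (UF : UltraFilter FF).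
Hypothesis Foo : \oo `<=` FF.

Lemma rhs_harmonic (e h k k' v : R) : 0 <= h -> h <= v -> 0 <= k -> k <= k' ->
  e + (1 + 2 * h) * k + v <= e + k' + (2 * k' + 1) * v.
Proof. by move=> h0 hv k0 kk; have := ler_pM h0 k0 hv kk; lra. Qed.

Lemma approximation : exists (U : nat -> R -> R * R -> R) (y : R -> nat -> R),
  [/\ (forall n t, exists c, U n t = lin n c f),
   (forall n a b G, intg leb1 (fun t => win1 a b t * G (U n t))) /\
   (forall n a b, [/\ sq leb3 (fun p => win a b p * U n p.1 p.2),
     sq leb3 (fun p => win a b p * dx (U n p.1) p.2) &
     sq leb3 (fun p => win a b p * dy (U n p.1) p.2)]),
   (forall T, 0 <= T -> exists2 A, 0 <= A & forall n,
     (forall t, 0 <= t <= T -> E0 (U n t) <= A) /\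
     Int leb1 (fun t => win1 0 T t * (E0 (U n t) + E1 (U n t))) <= A),
   (forall s t (e : R), 0 <= s -> s < t -> 0 < e -> FF [set n |
      expR (- (2 * gamma * t)) * E0 (U n t) + Int leb1 (fun r => win1 0 s r *
        (expR (- (2 * gamma * r)) * (mu * E1 (U n r) + E0 (U n r))))
      <= E0 u0 + kh 0 t + e]) &
   [/\ forall i T (e : R), 0 < e -> FF [set n | forall t, 0 <= t <= T ->
       `|ip leb2 (U n t) (f i) - y t i| <= e],
     forall i T, exists2 L, 0 <= L & forall s t, 0 <= s -> s <= t -> t <= T ->
       (y t i - y s i) ^+ 2 <= L * (t - s),
     forall i, y 0 i = ip leb2 u0 (f i) &
     forall i t (e : R), 0 <= t -> 0 < e -> FF [set n |
       `|ip leb2 (U n t) (f i) - ip leb2 u0 (f i)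
         - Int leb1 (fun r => win1 0 t r * F (U n r) (f i)) - kap 0 t (f i)| <= e]]].
Proof.
have PF : ProperFilter FF by exact: ultra_proper.
have /choice[h /choice[c G]] := fun n => galerkin hmu gammaE hgamma fD f_orth f_norm sK n su0.
pose U n := Us n (h n) (c n).
have hP n : 0 < h n <= n.+1%:R^-1 by have [] := G n.
have h0 n : 0 < h n by case/andP: (hP n).
have hN n : h n <= n.+1%:R^-1 by case/andP: (hP n).
have h1 n : h n <= 1 by apply: (le_trans (hN n)); rewrite invf_le1// ler1n.
have G1 n : forall i, c n 0%N i = ip leb2 u0 (f i) by have [] := G n.
have G2 n : forall k i, c n k.+1 i = c n k i + h n * F (lin n (c n k) f) (f i)
  + kap (k%:R * h n) (k.+1%:R * h n) (f i) by have [] := G n.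
have G3 n : forall k i, f i = (fun=> 0) -> c n k i = 0 by have [] := G n.
have G4 n := let: And5 _ _ _ _ g := G n in g.
have big (N : nat) : FF [set n | (N <= n)%N] by apply: Foo; exists N.
have bigR (T : R) : FF [set n : nat | T < n%:R].
  apply: filterS (big (Num.trunc `|T|).+1) => n /= Tn.
  apply: (le_lt_trans (ler_norm T)).
  have /trunc_itv/andP[_ H] := normr_ge0 T; apply: (lt_le_trans H).
  by rewrite ler_nat.
have small (e : R) : 0 < e -> FF [set n | h n <= e].
  move=> e0; have := near_harmonic e0; move=> /Foo; apply: filterS => n.
  exact: le_trans (hN n).
pose Yn n i t := Y n (h n) (c n) i t.
have Yholder i T : 0 <= T -> exists2 L, 0 <= L & forall n s t, 0 <= s -> s <= t -> t <= T ->
    (Yn n i t - Yn n i s) ^+ 2 <= L * (t - s).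
  move=> T0; have [C C0 HC] := F0_bound mu alpha beta (fD i).
  exists (2 * (C * ((1 + bound0 T) * ((1 + mu^-1) * (expR (2 * gamma * (T + 1)) * bound0 T)))
    + kh 0 T * E0 (f i))).
    have m0 : 0 < mu^-1 by rewrite invr_gt0.
    rewrite mulr_ge0// addr_ge0//; last by rewrite mulr_ge0 ?kh_ge0 ?E0_ge0.
    rewrite mulr_ge0// mulr_ge0//; first by rewrite addr_ge0// bound0_ge0.
    by rewrite mulr_ge0 ?addr_ge0 ?(ltW m0)// mulr_ge0 ?expR_ge0 ?bound0_ge0.
  move=> n s t s0 st tT; exact: (Y_holder (hP n) (G4 n) T0 HC C0 s0 st tT).
have Y0 n i : Yn n i 0 = ip leb2 u0 (f i).
  have w0 (s : R) : win1 0 0 s = 0.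
    by rewrite win1E; case: ifP => // /andP[/le_lt_trans x1 /x1]; rewrite ltxx.
  have k0 : kap 0 0 (f i) = 0.
    by rewrite -[RHS](Int0 leb3); apply: eq_Int => p; rewrite /win w0 !mul0r.
  rewrite /Yn /Y k0 addr0 -[RHS]addr0; congr (_ + _).
  by rewrite -[RHS](Int0 leb1); apply: eq_Int => s; rewrite w0 mul0r.
(* The Hoelder estimate from time 0, where the value does not depend on [n], bounds the sequence at
   every fixed time, so the ultrafilter gives it a limit. *)
have Ycvg : forall ti : R * nat, exists l : R, 0 <= ti.1 -> Yn n ti.2 ti.1 @[n --> FF] --> l.
  move=> [t i] /=; case: (leP 0 t) => [t0|_]; last by exists 0.
  have [L L0 HL] := Yholder i t t0.
  suff [l Hl] : exists l : R, Yn n i t @[n --> FF] --> l by exists l.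
  apply: (@ultra_lim R FF UF _ (`|ip leb2 u0 (f i)| + (L * t + 1))).
  apply: (filterS _ (@filterT _ FF _)) => n _ /=.
  rewrite -[Yn n i t](addrNK (Yn n i 0)) addrC; apply: (le_trans (ler_normD _ _)).
  rewrite {1}Y0 lerD2l; have Lt : 0 <= L * t by rewrite mulr_ge0.
  apply: norm_le_sqr; first by rewrite addr_ge0.
  apply: (le_trans (HL n 0 t (lexx 0) t0 (lexx t))); rewrite subr0.
  by have := sqr_ge0 (L * t); move: Lt; set z := L * t; lra.
have /choice[y' Hy'] := Ycvg; pose y t i := y' (t, i).
have Hy i t : 0 <= t -> Yn n i t @[n --> FF] --> y t i by move=> t0; exact: (Hy' (t, i)).
have yholder i T : exists2 L, 0 <= L & (forall s t, 0 <= s -> s <= t -> t <= T ->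
     (y t i - y s i) ^+ 2 <= L * (t - s)) /\
     (forall n s t, 0 <= s -> s <= t -> t <= T -> (Yn n i t - Yn n i s) ^+ 2 <= L * (t - s)).
  case: (leP 0 T) => T0; last first.
    exists 0 => //; split=> [|n] s t s0 st /(le_trans st)/(le_trans s0) x;
      by move: (le_lt_trans x T0); rewrite ltxx.
  have [L L0 HL] := Yholder i T T0; exists L => //; split=> [s t s0 st tT|//].
  have H : (Yn n i t - Yn n i s) * (Yn n i t - Yn n i s) @[n --> FF] -->
      (y t i - y s i) * (y t i - y s i).
    by apply: cvgM; apply: cvgB; apply: Hy => //; exact: le_trans st.
  rewrite expr2; apply: (ultra_cvg_le UF H).
  apply: (filterS _ (@filterT _ FF _)) => n _ /=.
  by rewrite -expr2; exact: HL.
(* [U n t] has the coefficient of [Y] at the last multiple of [h n] before [t], less than [h n]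
   away, so the Hoelder estimate bounds the difference uniformly in [t]. *)
have close i T e : 0 < e -> FF [set n | forall t, 0 <= t <= T ->
    `|ip leb2 (U n t) (f i) - Yn n i t| <= e].
  move=> e0; have [L L0 [_ HL]] := yholder i T.
  have Lp : 0 < L + 1 by rewrite ltr_wpDl.
  have e1 : 0 < e ^+ 2 / (L + 1) by rewrite divr_gt0// exprn_gt0.
  apply: filterS (filterI (small _ e1) (filterI (bigR T) (big i.+1))) => n /= [he [nT iN]].
  move=> t /andP[t0 tT]; have tn := le_lt_trans tT nT.
  rewrite /U (U_Y (hP n) (G1 n) (G2 n) (G3 n) t0 tn iN).
  have /andP[m1 m2] := step_idxP (h0 n) t0.
  rewrite distrC; apply: norm_le_sqr; first exact: ltW.
  apply: (le_trans (HL n _ t _ m1 tT)); first by rewrite mulr_ge0// ltW.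
  apply: (@le_trans _ _ ((L + 1) * (e ^+ 2 / (L + 1)))); last first.
    by rewrite mulrC divfK// gt_eqF.
  apply: ler_pM => //; first by rewrite subr_ge0.
    by rewrite lerDl.
  apply: le_trans he; move: m2; rewrite -natr1 mulrDl mul1r; lra.
have cclin n t : exists c0, U n t = lin n c0 f by exists (step_fun (h n) n (c n) t).
exists U, y; split => //.
- split=> [n a b g|n a b]; first exact: (Us_intg (c n) (hP n) a b g).
  have H (g : nat -> R * R -> R) : (forall i, sq leb2 (g i)) ->
      sq leb3 (fun p => win a b p * lin n (step_fun (h n) n (c n) p.1) g p.2).
    move=> sg; have := @sq_sum _ _ _ leb3 n (fun i p => win1 a b p.1 *
      step_fun (h n) n (c n) p.1 i * g i p.2).
    have -> : (fun p : R * (R * R) => \sum_(i < n) win1 a b p.1 * step_fun (h n) n (c n) p.1 i * g i p.2)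
       = (fun p => win a b p * lin n (step_fun (h n) n (c n) p.1) g p.2).
      by apply/funext => p; rewrite /lin mulr_sumr; apply: eq_bigr => i _; rewrite mulrA.
    apply=> i _; exact: (tensor_sq (step_fun_sq n (c n) (h0 n) a b (fun d => d i)) (sg i)).
  split; first by apply: H => i; exact: f_sq.
    have := H (fun i => dx (f i)) (fun i => let: And3 _ sx _ := Cc_sq (fD i) in sx).
    by congr sq; apply/funext => p; have [-> _] := dx_lin n (step_fun (h n) n (c n) p.1) fD.
  have := H (fun i => dy (f i)) (fun i => let: And3 _ _ sy := Cc_sq (fD i) in sy).
  by congr sq; apply/funext => p; have [_ ->] := dx_lin n (step_fun (h n) n (c n) p.1) fD.
- move=> T T0; have m0 : 0 < mu^-1 by rewrite invr_gt0.
  exists (bound0 T + (1 + mu^-1) * (expR (2 * gamma * (T + 1)) * bound0 T)).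
    rewrite addr_ge0 ?bound0_ge0// mulr_ge0// ?addr_ge0 ?(ltW m0)//.
    by rewrite mulr_ge0 ?expR_ge0 ?bound0_ge0.
  move=> n; split=> [t /andP[t0 tT]|].
    apply: (le_trans (level_E0 (hP n) (G4 n) t0 tT)); rewrite lerDl.
    by rewrite mulr_ge0 ?addr_ge0 ?(ltW m0)// mulr_ge0 ?expR_ge0 ?bound0_ge0.
  apply: (le_trans (level_E1 (hP n) (G4 n) T0)); rewrite lerDr.
  exact: bound0_ge0.
(* The discrete estimate controls the dissipation up to the last multiple of [h n] before [t] only.
   Since [s < t], that point lies beyond [s] as soon as [h n <= t - s]. *)
- move=> s t e s0 st e0; have t0 : 0 <= t by rewrite (le_trans s0)// ltW.
  pose B := E0 u0 + kh 0 t; pose q := 2 * kh 0 t + 1.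
  have cphi : continuous (fun x : R => expR (2 * gamma * x) * (B + q * x)).
    apply: continuousM2.
      by move=> x; apply: continuous_comp; [exact: mulrl_continuous|exact: continuous_expR].
    apply: continuousD2; first exact: cst_continuous.
    by move=> x; exact: mulrl_continuous.
  have phi : FF [set n | expR (2 * gamma * n.+1%:R^-1) * (B + q * n.+1%:R^-1) <= B + e].
    apply: Foo; apply: (near_continuous cphi).
    by rewrite !mulr0 expR0 mul1r addr0 ltrDl.
  have ts : 0 < t - s by rewrite subr_gt0.
  apply: filterS (filterI phi (filterI (small _ ts) (bigR t))) => n /= [hphi [hts tn]].
  apply: le_trans hphi.
  have /andP[m1 m2] := step_idxP (h0 n) t0; set m := step_idx (h n) t in m1 m2.
  have sm : s <= m%:R * h n by move: m2 hts; rewrite -natr1 mulrDl mul1r; lra.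
  have mn : m%:R * h n <= n.+1%:R by rewrite (le_trans m1)// (le_trans (ltW tn))// ler_nat.
  have sn : s <= n%:R by rewrite ltW// (lt_trans st).
  have := level_energy (hP n) (G4 n) mn sn sm; rewrite -/(U n).
  have -> : lin n (c n m) f = U n t.
    by rewrite /U /Us (@step_fun_in R (h n) n (c n) (h0 n) m)// m1.
  set J := Int leb1 _; set X := E0 (U n t) => H.
  have X0 : 0 <= X by exact: E0_ge0.
  have e2 : expR (- (2 * gamma * h n)) * (expR (- (2 * gamma * t)) * X + J) <=
      E0 u0 + (1 + 2 * h n) * kh 0 (m%:R * h n) + n.+1%:R^-1.
    apply: le_trans H; rewrite mulrDr lerD2r mulrA; apply: ler_wpM2r => //.
    rewrite -expRD ler_expR.
    have g0 : 0 <= 2 * gamma by rewrite mulr_ge0// ltW.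
    have := ler_wpM2l g0 m1; have := mulr_ge0 g0 (ltW (h0 n)); lra.
  have -> : expR (- (2 * gamma * t)) * X + J = expR (2 * gamma * h n) *
      (expR (- (2 * gamma * h n)) * (expR (- (2 * gamma * t)) * X + J)).
    by rewrite mulrA -expRD subrr expR0 mul1r.
  have g0 : 0 <= 2 * gamma by rewrite mulr_ge0// ltW.
  have k0 : 0 <= kh 0 t by exact: kh_ge0.
  have r1 : 0 <= B + q * n.+1%:R^-1.
    by rewrite !addr_ge0 ?E0_ge0// mulr_ge0 ?invr_ge0// addr_ge0// mulr_ge0.
  apply: (@le_trans _ _ (expR (2 * gamma * h n) * (B + q * n.+1%:R^-1))); last first.
    by apply: ler_wpM2r => //; rewrite ler_expR; apply: ler_wpM2l.
  apply: ler_wpM2l; first exact: expR_ge0.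
  have kk : kh 0 (m%:R * h n) <= kh 0 t.
    by apply: kh_mono => //; rewrite mulr_ge0// ltW.
  exact: (le_trans e2 (rhs_harmonic _ (ltW (h0 n)) (hN n) (kh_ge0 _ _ _) kk)).
- split.
  + move=> i T eps eps0; have e0 : 0 < eps / 4 by rewrite divr_gt0.
    set e := eps / 4 in e0; have [L L0 [yL HL]] := yholder i T.
    have Lp : 0 < L + 1 by rewrite ltr_wpDl.
    pose dl := e ^+ 2 / (L + 1); have dl0 : 0 < dl by rewrite divr_gt0// exprn_gt0.
    (* The argument of Arzela and Ascoli: pointwise convergence at finitely many multiples of [dl]
       and a common Hoelder bound give uniform convergence on [[0, T]]. Four differences of size [e]
       make up [eps]. *)
    have fin (N : nat) : FF [set n | forall k, (k < N)%N -> `|y (k%:R * dl) i - Yn n i (k%:R * dl)| <= e].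
      elim: N => [|N IH]; first by apply: (filterS _ (@filterT _ FF _)) => n _ k.
      have kd : 0 <= N%:R * dl by rewrite mulr_ge0// ltW.
      apply: filterS (filterI IH (ultra_near UF (Hy i _ kd) e0)) => n /= [h2 h3] k.
      by rewrite ltnS leq_eqVlt => /predU1P[->//|]; exact: h2.
    apply: filterS (filterI (close i T e e0) (fin (step_idx dl T).+1)) => n /= [h2 h3] t tT.
    have {}h2 := h2 t tT; case/andP: tT => t0 tT.
    have /andP[m1 m2] := step_idxP dl0 t0; set m := step_idx dl t in m1 m2.
    have mT : (m < (step_idx dl T).+1)%N.
      have /andP[_ m4] := step_idxP dl0 (le_trans t0 tT).
      by rewrite -(ltr_nat R) -(ltr_pM2r dl0) (le_lt_trans m1)// (le_lt_trans tT).
    have {}h3 := h3 m mT.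
    have md : 0 <= m%:R * dl by rewrite mulr_ge0// ltW.
    have Lt : L * (t - m%:R * dl) <= e ^+ 2.
      apply: (@le_trans _ _ ((L + 1) * dl)); last by rewrite mulrC divfK// gt_eqF.
      apply: ler_pM => //; rewrite ?subr_ge0// ?lerDl//.
      by move: m2; rewrite -natr1 mulrDl mul1r; lra.
    have h4 : `|y t i - y (m%:R * dl) i| <= e.
      by apply: norm_le_sqr; [exact: ltW|exact: (le_trans (yL _ _ md m1 tT))].
    have h5 : `|Yn n i t - Yn n i (m%:R * dl)| <= e.
      by apply: norm_le_sqr; [exact: ltW|exact: (le_trans (HL n _ _ md m1 tT))].
    have -> : eps = e + e + e + e by rewrite /e; field.
    move: h2 h3 h4 h5; rewrite !ler_norml.
    move: (y t i) (y _ i) (Yn n i t) (Yn n i _) (ip _ _ _) => a1 a2 a3 a4 a5.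
    by move=> /andP[? ?] /andP[? ?] /andP[? ?] /andP[? ?]; apply/andP; split; lra.
  + by move=> i T; have [L L0 [yL _]] := yholder i T; exists L.
  + move=> i; have := Hy i 0 (lexx 0).
    under eq_fun do rewrite Y0.
    by move=> /cvg_lim <-//; apply: lim_cst.
  + move=> i t e t0 e0; apply: filterS (close i t e e0) => n /= /(_ t).
    by rewrite t0 lexx /Yn /Y => /(_ isT); rewrite !opprD !addrA.
Qed.

End Family.

(** * Limits along an ultrafilter *)

Lemma geometric_le0 (R : realType) (C x : R) : (forall j, x <= C * 4^-1 ^+ j) -> x <= 0.
Proof.
move=> H; have : `|4^-1 : R| < 1 by rewrite ger0_norm ?invr_ge0// invf_lt1// ltr1n.
move=> /(@cvg_geometric R C) c0.
by apply: (cvgr_to_ge c0); apply: nearW => j; exact: H.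
Qed.

Lemma geometric_small (R : realType) (e : R) : 0 < e -> exists j : nat, 4^-1 ^+ j <= e :> R.
Proof.
move=> e0; apply: contrapT => /forallNP H.
suff : e <= 0 by rewrite leNgt e0.
apply: (@geometric_le0 _ 1) => j; rewrite mul1r.
by have /negP := H j; rewrite -ltNge => /ltW.
Qed.

(** * A jointly measurable function with prescribed coefficients *)

Section RieszFischer.
Context (R : realType).
Variable f : nat -> R * R -> R.
Hypotheses (fD : forall i, Cc_infty Omega (f i))
  (f_orth : forall i j, i != j -> ip leb2 (f i) (f j) = 0)
  (f_norm : forall i, (ip leb2 (f i) (f i) = 1) \/ (f i = fun=> 0)).

Lemma lin_diff (M N : nat) (a : nat -> R) : (M <= N)%N -> (forall i, f i = (fun=> 0) -> a i = 0) ->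
  ip leb2 (fun z => lin N a f z - lin M a f z) (fun z => lin N a f z - lin M a f z) =
  \sum_(i < N) a i ^+ 2 - \sum_(i < M) a i ^+ 2.
Proof.
move=> MN az; pose b i := if (M <= i)%N then a i else 0.
have split (g : nat -> R) : \sum_(i < N) g i - \sum_(i < M) g i =
    \sum_(i < N) (if (M <= i)%N then g i else 0).
  rewrite -(big_mkord xpredT g) -(big_mkord xpredT (fun i => if (M <= i)%N then g i else 0)).
  rewrite !(big_cat_nat (leq0n M) MN)/= big_mkord addrAC subrr add0r.
  rewrite [X in _ = X + _](_ : _ = 0) ?add0r; last first.
    by rewrite big_nat big1// => i /andP[_ iM]; rewrite leqNgt iM.
  by apply: eq_big_nat => i /andP[Mi _]; rewrite Mi.
have -> : (fun z => lin N a f z - lin M a f z) = lin N b f.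
  apply/funext => z; rewrite /lin (split (fun i => a i * f i z)); apply: eq_bigr => i _.
  by rewrite /b; case: ifP; rewrite ?mul0r.
rewrite (split (fun i => a i ^+ 2)); have := E0_lin fD f_orth f_norm N (c := b).
rewrite /E0 => ->; first by apply: eq_bigr => i _; rewrite /b; case: ifP; rewrite ?expr0n.
by move=> i /az ai; rewrite /b ai; case: ifP.
Qed.

(** For a fixed time this is the classical theorem, but the speed at which the series converges
    varies with [t]. The partial sums are cut at an index depending measurably on [t], chosen so
    that the remainder is small at every time; the limit is then measurable in time and space
    together. *)
Lemma riesz_fischer (a : R -> nat -> R) :
  (forall i, measurable_fun setT (fun t => a t i)) ->
  (forall t i, f i = (fun=> 0) -> a t i = 0) ->
  (forall t, exists B : R, forall n, \sum_(i < n) a t i ^+ 2 <= B) ->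
  exists u : R -> R * R -> R,
  [/\ measurable_fun setT (fun p : R * (R * R) => u p.1 p.2),
      forall t, sq leb2 (u t),
      forall t i, ip leb2 (u t) (f i) = a t i,
      forall t e, 0 < e -> exists N, let d z := u t z - lin N (a t) f z in ip leb2 d d <= e &
      forall t z, ~ Omega z -> u t z = 0].
Proof.
move=> ma az aB.
have sf i : sq leb2 (f i) by exact: f_sq.
pose s n t := \sum_(i < n) a t i ^+ 2.
have sS t n m : (n <= m)%N -> s n t <= s m t.
  move=> nm; rewrite /s -(big_mkord xpredT (fun i => a t i ^+ 2)) -[leRHS](big_mkord xpredT (fun i => a t i ^+ 2)).
  by rewrite (big_cat_nat (leq0n n) nm)//= lerDl sumr_ge0// => i _; exact: sqr_ge0.
pose S := esup_lim s.
have scvg t : s n t @[n --> \oo] --> S t.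
  have cs : cvgn (fun n => s n t).
    apply: nondecreasing_is_cvgn; first by move=> n m; exact: sS.
    by have [B HB] := aB t; exists B => _ [n _ <-]; exact: HB.
  by rewrite /S (esup_lim_cvg (l := limn (fun n => s n t))).
have ms n : measurable_fun setT (s n).
  by apply: measurable_sum => i; apply: measurable_funX; exact: ma.
have mS : measurable_fun setT S by exact: measurable_esup_lim.
pose r n t := S t - s n t.
have r0 n t : 0 <= r n t.
  have nd : nondecreasing_seq (fun n => s n t) by move=> k m; exact: sS.
  have cs : cvgn (fun n => s n t) by apply/cvg_ex; exists (S t); exact: scvg.
  by have := nondecreasing_cvgn_le nd cs n; rewrite (cvg_lim _ (scvg t))// subr_ge0.
pose c (j : nat) : R := 4^-1 ^+ j.+1.
have cj j : 0 < c j by rewrite exprn_gt0.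
(* The indicator switches a term off once the remainder [r i] has dropped to [c j]. As [r] decreases
   in [i], the terms that stay are exactly those before the index [N t j], although that index never
   occurs in the formula. *)
pose W j n (p : R * (R * R)) := \sum_(i < n) \1_(`]c j, +oo[%classic : set R) (r i p.1) * a p.1 i * f i p.2.
have mW j n : measurable_fun setT (W j n).
  apply: measurable_sum => i; apply: measurable_funM; last first.
    by apply: measurableT_comp; [have [] := sf i|exact: measurable_snd].
  apply: measurable_funM; last by apply: (measurableT_comp (ma i)); exact: measurable_fst.
  apply: measurable_indic_comp => //; apply: (measurableT_comp _ measurable_fst).
  by apply: measurable_funB.
pose V j := esup_lim (W j).
have Nex t j : exists n, r n t <= c j.
  have /cvgrPdist_le/(_ _ (cj j))[n _ Hn] := scvg t.
  by exists n; move: (Hn n (leqnn n)) => /=; rewrite -/(r n t) ger0_norm.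
pose N t j := ex_minn (Nex t j).
have NP t j i : (i < N t j)%N = (c j < r i t).
  rewrite /N; case: ex_minnP => n rn nmin; case: (ltP (c j) (r i t)) => ri.
    rewrite ltnNge; apply/negP => ni; move: (lt_le_trans ri (le_trans (lerB (lexx (S t)) (sS t _ _ ni)) rn)).
    by rewrite ltxx.
  by apply/negbTE; rewrite -leqNgt; exact: nmin.
have VE j t z : V j (t, z) = lin (N t j) (a t) f z.
  apply: esup_lim_cvg; apply: cvg_near_cst; exists (N t j) => // n /= Nn.
  rewrite /W -(big_mkord xpredT (fun i => \1_(`]c j, +oo[%classic : set R) (r i t) * a t i * f i z)).
  rewrite (big_cat_nat (leq0n (N t j)) Nn)//= [X in _ + X = _](_ : _ = 0) ?addr0; last first.
    rewrite big_nat big1// => i /andP[Ni _].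
    rewrite indicE mem_setE in_itv/= andbT -NP ltnNge Ni/=; by rewrite !mul0r.
  rewrite big_mkord; apply: eq_bigr => i _.
  by rewrite indicE mem_setE in_itv/= andbT -NP ltn_ord mul1r.
have rN t j : r (N t j) t <= c j by rewrite leNgt -NP ltnn.
have Vd t j m : (j <= m)%N ->
  ip leb2 (fun z => V m (t, z) - V j (t, z)) (fun z => V m (t, z) - V j (t, z)) <= 4^-1 ^+ j.
  move=> jm.
  have -> : (fun z => V m (t, z) - V j (t, z)) = (fun z => lin (N t m) (a t) f z - lin (N t j) (a t) f z).
    by apply/funext => z; rewrite !VE.
  have NN : (N t j <= N t m)%N.
    rewrite leqNgt; apply/negP; rewrite NP => h.
    suff h2 : c m <= c j by have := lt_le_trans h (le_trans (rN t m) h2); rewrite ltxx.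
    by apply: ler_wiXn2l => //; rewrite ?invr_ge0 ?invf_le1 ?ler1n.
  rewrite lin_diff//; last by move=> i; exact: az.
  apply: (@le_trans _ _ (r (N t j) t)); first by rewrite lerD2r -subr_ge0; exact: r0.
  apply: (le_trans (rN t j)); rewrite /c exprS ler_piMl ?exprn_ge0//.
  by rewrite invf_le1// ler1n.
have sV t j : sq leb2 (fun z => V j (t, z)).
  have [+ _ _] := Cc_sq (lin_Cc (N t j) (a t) fD); congr sq.
  by apply/funext => z; rewrite VE.
pose u t z := esup_lim V (t, z).
have uP t := @L2_complete _ _ R leb2 (fun j z => V j (t, z)) (sV t) (Vd t).
exists u; split.
- rewrite (_ : (fun p => _) = esup_lim V); last by apply/funext => -[].
  by apply: measurable_esup_lim => j; apply: measurable_esup_lim.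
- by move=> t; have [] := uP t.
- move=> t i; have [su Vu] := uP t.
  apply/eqP; rewrite -subr_eq0 -sqrf_eq0 eq_le sqr_ge0 andbT.
  apply: (@geometric_le0 _ 4) => j; rewrite -(subrKA (ip leb2 (fun z => V j (t, z)) (f i))).
  apply: sqrD_le4.
    rewrite -ipBl//; apply: (le_trans (cauchy_schwarz (sqB su (sV t j)) (sf i))).
    rewrite -[leRHS]mulr1; apply: ler_pM; rewrite ?ip_ge0//.
      by rewrite (le_trans _ (Vu j))// le_eqVlt; apply/orP; left; apply/eqP/eq_Int => z; rewrite -mulrNN !opprB.
    case: (f_norm i) => [->//|->]; rewrite (_ : ip _ _ _ = 0)//.
    by rewrite -[RHS](Int0 leb2); apply: eq_Int => z; rewrite mulr0.
  have -> : (fun z => V j (t, z)) = lin (N t j) (a t) f by apply/funext => z; rewrite VE.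
  case: (ltnP i (N t j)) => iN.
    by rewrite ip_lin// ?subrr ?expr0n ?exprn_ge0// ; exact: az.
  rewrite (_ : ip leb2 _ _ = 0) ?sub0r ?sqrrN.
    have : a t i ^+ 2 <= r i t.
      have := r0 i.+1 t; rewrite /r /s big_ord_recr/=; lra.
    move=> /le_trans; apply; apply: (@le_trans _ _ (c j)); first by rewrite leNgt -NP -leqNgt.
    by rewrite /c exprS ler_piMl ?exprn_ge0// invf_le1// ler1n.
  rewrite (@ip_suml _ _ _ leb2 (N t j) (fun i z => a t i * f i z))//; last by move=> k _; exact: sqZ.
  rewrite big1// => k _; rewrite ipZl// f_orth ?mulr0//.
  by apply: contraTneq (ltn_ord k) => ->; rewrite -leqNgt.
- move=> t e e0; have [su Vu] := uP t.
  have [j je] := geometric_small e0; exists (N t j) => /=; apply: le_trans je.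
  apply: le_trans (Vu j); rewrite le_eqVlt; apply/orP; left; apply/eqP/eq_Int => z.
  by rewrite VE -mulrNN !opprB.
- move=> t z zO; apply: esup_lim_cvg; rewrite (_ : (fun j => _) = fun=> 0); first exact: cvg_cst.
  apply/funext => j; rewrite VE /lin big1// => i _.
  have [M [_ _ _ _ /(_ z) H]] := Cc_dxy (fD i).
  by have [] := H; [apply/negP => /andP[_]; exact: zO|move=> -> _ _; rewrite mulr0].
Qed.

End RieszFischer.

(** * A weight in time that makes all bounds uniform *)

Section Weight.
Context (R : realType) (A : nat -> R).
Hypothesis A0 : forall k, 0 <= A k.

(** [A k] bounds the approximations on [[0, k + 1]] and may grow with [k]. With the weight [theta k]
    on [[k, k + 1[] the squared norms are summable, so the approximations are bounded in a single
    Hilbert space over all times, and one limit serves every time horizon. *)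
Definition theta (k : nat) : R := 2^-1 ^+ k.+1 / (1 + A k).

Lemma theta_gt0 k : 0 < theta k.
Proof. by rewrite divr_gt0 ?exprn_gt0 ?invr_gt0// ltr_pwDl. Qed.

Lemma thetaA k : theta k ^+ 2 * A k <= 2^-1 ^+ k.
Proof.
have p : (0 : R) < 1 + A k by rewrite ltr_pwDl.
have t1 : theta k <= 2^-1 ^+ k.+1.
  by rewrite ler_pdivrMr// ler_peMr ?exprn_ge0 ?invr_ge0// lerDl.
have t2 : theta k * A k <= 1.
  rewrite /theta -mulrA mulr_ile1 ?exprn_ge0 ?invr_ge0 ?mulr_ge0 ?invr_ge0 ?(ltW p)//.
    by rewrite exprn_ile1 ?invr_ge0// invf_le1// ler1n.
  by rewrite mulrC ler_pdivrMr// mul1r lerDr.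
rewrite expr2 -mulrA; apply: (@le_trans _ _ (theta k)).
  by rewrite ler_piMr// ltW// theta_gt0.
by apply: (le_trans t1); rewrite exprS ler_piMl ?exprn_ge0 ?invr_ge0// invf_le1// ler1n.
Qed.

Definition rho : R -> R := esup_lim (fun n t => \sum_(k < n) theta k * win1 k%:R k.+1%:R t).

Lemma sum_win (g : nat -> R) k n t : k%:R <= t < k.+1%:R -> (k < n)%N ->
  \sum_(i < n) g i * win1 i%:R i.+1%:R t = g k.
Proof.
move=> kt kn; rewrite (bigD1 (Ordinal kn))//= big1 ?addr0 => [|j /eqP jk].
  by rewrite win1E kt mulr1.
rewrite win1E; case: ifP => [/andP[h1 h2]|]; last by rewrite mulr0.
case: jk; apply: val_inj => /=; case/andP: kt => h3 h4.
apply/eqP; rewrite eqn_leq -[X in X && _]ltnS -[X in _ && X]ltnS -!(ltr_nat R).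
by rewrite (le_lt_trans h1)//= (le_lt_trans h3).
Qed.

Lemma sum_win0 (g : nat -> R) n t : t < 0 -> \sum_(i < n) g i * win1 i%:R i.+1%:R t = 0.
Proof.
move=> t0; rewrite big1// => i _; rewrite win1E; case: ifP => [/andP[h1 _]|]; last by rewrite mulr0.
by have : (0 : R) <= i%:R by []; rewrite leNgt (le_lt_trans h1 t0).
Qed.

Lemma trunc_in (t : R) : 0 <= t -> (Num.trunc t)%:R <= t < (Num.trunc t).+1%:R.
Proof. by move=> /trunc_itv. Qed.

Lemma sum_win_cvg (g : nat -> R) t : \sum_(i < n) g i * win1 i%:R i.+1%:R t @[n --> \oo] -->
  (if 0 <= t then g (Num.trunc t) else 0).
Proof.
case: (leP 0 t) => t0; apply: cvg_near_cst.
  exists (Num.trunc t).+1 => // n /= kn; exact: (sum_win g (trunc_in t0) kn).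
by apply: nearW => n; exact: sum_win0.
Qed.

Lemma rhoE t : rho t = if 0 <= t then theta (Num.trunc t) else 0.
Proof. by apply: esup_lim_cvg; exact: sum_win_cvg. Qed.

Lemma rho_meas : measurable_fun setT rho.
Proof.
apply: measurable_esup_lim => n; apply: measurable_sum => k.
by apply: measurable_funM; [exact: measurable_cst|exact: win1_meas].
Qed.

Lemma rhoV_meas : measurable_fun setT (fun t => (rho t)^-1).
Proof.
rewrite (_ : (fun t => _) = esup_lim (fun n t => \sum_(k < n) (theta k)^-1 * win1 k%:R k.+1%:R t)).
  apply: measurable_esup_lim => n; apply: measurable_sum => k.
  by apply: measurable_funM; [exact: measurable_cst|exact: win1_meas].
apply/funext => t; rewrite (esup_lim_cvg (@sum_win_cvg (fun k => (theta k)^-1) t)) rhoE.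
by case: ifP; rewrite ?invr0.
Qed.

Lemma rho_bnd (T : nat) : exists2 c : R, 0 < c & forall t, 0 <= t < T%:R -> c <= rho t.
Proof.
elim: T => [|T [c c0 H]]; first by exists 1 => // t /andP[/le_lt_trans h1 /h1]; rewrite ltxx.
exists (Num.min c (theta T)); first by rewrite lt_min c0 theta_gt0.
move=> t /andP[t0 tT]; rewrite ge_min; case: (ltP t T%:R) => tT'.
  by rewrite H// t0.
apply/orP; right; rewrite rhoE t0 le_eqVlt; apply/orP; left; apply/eqP; congr theta.
have /andP[h1 h2] := trunc_in t0.
apply/eqP; rewrite eqn_leq -[X in X && _]ltnS -[X in _ && X]ltnS -!(ltr_nat R).
by rewrite (le_lt_trans tT')//= (le_lt_trans h1).
Qed.

Lemma rho_sq (w : R * (R * R) -> R) : 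
  (forall k : nat, sq leb3 (fun p => win 0 k.+1%:R p * w p) /\
     ip leb3 (fun p => win 0 k.+1%:R p * w p) (fun p => win 0 k.+1%:R p * w p) <= A k) ->
  sq leb3 (fun p => rho p.1 * w p) /\ ip leb3 (fun p => rho p.1 * w p) (fun p => rho p.1 * w p) <= 2.
Proof.
move=> H.
have mr : measurable_fun setT (fun p : R * (R * R) => rho p.1).
  by apply: (measurableT_comp rho_meas); exact: measurable_fst.
have mrw : measurable_fun setT (fun p => rho p.1 * w p).
  have -> : (fun p => rho p.1 * w p) = esup_lim (fun k p => rho p.1 * (win 0 k.+1%:R p * w p)).
    apply/funext => p; apply/esym/esup_lim_cvg; apply: cvg_near_cst.
    case: (leP 0 p.1) => t0; last by apply: nearW => n; rewrite rhoE leNgt t0 !mul0r.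
    exists (Num.trunc p.1) => // n /= kn; rewrite /win win1E t0 /=.
    have /andP[_ h2] := trunc_in t0.
    by rewrite (lt_le_trans h2) ?mul1r// ler_nat ltnS.
  apply: measurable_esup_lim => k; apply: measurable_funM => //.
  by have [[]] := H k.
pose b k p := win k%:R k.+1%:R p * w p.
have bE k p : b k p = win k%:R k.+1%:R p * (win 0 k.+1%:R p * w p).
  by rewrite mulrA /win [win1 k%:R _ _ * _]mulrC -win1_out.
have sb k : sq leb3 (b k).
  by have := sq_win k%:R k.+1%:R (H k).1; congr sq; apply/funext => p; rewrite bE.
have bA k : ip leb3 (b k) (b k) <= A k.
  apply: le_trans (H k).2; apply: ip_le; [exact: sb|exact: (H k).1|move=> p].
  by rewrite bE normrM ler_piMl// win1_le1.
pose h n p := \sum_(k < n) theta k ^+ 2 * b k p ^+ 2.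
have ih n : intg leb3 (h n).
  apply: (@intg_sum _ _ _ leb3 n (fun k p => theta k ^+ 2 * b k p ^+ 2)) => k _.
  by apply: intgZ; exact: sq_intg (sb k).
have [] := @fatou_le _ _ R leb3 h (fun p => (rho p.1 * w p) ^+ 2) 2 ih.
- by move=> n p; apply: sumr_ge0 => k _; rewrite mulr_ge0// sqr_ge0.
- exact: measurable_funX.
- by move=> p; exact: sqr_ge0.
- apply: aeW => p; have E n : h n p = (\sum_(k < n) theta k ^+ 2 * win1 k%:R k.+1%:R p.1) * w p ^+ 2.
    rewrite /h mulr_suml; apply: eq_bigr => k _.
    by rewrite /b [(_ * w p) ^+ 2]exprMn /win (expr2 (win1 _ _ _)) win1_sqr mulrA.
  under eq_fun do rewrite E.
  rewrite exprMn; apply: cvgM; last exact: cvg_cst.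
  rewrite rhoE (_ : (if 0 <= p.1 then _ else _) ^+ 2 = if 0 <= p.1 then theta (Num.trunc p.1) ^+ 2 else 0).
    exact: (@sum_win_cvg (fun k => theta k ^+ 2) p.1).
  by case: ifP; rewrite ?expr0n.
- apply: nearW => n; rewrite (@Int_sum _ _ _ leb3 n (fun k p => theta k ^+ 2 * b k p ^+ 2)).
    apply: le_trans (sum_half_le R n); apply: ler_sum => k _.
    rewrite IntZ; last exact: sq_intg (sb k).
    rewrite -ipE; apply: le_trans (thetaA k); apply: ler_wpM2l; [exact: sqr_ge0|exact: bA].
  by move=> k _; apply: intgZ; exact: sq_intg (sb k).
by move=> i1 i2; rewrite ipE; split.
Qed.

End Weight.

(** * Weak limits of the approximations and their gradients *)

Section WeakLimit.
Context (R : realType).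
Variable U : nat -> R -> R * R -> R.
Hypotheses (UD : forall n t, Cc_infty Omega (U n t))
  (Usq : forall n a b, [/\ sq leb3 (fun p => win a b p * U n p.1 p.2),
     sq leb3 (fun p => win a b p * dx (U n p.1) p.2) &
     sq leb3 (fun p => win a b p * dy (U n p.1) p.2)])
  (Ub : forall T, 0 <= T -> exists2 A, 0 <= A & forall n,
     Int leb1 (fun t => win1 0 T t * (E0 (U n t) + E1 (U n t))) <= A)
  (Ui : forall n a b G, intg leb1 (fun t => win1 a b t * G (U n t))).
Variables (FF : set_system nat) (UF : UltraFilter FF).

Implicit Types v w : R -> R * R -> R.

Definition mid v w : R -> R * R -> R := fun t z => 2^-1 * v t z + 2^-1 * w t z.

Lemma dxy_mid v w t z : Cc_infty Omega (v t) -> Cc_infty Omega (w t) ->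
  Cc_infty Omega (mid v w t) /\
  dx (mid v w t) z = 2^-1 * dx (v t) z + 2^-1 * dx (w t) z /\
  dy (mid v w t) z = 2^-1 * dy (v t) z + 2^-1 * dy (w t) z.
Proof.
move=> vD wD; split; first by apply: Cc_inftyD; exact: Cc_inftyZ.
have [M [_ _ _ /(_ z)[vx vy] _]] := Cc_dxy vD.
have [N [_ _ _ /(_ z)[wx wy] _]] := Cc_dxy wD; split.
  by have [_ H] := is_derive_add (is_derive_scale 2^-1 vx) (is_derive_scale 2^-1 wx); exact: H.
by have [_ H] := is_derive_add (is_derive_scale 2^-1 vy) (is_derive_scale 2^-1 wy); exact: H.
Qed.

Lemma win_ip a b (w : R * (R * R) -> R) : sq leb3 (fun p => win a b p * w p) ->
  ip leb3 (fun p => win a b p * w p) (fun p => win a b p * w p) =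
  Int leb1 (fun t => win1 a b t * ip leb2 (fun z => w (t, z)) (fun z => w (t, z))).
Proof.
move=> sw; rewrite (ip_fubini sw sw); apply: eq_Int => t /=.
rewrite /win win1E; case: ifP => _; last first.
  by rewrite mul0r -[RHS](Int0 leb2); apply: eq_Int => z; rewrite !mul0r.
by rewrite mul1r; apply: eq_Int => z; rewrite !mul1r.
Qed.

Lemma mid_sq d (X : measurableType d) (m : {measure set X -> \bar R}) (a b : X -> R) :
  sq m a -> sq m b -> let c x := 2^-1 * a x + 2^-1 * b x in sq m c /\
  let e x := a x - b x in 2 * ip m a a + 2 * ip m b b - 4 * ip m c c = ip m e e.
Proof.
move=> sa sb c; have sa' : sq m (fun x => 2^-1 * a x) by exact: sqZ.
have sb' : sq m (fun x => 2^-1 * b x) by exact: sqZ.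
split=> [|e]; first exact: sqD.
rewrite ipBB// ipDD// !ipZr// !ipZl//.
set x := ip m a a; set y := ip m a b; set z := ip m b b; by field.
Qed.

Lemma comb3 (a a' a'' b b' b'' m m' m'' e e' e'' : R) : 2 * a + 2 * b - 4 * m = e ->
  2 * a' + 2 * b' - 4 * m' = e' -> 2 * a'' + 2 * b'' - 4 * m'' = e'' ->
  2 * (a + a' + a'') + 2 * (b + b' + b'') - 4 * (m + m' + m'') = e + e' + e''.
Proof. by move=> <- <- <-; ring. Qed.

(** [hull_cauchy] is applied to the triples of a function and its two derivatives, weighted by
    [rho]; the limit exists by completeness, and the weight is divided out afterwards. The last
    clause is the form of weak convergence used later: whatever holds along the ultrafilter and is
    stable under midpoints holds for elements close to the limit in norm. *)
Lemma weak_limit : exists u ux uy : R * (R * R) -> R,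
  [/\ [/\ measurable_fun setT u, measurable_fun setT ux & measurable_fun setT uy],
    forall T, [/\ sq leb3 (fun p => win 0 T p * u p), sq leb3 (fun p => win 0 T p * ux p) &
      sq leb3 (fun p => win 0 T p * uy p)],
    forall p, ~ Omega p.2 -> [/\ u p = 0, ux p = 0 & uy p = 0] &
    forall (T : R) (B : set nat) (e : R), FF B -> 0 < e -> exists2 x, hull mid (U @` B) x &
      let d0 p := win 0 T p * (x p.1 p.2 - u p) in
      let d1 p := win 0 T p * (dx (x p.1) p.2 - ux p) in
      let d2 p := win 0 T p * (dy (x p.1) p.2 - uy p) in
      ip leb3 d0 d0 + ip leb3 d1 d1 + ip leb3 d2 d2 <= e].
Proof.
have PF : ProperFilter FF by exact: ultra_proper.
have Tk k : exists A : R, 0 <= A /\ forall n,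
     Int leb1 (fun t => win1 0 k.+1%:R t * (E0 (U n t) + E1 (U n t))) <= A.
  by have [A A0 HA] := Ub (ler0n R k.+1); exists A.
have /choice[A HA] := Tk.
have A0 k : 0 <= A k by have [] := HA k.
have AU k n := (HA k).2 n.
pose X (w : R * (R * R) -> R) (p : R * (R * R)) := rho A p.1 * w p.
pose c0 v (p : R * (R * R)) := v p.1 p.2.
pose c1 v (p : R * (R * R)) := dx (v p.1) p.2.
pose c2 v (p : R * (R * R)) := dy (v p.1) p.2.
pose good v := (forall t, Cc_infty Omega (v t)) /\
  [/\ sq leb3 (X (c0 v)), sq leb3 (X (c1 v)) & sq leb3 (X (c2 v))].
pose N v := ip leb3 (X (c0 v)) (X (c0 v)) + ip leb3 (X (c1 v)) (X (c1 v)) + ip leb3 (X (c2 v)) (X (c2 v)).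
have N0 v : 0 <= N v by rewrite !addr_ge0 ?ip_ge0.
have UA n : good (U n) /\ N (U n) <= 6.
  have le3 k : [/\ ip leb3 (fun p => win 0 k.+1%:R p * c0 (U n) p) (fun p => win 0 k.+1%:R p * c0 (U n) p) <= A k,
      ip leb3 (fun p => win 0 k.+1%:R p * c1 (U n) p) (fun p => win 0 k.+1%:R p * c1 (U n) p) <= A k &
      ip leb3 (fun p => win 0 k.+1%:R p * c2 (U n) p) (fun p => win 0 k.+1%:R p * c2 (U n) p) <= A k].
    have [s0 s1 s2] := Usq n 0 k.+1%:R.
    have i1 := Ui n 0 k.+1%:R (fun g => E0 g + E1 g).
    split; apply: le_trans (AU k n).
    - rewrite (win_ip s0); apply: (@Int_le _ _ _ leb1 _ _ (Ui n 0 k.+1%:R (fun g => ip leb2 g g)) i1) => t.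
      rewrite win1E; case: ifP => _; rewrite ?mul0r// !mul1r.
      by rewrite lerDl addr_ge0 ?ip_ge0.
    - rewrite (win_ip s1); apply: (@Int_le _ _ _ leb1 _ _ (Ui n 0 k.+1%:R (fun g => ip leb2 (dx g) (dx g))) i1) => t.
      rewrite win1E; case: ifP => _; rewrite ?mul0r// !mul1r.
      by rewrite /E1 addrCA lerDl addr_ge0 ?ip_ge0.
    - rewrite (win_ip s2); apply: (@Int_le _ _ _ leb1 _ _ (Ui n 0 k.+1%:R (fun g => ip leb2 (dy g) (dy g))) i1) => t.
      rewrite win1E; case: ifP => _; rewrite ?mul0r// !mul1r.
      by rewrite /E1 addrA lerDr addr_ge0 ?ip_ge0.
  have [s0 b0] := rho_sq A0 (fun k => let: And3 s _ _ := Usq n 0 k.+1%:R in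
    let: And3 l _ _ := le3 k in conj s l).
  have [s1 b1] := rho_sq A0 (fun k => let: And3 _ s _ := Usq n 0 k.+1%:R in
    let: And3 _ l _ := le3 k in conj s l).
  have [s2 b2] := rho_sq A0 (fun k => let: And3 _ _ s := Usq n 0 k.+1%:R in
    let: And3 _ _ l := le3 k in conj s l).
  split; first exact: (conj (UD n) (And3 s0 s1 s2)).
  have -> : 6 = 2 + 2 + 2 :> R by rewrite -!natrD.
  exact: (lerD (lerD b0 b1) b2).
have Xmid v w : good v -> good w ->
  [/\ X (c0 (mid v w)) = fun p => 2^-1 * X (c0 v) p + 2^-1 * X (c0 w) p,
      X (c1 (mid v w)) = fun p => 2^-1 * X (c1 v) p + 2^-1 * X (c1 w) p &
      X (c2 (mid v w)) = fun p => 2^-1 * X (c2 v) p + 2^-1 * X (c2 w) p].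
  move=> [vD _] [wD _]; split; apply/funext => p; rewrite /X.
  - by rewrite /c0 /mid; ring.
  - by rewrite /c1; have [_ [-> _]] := dxy_mid p.2 (vD p.1) (wD p.1); ring.
  - by rewrite /c2; have [_ [_ ->]] := dxy_mid p.2 (vD p.1) (wD p.1); ring.
have gmid v w : good v -> good w -> good (mid v w).
  move=> gv gw; have [e0 e1 e2] := Xmid v w gv gw.
  split=> [t|]; first by have [] := dxy_mid (0, 0) (gv.1 t) (gw.1 t).
  rewrite e0 e1 e2; have [_ [v0 v1 v2]] := gv; have [_ [w0 w1 w2]] := gw.
  by split; apply: (mid_sq _ _).1.
have ghull B : hull mid (U @` B) `<=` good.
  by apply: hull_sub => // _ [n _ <-]; exact: (UA n).1.
pose D v w := let e0 p := X (c0 v) p - X (c0 w) p in let e1 p := X (c1 v) p - X (c1 w) p in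
  let e2 p := X (c2 v) p - X (c2 w) p in ip leb3 e0 e0 + ip leb3 e1 e1 + ip leb3 e2 e2.
have dD v w : good v -> good w -> dist2 mid N v w = D v w.
  move=> gv gw; have [e0 e1 e2] := Xmid v w gv gw; have [_ [v0 v1 v2]] := gv; have [_ [w0 w1 w2]] := gw.
  rewrite /dist2 /N e0 e1 e2.
  exact: (comb3 (mid_sq v0 w0).2 (mid_sq v1 w1).2 (mid_sq v2 w2).2).
have [AA [g [FA gA gg gB]]] := @hull_cauchy R _ mid N N0 FF PF U 6 (fun n => (UA n).2).
have gk k : good (g k) := ghull _ _ (gA k).
have le4 (x y e : R) : x <= e -> y <= e -> 2 * x + 2 * y <= 4 * e by lra.
have D3 (x y z e : R) : 0 <= x -> 0 <= y -> 0 <= z -> x + y + z <= e -> [/\ x <= e, y <= e & z <= e].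
  by split; lra.
have Dk k l : (k <= l)%N -> D (g l) (g k) <= 4^-1 ^+ k by move=> kl; rewrite -dD//; exact: gg.
have D3' v w e : D v w <= e -> _ := fun h => D3 _ _ _ e (ip_ge0 _ _) (ip_ge0 _ _) (ip_ge0 _ _) h.
pose G0 := esup_lim (fun k => X (c0 (g k))); pose G1 := esup_lim (fun k => X (c1 (g k))).
pose G2 := esup_lim (fun k => X (c2 (g k))).
have L2c (c : (R -> R * R -> R) -> R * (R * R) -> R) : (forall k, sq leb3 (X (c (g k)))) ->
    (forall k l, (k <= l)%N -> ip leb3 (fun p => X (c (g l)) p - X (c (g k)) p)
      (fun p => X (c (g l)) p - X (c (g k)) p) <= 4^-1 ^+ k) ->
    sq leb3 (esup_lim (fun k => X (c (g k)))) /\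
    forall k, ip leb3 (fun p => X (c (g k)) p - esup_lim (fun k => X (c (g k))) p)
      (fun p => X (c (g k)) p - esup_lim (fun k => X (c (g k))) p) <= 4^-1 ^+ k.
  exact: (@L2_complete _ _ R leb3 (fun k => X (c (g k)))).
have [sG0 HG0] := L2c c0 (fun k => let: conj _ (And3 s _ _) := gk k in s)
  (fun k l kl => let: And3 h _ _ := D3' _ _ _ (Dk k l kl) in h).
have [sG1 HG1] := L2c c1 (fun k => let: conj _ (And3 _ s _) := gk k in s)
  (fun k l kl => let: And3 _ h _ := D3' _ _ _ (Dk k l kl) in h).
have [sG2 HG2] := L2c c2 (fun k => let: conj _ (And3 _ _ s) := gk k in s)
  (fun k l kl => let: And3 _ _ h := D3' _ _ _ (Dk k l kl) in h).
rewrite -/G0 in sG0 HG0; rewrite -/G1 in sG1 HG1; rewrite -/G2 in sG2 HG2.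
have mO : measurable (Omega : set (R * R)).
  have -> : (Omega : set (R * R)) = setT `*` `]0, 1[%classic.
    by apply/seteqP; split=> [[x y]|[x y]] /=; rewrite /Omega /= in_itv //= => -[].
  exact: measurableX.
pose io (p : R * (R * R)) : R := \1_Omega p.2.
have mio : measurable_fun setT io.
  by apply: (measurableT_comp _ measurable_snd); exact: measurable_indic.
(* Removes the weight and sets the function to zero outside the strip, where the limit superior is
   known only through its norm. *)
pose rst (G : R * (R * R) -> R) p := io p * ((rho A p.1)^-1 * G p).
have mrst G : measurable_fun setT G -> measurable_fun setT (rst G).
  move=> mG; apply: measurable_funM => //; apply: measurable_funM => //.
  by apply: (measurableT_comp (rhoV_meas A)); exact: measurable_fst.
have rst_out G p : ~ Omega p.2 -> rst G p = 0.
  by move=> h; rewrite /rst /io indicE memNset// mul0r.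
have key T : exists2 c : R, 0 < c & forall G (w : R * (R * R) -> R) p,
    (forall p, ~ Omega p.2 -> w p = 0) ->
    `|win 0 T p * (w p - rst G p)| <= `|c * (X w p - G p)|.
  have [c cp Hc] := rho_bnd A0 (Num.trunc `|T|).+1.
  exists c^-1; first by rewrite invr_gt0.
  move=> G w p w0; rewrite /win win1E; case: ifP => [/andP[t0 tT]|]; last by rewrite mul0r normr0.
  have cr : c <= rho A p.1.
    apply: Hc; rewrite t0; apply: (lt_trans tT); apply: (le_lt_trans (ler_norm T)).
    by have /andP[] := trunc_in (normr_ge0 T).
  have r0 : 0 < rho A p.1 := lt_le_trans cp cr.
  rewrite mul1r; have [pO|pO] := pselect (Omega p.2); last first.
    by rewrite w0// rst_out// subrr normr0.
  rewrite /rst /io indicE mem_set//= mul1r.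
  have -> : w p - (rho A p.1)^-1 * G p = (rho A p.1)^-1 * (X w p - G p).
    by rewrite /X mulrBr mulrA mulVf ?gt_eqF// mul1r.
  by rewrite !normrM ler_wpM2r// !gtr0_norm ?invr_gt0// lef_pV2.
have rsq T G : sq leb3 G -> sq leb3 (fun p => win 0 T p * rst G p).
  move=> sG; have [c c_gt0 Hc] := key T.
  apply: (sq_le _ (sqZ c sG)).
    by apply: measurable_funM; [exact: win_meas|apply: mrst; case: sG].
  move=> p; have := Hc G (fun=> 0) p (fun _ _ => erefl).
  by rewrite /X mulr0 !sub0r !mulrN !normrN.
have c_out v : (forall t, Cc_infty Omega (v t)) -> [/\ forall p, ~ Omega p.2 -> c0 v p = 0,
    forall p, ~ Omega p.2 -> c1 v p = 0 & forall p, ~ Omega p.2 -> c2 v p = 0].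
  move=> vD; suff H p : ~ Omega p.2 -> [/\ c0 v p = 0, c1 v p = 0 & c2 v p = 0].
    by split=> p /H[].
  move=> pO; have [M [_ _ _ _ /(_ p.2) h]] := Cc_dxy (vD p.1).
  by apply: h; apply/negP => /andP[_]; exact: pO.
exists (rst G0), (rst G1), (rst G2); split.
- by split; apply: mrst; [case: sG0|case: sG1|case: sG2].
- by move=> T; exact: (And3 (rsq T G0 sG0) (rsq T G1 sG1) (rsq T G2 sG2)).
- by move=> p pO; exact: (And3 (rst_out G0 p pO) (rst_out G1 p pO) (rst_out G2 p pO)).
move=> T B e FB e_gt0; have [c c_gt0 Hc] := key T.
(* The triangle inequality through [g k] costs a factor 4 and the division by the weight a factor
   [c ^+ 2], which leaves [e / 3] for each of the three components. *)
have q_gt0 : 0 < e / (12 * c ^+ 2) by rewrite divr_gt0// mulr_gt0// exprn_gt0.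
have [k kq] := geometric_small q_gt0.
have [x xh dk] := gB B FB k.
have gx : good x := ghull _ _ xh; have [xD [x0 x1 x2]] := gx.
have [xo0 xo1 xo2] := c_out x xD.
move: dk; rewrite dD// => /D3'[k0 k1 k2].
have [gkD [g0 g1 g2]] := gk k.
have tri (a b G : R * (R * R) -> R) : sq leb3 a -> sq leb3 b -> sq leb3 G ->
    ip leb3 (fun p => a p - b p) (fun p => a p - b p) <= 4^-1 ^+ k ->
    ip leb3 (fun p => a p - G p) (fun p => a p - G p) <= 4^-1 ^+ k ->
    ip leb3 (fun p => b p - G p) (fun p => b p - G p) <= 4 * 4^-1 ^+ k.
  move=> sa sb sG h1 h2; have sab := sqB sa sb; have saG := sqB sa sG.
  have := ipD_le2 (sqN sab) saG; set l := ip leb3 _ _ => h3.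
  have -> : ip leb3 (fun p => b p - G p) (fun p => b p - G p) = l.
    by apply: eq_Int => p; ring.
  apply: (le_trans h3).
  have -> : ip leb3 (fun p => - (a p - b p)) (fun p => - (a p - b p)) =
     ip leb3 (fun p => a p - b p) (fun p => a p - b p) by apply: eq_Int => p; ring.
  exact: le4.
have est (w G : R * (R * R) -> R) : sq leb3 (X w) -> sq leb3 G ->
    (forall p, ~ Omega p.2 -> w p = 0) -> measurable_fun setT (fun p => win 0 T p * (w p - rst G p)) ->
    ip leb3 (fun p => X w p - G p) (fun p => X w p - G p) <= 4 * 4^-1 ^+ k ->
    ip leb3 (fun p => win 0 T p * (w p - rst G p)) (fun p => win 0 T p * (w p - rst G p)) <= e / 3.
  move=> sw sG w0 mw h; have sXG := sqZ c (sqB sw sG).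
  have sd : sq leb3 (fun p => win 0 T p * (w p - rst G p)).
    by apply: (sq_le _ sXG) => [|p]; [exact: mw|exact: Hc].
  apply: (@le_trans _ _ (ip leb3 (fun p => c * (X w p - G p)) (fun p => c * (X w p - G p)))).
    by apply: (ip_le sd sXG) => p; exact: Hc.
  rewrite ipZr ?ipZl//; [|exact: sqB..].
  apply: (@le_trans _ _ (c * (c * (4 * (e / (12 * c ^+ 2)))))).
    do 2![apply: ler_wpM2l; first exact: ltW].
    by apply: (le_trans h); apply: ler_wpM2l.
  by rewrite le_eqVlt; apply/orP; left; apply/eqP; field; rewrite gt_eqF.
have mwin (w : R * (R * R) -> R) : sq leb3 (X w) -> measurable_fun setT (fun p => win 0 T p * w p).
  move=> [mX _].
  have -> : (fun p => win 0 T p * w p) = (fun p => win 0 T p * ((rho A p.1)^-1 * X w p)).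
    apply/funext => p; rewrite /win win1E; case: ifP => [/andP[t0 _]|]; last by rewrite !mul0r.
    have r0 : 0 < rho A p.1 by rewrite rhoE t0; exact: theta_gt0.
    by rewrite !mul1r /X mulrA mulVf ?mul1r// gt_eqF.
  apply: measurable_funM; first exact: win_meas.
  apply: measurable_funM => //.
  by apply: (measurableT_comp (rhoV_meas A)); exact: measurable_fst.
have mwd (w G : R * (R * R) -> R) : sq leb3 (X w) -> sq leb3 G ->
    measurable_fun setT (fun p => win 0 T p * (w p - rst G p)).
  move=> sw sG; under eq_fun do rewrite mulrBr.
  apply: measurable_funB; first exact: mwin.
  by have [] := rsq T G sG.
exists x => //=.
have -> : e = e / 3 + e / 3 + e / 3 by field.
have h0 := est _ _ x0 sG0 xo0 (mwd _ _ x0 sG0) (tri _ _ _ g0 x0 sG0 k0 (HG0 k)).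
have h1 := est _ _ x1 sG1 xo1 (mwd _ _ x1 sG1) (tri _ _ _ g1 x1 sG1 k1 (HG1 k)).
have h2 := est _ _ x2 sG2 xo2 (mwd _ _ x2 sG2) (tri _ _ _ g2 x2 sG2 k2 (HG2 k)).
exact: (lerD (lerD h0 h1) h2).
Qed.

End WeakLimit.

Lemma cs_small d (X : measurableType d) (R : realType) (m : {measure set X -> \bar R})
    (a b : X -> R) (e : R) : sq m a -> sq m b -> ip m a a <= e -> ip m a b ^+ 2 <= ip m b b * e.
Proof.
move=> sa sb h; apply: (le_trans (cauchy_schwarz sa sb)).
by rewrite mulrC; apply: ler_wpM2l => //; exact: ip_ge0.
Qed.

(** * Integrals over a time window and a box *)

Section Windows.
Context (R : realType).
Definition boxind (M : R) (z : R * R) : R := \1_[set z | inbox M z] z.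

Lemma boxindE M z : boxind M z = if inbox M z then 1 else 0.
Proof.
by rewrite /boxind indicE; case: ifP => h; [rewrite mem_set|rewrite memNset//= h].
Qed.

Lemma boxind_meas M : measurable_fun setT (boxind M).
Proof. by apply: measurable_indic; exact: measurable_inbox. Qed.

Lemma boxind_bsupp M : bsupp M (boxind M).
Proof.
split; first exact: boxind_meas.
  by exists 1 => z; rewrite boxindE; case: ifP; rewrite ?normr1 ?normr0.
by move=> z /negbTE h; rewrite boxindE h.
Qed.

Lemma win_fubini a b (h : R * (R * R) -> R) : intg leb3 (fun p => win a b p * h p) ->
  intg leb1 (fun t => win1 a b t * Int leb2 (fun z => h (t, z))) /\
  Int leb3 (fun p => win a b p * h p) = Int leb1 (fun t => win1 a b t * Int leb2 (fun z => h (t, z))).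
Proof.
move=> ih; have E t : Int leb2 (fun z => win a b (t, z) * h (t, z)) = win1 a b t * Int leb2 (fun z => h (t, z)).
  rewrite /win /= win1E; case: ifP => _.
    by rewrite mul1r; apply: eq_Int => z; rewrite mul1r.
  by rewrite mul0r -[RHS](Int0 leb2); apply: eq_Int => z; rewrite mul0r.
split; first by have := intg_fubini ih; congr intg; apply/funext => t; exact: E.
by rewrite (Int_fubini ih); apply: eq_Int => t; exact: E.
Qed.

Lemma win_intgM a b (g h : R * (R * R) -> R) : sq leb3 (fun p => win a b p * g p) ->
  sq leb3 (fun p => win a b p * h p) -> intg leb3 (fun p => win a b p * (g p * h p)).
Proof.
move=> sg sh; have := intgM sg sh; congr intg; apply/funext => p.
by rewrite mulrACA /win win1_sqr.
Qed.

Lemma win_bsupp M a b (g : R * (R * R) -> R) (w : R * R -> R) : sq leb3 (fun p => win a b p * g p) ->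
  bsupp M w -> sq leb3 (fun p => win a b p * (g p * w p.2)).
Proof.
move=> sg [mw [B Bw] _].
have mw2 : measurable_fun setT (fun p : R * (R * R) => w p.2).
  by apply: (measurableT_comp mw); exact: measurable_snd.
have := @sqM_bounded _ _ _ leb3 B _ (fun p => w p.2) mw2 sg (fun p => Bw p.2).
by congr sq; apply/funext => p; rewrite mulrA.
Qed.

Lemma win_bsupp1 M a b (w : R * R -> R) : bsupp M w -> sq leb3 (fun p => win a b p * w p.2).
Proof. by move=> /bsupp_sq; exact: sq_winv. Qed.

Lemma nat_above (r : R) : exists M : nat, r <= M%:R.
Proof.
exists (Num.trunc `|r|).+1; have /andP[_ h] := trunc_in (normr_ge0 r).
by rewrite (le_trans (ler_norm r))// ltW.
Qed.

Lemma bsupp_box M (w : R * R -> R) : bsupp M w -> exists2 N : nat, M <= N%:R & forall z, w z = w z * boxind N%:R z.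
Proof.
move=> [_ _ w0]; have [N MN] := nat_above M; exists N => // z.
rewrite boxindE; case: ifP => zN; first by rewrite mulr1.
by rewrite w0 ?mul0r//; apply: contraFN zN; exact: inboxS.
Qed.

Lemma boxind_meas3 M : measurable_fun setT (fun p : R * (R * R) => boxind M p.2).
Proof. by apply: (measurableT_comp (boxind_meas M)); exact: measurable_snd. Qed.

Lemma win_ge0 a b p : 0 <= win a b p :> R. Proof. by rewrite /win win1E; case: ifP. Qed.

Lemma win_sub (s t T : R) (w : R * (R * R) -> R) : 0 <= s -> t <= T ->
  intg leb3 (fun p => win 0 T p * w p) -> intg leb3 (fun p => win s t p * w p).
Proof.
move=> s0 tT iw; apply: (@intg_le _ _ _ leb3 _ _ _ iw).
  have -> : (fun p => win s t p * w p) = fun p => win s t p * (win 0 T p * w p).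
    by apply/funext => p; rewrite mulrA; congr (_ * _); rewrite mulrC; exact: win1_out p.1 s0 tT.
  by apply: measurable_funM; [exact: win_meas|exact: intg_meas iw].
move=> p; rewrite /win (win1_out p.1 s0 tT) !normrM ler_wpM2r// ler_piMr//.
exact: win1_le1.
Qed.

Lemma bsupp_le_box M (w : R * R -> R) e : bsupp M w -> (forall z, `|w z| <= e) ->
  forall z, `|w z| <= e * boxind M z.
Proof.
move=> [_ _ w0] we z; rewrite boxindE; case: ifP => zM; first by rewrite mulr1.
by rewrite w0 ?zM// normr0 mulr0.
Qed.

Lemma ip_box M (a w : R * R -> R) e : sq leb2 a -> bsupp M w -> (forall z, `|w z| <= e) ->
  `|ip leb2 a w| <= e * ip leb2 (fun z => `|a z|) (boxind M).
Proof.
move=> sa bw we; have sw := bsupp_sq bw; have sb := bsupp_sq (boxind_bsupp M).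
have sa' : sq leb2 (fun z => `|a z|).
  apply: (@sq_le _ _ _ leb2 _ a) => //; last by move=> z; rewrite normr_id.
  by apply: measurableT_comp => //; case: sa.
apply: (le_trans (Int_norm (intgM sa sw))); rewrite -IntZ; last exact: intgM.
apply: (@Int_le _ _ _ leb2).
- exact: intg_norm (intgM sa sw).
- exact: intgZ (intgM sa' sb).
by move=> z; rewrite normrM mulrCA ler_wpM2l//; exact: bsupp_le_box.
Qed.

Lemma win_ac T e (h : R * (R * R) -> R) : intg leb3 (fun p => win 0 T p * h p) -> (forall p, 0 <= h p) ->
  0 < e -> exists2 dl, 0 < dl & forall s t, 0 <= s -> s <= t -> t <= T -> t - s <= dl ->
  Int leb3 (fun p => win s t p * h p) <= e.
Proof.
move=> iT h0 e0; have [ih _] := win_fubini iT.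
have [d [d0 H]] := integral_normr_continuous ih e0.
exists (d / 2) => [|s t s0 st tT std]; first by rewrite divr_gt0.
have mA : measurable (`[s, t[ : set (measurableTypeR R)) by exact: measurable_itv.
have leA : (leb1 (`[s, t[)%classic < d%:E)%E.
  suff : (lebesgue_measure `[s, t[%classic < d%:E)%E by [].
  rewrite lebesgue_measure_itv/= lte_fin; case: ifP => _; rewrite lte_fin; last by [].
  by apply: (le_lt_trans std); rewrite ltr_pdivrMr// mulr_natr mulr2n ltrDl.
apply: ltW; apply: le_lt_trans (H _ mA leA); rewrite le_eqVlt; apply/orP; left; apply/eqP.
have [_ ->] := win_fubini (win_sub s0 tT iT).
rewrite Rintegral_mkcond; apply: eq_Int => r.
rewrite patchE mem_setE in_itv/= win1E; case: ifP => [sr|_]; last by rewrite mul0r.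
have h1 : 0 <= Int leb2 (fun z => h (r, z)) by apply: Int_ge0 => z; exact: h0.
case/andP: sr => sr rt.
by rewrite win1E (le_trans s0 sr) (lt_le_trans rt tT)/= !mul1r ger0_norm.
Qed.

End Windows.

(** * The right-hand side as a functional of the test function *)

Section FluxForm.
Context (R : realType).
Variables g0 g1 g2 : R * (R * R) -> R.

(** The equation for a fixed [v] says that the pairing of [u t] with [v] has the integral of this
    expression over the strip as its time derivative, in integrated form. *)
Definition flux_form (v : R * R -> R) (p : R * (R * R)) :=
  g0 p * v p.2 + g1 p * dx v p.2 + g2 p * dy v p.2.

(** Dominates [flux_form v] for every [v] supported in the box [M] that is bounded by 1 together
    with its gradient. *)
Definition Gabs (M : R) (p : R * (R * R)) := boxind M p.2 * (`|g0 p| + `|g1 p| + `|g2 p|).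

Lemma flux_lin n c f p : (forall i, Cc_infty Omega (f i)) ->
  flux_form (lin n c f) p = \sum_(i < n) c i * flux_form (f i) p.
Proof.
move=> fD; have [e1 e2] := dx_lin n c fD; rewrite /flux_form e1 e2 /lin !mulr_sumr -!big_split /=.
by apply: eq_bigr => i _; ring.
Qed.

Hypothesis g_intg : forall M T, [/\ intg leb3 (fun p => win 0 T p * (g0 p * boxind M p.2)),
  intg leb3 (fun p => win 0 T p * (g1 p * boxind M p.2)) &
  intg leb3 (fun p => win 0 T p * (g2 p * boxind M p.2))].

Lemma Gabs_intg M T : intg leb3 (fun p => win 0 T p * Gabs M p).
Proof.
have [i0 i1 i2] := g_intg M T.
have := intgD (intgD (intg_norm i0) (intg_norm i1)) (intg_norm i2).
congr intg; apply/funext => p.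
have nm k : `|win 0 T p * (k * boxind M p.2)| = win 0 T p * (`|k| * boxind M p.2).
  by rewrite !normrM /win win1E boxindE; do 2!case: ifP; rewrite ?normr1 ?normr0.
by rewrite !nm /Gabs; move: `|g0 p| `|g1 p| `|g2 p| => *; ring.
Qed.

Lemma Gabs_ge0 M p : 0 <= Gabs M p.
Proof. by rewrite /Gabs mulr_ge0 ?addr_ge0// boxindE; case: ifP. Qed.

Definition Gm M s t := Int leb3 (fun p => win s t p * Gabs M p).

Lemma Gm_ge0 M s t : 0 <= Gm M s t.
Proof. by apply: Int_ge0 => p; rewrite mulr_ge0 ?win_ge0 ?Gabs_ge0. Qed.

Lemma GmD M (a b c : R) : 0 <= a -> a <= b -> b <= c -> Gm M a c = Gm M a b + Gm M b c.
Proof.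
move=> a0 ab bc; have i := Gabs_intg M c.
rewrite -IntD; [|exact: (win_sub a0 bc i)|exact: (win_sub (le_trans a0 ab) (lexx c) i)].
by apply: eq_Int => p; rewrite /win (win1D p.1 ab bc) mulrDl.
Qed.

Lemma flux_small M (s t e : R) (h k0 k1 k2 : R * (R * R) -> R) : 0 <= s -> 0 <= e ->
  intg leb3 (fun p => win s t p * h p) ->
  (forall p, s <= p.1 < t -> h p = g0 p * k0 p + g1 p * k1 p + g2 p * k2 p) ->
  (forall p, s <= p.1 < t -> [/\ `|k0 p| <= e * boxind M p.2, `|k1 p| <= e * boxind M p.2 & `|k2 p| <= e * boxind M p.2]) ->
  `|Int leb3 (fun p => win s t p * h p)| <= e * Gm M s t.
Proof.
move=> s0 e0 ih hE hk; apply: (le_trans (Int_norm ih)).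
have iG := win_sub s0 (lexx t) (Gabs_intg M t).
rewrite /Gm -IntZ//; apply: (@Int_le _ _ _ leb3); [exact: intg_norm|exact: intgZ|move=> p].
rewrite normrM ger0_norm ?win_ge0// mulrCA; rewrite /win win1E; case: ifP => [st|_]; last by rewrite !mul0r.
rewrite !mul1r hE//; have [q0 q1 q2] := hk p st.
apply: (le_trans (ler_normD _ _)); apply: (@le_trans _ _
   (`|g0 p| * (e * boxind M p.2) + `|g1 p| * (e * boxind M p.2) + `|g2 p| * (e * boxind M p.2))).
  apply: lerD; last by rewrite normrM ler_wpM2l.
  by apply: (le_trans (ler_normD _ _)); apply: lerD; rewrite normrM ler_wpM2l.
by rewrite /Gabs le_eqVlt; apply/orP; left; apply/eqP; ring.
Qed.

Lemma Gm_ac M T e : 0 < e -> exists2 dl, 0 < dl & forall s t, 0 <= s -> s <= t -> t <= T ->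
  t - s <= dl -> Gm M s t <= e.
Proof. by move=> e0; apply: win_ac e0; [exact: Gabs_intg|move=> p; exact: Gabs_ge0]. Qed.

End FluxForm.

(** * The limit equation *)

Lemma ip_subC d (X : measurableType d) (R : realType) (m : {measure set X -> \bar R}) (a b : X -> R) :
  ip m (fun x => a x - b x) (fun x => a x - b x) = ip m (fun x => b x - a x) (fun x => b x - a x).
Proof. by apply: eq_Int => x; ring. Qed.

Lemma ipDr d (X : measurableType d) (R : realType) (m : {measure set X -> \bar R}) (h a b : X -> R) :
  sq m h -> sq m a -> sq m b -> ip m h (fun x => a x + b x) = ip m h a + ip m h b.
Proof. by move=> sh sa sb; rewrite ipC ipDl// ![ip m _ h]ipC. Qed.

Lemma small_term (R : realType) (h : nat -> R) (M : R) : (forall k, 0 <= h k) ->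
  (forall n, \sum_(i < n) h i <= M) -> forall e : R, 0 < e -> forall K : nat,
  exists2 k, (K <= k)%N & h k <= e.
Proof.
move=> h0 hM e e0 K; apply: contrapT => /forall2NP H.
have big k : (K <= k)%N -> e < h k.
  by move=> Kk; have [//|/negP] := H k; rewrite ltNge.
pose n := (Num.trunc (M / e)).+1.
have M0 : 0 <= M by have := hM 0%N; rewrite big_ord0.
have /andP[_ Mn] := trunc_in (divr_ge0 M0 (ltW e0)).
have := hM (K + n)%N; apply/negP; rewrite -ltNge.
rewrite -(big_mkord xpredT h) (big_cat_nat (leq0n K) (leq_addr n K))/=.
rewrite ltr_wpDl//; first by apply: sumr_ge0.
apply: (@lt_le_trans _ _ (e * n%:R)); first by rewrite mulrC -ltr_pdivrMr.
have -> : e * n%:R = \sum_(i < n) e by rewrite sumr_const card_ord mulr_natr.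
rewrite -{1}[K]add0n big_addn addKn big_mkord.
by apply: ler_sum => i _; apply: ltW; apply: big; exact: leq_addl.
Qed.

Lemma sqr_le_small_eq0 (R : realType) (a C : R) : 0 <= C -> (forall e, 0 < e -> a ^+ 2 <= C * e) -> a = 0.
Proof.
move=> C0 H; apply/eqP; rewrite -sqrf_eq0 eq_le sqr_ge0 andbT.
by apply: (@geometric_le0 _ C) => j; apply: H; rewrite exprn_gt0.
Qed.

Lemma norm_limit d (X : measurableType d) (R : realType) (m : {measure set X -> \bar R})
    (a : X -> R) (B : R) : sq m a -> (forall e, 0 < e -> exists b, [/\ sq m b, ip m b b <= B &
      ip m (fun x => a x - b x) (fun x => a x - b x) <= e]) -> ip m a a <= B.
Proof.
move=> sa H; have B0 : 0 <= B.
  by have [b [_ h _]] := H 1 ltr01; apply: le_trans h; exact: ip_ge0.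
(* Expanding around [b] and weighting the cross term with [d'] costs [d' * B], plus [d'] for the
   weighted and [d'] for the plain squared distance. *)
apply/ler_addgt0Pr => e e0; pose d' := Num.min 1 (e / (B + 2)).
have B2 : 0 < B + 2 by rewrite ltr_wpDl.
have d0 : 0 < d' by rewrite lt_min ltr01 divr_gt0.
have d1 : d' <= 1 by rewrite ge_min lexx.
have de : d' * (B + 2) <= e by rewrite -ler_pdivlMr// ge_min lexx orbT.
have [b [sb hb hab]] := H _ (exprn_gt0 2 d0).
pose q := ip m (fun x => a x - b x) (fun x => a x - b x).
have := ip_le_half d0 sb (sqB sa sb); rewrite -/q; set s := ip m b _ => hs; rewrite -/q in hab.
have -> : ip m a a = ip m b b + 2 * s + q.
  have := ipDD sb (sqB sa sb); rewrite -/s -/q => <-.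
  by apply: eq_Int => x; ring.
have hq : d'^-1 * q <= d' by rewrite mulrC ler_pdivrMr// -expr2.
have hd : d' * ip m b b <= d' * B by rewrite ler_wpM2l// ltW.
have h1 : s <= `|s| by exact: ler_norm.
have hq2 : q <= d'.
  by apply: (le_trans hab); rewrite expr2 ler_piMl// ltW.
move: hs hq hb hd hq2 de h1; rewrite mulrDr; set z := d'^-1 * q; set z1 := d' * ip m b b; set z2 := d' * B.
lra.
Qed.

Lemma le3_split (R : realType) (a b c e : R) : 0 <= a -> 0 <= b -> 0 <= c ->
  a + b + c <= e -> [/\ a <= e, b <= e & c <= e].
Proof. by move=> a0 b0 c0 h; split; lra. Qed.

Section Limit.
Context (R : realType).
Variable f : nat -> R * R -> R.
Hypotheses (fD : forall i, Cc_infty Omega (f i))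
  (f_orth : forall i j, i != j -> ip leb2 (f i) (f j) = 0)
  (f_norm : forall i, (ip leb2 (f i) (f i) = 1) \/ (f i = fun=> 0))
  (f_dense : forall v : R * R -> R, Cc_infty Omega v -> exists M, C1c M v (dx v) (dy v) /\
     forall eps, 0 < eps -> exists n c, C1c M (lin n c f) (dx (lin n c f)) (dy (lin n c f)) /\
     forall z, [/\ `|v z - lin n c f z| <= eps, `|dx v z - dx (lin n c f) z| <= eps &
                   `|dy v z - dy (lin n c f) z| <= eps]).
Variables (FF : set_system nat) (UF : UltraFilter FF).
Variables (U : nat -> R -> R * R -> R) (y : R -> nat -> R).
Hypotheses (Ulin : forall n t, exists c, U n t = lin n c f)
  (Ui : forall n a b G, intg leb1 (fun t => win1 a b t * G (U n t)))
  (Usq : forall n a b, [/\ sq leb3 (fun p => win a b p * U n p.1 p.2),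
     sq leb3 (fun p => win a b p * dx (U n p.1) p.2) &
     sq leb3 (fun p => win a b p * dy (U n p.1) p.2)])
  (Ub : forall T, 0 <= T -> exists2 A, 0 <= A & forall n,
     (forall t, 0 <= t <= T -> E0 (U n t) <= A) /\
     Int leb1 (fun t => win1 0 T t * (E0 (U n t) + E1 (U n t))) <= A)
  (Uy : forall i T (e : R), 0 < e -> FF [set n | forall t, 0 <= t <= T ->
       `|ip leb2 (U n t) (f i) - y t i| <= e]).
Variable u : R -> R * R -> R.
Hypotheses (u_meas : measurable_fun setT (fun p : R * (R * R) => u p.1 p.2))
  (u_sq : forall t, sq leb2 (u t)) (u_f : forall t i, 0 <= t -> ip leb2 (u t) (f i) = y t i)
  (u_span : forall t e, 0 <= t -> 0 < e -> exists N, let d z := u t z - lin N (y t) f z in ip leb2 d d <= e).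
Variables (ub ux uy : R * (R * R) -> R).
Hypotheses (uxy_meas : [/\ measurable_fun setT ub, measurable_fun setT ux & measurable_fun setT uy])
  (uxy_sq : forall T, [/\ sq leb3 (fun p => win 0 T p * ub p), sq leb3 (fun p => win 0 T p * ux p) &
      sq leb3 (fun p => win 0 T p * uy p)])
  (uxy_out : forall p, ~ Omega p.2 -> [/\ ub p = 0, ux p = 0 & uy p = 0])
  (ub_hull : forall (T : R) (B : set nat) (e : R), FF B -> 0 < e -> exists2 x, hull (@mid R) (U @` B) x &
      let d0 p := win 0 T p * (x p.1 p.2 - ub p) in
      let d1 p := win 0 T p * (dx (x p.1) p.2 - ux p) in
      let d2 p := win 0 T p * (dy (x p.1) p.2 - uy p) in
      ip leb3 d0 d0 + ip leb3 d1 d1 + ip leb3 d2 d2 <= e).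

Implicit Types x : R -> R * R -> R.

Lemma UD n t : Cc_infty Omega (U n t).
Proof. by have [c ->] := Ulin n t; exact: lin_Cc. Qed.

Lemma f_sq' i : sq leb2 (f i). Proof. by have [] := Cc_sq (fD i). Qed.

(** What the approximations have in common with all their iterated midpoints. The last clause places
    the values in the closed span of the family, so that a difference with vanishing coefficients
    can be shown to be zero. *)
Definition nice x := [/\ forall t, Cc_infty Omega (x t),
  forall a b, [/\ sq leb3 (fun p => win a b p * x p.1 p.2),
     sq leb3 (fun p => win a b p * dx (x p.1) p.2) &
     sq leb3 (fun p => win a b p * dy (x p.1) p.2)] &
  forall t g, sq leb2 g -> (forall i, ip leb2 (f i) g = 0) -> ip leb2 (x t) g = 0].

Lemma ip_mid (v w : R -> R * R -> R) (g : R * R -> R) t : sq leb2 (v t) -> sq leb2 (w t) -> sq leb2 g ->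
  ip leb2 (mid v w t) g = 2^-1 * ip leb2 (v t) g + 2^-1 * ip leb2 (w t) g.
Proof.
move=> sv sw sg; rewrite /mid ipDl//; [|exact: sqZ..].
by rewrite !ipZl.
Qed.

Lemma nice_U n : nice (U n).
Proof.
split; [exact: UD|by move=> a b; exact: Usq|move=> t g sg fg].
have [c ->] := Ulin n t; rewrite /lin (@ip_suml _ _ _ leb2 n (fun i z => c i * f i z))//.
  by rewrite big1// => i _; rewrite ipZl ?fg ?mulr0//; exact: f_sq'.
by move=> i _; apply: sqZ; exact: f_sq'.
Qed.

Lemma nice_mid v w : nice v -> nice w -> nice (mid v w).
Proof.
move=> [vD vs vo] [wD ws wo]; split.
- by move=> t; have [] := dxy_mid (0, 0) (vD t) (wD t).
- move=> a b; have [v0 v1 v2] := vs a b; have [w0 w1 w2] := ws a b; split.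
  + have := sqD (sqZ 2^-1 v0) (sqZ 2^-1 w0); congr sq; apply/funext => p.
    by rewrite /mid; ring.
  + have := sqD (sqZ 2^-1 v1) (sqZ 2^-1 w1); congr sq; apply/funext => p.
    by have [_ [-> _]] := dxy_mid p.2 (vD p.1) (wD p.1); ring.
  + have := sqD (sqZ 2^-1 v2) (sqZ 2^-1 w2); congr sq; apply/funext => p.
    by have [_ [_ ->]] := dxy_mid p.2 (vD p.1) (wD p.1); ring.
- move=> t g sg fg; have [sv _ _] := Cc_sq (vD t); have [sw _ _] := Cc_sq (wD t).
  by rewrite ip_mid// vo// wo// !mulr0 addr0.
Qed.

Lemma nice_hull B x : hull (@mid R) (U @` B) x -> nice x.
Proof. by apply: hull_sub; [move=> _ [n _ <-]; exact: nice_U|exact: nice_mid]. Qed.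

Lemma hull_ip B x t (g : R * R -> R) (l e : R) : sq leb2 g -> hull (@mid R) (U @` B) x ->
  (forall n, B n -> `|ip leb2 (U n t) g - l| <= e) -> `|ip leb2 (x t) g - l| <= e.
Proof.
move=> sg xh H; suff [] : nice x /\ `|ip leb2 (x t) g - l| <= e by [].
move: x xh; apply: (@hull_sub _ _ _ (fun x => nice x /\ `|ip leb2 (x t) g - l| <= e)).
  by move=> _ [n Bn <-]; split; [exact: nice_U|exact: H].
move=> v w [nv hv] [nw hw]; split; first exact: nice_mid.
have [vD _ _] := nv; have [wD _ _] := nw.
have [sv _ _] := Cc_sq (vD t); have [sw _ _] := Cc_sq (wD t).
rewrite ip_mid//; move: hv hw; rewrite !ler_norml => /andP[? ?] /andP[? ?].
by apply/andP; split; lra.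
Qed.

Lemma Uy_fin k (T e : R) : 0 < e -> FF [set n | forall i, (i < k)%N -> forall t, 0 <= t <= T ->
  `|ip leb2 (U n t) (f i) - y t i| <= e].
Proof.
have PF : ProperFilter FF by exact: ultra_proper.
move=> e0; elim: k => [|k IH]; first by apply: (filterS _ (@filterT _ FF _)) => n _ i.
apply: filterS (filterI IH (Uy k T e0)) => n /= [h1 h2] i.
by rewrite ltnS leq_eqVlt => /predU1P[->//|]; exact: h1.
Qed.

Lemma slice_sq (w : R * (R * R) -> R) : (forall T, sq leb3 (fun p => win 0 T p * w p)) ->
  {ae leb1, forall t, 0 <= t -> sq leb2 (fun z => w (t, z))}.
Proof.
move=> sw; have := ae_countable (fun N : nat => sq_slice (sw N%:R)).
apply: ae_imp => t H t0; have := H (Num.trunc t).+1; congr sq; apply/funext => z /=.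
by have /andP[_ h] := trunc_in t0; rewrite /win win1E t0 h mul1r.
Qed.

(** Links two limits: [u], known at every time through its coefficients, and [ub], a norm limit in
    space-time that comes with a gradient. Summable errors in space-time give convergence on almost
    every time slice along suitable indices. There [ub - u] has zero coefficients and lies in the
    closed span, so it vanishes, and the same slices approximate [u t] by test functions in H^1. *)
Lemma ae_limit : {ae leb1, forall t, 0 <= t ->
  [/\ sq leb2 (fun z => ub (t, z)), sq leb2 (fun z => ux (t, z)), sq leb2 (fun z => uy (t, z)),
     (let d z := ub (t, z) - u t z in ip leb2 d d = 0) &
     forall e, 0 < e -> exists2 v, Cc_infty Omega v &
       let d0 z := v z - u t z in let d1 z := dx v z - ux (t, z) in
       let d2 z := dy v z - uy (t, z) in
       [/\ ip leb2 d0 d0 <= e, ip leb2 d1 d1 <= e & ip leb2 d2 d2 <= e]]}.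
Proof.
have e_gt0 k : (0 : R) < 4^-1 ^+ k by rewrite exprn_gt0.
have h_gt0 k : (0 : R) < 2^-1 ^+ k by rewrite exprn_gt0.
(* The hull elements must have prescribed coefficients as well as be close to [ub]. Coefficient
   errors [2^-1 ^+ k] have squares matching the rate [4^-1 ^+ k] in norm. *)
pose B k := [set n | forall i, (i < k)%N -> forall t, 0 <= t <= k%:R ->
  `|ip leb2 (U n t) (f i) - y t i| <= 2^-1 ^+ k].
have ex k : exists x, hull (@mid R) (U @` B k) x /\
      let d0 p := win 0 k%:R p * (x p.1 p.2 - ub p) in
      let d1 p := win 0 k%:R p * (dx (x p.1) p.2 - ux p) in
      let d2 p := win 0 k%:R p * (dy (x p.1) p.2 - uy p) in
      ip leb3 d0 d0 + ip leb3 d1 d1 + ip leb3 d2 d2 <= 4^-1 ^+ k.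
  have [x hx dx'] := ub_hull k%:R (Uy_fin k k%:R (h_gt0 k)) (e_gt0 k).
  by exists x.
have /choice[x Hx] := ex.
have nx k : nice (x k) by exact: nice_hull (Hx k).1.
pose h0 k t := ip leb2 (fun z => x k t z - ub (t, z)) (fun z => x k t z - ub (t, z)).
pose h1 k t := ip leb2 (fun z => dx (x k t) z - ux (t, z)) (fun z => dx (x k t) z - ux (t, z)).
pose h2 k t := ip leb2 (fun z => dy (x k t) z - uy (t, z)) (fun z => dy (x k t) z - uy (t, z)).
pose h k t := win1 0 k%:R t * h0 k t + win1 0 k%:R t * h1 k t + win1 0 k%:R t * h2 k t.
have sd k : [/\ sq leb3 (fun p => win 0 k%:R p * (x k p.1 p.2 - ub p)),
    sq leb3 (fun p => win 0 k%:R p * (dx (x k p.1) p.2 - ux p)) &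
    sq leb3 (fun p => win 0 k%:R p * (dy (x k p.1) p.2 - uy p))].
  have [_ /(_ 0 k%:R)[a0 a1 a2] _] := nx k; have [b0 b1 b2] := uxy_sq k%:R.
  split.
  + by have := sqB a0 b0; congr sq; apply/funext => p; rewrite mulrBr.
  + by have := sqB a1 b1; congr sq; apply/funext => p; rewrite mulrBr.
  + by have := sqB a2 b2; congr sq; apply/funext => p; rewrite mulrBr.
have wint (w : R * (R * R) -> R) k : sq leb3 (fun p => win 0 k%:R p * w p) ->
    intg leb1 (fun t => win1 0 k%:R t * ip leb2 (fun z => w (t, z)) (fun z => w (t, z))).
  move=> sw; have := intg_fubini (intgM sw sw); congr intg; apply/funext => t.
  rewrite /win /= win1E; case: ifP => _; last first.
    by rewrite mul0r -[RHS](Int0 leb2); apply: eq_Int => z; rewrite !mul0r.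
  by rewrite mul1r; apply: eq_Int => z; rewrite !mul1r.
have hi k : intg leb1 (h k).
  have [s0 s1 s2] := sd k.
  by apply: intgD; [apply: intgD|]; [exact: (wint _ _ s0)|exact: (wint _ _ s1)|exact: (wint _ _ s2)].
have w0 k t : (0 : R) <= win1 0 k%:R t by rewrite win1E; case: ifP.
have hge k t : 0 <= h k t by rewrite !addr_ge0 ?mulr_ge0 ?ip_ge0.
have hle k : Int leb1 (h k) <= 2^-1 ^+ k.
  have [s0 s1 s2] := sd k; have [i0 i1 i2] := And3 (wint _ _ s0) (wint _ _ s1) (wint _ _ s2).
  have -> : Int leb1 (h k) = Int leb1 (fun t => win1 0 k%:R t * h0 k t)
      + Int leb1 (fun t => win1 0 k%:R t * h1 k t) + Int leb1 (fun t => win1 0 k%:R t * h2 k t).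
    by rewrite -(@IntD _ _ _ leb1 _ _ i0 i1) -(@IntD _ _ _ leb1 _ _ (intgD i0 i1) i2).
  have := (Hx k).2 => /=; rewrite (win_ip s0) (win_ip s1) (win_ip s2).
  move=> /le_trans; apply; apply: lerXn2r; rewrite ?nnegrE ?invr_ge0// lef_pV2 ?posrE// ler_nat//.
have := ae_series_bounded hi hge hle (sum_half_le R).
have aeu := slice_sq (fun T => let: And3 s _ _ := uxy_sq T in s).
have aex := slice_sq (fun T => let: And3 _ s _ := uxy_sq T in s).
have aey := slice_sq (fun T => let: And3 _ _ s := uxy_sq T in s).
move=> /(ae_and (ae_and aeu (ae_and aex aey))); apply: ae_imp => t [[au [ax ay]] [M HM]] t0.
have {au} au := au t0; have {ax} ax := ax t0; have {ay} ay := ay t0.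
(* The series of the [h k t] is bounded at this time, so arbitrarily late terms are as small as
   desired. *)
have small e K : 0 < e -> exists2 k, (K <= k)%N & [/\ t < k%:R, h0 k t <= e, h1 k t <= e & h2 k t <= e].
  move=> e0; have [k Kk hk] := small_term (fun k => hge k t) HM e0 (maxn K (Num.trunc t).+1).
  move: Kk; rewrite geq_max => /andP[Kk tk]; exists k => //.
  have tk' : t < k%:R.
    by have /andP[_ /lt_le_trans] := trunc_in t0; apply; rewrite ler_nat.
  move: hk; rewrite /h win1E t0 tk' !mul1r => hk.
  by have [? ? ?] := le3_split (ip_ge0 _ _) (ip_ge0 _ _) (ip_ge0 _ _) hk.
have sx k : sq leb2 (x k t) by have [xD _ _] := nx k; have [] := Cc_sq (xD t).
pose g z := ub (t, z) - u t z.
have sg : sq leb2 g by exact: sqB.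
have fg i : ip leb2 (f i) g = 0.
  rewrite ipC /g ipBl ?u_f//; last exact: f_sq'.
  apply: (@sqr_le_small_eq0 _ _ (4 * (1 + E0 (f i)))); first by rewrite mulr_ge0 ?addr_ge0 ?ip_ge0.
  move=> e e0; have [j je] := geometric_small e0.
  have [k kK [tk k0 _ _]] := small e (maxn i.+1 j) e0.
  rewrite -(subrKA (ip leb2 (x k t) (f i))) -mulrA; apply: sqrD_le4.
    rewrite -ipBl//; last exact: f_sq'.
    apply: (le_trans (cauchy_schwarz (sqB au (sx k)) (f_sq' i))).
    rewrite mulrC; apply: ler_pM; rewrite ?ip_ge0 ?lerDr//.
    rewrite (_ : ip _ _ _ = h0 k t)//; apply: eq_Int => z; ring.
  have : `|ip leb2 (x k t) (f i) - y t i| <= 2^-1 ^+ k.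
    apply: hull_ip (Hx k).1 _; first exact: f_sq'.
    move=> n; apply; last by rewrite t0 ltW.
    by apply: leq_trans kK; rewrite leq_max ltnSn.
  have p0 : (0 : R) <= 2^-1 ^+ k by rewrite exprn_ge0// invr_ge0.
  move=> hk; rewrite -real_normK ?num_real//; apply: (@le_trans _ _ ((2^-1 ^+ k) ^+ 2)).
    by rewrite lerXn2r ?nnegrE.
  rewrite -exprM mulnC exprM; apply: (@le_trans _ _ e).
    apply: le_trans je; rewrite expr2 -invfM -natrM.
    apply: ler_wiXn2l; rewrite ?invr_ge0 ?invf_le1 ?ler1n//.
    by apply: leq_trans kK; rewrite leq_maxr.
  by rewrite ler_peMl ?(ltW e0)// lerDl ip_ge0.
have g0 : ip leb2 g g = 0.
  apply: (@sqr_le_small_eq0 _ _ (4 * ip leb2 g g)); first by rewrite mulr_ge0 ?ip_ge0.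
  move=> e e0; have [k _ [_ k0 _ _]] := small e 0%N e0; have [N Nc] := u_span t0 e0; set c := y t in Nc.
  have sl : sq leb2 (lin N c f) by have [] := Cc_sq (lin_Cc N c fD).
  have lg : ip leb2 (lin N c f) g = 0.
    rewrite /lin (@ip_suml _ _ _ leb2 N (fun i z => c i * f i z))//.
      by rewrite big1// => i _; rewrite ipZl ?fg ?mulr0//; exact: f_sq'.
    by move=> i _; apply: sqZ; exact: f_sq'.
  have xg : ip leb2 (x k t) g = 0 by have [_ _ H] := nx k; exact: H.
  (* [x k t] and the partial sum are both orthogonal to [g], so they can be inserted freely, and
     both differences have small norm. *)
  have E : ip leb2 g g = ip leb2 (fun z => ub (t, z) - x k t z) g +
      ip leb2 (fun z => lin N c f z - u t z) g.
    have e1 : ip leb2 (fun z => ub (t, z) - x k t z) g = ip leb2 (fun z => ub (t, z)) g.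
      by rewrite (ipBl au (sx k) sg) xg subr0.
    have e2 : ip leb2 (fun z => lin N c f z - u t z) g = - ip leb2 (u t) g.
      by rewrite (ipBl sl (u_sq t) sg) lg sub0r.
    by rewrite e1 e2; exact: (ipBl au (u_sq t) sg).
  rewrite [X in X ^+ 2]E -mulrA; apply: sqrD_le4.
    by apply: (@cs_small _ _ _ leb2 _ _ _ (sqB au (sx k)) sg); rewrite ip_subC.
  by apply: (@cs_small _ _ _ leb2 _ _ _ (sqB sl (u_sq t)) sg); rewrite ip_subC.
split => //.
move=> e e0; have e40 : 0 < e / 2 by rewrite divr_gt0.
have [k _ [_ k0 k1 k2]] := small (e / 2) 0%N e40.
have [xD _ _] := nx k; exists (x k t) => //; split.
- have := ipD_le2 (sqB (sx k) au) sg; rewrite g0 mulr0 addr0.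
  rewrite (_ : ip leb2 (fun z => x k t z - ub (t, z) + g z) _ =
    ip leb2 (fun z => x k t z - u t z) (fun z => x k t z - u t z)).
    move=> /le_trans; apply; rewrite -/(h0 k t); move: k0; lra.
  by apply: eq_Int => z; rewrite /g; ring.
- by apply: (le_trans k1); lra.
- by apply: (le_trans k2); lra.
Qed.

Let u3 (p : R * (R * R)) := u p.1 p.2.

Lemma u_ub T : sq leb3 (fun p => win 0 T p * (ub p - u3 p)) /\
  ip leb3 (fun p => win 0 T p * (ub p - u3 p)) (fun p => win 0 T p * (ub p - u3 p)) <= 0.
Proof.
have [mub _ _] := uxy_meas.
have [] := @sq_fubini_le _ _ _ _ R leb1 leb2 (fun p => win 0 T p * (ub p - u3 p)) (fun=> 0).
- by apply: measurable_funM; [exact: win_meas|exact: measurable_funB].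
- exact: sq0.
- apply: ae_imp ae_limit => t H; rewrite /win /= win1E; case: ifP => [/andP[t0 _]|_].
    have [au _ _ d0 _] := H t0.
    have E : (fun z => 1 * (ub (t, z) - u3 (t, z))) = (fun z => ub (t, z) - u t z).
      by apply/funext => z; rewrite mul1r.
    by rewrite E; split; [exact: sqB|rewrite d0; exact: ip_ge0].
  have E : (fun z => 0 * (ub (t, z) - u3 (t, z))) = fun=> 0.
    by apply/funext => z; rewrite mul0r.
  by rewrite E; split; [exact: sq0|].
move=> s h; split => //; apply: (le_trans h).
by rewrite (_ : ip _ _ _ = 0)// -[RHS](Int0 leb3); apply: eq_Int => p; rewrite mulr0.
Qed.

Lemma u_win T : sq leb3 (fun p => win 0 T p * u3 p).
Proof.
have [s _ _] := uxy_sq T; have := sqB s (u_ub T).1; congr sq; apply/funext => p; ring.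
Qed.

Lemma u_hull T B e : FF B -> 0 < e -> exists2 x, hull (@mid R) (U @` B) x &
  [/\ ip leb3 (fun p => win 0 T p * (x p.1 p.2 - u3 p)) (fun p => win 0 T p * (x p.1 p.2 - u3 p)) <= e,
      ip leb3 (fun p => win 0 T p * (dx (x p.1) p.2 - ux p)) (fun p => win 0 T p * (dx (x p.1) p.2 - ux p)) <= e &
      ip leb3 (fun p => win 0 T p * (dy (x p.1) p.2 - uy p)) (fun p => win 0 T p * (dy (x p.1) p.2 - uy p)) <= e].
Proof.
move=> FB e0; have e2 : 0 < e / 2 by rewrite divr_gt0.
have [x xh] := ub_hull T FB e2; move=> /= /(le3_split (ip_ge0 _ _) (ip_ge0 _ _) (ip_ge0 _ _))[h0 h1 h2].
have ee : e / 2 <= e by rewrite ler_pdivrMr// ler_peMr ?ler1n// ltW.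
exists x => //; split; [|exact: le_trans ee|exact: le_trans ee].
have [xD xs _] := nice_hull xh; have [x0 _ _] := xs 0 T; have [b0 _ _] := uxy_sq T.
have s0 : sq leb3 (fun p => win 0 T p * (x p.1 p.2 - ub p)).
  by have := sqB x0 b0; congr sq; apply/funext => p; rewrite mulrBr.
have [s1 z1] := u_ub T; have := ipD_le2 s0 s1.
set a := ip leb3 _ _; have -> : a = ip leb3 (fun p => win 0 T p * (x p.1 p.2 - u3 p))
    (fun p => win 0 T p * (x p.1 p.2 - u3 p)) by apply: eq_Int => p; ring.
move: (ip leb3 _ _) h0 z1 => l; move: (ip leb3 _ _) => l'; move: (ip leb3 _ _) => l''.
by move=> h0 z1; lra.
Qed.

Lemma hull_le B (N : (R -> R * R -> R) -> R) (C : R) x :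
  (forall n, B n -> N (U n) <= C) ->
  (forall v w, nice v -> nice w -> N (mid v w) <= 2^-1 * N v + 2^-1 * N w) ->
  hull (@mid R) (U @` B) x -> N x <= C.
Proof.
move=> NU Nm xh; suff [] : nice x /\ N x <= C by [].
move: x xh; apply: (@hull_sub _ _ _ (fun x => nice x /\ N x <= C)).
  by move=> _ [n Bn <-]; split; [exact: nice_U|exact: NU].
move=> v w [nv hv] [nw hw]; split; first exact: nice_mid.
by apply: (le_trans (Nm v w nv nw)); lra.
Qed.

(** * Weak convergence of linear quantities *)

Section LinearFunctional.
Variables (c : (R -> R * R -> R) -> R * (R * R) -> R) (G psi : R * (R * R) -> R) (T : R).
Hypotheses (c_mid : forall v w p, nice v -> nice w -> c (mid v w) p = 2^-1 * c v p + 2^-1 * c w p)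
  (c_sq : forall x, nice x -> sq leb3 (fun p => win 0 T p * c x p))
  (G_sq : sq leb3 (fun p => win 0 T p * G p)) (psi_sq : sq leb3 (fun p => win 0 T p * psi p))
  (c_hull : forall B e, FF B -> 0 < e -> exists2 x, hull (@mid R) (U @` B) x &
     ip leb3 (fun p => win 0 T p * (c x p - G p)) (fun p => win 0 T p * (c x p - G p)) <= e)
  (c_bound : exists A, forall n, ip leb3 (fun p => win 0 T p * c (U n) p) (fun p => win 0 T p * c (U n) p) <= A).

(** The bounded scalar sequence has a limit [l] along the ultrafilter. Being close to [l] is stable
    under midpoints, because the pairing is linear, so it holds for some element of the hull close
    to [G] in norm; this forces [l] to be the pairing of [G]. The function [c] stands for [u], a
    derivative of it, or T u_x. *)
Lemma weak_lim e : 0 < e -> FF [set n |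
  `|Int leb3 (fun p => win 0 T p * (G p * psi p)) - Int leb3 (fun p => win 0 T p * (c (U n) p * psi p))| <= e].
Proof.
have PF : ProperFilter FF by exact: ultra_proper.
pose L (g : R * (R * R) -> R) := Int leb3 (fun p => win 0 T p * (g p * psi p)).
have LE g : L g = ip leb3 (fun p => win 0 T p * g p) (fun p => win 0 T p * psi p).
  by apply: eq_Int => p; rewrite mulrACA /win win1_sqr.
pose P := ip leb3 (fun p => win 0 T p * psi p) (fun p => win 0 T p * psi p).
have P0 : 0 <= P by exact: ip_ge0.
have [A HA] := c_bound.
have A0 : 0 <= A by apply: le_trans (HA 0%N); exact: ip_ge0.
have [l Hl] : exists l : R, L (c (U n)) @[n --> FF] --> l.
  apply: (@ultra_lim R FF UF _ (P * A + 1)).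
  apply: (filterS _ (@filterT _ FF _)) => n _ /=.
  have PA : 0 <= P * A by rewrite mulr_ge0.
  apply: norm_le_sqr; first by rewrite addr_ge0.
  have := @cs_small _ _ _ leb3 _ _ A (c_sq (nice_U n)) psi_sq (HA n); rewrite -LE -/P => h.
  by apply: (le_trans h); have := sqr_ge0 (P * A); move: PA; set z := P * A; lra.
have lG : l = L G.
  apply/eqP; rewrite -subr_eq0; apply/eqP.
  apply: (@sqr_le_small_eq0 _ _ (4 * (1 + P))); first by rewrite mulr_ge0 ?addr_ge0.
  move=> d d0; pose d' := Num.min 1 d.
  have d'0 : 0 < d' by rewrite lt_min ltr01.
  have d'd : d' ^+ 2 <= d.
    apply: (@le_trans _ _ d'); last by rewrite ge_min lexx orbT.
    by rewrite expr2 ler_piMl ?(ltW d'0)// ge_min lexx.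
  have [x xh hx] := c_hull (ultra_near UF Hl d'0) d0.
  have nx := nice_hull xh.
  have Lx : `|l - L (c x)| <= d'.
    suff [] : nice x /\ `|l - L (c x)| <= d' by [].
    move: x xh {hx nx}; apply: (@hull_sub _ _ _ (fun x => nice x /\ `|l - L (c x)| <= d')).
      by move=> _ [n Bn <-]; split; [exact: nice_U|exact: Bn].
    move=> v w [nv hv] [nw hw]; split; first exact: nice_mid.
    have -> : L (c (mid v w)) = 2^-1 * L (c v) + 2^-1 * L (c w).
      have iL z : nice z -> intg leb3 (fun p => win 0 T p * (c z p * psi p)).
        move=> /c_sq sz; have := intgM sz psi_sq; congr intg; apply/funext => p.
        by rewrite mulrACA /win win1_sqr.
      rewrite /L -!IntZ; [|exact: iL..].
      rewrite -IntD; [|exact: intgZ (iL _ nv)|exact: intgZ (iL _ nw)].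
      by apply: eq_Int => p; rewrite c_mid//; ring.
    move: hv hw; rewrite !ler_norml => /andP[? ?] /andP[? ?].
    by apply/andP; split; lra.
  have s : sq leb3 (fun p => win 0 T p * (c x p - G p)).
    by have := sqB (c_sq nx) G_sq; congr sq; apply/funext => p; rewrite mulrBr.
  have Ld : L (c x) - L G = ip leb3 (fun p => win 0 T p * (c x p - G p)) (fun p => win 0 T p * psi p).
    rewrite !LE -ipBl//; last exact: c_sq.
    by apply: eq_Int => p; rewrite mulrBr.
  rewrite -(subrKA (L (c x))) -mulrA; apply: sqrD_le4.
    rewrite -real_normK ?num_real//; apply: (@le_trans _ _ (d' ^+ 2)).
      by rewrite lerXn2r ?nnegrE// ltW.
    by apply: (le_trans d'd); rewrite ler_peMl ?(ltW d0)// lerDl.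
  rewrite Ld; apply: (le_trans (@cs_small _ _ _ leb3 _ _ d s psi_sq hx)).
  by apply: ler_wpM2r; [exact: ltW|rewrite -/P lerDr].
by move=> e0; rewrite -/(L G) -lG; exact: ultra_near Hl e0.
Qed.

End LinearFunctional.

Let Tx (p : R * (R * R)) := TO3 ux p.

Lemma TO3_win (w : R * (R * R) -> R) a b p :
  win a b p * TO3 w p = TO3 (fun q => win a b q * w q) p.
Proof.
rewrite /TO3 /win win1E; case: ifP => _.
  by rewrite mul1r; congr TO; apply/funext => z; rewrite mul1r.
rewrite [LHS]mul0r -[LHS](TO0 p.2); congr TO; apply/funext => z; by rewrite mul0r.
Qed.

Lemma Tx_sq T : sq leb3 (fun p => win 0 T p * Tx p).
Proof.
have [_ s _] := uxy_sq T.
have -> : (fun p => win 0 T p * Tx p) = TO3 (fun q => win 0 T q * ux q).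
  by apply/funext => p; exact: TO3_win.
by have [] := TO3_sq s.
Qed.

Let dTO x (p : R * (R * R)) := TO (dx (x p.1)) p.2.

Lemma dTO_sq x a b : sq leb3 (fun p => win a b p * dx (x p.1) p.2) ->
  sq leb3 (fun p => win a b p * dTO x p) /\
  ip leb3 (fun p => win a b p * dTO x p) (fun p => win a b p * dTO x p) <=
  ip leb3 (fun p => win a b p * dx (x p.1) p.2) (fun p => win a b p * dx (x p.1) p.2).
Proof.
move=> s; have -> : (fun p => win a b p * dTO x p) = TO3 (fun q => win a b q * dx (x q.1) q.2).
  by apply/funext => p; rewrite -TO3_win.
exact: TO3_sq.
Qed.

Lemma dTO_mid v w p : nice v -> nice w -> dTO (mid v w) p = 2^-1 * dTO v p + 2^-1 * dTO w p.
Proof.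
move=> [vD _ _] [wD _ _]; have [M vC] := Cc_dxy (vD p.1); have [N wC] := Cc_dxy (wD p.1).
have [lM lN] : M <= Num.max M N /\ N <= Num.max M N by rewrite !le_max !lexx orbT.
have [_ bv _] := C1c_bsupp (C1c_le lM vC); have [_ bw _] := C1c_bsupp (C1c_le lN wC).
rewrite /dTO -(TO_lin _ _ _ bv bw); congr TO; apply/funext => z.
by have [_ [-> _]] := dxy_mid z (vD p.1) (wD p.1).
Qed.

Lemma U_bound T : 0 <= T -> exists2 A, 0 <= A & forall n,
  [/\ ip leb3 (fun p => win 0 T p * U n p.1 p.2) (fun p => win 0 T p * U n p.1 p.2) <= A,
      ip leb3 (fun p => win 0 T p * dx (U n p.1) p.2) (fun p => win 0 T p * dx (U n p.1) p.2) <= A &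
      ip leb3 (fun p => win 0 T p * dy (U n p.1) p.2) (fun p => win 0 T p * dy (U n p.1) p.2) <= A].
Proof.
move=> T0; have [A A0 HA] := Ub T0; exists A => // n; have [_ An] := HA n.
have [s0 s1 s2] := Usq n 0 T; have i1 := Ui n 0 T (fun g => E0 g + E1 g).
have H (g : (R * R -> R) -> R * R -> R) : sq leb3 (fun p => win 0 T p * g (U n p.1) p.2) ->
    (forall w, ip leb2 (g w) (g w) <= E0 w + E1 w) ->
    ip leb3 (fun p => win 0 T p * g (U n p.1) p.2) (fun p => win 0 T p * g (U n p.1) p.2) <= A.
  move=> sg Hg; apply: le_trans An; rewrite (win_ip sg); apply: (@Int_le _ _ _ leb1) => //.
    exact: (Ui n 0 T (fun w => ip leb2 (g w) (g w))).
  move=> t; rewrite win1E; case: ifP => _; last by rewrite !mul0r.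
  by rewrite !mul1r; exact: (Hg (U n t)).
have [q0 q1 q2] : [/\ forall w : R * R -> R, ip leb2 w w <= E0 w + E1 w,
    forall w : R * R -> R, ip leb2 (dx w) (dx w) <= E0 w + E1 w &
    forall w : R * R -> R, ip leb2 (dy w) (dy w) <= E0 w + E1 w].
  split=> w.
  - by rewrite lerDl; exact: E1_ge0.
  - by rewrite /E1 addrCA lerDl addr_ge0 ?ip_ge0.
  - by rewrite /E1 addrA lerDr addr_ge0 ?ip_ge0.
exact: (And3 (H id s0 q0) (H (@dx R) s1 q1) (H (@dy R) s2 q2)).
Qed.

Lemma lim_x T psi e : 0 <= T -> sq leb3 (fun p => win 0 T p * psi p) -> 0 < e -> FF [set n |
  `|Int leb3 (fun p => win 0 T p * (ux p * psi p))
    - Int leb3 (fun p => win 0 T p * (dx (U n p.1) p.2 * psi p))| <= e].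
Proof.
move=> T0 sp e0; have [A A0 HA] := U_bound T0.
apply: (@weak_lim (fun x p => dx (x p.1) p.2)) => //.
- move=> v w p [vD _ _] [wD _ _]; by have [_ [-> _]] := dxy_mid p.2 (vD p.1) (wD p.1).
- by move=> x [_ /(_ 0 T)[_ s _] _]; exact: s.
- by have [_ s _] := uxy_sq T; exact: s.
- move=> B d FB d0; have [x xh [_ h _]] := u_hull T FB d0; by exists x.
- by exists A => n; have [_ h _] := HA n; exact: h.
Qed.

Lemma lim_y T psi e : 0 <= T -> sq leb3 (fun p => win 0 T p * psi p) -> 0 < e -> FF [set n |
  `|Int leb3 (fun p => win 0 T p * (uy p * psi p))
    - Int leb3 (fun p => win 0 T p * (dy (U n p.1) p.2 * psi p))| <= e].
Proof.
move=> T0 sp e0; have [A A0 HA] := U_bound T0.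
apply: (@weak_lim (fun x p => dy (x p.1) p.2)) => //.
- move=> v w p [vD _ _] [wD _ _]; by have [_ [_ ->]] := dxy_mid p.2 (vD p.1) (wD p.1).
- by move=> x [_ /(_ 0 T)[_ _ s] _]; exact: s.
- by have [_ _ s] := uxy_sq T; exact: s.
- move=> B d FB d0; have [x xh [_ _ h]] := u_hull T FB d0; by exists x.
- by exists A => n; have [_ _ h] := HA n; exact: h.
Qed.

Lemma lim_T T psi e : 0 <= T -> sq leb3 (fun p => win 0 T p * psi p) -> 0 < e -> FF [set n |
  `|Int leb3 (fun p => win 0 T p * (Tx p * psi p))
    - Int leb3 (fun p => win 0 T p * (dTO (U n) p * psi p))| <= e].
Proof.
move=> T0 sp e0; have [A A0 HA] := U_bound T0.
apply: (@weak_lim dTO) => //.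
- exact: dTO_mid.
- by move=> x [_ /(_ 0 T)[_ s _] _]; have [] := dTO_sq s.
- exact: Tx_sq.
- move=> B d FB d0; have [x xh [_ h _]] := u_hull T FB d0; exists x => //; apply: le_trans h.
  have [_ /(_ 0 T)[_ s _] _] := nice_hull xh; have [_ sx _] := uxy_sq T.
  have [_] := TO3_diff s sx; congr (_ <= _).
    by congr ip; apply/funext => p; rewrite mulrBr /dTO -!TO3_win.
  by congr ip; apply/funext => p; rewrite mulrBr.
- by exists A => n; have [_ h _] := HA n; have [_ s _] := Usq n 0 T; exact: (le_trans (dTO_sq s).2 h).
Qed.

(** Bessel's inequality for [U n t] together with convergence of the first [N] coefficients: lower
    semicontinuity of the norm at a fixed time. *)
Lemma y_liminf N t e : 0 <= t -> 0 < e -> FF [set n | \sum_(i < N) y t i ^+ 2 <= E0 (U n t) + e].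
Proof.
have PF : ProperFilter FF by exact: ultra_proper.
move=> t0 e0; set S := \sum_(i < N) _; pose Q := \sum_(i < N) `|y t i|.
have Q0 : 0 <= Q by apply: sumr_ge0.
(* A limit coefficient [b] and its approximation [a] satisfy [b ^+ 2 <= a ^+ 2 + 2 * b * (b - a)],
   so the total error is at most [2 * Q] times this accuracy. *)
have d0 : 0 < e / (2 * Q + 1).
  by rewrite divr_gt0// ltr_wpDl// mulr_ge0.
apply: filterS (Uy_fin N t d0) => n /= Hn.
have b : \sum_(i < N) ip leb2 (U n t) (f i) ^+ 2 <= E0 (U n t).
  rewrite -[leRHS]mul1r; apply: (@bessel _ _ _ leb2) => //; [exact: f_sq'|by have [] := Cc_sq (UD n t)|].
  move=> i; case: (f_norm i) => [->//|->]; rewrite (_ : ip _ _ _ = 0)//.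
  by rewrite -[RHS](Int0 leb2); apply: eq_Int => z; rewrite mulr0.
have : S <= \sum_(i < N) (ip leb2 (U n t) (f i) ^+ 2 + 2 * (`|y t i| * (e / (2 * Q + 1)))).
  apply: ler_sum => i _; have := Hn i (ltn_ord i) t; rewrite t0 lexx => /(_ isT).
  set a := ip leb2 _ _; set b' := y t i; set d := e / _ => h.
  have h2 : b' * (b' - a) <= `|b'| * d.
    by apply: (le_trans (ler_norm _)); rewrite normrM ler_wpM2l// distrC.
  have := sqr_ge0 (a - b'); rewrite -/a; lra.
rewrite big_split /= -mulr_sumr -mulr_suml -/Q => /le_trans; apply; apply: lerD => //.
rewrite mulrA mulrCA ler_piMr ?(ltW e0)// ler_pdivrMr ?mul1r ?lerDl//.
by rewrite ltr_wpDl// mulr_ge0.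
Qed.

Lemma u_le_sum t A : 0 <= t -> (forall N, \sum_(i < N) y t i ^+ 2 <= A) -> ip leb2 (u t) (u t) <= A.
Proof.
move=> t0 HS; apply: norm_limit => // e e0; have [N HN] := u_span t0 e0.
exists (lin N (y t) f); split => //; first by have [] := Cc_sq (lin_Cc N (y t) fD).
have := E0_lin fD f_orth f_norm N (c := y t); rewrite /E0 => ->//.
by move=> i fi; rewrite -u_f// fi -[RHS](Int0 leb2); apply: eq_Int => z; rewrite mulr0.
Qed.

Lemma y_sum T : 0 <= T -> exists2 A, 0 <= A & forall t, 0 <= t <= T ->
  (forall N, \sum_(i < N) y t i ^+ 2 <= A) /\ ip leb2 (u t) (u t) <= A.
Proof.
have PF : ProperFilter FF by exact: ultra_proper.
move=> T0; have [A A0 HA] := Ub T0; exists A => // t tT; have /andP[t0 _] := tT.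
suff HS N : \sum_(i < N) y t i ^+ 2 <= A by split => //; exact: u_le_sum.
apply/ler_addgt0Pr => e e0; have [n /= h] := filter_ex (y_liminf N t0 e0).
have [/(_ t tT) h' _] := HA n; exact: le_trans h (lerD h' (lexx e)).
Qed.

(** * Strong convergence on bounded sets *)

Local Notation chi a dl s := (\1_(`[a, a + dl]%classic : set R) s : R).

Lemma chi_sum (a dl s : R) n : 0 < dl ->
  [/\ s < a + n%:R * dl -> \sum_(i < n) chi (a + i%:R * dl) dl s <= 2,
      s = a + n%:R * dl -> \sum_(i < n) chi (a + i%:R * dl) dl s <= 1 &
      a + n%:R * dl < s -> \sum_(i < n) chi (a + i%:R * dl) dl s = 0].
Proof.
move=> d0; elim: n => [|n [IH1 IH2 IH3]]; first by rewrite big_ord0; split => // _; exact: ler01.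
rewrite big_ord_recr /=; set S := \sum_(i < n) _ in IH1 IH2 IH3 *.
have /andP[c0 c1] := chi01 (a + n%:R * dl) dl s.
have E : a + n.+1%:R * dl = a + n%:R * dl + dl by rewrite -natr1; ring.
rewrite E; have cz : s < a + n%:R * dl \/ a + n%:R * dl + dl < s -> chi (a + n%:R * dl) dl s = 0.
  by rewrite indicE mem_setE in_itv /= => -[h|h]; [rewrite (ltNge s) in h|rewrite ltNge in h];
    rewrite (negbTE h) ?andbF.
split=> hs.
- have [h|h|h] := ltgtP s (a + n%:R * dl).
  + by rewrite cz; [rewrite addr0; exact: IH1|left].
  + by rewrite IH3// add0r (le_trans c1)// ler1n.
  + by rewrite -[2]/(1 + 1); apply: lerD => //; exact: IH2.
- by rewrite IH3 ?add0r// hs ltrDl.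
- by rewrite IH3 ?cz ?addr0//; [right|apply: lt_trans hs; rewrite ltrDl].
Qed.

Lemma chi_sum_le2 (a dl s : R) n : 0 < dl -> 0 <= \sum_(i < n) chi (a + i%:R * dl) dl s <= 2.
Proof.
move=> d0; apply/andP; split; first by apply: sumr_ge0 => i _; have /andP[] := chi01 (a + i%:R * dl) dl s.
have [h1 h2 h3] := chi_sum a s n d0.
have [/h1//|/h3->//|/h2 h] := ltgtP s (a + n%:R * dl).
by rewrite (le_trans h)// ler1n.
Qed.

Lemma chi2_meas (a b dl : R) : measurable_fun setT (chi2 a b dl).
Proof.
by apply: measurable_funM; apply: measurable_indic_comp.
Qed.

(** Summation of [poincare_square] over a grid of mesh [1 / N]. Vertically the cells fill the strip
    exactly, so their weights are test functions; a point lies in at most two cells in each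
    direction, hence the factor 4. *)
Lemma tile_poincare (M : nat) : exists2 C : R, 0 < C & forall N : nat, (0 < N)%N ->
  exists (I : nat) (W : nat -> nat -> R * R -> R),
  (forall i j, (j < N)%N -> Cc_infty Omega (W i j)) /\
  forall v, Cc_infty Omega v -> Int leb2 (fun z => boxind M%:R z * v z ^+ 2) <=
    2 * (\sum_(i < I) \sum_(j < N) ip leb2 v (W i j) ^+ 2) + C * N%:R^-1 ^+ 2 * E1 v.
Proof.
have [C C0 HC] := poincare_square R; exists (4 * C); first by rewrite mulr_gt0.
move=> N N0; pose dl : R := N%:R^-1; have NR : (0 : R) < N%:R by rewrite ltr0n.
have d0 : 0 < dl by rewrite invr_gt0.
have d1 : dl <= 1 by rewrite invf_le1// ler1n.
have Nd : N%:R * dl = 1 by rewrite mulfV// gt_eqF.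
(* One column more than the width requires, because the right end [M] belongs to the closed box. *)
pose I := (2 * M * N).+1; pose a i : R := - M%:R + i%:R * dl; pose b j : R := 0 + j%:R * dl.
exists I, (fun i j => omega (a i) (b j) dl); split.
  move=> i j jN; apply: omega_Cc => //; first by rewrite /b add0r mulr_ge0// ltW.
  have -> : b j + dl = j.+1%:R * dl by rewrite /b -natr1; ring.
  apply: (@le_trans _ _ (N%:R * dl)); last by rewrite Nd.
  by apply: ler_wpM2r; [exact: ltW|rewrite ler_nat].
move=> v vD; have [B vC] := Cc_dxy vD; have [bv bx bY] := C1c_bsupp vC.
pose q z := dx v z ^+ 2 + dy v z ^+ 2.
have iv2 : intg leb2 (fun z => v z ^+ 2) by exact: sq_intg (bsupp_sq bv).
have iq : intg leb2 q by apply: intgD; [exact: sq_intg (bsupp_sq bx)|exact: sq_intg (bsupp_sq bY)].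
have chi2_01 i j z : 0 <= chi2 (a i) (b j) dl z <= 1.
  have /andP[h1 h2] := chi01 (a i) dl z.1; have /andP[h3 h4] := chi01 (b j) dl z.2.
  by rewrite /chi2 mulr_ge0//= mulr_ile1.
have ichi i j (g : R * R -> R) : intg leb2 g -> intg leb2 (fun z => chi2 (a i) (b j) dl z * g z).
  move=> ig; apply: (@intg_le _ _ _ leb2 _ g) => //.
    by apply: measurable_funM; [exact: chi2_meas|exact: intg_meas ig].
  by move=> z; have /andP[h1 h2] := chi2_01 i j z; rewrite normrM ler_piMl// ger0_norm.
have isum (g : R * R -> R) : intg leb2 g ->
    intg leb2 (fun z => \sum_(i < I) \sum_(j < N) chi2 (a i) (b j) dl z * g z) /\
    Int leb2 (fun z => \sum_(i < I) \sum_(j < N) chi2 (a i) (b j) dl z * g z) =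
    \sum_(i < I) \sum_(j < N) Int leb2 (fun z => chi2 (a i) (b j) dl z * g z).
  move=> ig; have i1 i : intg leb2 (fun z => \sum_(j < N) chi2 (a i) (b j) dl z * g z).
    by apply: (@intg_sum _ _ _ leb2 N (fun j z => chi2 (a i) (b j) dl z * g z)) => j _; exact: ichi.
  split.
    by apply: (@intg_sum _ _ _ leb2 I (fun i z => \sum_(j < N) chi2 (a i) (b j) dl z * g z)).
  rewrite (@Int_sum _ _ _ leb2 I (fun i z => \sum_(j < N) chi2 (a i) (b j) dl z * g z))//.
  apply: eq_bigr => i _.
  by rewrite (@Int_sum _ _ _ leb2 N (fun j z => chi2 (a i) (b j) dl z * g z))// => j _; exact: ichi.
have prod z : \sum_(i < I) \sum_(j < N) chi2 (a i) (b j) dl z =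
    (\sum_(i < I) chi (a i) dl z.1) * (\sum_(j < N) chi (b j) dl z.2).
  by rewrite mulr_suml; apply: eq_bigr => i _; rewrite mulr_sumr.
have prodg z (g : R) : \sum_(i < I) \sum_(j < N) chi2 (a i) (b j) dl z * g =
    (\sum_(i < I) \sum_(j < N) chi2 (a i) (b j) dl z) * g.
  by rewrite mulr_suml; apply: eq_bigr => i _; rewrite mulr_suml.
apply: (@le_trans _ _ (\sum_(i < I) \sum_(j < N) Int leb2 (fun z => chi2 (a i) (b j) dl z * v z ^+ 2))).
  have [i1 <-] := isum _ iv2; apply: (@Int_le _ _ _ leb2) => //.
    apply: (@intg_le _ _ _ leb2 _ _ _ iv2).
      by apply: measurable_funM; [exact: boxind_meas|exact: intg_meas iv2].
    by move=> z; rewrite normrM ler_piMl// boxindE; case: ifP; rewrite ?normr1 ?normr0.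
  move=> z; rewrite prodg; apply: ler_wpM2r; first exact: sqr_ge0.
  have /andP[s1 _] := chi_sum_le2 (- M%:R) z.1 I d0; have /andP[s2 _] := chi_sum_le2 0 z.2 N d0.
  rewrite prod boxindE; case: ifP => [/andP[zM /andP[y0 y1]]|_]; last by rewrite mulr_ge0.
  have {}s1 : 1 <= \sum_(i < I) chi (a i) dl z.1.
    have x0 : 0 <= z.1 + M%:R by move: zM; rewrite ler_norml => /andP[]; lra.
    have /andP[k1 k2] := step_idxP d0 x0; set k := step_idx _ _ in k1 k2.
    have kI : (k < I)%N.
      rewrite ltnS -(ler_nat R) -(ler_pM2r d0) (le_trans k1)// natrM -mulrA Nd mulr1 natrM.
      by move: zM; rewrite ler_norml => /andP[]; lra.
    rewrite (bigD1 (Ordinal kI))//= chi1; last first.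
      by rewrite /a; move: k2; rewrite -natr1 mulrDl mul1r => k2; apply/andP; split; lra.
    by rewrite lerDl sumr_ge0// => j _; have /andP[] := chi01 (a j) dl z.1.
  have {}s2 : 1 <= \sum_(j < N) chi (b j) dl z.2.
    have /andP[k1 k2] := step_idxP d0 (ltW y0); set k := step_idx _ _ in k1 k2.
    have kI : (k < N)%N by rewrite -(ltr_nat R) -(ltr_pM2r d0) (le_lt_trans k1)// Nd.
    rewrite (bigD1 (Ordinal kI))//= chi1; last first.
      by rewrite /b; move: k2; rewrite -natr1 mulrDl mul1r => k2; apply/andP; split; lra.
    by rewrite lerDl sumr_ge0// => j _; have /andP[] := chi01 (b j) dl z.2.
  by rewrite -[1]mulr1; apply: ler_pM.
apply: (@le_trans _ _ (\sum_(i < I) \sum_(j < N) (2 * ip leb2 v (omega (a i) (b j) dl) ^+ 2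
   + C * dl ^+ 2 * Int leb2 (fun z => chi2 (a i) (b j) dl z * q z)))).
  apply: ler_sum => i _; apply: ler_sum => j _; apply: (le_trans (HC (a i) (b j) dl B v _ _ d0 vC)).
  rewrite lerD2r; apply: ler_wpM2r; first exact: sqr_ge0.
  by rewrite ler_piMr// exprn_ile1// ltW.
under eq_bigr => i _ do rewrite big_split /= -!mulr_sumr.
rewrite big_split /= -!mulr_sumr lerD2l.
have [i1 <-] := isum _ iq.
have -> : 4 * C * N%:R^-1 ^+ 2 * E1 v = C * dl ^+ 2 * (4 * E1 v) by rewrite -/dl; ring.
apply: ler_wpM2l; first by apply: mulr_ge0; [exact: ltW|exact: sqr_ge0].
have -> : E1 v = Int leb2 q.
  rewrite IntD; first by rewrite -!ipE.
    exact: sq_intg (bsupp_sq bx).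
  exact: sq_intg (bsupp_sq bY).
rewrite -IntZ//; apply: (@Int_le _ _ _ leb2) => //; first exact: intgZ.
move=> z; rewrite prodg prod; apply: ler_wpM2r; first by rewrite addr_ge0 ?sqr_ge0.
have /andP[s1 s2] := chi_sum_le2 (- M%:R) z.1 I d0; have /andP[s3 s4] := chi_sum_le2 0 z.2 N d0.
have -> : 4 = 2 * 2 :> R by rewrite -natrM.
by apply: ler_pM.
Qed.

Lemma bsupp_small M (v : R * R -> R) (e : R) : bsupp M v -> (forall z, `|v z| <= e) ->
  ip leb2 v v <= e ^+ 2 * ip leb2 (boxind M) (boxind M).
Proof.
move=> bv ve; have sb := bsupp_sq (boxind_bsupp M).
have -> : e ^+ 2 * ip leb2 (boxind M) (boxind M) = ip leb2 (fun z => e * boxind M z) (fun z => e * boxind M z).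
  by rewrite ipZr ?ipZl//; [rewrite expr2 mulrA|exact: sqZ].
apply: (@ip_le _ _ _ leb2); [exact: bsupp_sq bv|exact: sqZ|move=> z].
rewrite boxindE; case: ifP => zM.
  by rewrite mulr1 (le_trans (ve z))// ler_norm.
by have [_ _ ->] := bv; rewrite ?normr0// zM.
Qed.

Lemma dxy_sub (v w : R * R -> R) : Cc_infty Omega v -> Cc_infty Omega w ->
  [/\ Cc_infty Omega (fun z => v z - w z),
   dx (fun z => v z - w z) = (fun z => dx v z - dx w z) &
   dy (fun z => v z - w z) = (fun z => dy v z - dy w z)].
Proof.
move=> vD wD.
have E : (fun z => v z - w z) = (fun z => v z + (-1) * w z) by apply/funext => z; ring.
rewrite E; have [M [_ _ _ dv _]] := Cc_dxy vD; have [N [_ _ _ dw _]] := Cc_dxy wD.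
split; first by apply: Cc_inftyD => //; exact: Cc_inftyZ.
  apply/funext => z; have [vx _] := dv z; have [wx _] := dw z.
  have [_ H] := is_derive_add vx (is_derive_scale (-1) wx).
  by rewrite [LHS]H mulN1r.
apply/funext => z; have [_ vy] := dv z; have [_ wy] := dw z.
have [_ H] := is_derive_add vy (is_derive_scale (-1) wy).
by rewrite [LHS]H mulN1r.
Qed.

(** [v] is replaced by a combination of the family that is uniformly close and supported in the same
    box. The error is controlled by the bounds on [U n t] and [u t], and only finitely many
    coefficients remain. *)
Lemma weak_uniform v T e : 0 <= T -> Cc_infty Omega v -> 0 < e ->
  FF [set n | forall t, 0 <= t <= T -> `|ip leb2 (U n t) v - ip leb2 (u t) v| <= e].
Proof.
have PF : ProperFilter FF by exact: ultra_proper.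
move=> T0 vD e0; have [M [vC dense]] := f_dense vD.
have [A A0 HA] := y_sum T0; have [A' A'0 HA'] := Ub T0.
have sv : sq leb2 v by have [] := Cc_sq vD.
pose m := ip leb2 (boxind M) (boxind M).
have m0 : 0 <= m by exact: ip_ge0.
pose C := (2 * A + 2 * A') * m.
have C0 : 0 <= C by rewrite mulr_ge0 ?addr_ge0 ?mulr_ge0.
have e2 : 0 < e / 2 by rewrite divr_gt0.
pose eps := e / 2 / (1 + C).
have C1 : 0 < 1 + C by rewrite ltr_pwDl.
have eps0 : 0 < eps by rewrite divr_gt0.
have epsC : C * eps ^+ 2 <= (e / 2) ^+ 2.
  rewrite /eps expr_div_n mulrCA ler_piMr ?sqr_ge0// ler_pdivrMr ?exprn_gt0// mul1r.
  by have := sqr_ge0 C; rewrite sqrrD expr1n mul1r; lra.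
have [N [c [wC hw]]] := dense eps eps0; set w := lin N c f in wC hw.
have sw : sq leb2 w by have [] := Cc_sq (lin_Cc N c fD).
pose Q := \sum_(i < N) `|c i|.
have Q0 : 0 <= Q by apply: sumr_ge0.
have d0 : 0 < e / 2 / (Q + 1) by rewrite divr_gt0// ltr_wpDl.
apply: filterS (Uy_fin N T d0) => n /= Hn t tT; have /andP[t0 _] := tT.
have sU : sq leb2 (U n t) by have [] := Cc_sq (UD n t).
have -> : ip leb2 (U n t) v - ip leb2 (u t) v =
    ip leb2 (fun z => U n t z - u t z) (fun z => v z - w z) + ip leb2 (fun z => U n t z - u t z) w.
  rewrite -ipBl//; have <- := @ipDr _ _ _ leb2 (fun z => U n t z - u t z) _ _
    (sqB sU (u_sq t)) (sqB sv sw) sw.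
  by apply: eq_Int => z; ring.
have -> : e = e / 2 + e / 2 by field.
apply: (le_trans (ler_normD _ _)); apply: lerD.
  apply: norm_le_sqr; first exact: ltW.
  apply: le_trans epsC; apply: (le_trans (cauchy_schwarz (sqB sU (u_sq t)) (sqB sv sw))).
  rewrite /C -mulrA; apply: ler_pM; rewrite ?ip_ge0//.
    apply: (le_trans _ (_ : 2 * ip leb2 (u t) (u t) + 2 * ip leb2 (U n t) (U n t) <= _)).
      have := ipD_le2 (sqN (u_sq t)) sU.
      set l := ip leb2 _ _; have -> : l = ip leb2 (fun z => U n t z - u t z) (fun z => U n t z - u t z).
        by apply: eq_Int => z; ring.
      by move=> /le_trans; apply; rewrite lerD2r ler_wpM2l// le_eqVlt; apply/orP; left; apply/eqP/eq_Int => z; ring.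
    apply: lerD; apply: ler_wpM2l => //; first by have [] := HA t tT.
    by have [/(_ t tT)] := HA' n.
  rewrite mulrC; apply: bsupp_small; last by move=> z; have [] := hw z.
  have [bv _ _] := C1c_bsupp vC; have [bw _ _] := C1c_bsupp wC.
  apply: continuous_bsupp; last by move=> z zM; have [_ _ -> //] := bv; have [_ _ -> //] := bw; rewrite subrr.
  have [cv _ _ _ _] := vC; have [cw _ _ _ _] := wC.
  have -> : (fun z => v z - w z) = (fun z => v z + (-1) * w z) by apply/funext => z; ring.
  by apply: continuousD2 => //; apply: continuousM2 => //; exact: cst_continuous.
have E (g : R * R -> R) : sq leb2 g -> ip leb2 g w = \sum_(i < N) c i * ip leb2 g (f i).
  move=> sg; rewrite ipC /w /lin (@ip_suml _ _ _ leb2 N (fun i z => c i * f i z))//.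
    by apply: eq_bigr => i _; rewrite (ipZl _ (f_sq' i) sg) (ipC leb2 (f i) g).
  by move=> i _; apply: sqZ; exact: f_sq'.
rewrite E; last exact: sqB.
apply: (le_trans (ler_norm_sum _ _ _)).
apply: (@le_trans _ _ (\sum_(i < N) `|c i| * (e / 2 / (Q + 1)))).
  apply: ler_sum => i _; rewrite normrM; apply: ler_wpM2l => //.
  by rewrite ipBl// ?u_f//; [exact: Hn|exact: f_sq'].
have Q1 : 0 < Q + 1 by rewrite ltr_wpDl.
rewrite -mulr_suml -/Q mulrA ler_pdivrMr// mulrC; apply: ler_wpM2l; first exact: ltW.
by rewrite lerDl.
Qed.

Lemma slice_intg a b (w : R * (R * R) -> R) : sq leb3 (fun p => win a b p * w p) ->
  intg leb1 (fun t => win1 a b t * ip leb2 (fun z => w (t, z)) (fun z => w (t, z))).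
Proof.
move=> sw; have := intg_fubini (intgM sw sw); congr intg; apply/funext => t.
rewrite /win /= win1E; case: ifP => _; last first.
  by rewrite mul0r -[RHS](Int0 leb2); apply: eq_Int => z; rewrite !mul0r.
by rewrite mul1r; apply: eq_Int => z; rewrite !mul1r.
Qed.

Lemma ip_sub_le2 d (X : measurableType d) (m : {measure set X -> \bar R}) (a b : X -> R) :
  sq m a -> sq m b -> ip m (fun s => a s - b s) (fun s => a s - b s) <= 2 * ip m a a + 2 * ip m b b.
Proof.
move=> sa sb; have := ipD_le2 sa (sqN sb); rewrite [ip m (fun s => - b s) _](_ : _ = ip m b b)//.
by apply: eq_Int => s; rewrite mulrNN.
Qed.

Lemma mulr_E1 (k : R) (v : R * R -> R) : k * E1 v = k * ip leb2 (dx v) (dx v) + k * ip leb2 (dy v) (dy v).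
Proof. exact: mulrDr. Qed.

Lemma Int4 (a b c d : R -> R) : intg leb1 a -> intg leb1 b -> intg leb1 c -> intg leb1 d ->
  intg leb1 (fun t => (a t + b t) + (c t + d t)) /\
  Int leb1 (fun t => (a t + b t) + (c t + d t)) = (Int leb1 a + Int leb1 b) + (Int leb1 c + Int leb1 d).
Proof.
move=> ia ib ic id; split; first exact: (intgD (intgD ia ib) (intgD ic id)).
by rewrite (@IntD _ _ _ leb1 _ _ (intgD ia ib) (intgD ic id)) (@IntD _ _ _ leb1 _ _ ia ib) (@IntD _ _ _ leb1 _ _ ic id).
Qed.

Lemma comb_sub (k1 k2 a b c d : R) : k1 <= 2 * a + 2 * b -> k2 <= 2 * c + 2 * d ->
  k1 + k2 <= 2 * ((a + c) + (b + d)).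
Proof. by lra. Qed.

Lemma comb_eight (e k1 k2 k3 k4 : R) : k1 <= k3 + k4 -> k2 <= e / 8 -> k4 <= e / 8 -> k3 <= e / 8 ->
  0 < e -> 2 * k1 + 2 * k2 <= e.
Proof. by lra. Qed.

(** The comparison is with an element [x] of the hull instead of [u], since [U n t - x t] is a test
    function at every time and the Poincare inequality applies to it. Its gradient contributes
    [8 * A]: a factor 2 from the difference and four integrals bounded by [A]. *)
Lemma strong_lemma M T n x (dl C A c : R) (N I : nat) (W : nat -> nat -> R * R -> R) :
  0 <= T -> nice x -> 0 <= c -> 0 <= dl ->
  (forall v, Cc_infty Omega v -> Int leb2 (fun z => boxind M z * v z ^+ 2) <=
    2 * (\sum_(i < I) \sum_(j < N) ip leb2 v (W i j) ^+ 2) + c * E1 v) ->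
  (forall i j t, (i < I)%N -> (j < N)%N -> 0 <= t <= T ->
     ip leb2 (fun z => U n t z - x t z) (W i j) ^+ 2 <= dl) ->
  ip leb3 (fun p => win 0 T p * dx (x p.1) p.2) (fun p => win 0 T p * dx (x p.1) p.2) <= A ->
  ip leb3 (fun p => win 0 T p * dy (x p.1) p.2) (fun p => win 0 T p * dy (x p.1) p.2) <= A ->
  ip leb3 (fun p => win 0 T p * dx (U n p.1) p.2) (fun p => win 0 T p * dx (U n p.1) p.2) <= A ->
  ip leb3 (fun p => win 0 T p * dy (U n p.1) p.2) (fun p => win 0 T p * dy (U n p.1) p.2) <= A ->
  let d p := win 0 T p * (boxind M p.2 * (U n p.1 p.2 - x p.1 p.2)) in
  sq leb3 d /\ ip leb3 d d <= T * (2 * (I%:R * (N%:R * dl))) + c * (8 * A).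
Proof.
move=> T0 [xD /(_ 0 T)[x0 x1 x2] _] c_ge0 dl0 HP HW Ax Ay AUx AUy d.
have [U0 U1 U2] := Usq n 0 T.
have s01 : sq leb3 (fun p => win 0 T p * (U n p.1 p.2 - x p.1 p.2)).
  by have := sqB U0 x0; congr sq; apply/funext => p; rewrite mulrBr.
have mb : measurable_fun setT (fun p : R * (R * R) => boxind M p.2).
  by apply: (measurableT_comp (boxind_meas M)); exact: measurable_snd.
have sd : sq leb3 d.
  have := @sqM_bounded _ _ _ leb3 1 _ (fun p => boxind M p.2) mb s01.
  rewrite (_ : d = fun p => win 0 T p * (U n p.1 p.2 - x p.1 p.2) * boxind M p.2).
    by apply=> p; rewrite boxindE; case: ifP; rewrite ?normr1 ?normr0.
  by apply/funext => p; rewrite /d mulrAC mulrA.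
split => //; rewrite (win_ip sd).
pose q t := E1 (U n t) + E1 (x t).
have j1 : intg leb1 (fun t => win1 0 T t * ip leb2 (dx (U n t)) (dx (U n t))) := slice_intg U1.
have j2 : intg leb1 (fun t => win1 0 T t * ip leb2 (dy (U n t)) (dy (U n t))) := slice_intg U2.
have j3 : intg leb1 (fun t => win1 0 T t * ip leb2 (dx (x t)) (dx (x t))) := slice_intg x1.
have j4 : intg leb1 (fun t => win1 0 T t * ip leb2 (dy (x t)) (dy (x t))) := slice_intg x2.
have [j12 J12] := Int4 j1 j2 j3 j4.
have qE : (fun t => win1 0 T t * q t) = fun t =>
    (win1 0 T t * ip leb2 (dx (U n t)) (dx (U n t)) + win1 0 T t * ip leb2 (dy (U n t)) (dy (U n t))) +
    (win1 0 T t * ip leb2 (dx (x t)) (dx (x t)) + win1 0 T t * ip leb2 (dy (x t)) (dy (x t))).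
  apply/funext => t; rewrite /q.
  exact: (etrans (mulrDr _ _ _) (congr2 +%R (mulr_E1 _ (U n t)) (mulr_E1 _ (x t)))).
have iq : intg leb1 (fun t => win1 0 T t * q t) by rewrite qE; exact: j12.
have Iq : Int leb1 (fun t => win1 0 T t * q t) <= 4 * A.
  have -> : 4 * A = (A + A) + (A + A) by ring.
  rewrite qE J12.
  have h1 : Int leb1 (fun t => win1 0 T t * ip leb2 (dx (U n t)) (dx (U n t))) <= A :=
    eq_ind _ (fun k => k <= A) AUx _ (win_ip U1).
  have h2 : Int leb1 (fun t => win1 0 T t * ip leb2 (dy (U n t)) (dy (U n t))) <= A :=
    eq_ind _ (fun k => k <= A) AUy _ (win_ip U2).
  have h3 : Int leb1 (fun t => win1 0 T t * ip leb2 (dx (x t)) (dx (x t))) <= A :=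
    eq_ind _ (fun k => k <= A) Ax _ (win_ip x1).
  have h4 : Int leb1 (fun t => win1 0 T t * ip leb2 (dy (x t)) (dy (x t))) <= A :=
    eq_ind _ (fun k => k <= A) Ay _ (win_ip x2).
  exact: (lerD (lerD h1 h2) (lerD h3 h4)).
pose K0 := 2 * (I%:R * (N%:R * dl)).
have K00 : 0 <= K0 by rewrite !mulr_ge0.
apply: (@le_trans _ _ (Int leb1 (fun t => K0 * win1 0 T t + (2 * c) * (win1 0 T t * q t)))).
  apply: (@Int_le _ _ _ leb1).
  - exact: slice_intg sd.
  - by apply: intgD; [apply: intgZ; exact: intg_win1|exact: intgZ].
  move=> t; rewrite win1E; case: ifP => [/andP[t0 tT]|_]; last by rewrite !mul0r !mulr0 addr0.
  rewrite !mul1r mulr1.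
  have [vD vx vy] := dxy_sub (UD n t) (xD t).
  set v := (fun z => U n t z - x t z) in vD vx vy.
  have -> : ip leb2 (fun z => boxind M z * v z) (fun z => boxind M z * v z) = Int leb2 (fun z => boxind M z * v z ^+ 2).
    by apply: eq_Int => z; rewrite boxindE; case: ifP; rewrite ?mul0r// !mul1r expr2.
  apply: (le_trans (HP v vD)); apply: lerD.
    rewrite /K0; apply: ler_wpM2l => //.
    apply: (@le_trans _ _ (\sum_(i < I) \sum_(j < N) dl)).
      apply: ler_sum => i _; apply: ler_sum => j _; apply: HW => //.
      by rewrite t0 ltW.
    by rewrite !sumr_const !card_ord mulr_natl mulr_natl.
  have hq : E1 v <= 2 * q t.
    rewrite /q {1}/E1 vx vy.
    have [_ a1 a2] := Cc_sq (UD n t); have [_ b1 b2] := Cc_sq (xD t).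
    exact: (comb_sub (ip_sub_le2 a1 b1) (ip_sub_le2 a2 b2)).
  have -> : 2 * c * q t = c * (2 * q t) by ring.
  exact: (ler_wpM2l c_ge0 hq).
rewrite IntD; [|by apply: intgZ; exact: intg_win1|exact: intgZ].
rewrite !IntZ//; last exact: intg_win1.
rewrite Int_win1// subr0 mulrC -/K0 lerD2l.
have -> : c * (8 * A) = 2 * c * (4 * A) by ring.
by apply: ler_wpM2l => //; rewrite mulr_ge0.
Qed.

Lemma hull_grad_le B T A x : hull (@mid R) (U @` B) x ->
  (forall n, [/\ ip leb3 (fun p => win 0 T p * U n p.1 p.2) (fun p => win 0 T p * U n p.1 p.2) <= A,
      ip leb3 (fun p => win 0 T p * dx (U n p.1) p.2) (fun p => win 0 T p * dx (U n p.1) p.2) <= A &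
      ip leb3 (fun p => win 0 T p * dy (U n p.1) p.2) (fun p => win 0 T p * dy (U n p.1) p.2) <= A]) ->
  ip leb3 (fun p => win 0 T p * dx (x p.1) p.2) (fun p => win 0 T p * dx (x p.1) p.2) <= A /\
  ip leb3 (fun p => win 0 T p * dy (x p.1) p.2) (fun p => win 0 T p * dy (x p.1) p.2) <= A.
Proof.
move=> xh HA.
have H (a b c : R * (R * R) -> R) : sq leb3 a -> sq leb3 b -> (forall p, c p = 2^-1 * a p + 2^-1 * b p) ->
    ip leb3 c c <= 2^-1 * ip leb3 a a + 2^-1 * ip leb3 b b.
  move=> sa sb cE; have [_] := mid_sq sa sb; have -> : c = fun p => 2^-1 * a p + 2^-1 * b p by apply/funext.
  move=> /= E; have := ip_ge0 leb3 (fun p => a p - b p); rewrite -E.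
  by move: (ip leb3 a a) (ip leb3 b b) (ip leb3 _ _) => ? ? ?; lra.
split.
  apply: (hull_le (N := fun x => ip leb3 (fun p => win 0 T p * dx (x p.1) p.2) (fun p => win 0 T p * dx (x p.1) p.2)) _ _ xh).
    by move=> n _; have [_ h _] := HA n; exact: h.
  move=> v w [vD /(_ 0 T)[_ s _] _] [wD /(_ 0 T)[_ s' _] _]; apply: (H _ _ _ s s') => p.
  by have [_ [-> _]] := dxy_mid p.2 (vD p.1) (wD p.1); ring.
apply: (hull_le (N := fun x => ip leb3 (fun p => win 0 T p * dy (x p.1) p.2) (fun p => win 0 T p * dy (x p.1) p.2)) _ _ xh).
  by move=> n _; have [_ _ h] := HA n; exact: h.
move=> v w [vD /(_ 0 T)[_ _ s] _] [wD /(_ 0 T)[_ _ s'] _]; apply: (H _ _ _ s s') => p.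
by have [_ [_ ->]] := dxy_mid p.2 (vD p.1) (wD p.1); ring.
Qed.

Lemma weak_uniform_fin I J (W : nat -> nat -> R * R -> R) T e : 0 <= T -> 0 < e ->
  (forall i j, (j < J)%N -> Cc_infty Omega (W i j)) ->
  FF [set n | forall i j, (i < I)%N -> (j < J)%N -> forall t, 0 <= t <= T ->
    `|ip leb2 (U n t) (W i j) - ip leb2 (u t) (W i j)| <= e].
Proof.
have PF : ProperFilter FF by exact: ultra_proper.
move=> T0 e0 WD; elim: I => [|I IH]; first by apply: (filterS _ (@filterT _ FF _)) => n _ i.
suff H (J' : nat) : (J' <= J)%N -> FF [set n | forall j, (j < J')%N -> forall t, 0 <= t <= T ->
    `|ip leb2 (U n t) (W I j) - ip leb2 (u t) (W I j)| <= e].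
  apply: filterS (filterI IH (H J (leqnn J))) => n /= [h1 h2] i j.
  by rewrite ltnS leq_eqVlt => /predU1P[->|]; [exact: h2|exact: h1].
elim: J' => [|k IHk] kJ; first by apply: (filterS _ (@filterT _ FF _)) => n _ i.
apply: filterS (filterI (IHk (ltnW kJ)) (weak_uniform T0 (WD I k kJ) e0)) => n /= [h1 h2] j.
by rewrite ltnS leq_eqVlt => /predU1P[->//|]; exact: h1.
Qed.

(** The mesh is chosen so fine that the gradient term is small by the uniform bound. Finitely many
    weights are then left, whose pairings converge uniformly in time; [x] is taken in the hull of
    indices where this has happened, so its pairings are equally close to those of [u]. *)
Lemma strong_convergence (M : nat) T e : 0 <= T -> 0 < e -> FF [set n |
  let d p := win 0 T p * (boxind M%:R p.2 * (U n p.1 p.2 - u3 p)) in sq leb3 d /\ ip leb3 d d <= e].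
Proof.
move=> T0 e0; have [C C0 HC] := tile_poincare M; have [A A0 HA] := U_bound T0.
have PF : ProperFilter FF by exact: ultra_proper.
pose N := (Num.trunc (8 * (C * (8 * A)) / e)).+1.
have NP : (0 < N)%N by [].
have NR : (0 : R) < N%:R by rewrite ltr0n.
have [I [W [WD HW]]] := HC N NP.
have CA : 0 <= C * (8 * A) by rewrite !mulr_ge0// ltW.
have cN : C * N%:R^-1 ^+ 2 * (8 * A) <= e / 8.
  have /andP[_ h] := trunc_in (divr_ge0 (mulr_ge0 (ler0n R 8) CA) (ltW e0)).
  rewrite -/N in h; rewrite ltr_pdivrMr// in h.
  have -> : C * N%:R^-1 ^+ 2 * (8 * A) = (C * (8 * A)) * N%:R^-1 ^+ 2 by ring.
  rewrite exprVn ler_pdivrMr ?exprn_gt0//; apply: (@le_trans _ _ (e / 8 * N%:R)); first by lra.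
  apply: ler_wpM2l; first by rewrite divr_ge0// ltW.
  by rewrite expr2 ler_peMr ?ler1n// ltW.
pose S := T * (2 * (I%:R * (N%:R * 4))) + 1.
have S0 : 0 < S by rewrite ltr_wpDl// !mulr_ge0.
pose eta := Num.min 1 (e / 8 / S).
have eta0 : 0 < eta by rewrite lt_min ltr01 !divr_gt0.
have etaS : T * (2 * (I%:R * (N%:R * (4 * eta ^+ 2)))) <= e / 8.
  have -> : T * (2 * (I%:R * (N%:R * (4 * eta ^+ 2)))) = (S - 1) * eta ^+ 2 by rewrite /S; ring.
  apply: (@le_trans _ _ (S * eta)); last by rewrite mulrC -ler_pdivlMr// ge_min lexx orbT.
  apply: (@le_trans _ _ (S * eta ^+ 2)).
    by apply: ler_wpM2r; [exact: sqr_ge0|rewrite gerBl].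
  apply: ler_wpM2l; first exact: ltW.
  by rewrite expr2 ler_piMl ?(ltW eta0)// ge_min lexx.
pose B := [set n | forall i j, (i < I)%N -> (j < N)%N -> forall t, 0 <= t <= T ->
    `|ip leb2 (U n t) (W i j) - ip leb2 (u t) (W i j)| <= eta].
have FB : FF B := weak_uniform_fin I T0 eta0 WD.
have e8 : 0 < e / 8 by rewrite divr_gt0.
have [x xh [hx _ _]] := u_hull T FB e8; have nx := nice_hull xh.
have [gx gy] := hull_grad_le xh HA.
apply: filterS FB => n Bn d.
have [_ ux' uy'] := HA n.
have c0 : 0 <= C * N%:R^-1 ^+ 2 by rewrite mulr_ge0 ?sqr_ge0// ltW.
have dl0 : 0 <= 4 * eta ^+ 2 by rewrite mulr_ge0 ?sqr_ge0.
have HWx i j t : (i < I)%N -> (j < N)%N -> 0 <= t <= T ->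
    ip leb2 (fun z => U n t z - x t z) (W i j) ^+ 2 <= 4 * eta ^+ 2.
  move=> iI jN tT; have sW : sq leb2 (W i j) by have [] := Cc_sq (WD i j jN).
  have sU : sq leb2 (U n t) by have [] := Cc_sq (UD n t).
  have sx : sq leb2 (x t) by have [xD _ _] := nx; have [] := Cc_sq (xD t).
  rewrite ipBl// -(subrKA (ip leb2 (u t) (W i j))); apply: sqrD_le4.
    rewrite -real_normK ?num_real// lerXn2r ?nnegrE ?(ltW eta0)//.
    exact: Bn.
  rewrite -sqrrN opprB -real_normK ?num_real// lerXn2r ?nnegrE ?(ltW eta0)//.
  by apply: (hull_ip sW xh) => m Bm; exact: Bm.
have [sd1 hd1] := @strong_lemma M%:R T n x (4 * eta ^+ 2) C A _ N I W T0 nx c0 dl0 HW HWx gx gy ux' uy'.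
have [xD /(_ 0 T)[x0 _ _] _] := nx.
have mb : measurable_fun setT (fun p : R * (R * R) => boxind M%:R p.2).
  by apply: (measurableT_comp (boxind_meas M%:R)); exact: measurable_snd.
have sxu : sq leb3 (fun p => win 0 T p * (x p.1 p.2 - u3 p)).
  by have := sqB x0 (u_win T); congr sq; apply/funext => p; rewrite mulrBr.
pose d2 (p : R * (R * R)) := win 0 T p * (x p.1 p.2 - u3 p) * boxind M%:R p.2.
have b1 (p : R * (R * R)) : `|boxind M%:R p.2| <= 1 by rewrite boxindE; case: ifP; rewrite ?normr1 ?normr0.
have sd2 : sq leb3 d2 := @sqM_bounded _ _ _ leb3 1 _ (fun p => boxind M%:R p.2) mb sxu b1.
have hd2 : ip leb3 d2 d2 <= e / 8.
  apply: le_trans hx; apply: (@ip_le _ _ _ leb3) => // p.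
  by rewrite normrM ler_piMr.
have E : d = fun p => win 0 T p * (boxind M%:R p.2 * (U n p.1 p.2 - x p.1 p.2)) + d2 p.
  by apply/funext => p; rewrite /d /d2; ring.
rewrite E; split; first exact: sqD.
apply: (le_trans (ipD_le2 sd1 sd2)).
exact: (comb_eight hd1 hd2 cN etaS e0).
Qed.

(** * Limits of products *)

Section Products.
Variables (T M : R) (w : R * R -> R).
Hypotheses (T0 : 0 <= T) (bw : bsupp M w).

Lemma diff_small e : 0 < e -> FF [set n |
  let d p := win 0 T p * ((U n p.1 p.2 - u3 p) * w p.2) in sq leb3 d /\ ip leb3 d d <= e].
Proof.
have PF : ProperFilter FF by exact: ultra_proper.
move=> e0; have [_ [B Bw] _] := bw; have [N MN wN] := bsupp_box bw.
have B2 : 0 < B ^+ 2 + 1 by rewrite ltr_wpDl// sqr_ge0.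
have e1 : 0 < e / (B ^+ 2 + 1) by rewrite divr_gt0.
apply: filterS (strong_convergence N T0 e1) => n /= [s h]; have [mw _ _] := bw.
have mw2 : measurable_fun setT (fun p : R * (R * R) => w p.2).
  by apply: (measurableT_comp mw); exact: measurable_snd.
have E : (fun p => win 0 T p * ((U n p.1 p.2 - u3 p) * w p.2)) =
    fun p => win 0 T p * (boxind N%:R p.2 * (U n p.1 p.2 - u3 p)) * w p.2.
  by apply/funext => p; rewrite {1}wN; ring.
rewrite E; have s' := @sqM_bounded _ _ _ leb3 B _ (fun p => w p.2) mw2 s (fun p => Bw p.2).
split => //; apply: (@le_trans _ _ (B ^+ 2 * (e / (B ^+ 2 + 1)))).
  apply: (@le_trans _ _ (ip leb3 (fun p => B * (win 0 T p * (boxind N%:R p.2 * (U n p.1 p.2 - u3 p))))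
     (fun p => B * (win 0 T p * (boxind N%:R p.2 * (U n p.1 p.2 - u3 p)))))).
    apply: (@ip_le _ _ _ leb3) => //; first exact: sqZ.
    move=> p; move: (win 0 T p * _) => k; rewrite !normrM mulrC; apply: ler_wpM2r => //.
    exact: le_trans (Bw _) (ler_norm _).
  rewrite ipZr ?ipZl//; last exact: sqZ.
  by rewrite mulrA -expr2 ler_wpM2l ?sqr_ge0.
by rewrite mulrA ler_pdivrMr// mulrC ler_wpM2l ?(ltW e0)// lerDl.
Qed.

Lemma lim_U e : 0 < e -> FF [set n | `|Int leb3 (fun p => win 0 T p * (u3 p * w p.2))
  - Int leb3 (fun p => win 0 T p * (U n p.1 p.2 * w p.2))| <= e].
Proof.
have PF : ProperFilter FF by exact: ultra_proper.
move=> e0; have [N MN wN] := bsupp_box bw.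
have sN : sq leb3 (fun p => win 0 T p * boxind N%:R p.2) := win_bsupp1 0 T (boxind_bsupp N%:R).
pose m := ip leb3 (fun p => win 0 T p * boxind N%:R p.2) (fun p => win 0 T p * boxind N%:R p.2).
have m0 : 0 <= m by exact: ip_ge0.
have m1 : 0 < m + 1 by rewrite ltr_wpDl.
have e1 : 0 < e ^+ 2 / (m + 1) by rewrite divr_gt0// exprn_gt0.
apply: filterS (diff_small e1) => n /= [s h].
have [U0 _ _] := Usq n 0 T.
have iu := win_intgM (u_win T) (win_bsupp1 0 T bw); have iU := win_intgM U0 (win_bsupp1 0 T bw).
apply: norm_le_sqr; first exact: ltW.
rewrite -IntB// -sqrrN -IntN; last exact: intgB.
rewrite (_ : Int _ _ = ip leb3 (fun p => win 0 T p * ((U n p.1 p.2 - u3 p) * w p.2))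
   (fun p => win 0 T p * boxind N%:R p.2)).
  apply: (le_trans (@cs_small _ _ _ leb3 _ _ _ s sN h)); rewrite -/m.
  by rewrite mulrCA ler_piMr ?sqr_ge0// ler_pdivrMr// mul1r lerDl.
apply: eq_Int => p; rewrite mulrACA win1_sqr {1 2}wN; ring.
Qed.

(** Weak convergence of [c n] is used against the fixed function [u w]; strong convergence of
    [U n w] is used against the bounded sequence [c n]. *)
Lemma lim_prod (c : nat -> R * (R * R) -> R) (G : R * (R * R) -> R) (A : R) :
  (forall n, sq leb3 (fun p => win 0 T p * c n p)) ->
  (forall n, ip leb3 (fun p => win 0 T p * c n p) (fun p => win 0 T p * c n p) <= A) ->
  (forall psi e, sq leb3 (fun p => win 0 T p * psi p) -> 0 < e -> FF [set n |
     `|Int leb3 (fun p => win 0 T p * (G p * psi p)) - Int leb3 (fun p => win 0 T p * (c n p * psi p))| <= e]) ->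
  forall e, 0 < e -> FF [set n | `|Int leb3 (fun p => win 0 T p * (G p * (u3 p * w p.2)))
     - Int leb3 (fun p => win 0 T p * (c n p * (U n p.1 p.2 * w p.2)))| <= e].
Proof.
have PF : ProperFilter FF by exact: ultra_proper.
move=> sc cA cG e e0; have e2 : 0 < e / 2 by rewrite divr_gt0.
have suw : sq leb3 (fun p => win 0 T p * (u3 p * w p.2)) := win_bsupp (u_win T) bw.
have A0 : 0 <= A by apply: le_trans (cA 0%N); exact: ip_ge0.
have A1 : 0 < A + 1 by rewrite ltr_wpDl.
have e1 : 0 < (e / 2) ^+ 2 / (A + 1) by rewrite divr_gt0// exprn_gt0.
apply: filterS (filterI (cG _ _ suw e2) (diff_small e1)) => n /= [h1 [s h2]].
have [U0 _ _] := Usq n 0 T; have sUw := win_bsupp U0 bw.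
have i1 := win_intgM (sc n) suw; have i2 := win_intgM (sc n) sUw.
rewrite -(subrKA (Int leb3 (fun p => win 0 T p * (c n p * (u3 p * w p.2))))).
have -> : e = e / 2 + e / 2 by field.
apply: (le_trans (ler_normD _ _)); apply: lerD => //.
apply: norm_le_sqr; first exact: ltW.
rewrite -IntB// -sqrrN -IntN; last exact: intgB.
rewrite (_ : Int _ _ = ip leb3 (fun p => win 0 T p * c n p) (fun p => win 0 T p * ((U n p.1 p.2 - u3 p) * w p.2))).
  apply: (le_trans (cauchy_schwarz (sc n) s)).
  apply: (@le_trans _ _ (A * ((e / 2) ^+ 2 / (A + 1)))); first by apply: ler_pM; rewrite ?ip_ge0.
  by rewrite mulrCA ler_piMr ?sqr_ge0// ler_pdivrMr// mul1r lerDl.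
by apply: eq_Int => p; rewrite mulrACA win1_sqr; ring.
Qed.

End Products.

(** * The equation satisfied by the limit *)

Variables (mu alpha beta : R) (K : R * (R * R) -> R) (u0 : R * R -> R).
Hypotheses (sK : forall b, sq leb3 (fun p => win 0 b p * K p)) (su0 : sq leb2 u0)
  (Ueq : forall i t (e : R), 0 <= t -> 0 < e -> FF [set n |
       `|ip leb2 (U n t) (f i) - ip leb2 u0 (f i)
         - Int leb1 (fun r => win1 0 t r * F0 mu alpha beta (U n r) (f i)) - kap K 0 t (f i)| <= e]).

Lemma F0_Int n T v M : 0 <= T -> Cc_infty Omega v -> bsupp M v -> bsupp M (dx v) -> bsupp M (dy v) ->
  Int leb1 (fun r => win1 0 T r * F0 mu alpha beta (U n r) v) =
  - mu * (Int leb3 (fun p => win 0 T p * (dx (U n p.1) p.2 * dx v p.2))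
        + Int leb3 (fun p => win 0 T p * (dy (U n p.1) p.2 * dy v p.2)))
  - (2 * Int leb3 (fun p => win 0 T p * (dx (U n p.1) p.2 * (U n p.1 p.2 * v p.2)))
     + Int leb3 (fun p => win 0 T p * (dTO (U n) p * (U n p.1 p.2 * dy v p.2))))
  + alpha * Int leb3 (fun p => win 0 T p * (U n p.1 p.2 * v p.2))
  - beta * Int leb3 (fun p => win 0 T p * (dTO (U n) p * v p.2)).
Proof.
move=> T0 vD bv bx bY; have [U0 U1 U2] := Usq n 0 T; have [UT _] := dTO_sq U1.
have [i1 ->] := win_fubini (win_intgM U1 (win_bsupp1 0 T bx)).
have [i2 ->] := win_fubini (win_intgM U2 (win_bsupp1 0 T bY)).
have [i3 ->] := win_fubini (win_intgM U1 (win_bsupp U0 bv)).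
have [i4 ->] := win_fubini (win_intgM UT (win_bsupp U0 bY)).
have [i5 ->] := win_fubini (win_intgM U0 (win_bsupp1 0 T bv)).
have [i6 ->] := win_fubini (win_intgM UT (win_bsupp1 0 T bv)).
rewrite -(@IntD _ _ _ leb1 _ _ i1 i2) -(@IntZ _ _ _ leb1 _ _ (intgD i1 i2)).
rewrite -(@IntZ _ _ _ leb1 _ _ i3) -(@IntD _ _ _ leb1 _ _ (intgZ 2 i3) i4).
rewrite -(@IntB _ _ _ leb1 _ _ (intgZ (- mu) (intgD i1 i2)) (intgD (intgZ 2 i3) i4)).
rewrite -(@IntZ _ _ _ leb1 _ _ i5) -(@IntZ _ _ _ leb1 _ _ i6).
rewrite -(@IntD _ _ _ leb1 _ _ (intgB (intgZ (- mu) (intgD i1 i2)) (intgD (intgZ 2 i3) i4)) (intgZ alpha i5)).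
rewrite -(@IntB _ _ _ leb1 _ _ (intgD (intgB (intgZ (- mu) (intgD i1 i2)) (intgD (intgZ 2 i3) i4)) (intgZ alpha i5)) (intgZ beta i6)).
apply: eq_Int => r /=; rewrite /F0 /Btri /ip.
have [k1 k2] := Btri_intg (UD n r) vD.
have -> : Int leb2 (fun z => 2 * (U n r z * dx (U n r) z) * v z) =
    2 * Int leb2 (fun z => dx (U n r) z * (U n r z * v z)).
  rewrite -IntZ; first by apply: eq_Int => z; ring.
  by have := intgZ 2^-1 k1; congr intg; apply/funext => z; field.
have -> : Int leb2 (fun z => U n r z * TO (dx (U n r)) z * dy v z) =
    Int leb2 (fun z => dTO (U n) (r, z) * (U n r z * dy v z)).
  by apply: eq_Int => z; rewrite /dTO /=; ring.
rewrite /dTO /=.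
move: (Int leb2 _) (Int leb2 _) (Int leb2 _) => a1 a2 a3.
move: (Int leb2 _) (Int leb2 _) (Int leb2 _) => a4 a5 a6; ring.
Qed.

(** Coefficients of [v], [dx v] and [dy v] in the limit equation. The products are known to be
    integrable only, as products of two functions in L_2, so the equation is extended in [v] by
    density in the C^1 norm. *)
Definition g0 (p : R * (R * R)) := - 2 * (u3 p * ux p) + alpha * u3 p - beta * Tx p + K p.
Definition g1 (p : R * (R * R)) := - mu * ux p.
Definition g2 (p : R * (R * R)) := - mu * uy p - u3 p * Tx p.
Local Notation flux := (flux_form g0 g1 g2).

Lemma flux_Int T v M : Cc_infty Omega v -> bsupp M v -> bsupp M (dx v) -> bsupp M (dy v) ->
  intg leb3 (fun p => win 0 T p * flux v p) /\
  Int leb3 (fun p => win 0 T p * flux v p) =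
  - mu * (Int leb3 (fun p => win 0 T p * (ux p * dx v p.2))
        + Int leb3 (fun p => win 0 T p * (uy p * dy v p.2)))
  - (2 * Int leb3 (fun p => win 0 T p * (ux p * (u3 p * v p.2)))
     + Int leb3 (fun p => win 0 T p * (Tx p * (u3 p * dy v p.2))))
  + alpha * Int leb3 (fun p => win 0 T p * (u3 p * v p.2))
  - beta * Int leb3 (fun p => win 0 T p * (Tx p * v p.2)) + kap K 0 T v.
Proof.
move=> vD bv bx bY; have [_ U1 U2] := uxy_sq T; have U0 := u_win T; have UT := Tx_sq T.
have i1 := win_intgM U1 (win_bsupp1 0 T bx).
have i2 := win_intgM U2 (win_bsupp1 0 T bY).
have i3 := win_intgM U1 (win_bsupp U0 bv).
have i4 := win_intgM UT (win_bsupp U0 bY).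
have i5 := win_intgM U0 (win_bsupp1 0 T bv).
have i6 := win_intgM UT (win_bsupp1 0 T bv).
have i7 : intg leb3 (fun p => win 0 T p * K p * v p.2).
  by have := win_intgM (sK T) (win_bsupp1 0 T bv); congr intg; apply/funext => p; rewrite mulrA.
have j1 := intgZ (- mu) (intgD i1 i2); have j2 := intgD (intgZ 2 i3) i4; have j3 := intgB j1 j2.
have j4 := intgD j3 (intgZ alpha i5); have j5 := intgB j4 (intgZ beta i6); have j6 := intgD j5 i7.
have E : (fun p => win 0 T p * flux v p) = fun p =>
  - mu * (win 0 T p * (ux p * dx v p.2) + win 0 T p * (uy p * dy v p.2))
  - (2 * (win 0 T p * (ux p * (u3 p * v p.2))) + win 0 T p * (Tx p * (u3 p * dy v p.2)))
  + alpha * (win 0 T p * (u3 p * v p.2)) - beta * (win 0 T p * (Tx p * v p.2)) + win 0 T p * K p * v p.2.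
  apply/funext => p; rewrite /flux_form /g0 /g1 /g2.
  move: (win 0 T p) (ux p) (uy p) (u3 p) (Tx p) (K p) (v p.2) (dx v p.2) (dy v p.2) => *; ring.
rewrite E; split; first exact: j6.
rewrite (@IntD _ _ _ leb3 _ _ j5 i7) (@IntB _ _ _ leb3 _ _ j4 (intgZ beta i6)).
rewrite (@IntD _ _ _ leb3 _ _ j3 (intgZ alpha i5)) (@IntB _ _ _ leb3 _ _ j1 j2).
rewrite (@IntZ _ _ _ leb3 _ _ (intgD i1 i2)) (@IntD _ _ _ leb3 _ _ i1 i2) (@IntD _ _ _ leb3 _ _ (intgZ 2 i3) i4).
by rewrite (@IntZ _ _ _ leb3 _ _ i3) (@IntZ _ _ _ leb3 _ _ i5) (@IntZ _ _ _ leb3 _ _ i6).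
Qed.

Lemma comb_close (e a1 a2 a3 a4 a5 a6 b1 b2 b3 b4 b5 b6 m al be : R) : 0 <= e ->
  `|a1 - b1| <= e -> `|a2 - b2| <= e -> `|a3 - b3| <= e -> `|a4 - b4| <= e -> `|a5 - b5| <= e -> `|a6 - b6| <= e ->
  `|(- m * (a1 + a2) - (2 * a3 + a4) + al * a5 - be * a6)
    - (- m * (b1 + b2) - (2 * b3 + b4) + al * b5 - be * b6)| <= (2 * `|m| + 3 + `|al| + `|be|) * e.
Proof.
move=> e0 h1 h2 h3 h4 h5 h6.
have -> : (- m * (a1 + a2) - (2 * a3 + a4) + al * a5 - be * a6)
    - (- m * (b1 + b2) - (2 * b3 + b4) + al * b5 - be * b6) =
   - (m * (a1 - b1)) + - (m * (a2 - b2)) + - (2 * (a3 - b3)) + - (a4 - b4) + al * (a5 - b5) + - (be * (a6 - b6)) by ring.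
have -> : (2 * `|m| + 3 + `|al| + `|be|) * e = `|m| * e + `|m| * e + 2 * e + e + `|al| * e + `|be| * e by ring.
have nD (a b k l : R) : `|a| <= k -> `|b| <= l -> `|a + b| <= k + l.
  by move=> ha hb; apply: (le_trans (ler_normD _ _)); exact: lerD.
have nM (k a : R) : `|a| <= e -> `|k * a| <= `|k| * e.
  by move=> ha; rewrite normrM; exact: ler_wpM2l.
have n2 (a : R) : `|a| <= e -> `|2 * a| <= 2 * e by move=> /(nM 2); rewrite normr_nat.
apply: (nD _ _ _ _); last by rewrite normrN; exact: nM.
apply: (nD _ _ _ _); last exact: nM.
apply: (nD _ _ _ _); last by rewrite normrN.
apply: (nD _ _ _ _); last by rewrite normrN; exact: n2.
by apply: (nD _ _ _ _); rewrite normrN; exact: nM.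
Qed.

Lemma comb_fin (y' a w Fn L k e s : R) : `|a - y'| <= e -> `|a - w - Fn - k| <= e ->
  `|L - Fn| <= s * e -> 0 <= e -> `|y' - w - (L + k)| <= (s + 3) * e.
Proof.
rewrite !ler_norml mulrDl => /andP[? ?] /andP[? ?] /andP[? ?] ?; apply/andP; split; lra.
Qed.

Lemma limit_equation_basis i t : 0 <= t ->
  ip leb2 (u t) (f i) - ip leb2 u0 (f i) = Int leb3 (fun p => win 0 t p * flux (f i) p).
Proof.
have PF : ProperFilter FF by exact: ultra_proper.
move=> t0; have vD := fD i; set v := f i in vD *.
have [M [_ bv bx bY]] := Cc_facts vD; have [A A0 HA] := U_bound t0.
have [_ ->] := flux_Int t vD bv bx bY.
have [_ sux suy] := uxy_sq t; have sTx := Tx_sq t.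
apply: ultra_eq => d d0; pose S := 2 * `|mu| + 3 + `|alpha| + `|beta| + 3.
have S0 : 0 < S.
  by rewrite /S; have := normr_ge0 mu; have := normr_ge0 alpha; have := normr_ge0 beta; lra.
have e0 : 0 < d / S by rewrite divr_gt0.
set e := d / S in e0.
have c1 n : sq leb3 (fun p => win 0 t p * dx (U n p.1) p.2) by have [_ s _] := Usq n 0 t; exact: s.
have cT n : sq leb3 (fun p => win 0 t p * dTO (U n) p) by have [] := dTO_sq (c1 n).
have b1 n : ip leb3 (fun p => win 0 t p * dx (U n p.1) p.2) (fun p => win 0 t p * dx (U n p.1) p.2) <= A.
  by have [_ h _] := HA n; exact: h.
have bT n : ip leb3 (fun p => win 0 t p * dTO (U n) p) (fun p => win 0 t p * dTO (U n) p) <= A.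
  exact: (le_trans (dTO_sq (c1 n)).2 (b1 n)).
have F1 := lim_x t0 (win_bsupp1 0 t bx) e0; have F2 := lim_y t0 (win_bsupp1 0 t bY) e0.
have F3 := lim_prod t0 bv c1 b1 (fun psi e => @lim_x t psi e t0) e0.
have F4 := lim_prod t0 bY cT bT (fun psi e => @lim_T t psi e t0) e0.
have F5 := lim_U t0 bv e0; have F6 := lim_T t0 (win_bsupp1 0 t bv) e0.
have F7 := Uy i t e0; have F8 := Ueq i t0 e0.
apply: filterS (filterI F1 (filterI F2 (filterI F3 (filterI F4 (filterI F5 (filterI F6 (filterI F7 F8))))))).
move=> n /= [h1 [h2 [h3 [h4 [h5 [h6 [h7 h8]]]]]]].
rewrite (F0_Int n t0 vD bv bx bY) in h8; rewrite u_f//.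
have := comb_close mu alpha beta (ltW e0) h1 h2 h3 h4 h5 h6 => h.
have {}h7 := h7 t; rewrite t0 lexx in h7; have {}h7 := h7 isT.
have -> : d = S * e by rewrite /e mulrC divfK// gt_eqF.
exact: (comb_fin h7 h8 h (ltW e0)).
Qed.

Lemma g_intg M T : [/\ intg leb3 (fun p => win 0 T p * (g0 p * boxind M p.2)),
  intg leb3 (fun p => win 0 T p * (g1 p * boxind M p.2)) &
  intg leb3 (fun p => win 0 T p * (g2 p * boxind M p.2))].
Proof.
have [_ U1 U2] := uxy_sq T; have U0 := u_win T; have UT := Tx_sq T; have UK := sK T.
have bb := win_bsupp1 0 T (boxind_bsupp M).
have box1 (w : R * (R * R) -> R) : sq leb3 (fun p => win 0 T p * w p) -> intg leb3 (fun p => win 0 T p * (w p * boxind M p.2)).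
  by move=> sw; exact: win_intgM.
have box2 (w : R * (R * R) -> R) : intg leb3 (fun p => win 0 T p * w p) -> intg leb3 (fun p => win 0 T p * (w p * boxind M p.2)).
  move=> iw; apply: (@intg_le _ _ _ leb3 _ _ _ iw).
    under eq_fun do rewrite mulrA.
    by apply: measurable_funM; [exact: intg_meas iw|exact: boxind_meas3].
  move=> p; rewrite mulrA normrM ler_piMr// boxindE; case: ifP; rewrite ?normr1 ?normr0//.
have i0 : intg leb3 (fun p => win 0 T p * (g0 p * boxind M p.2)).
  have := intgD (intgB (intgD (intgZ (- 2) (box2 _ (win_intgM U0 U1))) (intgZ alpha (box1 _ U0)))
    (intgZ beta (box1 _ UT))) (box1 _ UK).
  by congr intg; apply/funext => p; rewrite /g0; ring.
have i1 : intg leb3 (fun p => win 0 T p * (g1 p * boxind M p.2)).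
  by have := intgZ (- mu) (box1 _ U1); congr intg; apply/funext => p; rewrite /g1; ring.
have i2 : intg leb3 (fun p => win 0 T p * (g2 p * boxind M p.2)).
  have := intgB (intgZ (- mu) (box1 _ U2)) (box2 _ (win_intgM U0 UT)).
  by congr intg; apply/funext => p; rewrite /g2; ring.
exact: (And3 i0 i1 i2).
Qed.

Local Notation Gabs_intg := (Gabs_intg g_intg).

(** Among functions supported in a fixed box both sides are continuous for the C^1 norm, and
    combinations of the family are dense there. [C] is the resulting modulus of continuity. *)
Lemma limit_equation v t : 0 <= t -> Cc_infty Omega v ->
  ip leb2 (u t) v - ip leb2 u0 v = Int leb3 (fun p => win 0 t p * flux v p).
Proof.
move=> t0 vD; have [M [vC dense]] := f_dense vD.
have [bv bx bY] := C1c_bsupp vC.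
have sv : sq leb2 v by have [] := Cc_sq vD.
have [iv _] := flux_Int t vD bv bx bY.
pose P w := ip leb2 (u t) w - ip leb2 u0 w - Int leb3 (fun p => win 0 t p * flux w p).
pose C := ip leb2 (fun z => `|u t z|) (boxind M) + ip leb2 (fun z => `|u0 z|) (boxind M) + Gm g0 g1 g2 M 0 t.
have C0 : 0 <= C.
  rewrite !addr_ge0 ?Gm_ge0//; apply: Int_ge0 => z; rewrite mulr_ge0// boxindE; by case: ifP.
suff : P v = 0 by move/eqP; rewrite subr_eq0 => /eqP.
apply: (@sqr_le_small_eq0 _ _ (C ^+ 2)); first exact: sqr_ge0.
move=> e0' e0'_gt0; pose e := Num.min 1 e0'.
have e_gt0 : 0 < e by rewrite lt_min ltr01.
have ee : e ^+ 2 <= e0'.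
  apply: (@le_trans _ _ e); last by rewrite ge_min lexx orbT.
  by rewrite expr2 ler_piMl ?(ltW e_gt0)// ge_min lexx.
have [n [c [wC hw]]] := dense e e_gt0; set w := lin n c f in wC hw.
have wD : Cc_infty Omega w := lin_Cc n c fD.
have [bw bwx bwy] := C1c_bsupp wC.
have sw : sq leb2 w by have [] := Cc_sq wD.
have [iw _] := flux_Int t wD bw bwx bwy.
have ifl i : intg leb3 (fun p => win 0 t p * flux (f i) p).
  by have [N [_ b1 b2 b3]] := Cc_facts (fD i); have [] := flux_Int t (fD i) b1 b2 b3.
have Pw : P w = 0.
  rewrite /P; have E (g : R * R -> R) : sq leb2 g -> ip leb2 g w = \sum_(i < n) c i * ip leb2 g (f i).
    move=> sg; rewrite ipC /w /lin (@ip_suml _ _ _ leb2 n (fun i z => c i * f i z))//.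
      by apply: eq_bigr => i _; rewrite (ipZl _ (f_sq' i) sg) (ipC leb2 (f i) g).
    by move=> i _; apply: sqZ; exact: f_sq'.
  rewrite !E//; have -> : Int leb3 (fun p => win 0 t p * flux w p) =
     \sum_(i < n) c i * Int leb3 (fun p => win 0 t p * flux (f i) p).
    under [RHS]eq_bigr => i _ do rewrite -(IntZ (c i) (ifl i)).
    rewrite -(@Int_sum _ _ _ leb3 n (fun i p => c i * (win 0 t p * flux (f i) p))).
      by apply: eq_Int => p; rewrite (@flux_lin _ _ _ _ _ _ _ _ fD) mulr_sumr; apply: eq_bigr => i _; rewrite mulrCA.
    by move=> i _; exact: intgZ.
  rewrite -sumrB -sumrB big1// => i _.
  by rewrite -limit_equation_basis//; ring.
have bd (a b : R * R -> R) : bsupp M a -> bsupp M b -> bsupp M (fun z => a z - b z).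
  move=> [ma [A HA] a0] [mb [B HB] b0]; split.
  - exact: measurable_funB.
  - by exists (A + B) => z; apply: (le_trans (ler_normB _ _)); exact: lerD.
  - by move=> z zM; rewrite a0// b0// subrr.
have vw := bd _ _ bv bw; have vwx := bd _ _ bx bwx; have vwy := bd _ _ bY bwy.
have h0 z : `|v z - w z| <= e by have [] := hw z.
have h1 z : `|dx v z - dx w z| <= e by have [] := hw z.
have h2 z : `|dy v z - dy w z| <= e by have [] := hw z.
rewrite -[P v ^+ 2]real_normK ?num_real//; apply: (@le_trans _ _ ((C * e) ^+ 2)); last first.
  by rewrite exprMn ler_wpM2l ?sqr_ge0.
rewrite lerXn2r ?nnegrE ?mulr_ge0 ?(ltW e_gt0)//.
have -> : P v = ip leb2 (u t) (fun z => v z - w z) - ip leb2 u0 (fun z => v z - w z)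
    - Int leb3 (fun p => win 0 t p * (flux v p - flux w p)).
  have B (g : R * R -> R) : sq leb2 g -> ip leb2 g (fun z => v z - w z) = ip leb2 g v - ip leb2 g w.
    by move=> sg; rewrite ipC ipBl// (ipC leb2 v g) (ipC leb2 w g).
  have -> : P v = P v - P w by rewrite Pw subr0.
  rewrite /P !B//.
  have -> : Int leb3 (fun p => win 0 t p * (flux v p - flux w p)) =
     Int leb3 (fun p => win 0 t p * flux v p) - Int leb3 (fun p => win 0 t p * flux w p).
    by rewrite -IntB//; apply: eq_Int => p; rewrite mulrBr.
  move: (ip leb2 (u t) v) (ip leb2 u0 v) (ip leb2 (u t) w) (ip leb2 u0 w) (Int leb3 _) (Int leb3 _) => *; ring.
have iD : intg leb3 (fun p => win 0 t p * (flux v p - flux w p)).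
  by have := intgB iv iw; congr intg; apply/funext => p; rewrite mulrBr.
have q1 := ip_box (u_sq t) vw h0; have q2 := ip_box su0 vw h0.
have q3 := @flux_small _ g0 g1 g2 g_intg M 0 t e _ (fun p => v p.2 - w p.2) (fun p => dx v p.2 - dx w p.2)
  (fun p => dy v p.2 - dy w p.2) (lexx 0) (ltW e_gt0) iD.
have -> : C * e = e * ip leb2 (fun z => `|u t z|) (boxind M) + e * ip leb2 (fun z => `|u0 z|) (boxind M) + e * Gm g0 g1 g2 M 0 t.
  by rewrite /C; ring.
apply: (le_trans (ler_normB _ _)); apply: lerD.
  by apply: (le_trans (ler_normB _ _)); exact: lerD.
apply: q3 => p _; first by rewrite /flux_form; ring.
by split; [exact: (bsupp_le_box vw h0)|exact: (bsupp_le_box vwx h1)|exact: (bsupp_le_box vwy h2)].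
Qed.

Lemma limit_equation_between v s t M : 0 <= s -> s <= t -> Cc_infty Omega v -> bsupp M v -> bsupp M (dx v) -> bsupp M (dy v) ->
  intg leb3 (fun p => win s t p * flux v p) /\
  ip leb2 (u t) v - ip leb2 (u s) v = Int leb3 (fun p => win s t p * flux v p).
Proof.
move=> s0 st vD bv bx bY; have [i _] := flux_Int t vD bv bx bY.
have i1 := win_sub s0 (lexx t) i; have i0 := win_sub (lexx 0) st i; split => //.
have E : ip leb2 (u t) v - ip leb2 (u s) v = (ip leb2 (u t) v - ip leb2 u0 v) - (ip leb2 (u s) v - ip leb2 u0 v) by ring.
rewrite E (limit_equation (le_trans s0 st) vD) (limit_equation s0 vD) -(@IntB _ _ _ leb3 _ _ i i0).
by apply: eq_Int => p; rewrite /win (win1D p.1 s0 st); ring.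
Qed.

Lemma comb_energy (I1 I3 E k S a b d : R) : I3 <= I1 + d / 3 -> b + I1 <= E + k + d / 3 ->
  S <= b + a -> a <= d / 3 -> S + I3 <= E + k + d.
Proof. by move=> ? ? ? ?; lra. Qed.

Lemma comb_dens (m d a1 a2 a3 b1 b2 b3 I : R) : 0 <= m ->
  `|a1 - b1| <= d -> `|a2 - b2| <= d -> `|a3 - b3| <= d ->
  2 * (m * b1 + m * b2 + b3) - (m * a1 + m * a2 + a3) <= I ->
  m * a1 + m * a2 + a3 <= I + 2 * (m * d + m * d + d).
Proof.
rewrite !ler_norml => m0 /andP[_ h1] /andP[_ h2] /andP[_ h3] h.
have q1 := ler_wpM2l m0 h1; have q2 := ler_wpM2l m0 h2; lra.
Qed.

(** * The energy inequality for the limit *)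

Section Energy.
Variable gamma : R.
Hypotheses (mu0 : 0 < mu) (gamma0 : 0 < gamma)
  (Uen : forall (s t e : R), s < t -> 0 < e -> 0 <= s -> FF [set n |
      expR (- (2 * gamma * t)) * E0 (U n t)
      + Int leb1 (fun r => win1 0 s r * (expR (- (2 * gamma * r)) * (mu * E1 (U n r) + E0 (U n r))))
      <= E0 u0 + kh K 0 t + e]).

Let ex (p : R * (R * R)) : R := expR (- (2 * gamma * p.1)).

Lemma ex_meas : measurable_fun setT ex.
Proof.
apply: (@measurableT_comp _ _ _ _ _ _ (fun r : R => expR (- (2 * gamma * r)))); last exact: measurable_fst.
apply: measurableT_comp => //; apply: measurableT_comp => //.
Qed.

Lemma sq_ex T (w : R * (R * R) -> R) : sq leb3 (fun p => win 0 T p * w p) -> sq leb3 (fun p => win 0 T p * (ex p * w p)).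
Proof.
move=> sw; apply: (@sq_le _ _ _ leb3 _ _ _ sw).
  have -> : (fun p => win 0 T p * (ex p * w p)) = fun p => ex p * (win 0 T p * w p).
    by apply/funext => p; ring.
  by apply: measurable_funM; [exact: ex_meas|case: sw].
move=> p; rewrite /win win1E; case: ifP => [/andP[p0 _]|_]; last by rewrite !mul0r.
rewrite !mul1r normrM ler_piMl// ger0_norm ?expR_ge0// -expR0 ler_expR oppr_le0.
by rewrite !mulr_ge0 ?(ltW gamma0).
Qed.

Definition energy_density p := ex p * (mu * (ux p ^+ 2 + uy p ^+ 2) + u3 p ^+ 2).

Lemma dens_ge0 p : 0 <= energy_density p.
Proof. by rewrite mulr_ge0 ?expR_ge0// addr_ge0 ?sqr_ge0// mulr_ge0 ?(ltW mu0)// addr_ge0 ?sqr_ge0. Qed.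

Lemma dens_intg T : intg leb3 (fun p => win 0 T p * energy_density p).
Proof.
have [_ s1 s2] := uxy_sq T; have s0 := u_win T.
have := intgD (intgZ mu (intgD (win_intgM s1 (sq_ex s1)) (win_intgM s2 (sq_ex s2)))) (win_intgM s0 (sq_ex s0)).
by congr intg; apply/funext => p; rewrite /energy_density; ring.
Qed.

Lemma lim_u T psi e : 0 <= T -> sq leb3 (fun p => win 0 T p * psi p) -> 0 < e -> FF [set n |
  `|Int leb3 (fun p => win 0 T p * (u3 p * psi p))
    - Int leb3 (fun p => win 0 T p * (U n p.1 p.2 * psi p))| <= e].
Proof.
move=> T0 sp e0; have [A A0 HA] := U_bound T0.
apply: (@weak_lim (fun x p => x p.1 p.2)) => //.
- by move=> x [_ /(_ 0 T)[s _ _] _]; exact: s.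
- exact: u_win.
- by move=> B d FB d0; have [x xh [h _ _]] := u_hull T FB d0; exists x.
- by exists A => n; have [h _ _] := HA n; exact: h.
Qed.

Lemma young_dens (e0 a b c a' b' c' m : R) : 0 <= e0 -> 0 <= m ->
  2 * (m * (a' * (e0 * a)) + m * (b' * (e0 * b)) + c' * (e0 * c)) - e0 * (m * (a ^+ 2 + b ^+ 2) + c ^+ 2)
  <= e0 * (m * (a' ^+ 2 + b' ^+ 2) + c' ^+ 2).
Proof.
move=> he hm.
have : 0 <= e0 * (m * ((a' - a) ^+ 2 + (b' - b) ^+ 2) + (c' - c) ^+ 2).
  by rewrite mulr_ge0// addr_ge0 ?sqr_ge0// mulr_ge0// addr_ge0 ?sqr_ge0.
move=> h; rewrite -subr_ge0; apply: (le_trans h); rewrite le_eqVlt; apply/orP; left; apply/eqP; ring.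
Qed.

Lemma U_dens n T : intg leb3 (fun p => win 0 T p * (ex p * (mu * (dx (U n p.1) p.2 ^+ 2 + dy (U n p.1) p.2 ^+ 2) + U n p.1 p.2 ^+ 2))) /\
  Int leb1 (fun r => win1 0 T r * (expR (- (2 * gamma * r)) * (mu * E1 (U n r) + E0 (U n r)))) =
  Int leb3 (fun p => win 0 T p * (ex p * (mu * (dx (U n p.1) p.2 ^+ 2 + dy (U n p.1) p.2 ^+ 2) + U n p.1 p.2 ^+ 2))).
Proof.
have [s0 s1 s2] := Usq n 0 T.
have i : intg leb3 (fun p => win 0 T p * (ex p * (mu * (dx (U n p.1) p.2 ^+ 2 + dy (U n p.1) p.2 ^+ 2) + U n p.1 p.2 ^+ 2))).
  have := intgD (intgZ mu (intgD (win_intgM s1 (sq_ex s1)) (win_intgM s2 (sq_ex s2)))) (win_intgM s0 (sq_ex s0)).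
  by congr intg; apply/funext => p; ring.
split => //; have [_ ->] := win_fubini i.
apply: eq_Int => r; congr (_ * _); rewrite /ex /=.
have [q0 q1 q2] := Cc_sq (UD n r).
have j1 := intgM q1 q1; have j2 := intgM q2 q2; have j0 := intgM q0 q0.
rewrite /E1 /E0 /ip -(@IntD _ _ _ leb2 _ _ j1 j2) -(@IntZ _ _ _ leb2 _ _ (intgD j1 j2)).
rewrite -(@IntD _ _ _ leb2 _ _ (intgZ mu (intgD j1 j2)) j0).
rewrite -(@IntZ _ _ _ leb2 _ _ (intgD (intgZ mu (intgD j1 j2)) j0)).
by apply: eq_Int => z; ring.
Qed.

(** Weak lower semicontinuity: a square lies above its tangent at the limit, and the tangent is
    linear in the approximation, so that its integral converges by weak convergence. *)
Lemma dens_liminf s e : 0 <= s -> 0 < e -> FF [set n | Int leb3 (fun p => win 0 s p * energy_density p) <=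
  Int leb1 (fun r => win1 0 s r * (expR (- (2 * gamma * r)) * (mu * E1 (U n r) + E0 (U n r)))) + e].
Proof.
have PF : ProperFilter FF by exact: ultra_proper.
move=> s0 e0; have M0 : 0 < 2 * (2 * mu + 1) by rewrite mulr_gt0// addr_gt0// mulr_gt0.
have d0 : 0 < e / (2 * (2 * mu + 1)) by rewrite divr_gt0.
set d := e / _ in d0; have eE : e = 2 * (mu * d + mu * d + d) by rewrite /d; field; rewrite gt_eqF//; lra.
have [_ s1 s2] := uxy_sq s; have su := u_win s.
apply: filterS (filterI (lim_x s0 (sq_ex s1) d0) (filterI (lim_y s0 (sq_ex s2) d0) (lim_u s0 (sq_ex su) d0))).
move=> n /= [h1 [h2 h3]]; have [iU ->] := U_dens n s; have [t0 t1 t2] := Usq n 0 s.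
have i1 := win_intgM t1 (sq_ex s1); have i2 := win_intgM t2 (sq_ex s2); have i3 := win_intgM t0 (sq_ex su).
have j1 := win_intgM s1 (sq_ex s1); have j2 := win_intgM s2 (sq_ex s2); have j3 := win_intgM su (sq_ex su).
have iD := dens_intg s.
have ED : Int leb3 (fun p => win 0 s p * energy_density p) = mu * Int leb3 (fun p => win 0 s p * (ux p * (ex p * ux p)))
   + mu * Int leb3 (fun p => win 0 s p * (uy p * (ex p * uy p))) + Int leb3 (fun p => win 0 s p * (u3 p * (ex p * u3 p))).
  rewrite -(IntZ mu j1) -(IntZ mu j2) -(@IntD _ _ _ leb3 _ _ (intgZ mu j1) (intgZ mu j2)).
  rewrite -(@IntD _ _ _ leb3 _ _ (intgD (intgZ mu j1) (intgZ mu j2)) j3).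
  by apply: eq_Int => p; rewrite /energy_density; ring.
set IU := Int leb3 (fun p => _ * (ex p * (mu * (dx _ _ ^+ 2 + _) + _))).
have : 2 * (mu * Int leb3 (fun p => win 0 s p * (dx (U n p.1) p.2 * (ex p * ux p)))
   + mu * Int leb3 (fun p => win 0 s p * (dy (U n p.1) p.2 * (ex p * uy p)))
   + Int leb3 (fun p => win 0 s p * (U n p.1 p.2 * (ex p * u3 p)))) - Int leb3 (fun p => win 0 s p * energy_density p) <= IU.
  have k1 := intgD (intgZ mu i1) (intgZ mu i2); have k2 := intgD k1 i3.
  rewrite -(IntZ mu i1) -(IntZ mu i2) -(@IntD _ _ _ leb3 _ _ (intgZ mu i1) (intgZ mu i2)).
  rewrite -(@IntD _ _ _ leb3 _ _ k1 i3) -(IntZ 2 k2) -(@IntB _ _ _ leb3 _ _ (intgZ 2 k2) iD).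
  apply: (@Int_le _ _ _ leb3 _ _ (intgB (intgZ 2 k2) iD) iU) => p.
  have := young_dens (ux p) (uy p) (u3 p) (dx (U n p.1) p.2) (dy (U n p.1) p.2) (U n p.1 p.2) (expR_ge0 (- (2 * gamma * p.1))) (ltW mu0).
  rewrite -/(ex p) => h; have := ler_wpM2l (win_ge0 0 s p) h; apply: le_trans.
  by rewrite /energy_density le_eqVlt; apply/orP; left; apply/eqP; ring.
rewrite ED eE; exact: (comb_dens (ltW mu0) h1 h2 h3).
Qed.

Lemma energy_lt s t : 0 <= s -> s < t ->
  expR (- (2 * gamma * t)) * ip leb2 (u t) (u t) + Int leb3 (fun p => win 0 s p * energy_density p)
  <= E0 u0 + kh K 0 t.
Proof.
have PF : ProperFilter FF by exact: ultra_proper.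
move=> s0 st; have t0 : 0 <= t by rewrite (le_trans s0)// ltW.
have e0 : 0 < expR (- (2 * gamma * t)) by exact: expR_gt0.
rewrite -lerBrDr mulrC -ler_pdivlMr//; apply: u_le_sum => // N.
rewrite ler_pdivlMr// lerBrDr; apply/ler_addgt0Pr => d d0.
have e1 : expR (- (2 * gamma * t)) <= 1.
  by rewrite -expR0 ler_expR oppr_le0 !mulr_ge0 ?(ltW gamma0).
have d3 : 0 < d / 3 by rewrite divr_gt0.
have [n /= [h1 [h2 h3]]] := filter_ex (filterI (y_liminf N t0 d3) (filterI (dens_liminf s0 d3) (Uen st d3 s0))).
have h4 := ler_wpM2l (ltW e0) h1; rewrite mulrDr in h4.
have h5 : expR (- (2 * gamma * t)) * (d / 3) <= d / 3 by rewrite ler_piMl// ltW.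
by rewrite [_ * expR _]mulrC; exact: (comb_energy h2 h3 h4 h5).
Qed.

(** The approximations yield the dissipation only up to times [s < t]; the integral over the
    remaining interval is arbitrarily small by absolute continuity. *)
Lemma energy_le t : 0 < t ->
  expR (- (2 * gamma * t)) * ip leb2 (u t) (u t) + Int leb3 (fun p => win 0 t p * energy_density p)
  <= E0 u0 + kh K 0 t.
Proof.
move=> t0; apply/ler_addgt0Pr => e e0.
have [dl d0 H] := win_ac (dens_intg t) dens_ge0 e0.
pose s := Num.max 0 (t - dl).
have s0 : 0 <= s by rewrite le_max lexx.
have st : s < t by rewrite gt_max t0 ltrBlDr ltrDl.
have h1 := energy_lt s0 st.
have h2 := H s t s0 (ltW st) (lexx t).
have {}h2 : Int leb3 (fun p => win s t p * energy_density p) <= e.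
  by apply: h2; rewrite lerBlDr -lerBlDl le_max lexx orbT.
have -> : Int leb3 (fun p => win 0 t p * energy_density p) = Int leb3 (fun p => win 0 s p * energy_density p) + Int leb3 (fun p => win s t p * energy_density p).
  have i := dens_intg t.
  rewrite -(@IntD _ _ _ leb3 _ _ (win_sub (lexx 0) (ltW st) i) (win_sub s0 (lexx t) i)).
  by apply: eq_Int => p; rewrite /win (win1D p.1 s0 (ltW st)) mulrDl.
by rewrite addrA; exact: lerD.
Qed.

End Energy.
End Limit.

(** * Time-dependent test functions *)

Section Slices.
Context (R : realType).

Lemma within_measurable3 (D : set (R * (R * R))) (f : R * (R * R) -> R) : measurable D ->
  {within D, continuous f} -> measurable_fun D f.
Proof.
move=> mD /continuousP cf; apply: (measurability _ (RGenOpens.measurableE R)).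
move=> _ [_ [a [b ->] <-]].
have oab : open (`]a, b[%classic : set R) by exact: interval_open.
have /(@open_subspaceP _ D)[U oU UE] := cf _ oab.
by rewrite setIC -UE; apply: measurableI => //; exact: open_measurable3.
Qed.

Lemma is_derive_near (V : normedModType R) (f g : V -> R) x w df :
  (\forall y \near x, f y = g y) -> is_derive x w f df -> is_derive x w g df.
Proof.
move=> fg [fd fE]; split; first exact: near_eq_derivable fg fd.
by rewrite -(near_eq_derive _ fg).
Qed.

Lemma continuous_near (U V : topologicalType) (f g : U -> V) x :
  (\forall y \near x, f y = g y) -> {for x, continuous f} -> {for x, continuous g}.
Proof.
move=> fg cf A; rewrite -(nbhs_singleton fg) => /cf fA.
by apply: filterS2 fg (fA : nbhs x (f @^-1` A)) => y E; rewrite /= E.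
Qed.

Lemma is_derive_slice (V : normedModType R) (g : R * V -> R) c z (w : V) (dg : R) :
  is_derive (c, z) (0, w) g dg -> is_derive z w (fun y => g (c, y)) dg.
Proof.
move=> [gd gE].
have E : (fun h : R => h^-1 *: (((fun y => g (c, y)) \o shift z) (h *: w) - g (c, z))) =
         (fun h : R => h^-1 *: ((g \o shift (c, z)) (h *: ((0 : R), w)) - g (c, z))).
  apply/funext => h /=; congr (_ *: (g _ - _)).
  by rewrite [RHS](_ : _ = (h * 0 + c, h *: w + z))// mulr0 add0r.
split; first by move: gd; rewrite /derivable E.
by rewrite -gE /derive E.
Qed.

Lemma is_derive_time (g : R * (R * R) -> R) (c : R) (z : R * R) (dg : R) :
  is_derive (c, z) (1, (0, 0)) g dg -> is_derive c 1 (fun r => g (r, z)) dg.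
Proof.
move=> gd; have := @is_derive_line _ _ g (0, z) (1, (0, 0)) c dg.
have h (r : R) : (0, z) + r *: ((1, (0, 0)) : R * (R * R)) = (r, z).
  by rewrite [LHS](_ : _ = (0 + r * 1, z + r *: 0))// add0r mulr1 scaler0 addr0.
by rewrite h; under eq_fun do rewrite h; apply.
Qed.

Lemma open_setX2 (U V : topologicalType) (A : set U) (C : set V) : open A -> open C -> open (A `*` C).
Proof.
move=> oA oC; have -> : A `*` C = (fst @^-1` A) `&` (snd @^-1` C) by [].
by apply: openI; apply: open_comp => // p _; [exact: cvg_fst|exact: cvg_snd].
Qed.

Lemma open_Omega : open (Omega : set (R * R)).
Proof.
rewrite (_ : Omega = snd @^-1` `]0, 1[%classic); last by apply/funext => y; rewrite /= in_itv.
by apply: open_comp => [y _|]; [exact: cvg_snd|exact: interval_open].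
Qed.

Lemma closure_Omega (z : R * R) : 0 <= z.2 <= 1 -> closure (Omega : set (R * R)) z.
Proof.
case: z => x y /= /andP[y0 y1] A /nbhs_ballP[e /= e0 eA].
pose l : R := Num.min 1 (e / 2); have l0 : 0 < l by rewrite lt_min ltr01 divr_gt0.
have l1 : l <= 1 by rewrite ge_min lexx.
have le : l < e by rewrite gt_min [X in _ || X]ltr_pdivrMr// mulr_natr mulr2n ltrDl e0 orbT.
exists (x, y + l * (2^-1 - y)); split; first by apply/andP; split; rewrite /=; nra.
apply: eA; split; first exact: ballxx.
rewrite /ball /= /ball_ opprD addNKr normrN normrM (ger0_norm (ltW l0)).
apply: le_lt_trans le; rewrite ler_piMr ?(ltW l0)// ler_norml; apply/andP; split; lra.
Qed.

Variables (t B : R) (phi : R * (R * R) -> R).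
Let E : set (R * (R * R)) := `[0, t]%classic `*` closure Omega.
Let D : set (R * (R * R)) := `[0, t]%classic `*` (`[- B, B]%classic `*` `[0, 1]%classic).

Lemma box_sub : D `<=` E.
Proof. by move=> [s z] /= [st [_ /= zy]]; split => //; apply: closure_Omega; move: zy; rewrite in_itv. Qed.

Lemma compact_D : compact D.
Proof. by apply: compact_setX; [exact: segment_compact|exact: compact_box]. Qed.

Lemma inbox_D s z : 0 <= s <= t -> inbox B z -> D (s, z).
Proof.
move=> st /andP[zB /andP[/ltW y0 /ltW y1]]; split; first by rewrite /= in_itv.
by split; rewrite /= in_itv/= -?ler_norml// y0.
Qed.

Lemma interior_E s z : 0 < s < t -> Omega z -> interior E (s, z).
Proof.
move=> st zO; apply: (@interiorS _ (`]0, t[%classic `*` (Omega : set (R * R)))).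
  move=> [r y] [/= rt yO]; split; last exact: subset_closure.
  by move: rt; rewrite /= !in_itv/= => /andP[/ltW -> /ltW ->].
have oO : open (`]0, t[%classic `*` (Omega : set (R * R))).
  by apply: open_setX2; [exact: interval_open|exact: open_Omega].
by move: oO; rewrite openE; apply; split => //; rewrite /= in_itv.
Qed.

Lemma Ck_within k (g : R * (R * R) -> R) : Ck k E g -> {within E, continuous g}.
Proof. by case: k => [|k] []. Qed.

Lemma Ck_at k (g : R * (R * R) -> R) p : Ck k E g -> interior E p -> {for p, continuous g}.
Proof.
move=> /Ck_within cg pE; have oE : open (interior E) by exact: open_interior.
have := continuous_subspaceW (@interior_subset _ E) cg.
by rewrite (continuous_open_subspace g oE); apply; rewrite inE.
Qed.

(** A test function has arbitrary values outside the closed strip. The cut-off replaces them by 0;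
    inside the strip it changes nothing, thanks to the support condition. *)
Definition ext (g : R * (R * R) -> R) (s : R) (z : R * R) : R := if inbox B z then g (s, z) else 0.

Lemma ext_meas k g : 0 < t -> Ck k E g ->
  measurable_fun setT (fun p : R * (R * R) => (if 0 <= p.1 <= t then ext g p.1 p.2 else 0)).
Proof.
move=> t0 /Ck_within cg.
have mD : measurable D.
  by apply: measurableX; [exact: measurable_itv|apply: measurableX; exact: measurable_itv].
have mg := within_measurable3 mD (continuous_subspaceW box_sub cg).
have mg' : measurable_fun setT (g \_ D) by apply/(measurable_restrictT _ mD).
have -> : (fun p : R * (R * R) => (if 0 <= p.1 <= t then ext g p.1 p.2 else 0)) =
    fun p => boxind B p.2 * (g \_ D) p.
  apply/funext => -[s z]; rewrite /= /ext boxindE patchE.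
  case: ifP => st; case: ifP => zB; rewrite ?mul0r ?mul1r//.
    by rewrite mem_set//; exact: inbox_D.
  by rewrite memNset// => -[/=]; rewrite in_itv/= st.
by apply: measurable_funM => //; exact: boxind_meas3.
Qed.

Lemma ext_bound k g : Ck k E g -> exists2 C, 0 < C & forall s z, 0 <= s <= t -> `|ext g s z| <= C * boxind B z.
Proof.
move=> /Ck_within /(continuous_subspaceW box_sub) cg.
have [C C0 H] := bounded_on_compact compact_D cg; exists C => // s z st.
rewrite /ext boxindE; case: ifP => zB; last by rewrite normr0 mulr0.
by rewrite mulr1; apply: H; exact: inbox_D.
Qed.

Lemma ext_unif k g e : Ck k E g -> 0 < e -> exists2 dl, 0 < dl & forall s r z, 0 <= s <= t -> 0 <= r <= t ->
  `|s - r| < dl -> `|ext g s z - ext g r z| <= e * boxind B z.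
Proof.
move=> /Ck_within /(continuous_subspaceW box_sub) cg e0.
have [dl d0 H] := uniformly_continuous_on compact_D cg e0; exists dl => // s r z st rt sr.
rewrite /ext boxindE; case: ifP => zB; last by rewrite subr0 normr0 mulr0.
rewrite mulr1; apply: ltW; apply: H; [exact: inbox_D|exact: inbox_D|].
by split => //=; exact: ballxx.
Qed.

Section Slice.
Variables (c : R).
Hypothesis ct : 0 < c < t.
Let Kc := closure [set z | closure Omega z /\ phi (c, z) != 0].
Hypothesis KcB : Kc `<=` `]- B, B[%classic `*` `]0, 1[%classic.

Lemma slice_inbox z : Kc z -> inbox B z.
Proof.
move=> /KcB[]; rewrite /= !in_itv/= /inbox => /andP[/ltW h1 /ltW h2] ->.
by rewrite andbT ler_norml h1.
Qed.

Lemma inbox_Omega z : inbox B z -> Omega z.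
Proof. by case/andP. Qed.

Lemma slice_near_out z : ~ Kc z -> \forall y \near z, ~ Kc y.
Proof.
have : open (~` Kc) by apply: closed_openC; exact: closed_closure.
by rewrite openE => /[apply].
Qed.

Lemma slice_near_in z : Kc z -> \forall y \near z, inbox B y.
Proof.
move=> /KcB zK; have : open ((`]- B, B[%classic `*` `]0, 1[%classic) : set (R * R)).
  by apply: open_setX2; exact: interval_open.
rewrite openE => /(_ _ zK); apply: filterS => y []; rewrite /= !in_itv/= /inbox => /andP[/ltW h1 /ltW h2] ->.
by rewrite andbT ler_norml h1.
Qed.

Let vanish (g : R * (R * R) -> R) := forall z, Omega z -> ~ Kc z -> g (c, z) = 0.

Lemma vanish_near g z : vanish g -> Omega z -> ~ Kc z -> \forall y \near z, g (c, y) = 0.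
Proof.
move=> g0 zO zK; have := open_Omega; rewrite openE => /(_ _ zO) zO'.
by apply: filterS2 zO' (slice_near_out zK) => y; exact: g0.
Qed.

Lemma ext_near_out g z : vanish g -> ~ Kc z -> \forall y \near z, ext g c y = 0.
Proof.
move=> g0 zK; apply: filterS (slice_near_out zK) => y yK.
by rewrite /ext; case: ifP => // /inbox_Omega yO; exact: g0.
Qed.

Lemma ext_near_in (g : R * (R * R) -> R) z : Kc z -> \forall y \near z, g (c, y) = ext g c y.
Proof. by move=> zK; apply: filterS (slice_near_in zK) => y yB; rewrite /ext yB. Qed.

Lemma vanish_derive g g' w : vanish g -> (forall p, interior E p -> is_derive p (0, w) g (g' p)) -> vanish g'.
Proof.
move=> g0 gd z zO zK; have := is_derive_slice (gd (c, z) (interior_E ct zO)).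
exact: near_zero_derive (vanish_near g0 zO zK).
Qed.

Lemma ext_derive g g' w z : vanish g -> (forall p, interior E p -> is_derive p (0, w) g (g' p)) ->
  is_derive z w (ext g c) (ext g' c z).
Proof.
move=> g0 gd; have [zK|zK] := pselect (Kc z).
  have zB := slice_inbox zK.
  have := is_derive_slice (gd (c, z) (interior_E ct (inbox_Omega zB))).
  by rewrite {2}/ext zB; exact: is_derive_near (ext_near_in g zK).
have -> : ext g' c z = 0.
  by rewrite /ext; case: ifP => // /inbox_Omega zO; exact: vanish_derive gd _ zO zK.
have h : is_derive z w (cst 0 : R * R -> R) 0 by exact: is_derive_cst.
by apply: (is_derive_near _ h); apply: filterS (ext_near_out g0 zK) => y ->.
Qed.

Lemma slice_cont k g : Ck k E g -> vanish g -> continuous (ext g c).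
Proof.
move=> gk g0 z; have [zK|zK] := pselect (Kc z).
  apply: (continuous_near (ext_near_in g zK)).
  have cg := Ck_at gk (interior_E ct (inbox_Omega (slice_inbox zK))).
  exact: (continuous_comp (@continuous_pairr _ _ c z) cg).
by apply: near_cst_continuous; exact: ext_near_out g0 zK.
Qed.

(** The induction on the order works because vanishing off the support of the slice is inherited by
    the spatial derivatives, so the cut-off never creates a jump. *)
Lemma slice_Ck k g : Ck k E g -> vanish g -> Ck k setT (ext g c).
Proof.
elim: k g => [|k IH] g gk g0; split => //.
- by apply: continuous_subspaceT; exact: slice_cont gk g0.
- by apply: continuous_subspaceT; exact: slice_cont gk g0.
move=> w; case: gk => _ /(_ (0, w))[g' [gk' gd]].
exists (ext g' c); split; first by apply: IH gk' _; exact: vanish_derive g0 gd.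
by move=> z _; exact: ext_derive g0 gd.
Qed.

Lemma slice_Cc : smooth_on E phi -> Cc_infty Omega (ext phi c).
Proof.
move=> sphi; have v0 : vanish phi.
  move=> z zO zK; apply/eqP; apply: contra_notT zK => pz.
  by apply: subset_closure; split => //; exact: subset_closure.
apply: (@Cc_infty_supp _ _ _ Kc); first by move=> k; exact: slice_Ck (sphi k) v0.
- apply: subclosed_compact (@compact_box R B) _; first exact: closed_closure.
  move=> z /slice_inbox /andP[]; rewrite ler_norml => zB /andP[/ltW y0 /ltW y1].
  by split; rewrite /= in_itv/= ?y0.
- by move=> z /slice_inbox /inbox_Omega.
move=> z zK; exact: nbhs_singleton (ext_near_out v0 zK).
Qed.

End Slice.

Lemma slice_time_cont (g : R * (R * R) -> R) (a b : R) (z : R * R) : {within E, continuous g} -> 0 <= a -> b <= t -> closure Omega z ->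
  {within `[a, b], continuous (fun r => g (r, z))}.
Proof.
move=> cg a0 bt zO; apply/subspace_continuousP => r rab A gA.
have rE : E (r, z).
  by split => //; move: rab; rewrite /= !in_itv/= => /andP[h1 h2]; rewrite (le_trans a0)// (le_trans h2).
have h := (@subspace_continuousP _ E _ g).1 cg (r, z) rE A gA.
have : nbhs r ((fun y => (y, z)) @^-1` (fun p => E p -> A (g p))) by exact: (@continuous_pairl _ _ z r _ h).
apply: filterS => s /= H sab; apply: H.
by split => //; move: sab; rewrite /= !in_itv/= => /andP[h1 h2]; rewrite (le_trans a0)// (le_trans h2).
Qed.

(** What the argument of freezing in time uses of the test function and of each of its first
    derivatives; the uniform continuity is in time, uniformly in space. *)
Definition tame_family (Q : R -> R * R -> R) :=
  [/\ measurable_fun setT (fun p : R * (R * R) => if 0 <= p.1 <= t then Q p.1 p.2 else 0),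
     exists2 C, 0 < C & forall s z, 0 <= s <= t -> `|Q s z| <= C * boxind B z &
     forall e, 0 < e -> exists2 dl, 0 < dl & forall s r z, 0 <= s <= t -> 0 <= r <= t ->
       `|s - r| < dl -> `|Q s z - Q r z| <= e * boxind B z].

Lemma ext_tame k g : 0 < t -> Ck k E g -> tame_family (ext g).
Proof.
move=> t0 gk; split; [exact: ext_meas t0 gk|exact: ext_bound gk|].
by move=> e e0; exact: ext_unif gk e0.
Qed.

End Slices.

(** * Slices of a test function *)

Section TestFunctions.
Context (R : realType).

(** The second clause is the mean value theorem in time and holds up to the end points, where slices
    need not be known as test functions. The time [c] depends on [z]; uniform continuity of [Pt] in
    time makes this harmless. *)
Definition slices (t B : R) (phi : R * (R * R) -> R) (P Pt Px Py : R -> R * R -> R) :=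
  [/\ forall c, 0 < c < t -> [/\ Cc_infty Omega (P c), dx (P c) = Px c & dy (P c) = Py c],
    forall a b z, 0 <= a -> a < b -> b <= t -> exists2 c, a < c < b & P b z - P a z = Pt c z * (b - a),
    forall s z, 0 <= s <= t -> Omega z -> phi (s, z) = P s z &
    forall s z, 0 < s < t -> Omega z -> [/\ 'D_(1, (0, 0)) phi (s, z) = Pt s z,
      'D_(0, (1, 0)) phi (s, z) = Px s z & 'D_(0, (0, 1)) phi (s, z) = Py s z]].

Lemma test_slices (t : R) phi : 0 < t -> test_function t phi -> exists B P Pt Px Py,
  [/\ tame_family t B P, tame_family t B Pt, tame_family t B Px & tame_family t B Py] /\
  slices t B phi P Pt Px Py.
Proof.
move=> t0 [sphi [M M0 supp]]; pose B : R := 2 `^ M; exists B.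
have [c0 /(_ _)/cid gd] := sphi 1%N.
have gk w := (proj2_sig (gd w)).1; have gD w := (proj2_sig (gd w)).2.
pose g w := proj1_sig (gd w).
exists (ext B phi), (ext B (g (1, (0, 0)))), (ext B (g (0, (1, 0)))), (ext B (g (0, (0, 1)))).
have KB c : 0 < c < t -> closure [set z | closure Omega z /\ phi (c, z) != 0] `<=` `]- B, B[%classic `*` `]0, 1[%classic.
  by move=> /andP[/ltW h1 /ltW h2]; apply: supp; rewrite h1.
have v0 c : 0 < c < t -> forall z, Omega z -> ~ closure [set z | closure Omega z /\ phi (c, z) != 0] z -> phi (c, z) = 0.
  move=> ct z zO zK; apply/eqP; apply: contra_notT zK => pz.
  by apply: subset_closure; split => //; exact: subset_closure.
have out s z : 0 <= s <= t -> Omega z -> ~~ inbox B z -> phi (s, z) = 0.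
  move=> st zO zB; apply/eqP; apply: contraNT zB => pz.
  have : closure [set z | closure Omega z /\ phi (s, z) != 0] z.
    by apply: subset_closure; split => //; exact: subset_closure.
  by move=> /(supp _ st)[]; rewrite /= in_itv/= /inbox => /andP[/ltW h1 /ltW h2] _; rewrite ler_norml h1 h2.
have tw w := @ext_tame _ t B 0%N (g w) t0 (gk w).
split; first by split; [exact: (@ext_tame _ t B 0%N phi t0 (sphi 0%N))|exact: tw|exact: tw|exact: tw].
split.
- move=> c ct; split; first exact: slice_Cc ct (KB _ ct) sphi.
    by apply/funext => z; have [_ h] := ext_derive ct (KB _ ct) z (v0 _ ct) (gD (0, (1, 0))); exact: h.
  by apply/funext => z; have [_ h] := ext_derive ct (KB _ ct) z (v0 _ ct) (gD (0, (0, 1))); exact: h.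
- move=> a b z a0 ab bt; have [zB|zB] := boolP (inbox B z); last first.
    exists (2^-1 * (a + b)); first by apply/andP; split; lra.
    by rewrite /ext (negbTE zB) mul0r subr0.
  have zO := inbox_Omega zB.
  have cz := slice_time_cont c0 a0 bt (@subset_closure _ _ _ zO).
  have dz (r : R) : r \in `]a, b[ -> is_derive r 1 (fun r => phi (r, z)) (g (1, (0, 0)) (r, z)).
    move=> rab; apply: is_derive_time; apply: gD; apply: interior_E zO.
    by move: rab; rewrite in_itv/= => /andP[h1 h2]; rewrite (le_lt_trans a0 h1) (lt_le_trans h2 bt).
  have [c cab E] := MVT ab dz cz; exists c; first by move: cab; rewrite in_itv.
  by rewrite /ext zB E.
- by move=> s z st zO; rewrite /ext; case: ifP => // /negbT; exact: out.
move=> s z st zO; have st' : 0 <= s <= t by case/andP: st => /ltW -> /ltW ->.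
have H w : 'D_w phi (s, z) = ext B (g w) s z.
  have iE := interior_E st zO; rewrite /ext; case: ifP => [_|/negbT zB].
    by have [_ ->] := gD w _ iE.
  (* Off the box but inside the strip [phi] vanishes in a whole neighbourhood, as the condition on
     the first space coordinate is open, so every derivative is 0 there. *)
  have h := gD w _ iE; have [_ ->] := h; apply: near_zero_derive h.
  have zB1 : B < `|z.1|.
    by move: zB; rewrite /inbox negb_and -ltNge => /orP[//|]; rewrite (_ : 0 < z.2 < 1).
  have oN : open [set y : R * R | B < `|y.1|].
    rewrite (_ : [set y | _] = (fun y : R * R => `|y.1|) @^-1` `]B, +oo[%classic); last first.
      by apply/funext => y; rewrite /= in_itv/= andbT.
    apply: open_comp => [y _|]; last exact: interval_open.
    by apply: continuous_comp; [exact: cvg_fst|exact: norm_continuous].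
  have : open (`]0, t[%classic `*` (Omega `&` [set y : R * R | B < `|y.1|])).
    by apply: open_setX2; [exact: interval_open|apply: openI oN; exact: open_Omega].
  rewrite openE => /(_ (s, z)) hO.
  have {}hO : nbhs (s, z) (`]0, t[%classic `*` (Omega `&` [set y : R * R | B < `|y.1|])).
    by apply: hO; split; [rewrite /= in_itv|split].
  apply: filterS hO => -[r y] [/= rt [yO yB]]; apply: out => //.
    by move: rt; rewrite in_itv/= => /andP[/ltW -> /ltW ->].
  by rewrite /inbox negb_and -ltNge yB.
by split; exact: H.
Qed.

End TestFunctions.

Lemma add_le4 (R : realType) (e m L d x1 x2 x3 x4 x5 : R) :
  `|x1| <= e * m -> `|x2| <= d * (e * L) -> `|x3| <= d * (e * L) -> `|x4| <= d * e -> `|x5| <= d * (e * L + e) ->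
  `|x1 + x2 + x3 + x4 - x5| <= e * m + (3 * L + 2) * e * d.
Proof.
move=> h1 h2 h3 h4 h5.
have -> : e * m + (3 * L + 2) * e * d = e * m + d * (e * L) + d * (e * L) + d * e + d * (e * L + e) by ring.
apply: (le_trans (ler_normB _ _)); apply: lerD => //.
do 3!(apply: (le_trans (ler_normD _ _)); apply: lerD => //).
Qed.

Lemma dist_lt (R : realType) (a x b d : R) : a <= x -> x <= b -> b - a < d -> `|x - a| < d.
Proof. by move=> ax xb bd; rewrite ger0_norm; lra. Qed.

Lemma dist_mid (R : realType) (a c b p d : R) : a < c -> c < b -> a <= p -> p < b -> b - a < d -> `|c - p| < d.
Proof. by move=> ? ? ? ? ?; rewrite ltr_norml; apply/andP; split; lra. Qed.

(** * The defect of the weak formulation *)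

Section TestArgument.
Context (R : realType).
Variables (g0 g1 g2 : R * (R * R) -> R) (u : R -> R * R -> R).
Hypotheses (g_intg : forall M T, [/\ intg leb3 (fun p => win 0 T p * (g0 p * boxind M p.2)),
    intg leb3 (fun p => win 0 T p * (g1 p * boxind M p.2)) &
    intg leb3 (fun p => win 0 T p * (g2 p * boxind M p.2))])
  (u_sq : forall s, sq leb2 (u s))
  (u_win : forall T, sq leb3 (fun p => win 0 T p * u p.1 p.2))
  (u_bd : forall T, 0 <= T -> exists A, forall s, 0 <= s <= T -> ip leb2 (u s) (u s) <= A)
  (u_eq : forall v s t M, 0 <= s -> s <= t -> Cc_infty Omega v -> bsupp M v -> bsupp M (dx v) -> bsupp M (dy v) ->
    intg leb3 (fun p => win s t p * flux_form g0 g1 g2 v p) /\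
    ip leb2 (u t) v - ip leb2 (u s) v = Int leb3 (fun p => win s t p * flux_form g0 g1 g2 v p)).
Variables (t B : R) (phi : R * (R * R) -> R) (P Pt Px Py : R -> R * R -> R).
Hypotheses (t0 : 0 < t) (tP : tame_family t B P) (tPt : tame_family t B Pt)
  (tPx : tame_family t B Px) (tPy : tame_family t B Py) (sl : slices t B phi P Pt Px Py).
Local Notation Gm := (Gm g0 g1 g2).

Lemma tame_bsupp Q s : tame_family t B Q -> 0 <= s <= t -> bsupp B (Q s).
Proof.
move=> [mQ [C C0 HC] _] st; split.
- have := measurableT_comp mQ (measurable_pair1 s).
  by congr (measurable_fun _ _); apply/funext => z; rewrite /= st.
- exists C => z; apply: (le_trans (HC s z st)).
  by rewrite boxindE; case: ifP; rewrite ?mulr1// mulr0 ltW.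
move=> z /negbTE zB; apply/eqP; rewrite -normr_le0.
by apply: (le_trans (HC s z st)); rewrite boxindE zB mulr0.
Qed.

Lemma tame_intg Q g : tame_family t B Q -> intg leb3 (fun p => win 0 t p * (g p * boxind B p.2)) ->
  intg leb3 (fun p => win 0 t p * (g p * Q p.1 p.2)).
Proof.
move=> [mQ [C C0 HC] _] ig.
have bd p : `|win 0 t p * (g p * Q p.1 p.2)| <= `|C * (win 0 t p * (g p * boxind B p.2))|.
  rewrite /win win1E; case: ifP => [/andP[p0 pt]|_]; last by rewrite !mul0r mulr0.
  have := HC p.1 p.2; rewrite p0 (ltW pt) => /(_ isT) h.
  rewrite !mul1r mulrCA !normrM ler_wpM2l// (le_trans h)//.
  by rewrite (gtr0_norm C0) ler_wpM2l ?(ltW C0)// ler_norm.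
apply: (@intg_le _ _ _ leb3 _ _ _ (intgZ C ig)) => //.
have -> : (fun p => win 0 t p * (g p * Q p.1 p.2)) = fun p => (win 0 t p * (g p * boxind B p.2)) *
    (if 0 <= p.1 <= t then Q p.1 p.2 else 0).
  apply/funext => p; rewrite /win win1E; case: ifP => [/andP[p0 pt]|_]; last by rewrite !mul0r.
  rewrite p0 (ltW pt) !mul1r boxindE; case: ifP => [_|/negbT zB]; first by rewrite mulr1.
  have := HC p.1 p.2; rewrite p0 (ltW pt) boxindE (negbTE zB) mulr0 => /(_ isT).
  by rewrite normr_le0 => /eqP ->; rewrite !mulr0.
by apply: measurable_funM; [exact: intg_meas ig|exact: mQ].
Qed.

Definition test_flux (p : R * (R * R)) := g0 p * P p.1 p.2 + g1 p * Px p.1 p.2 + g2 p * Py p.1 p.2.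

Lemma test_flux_intg : intg leb3 (fun p => win 0 t p * test_flux p).
Proof.
have [i0 i1 i2] := g_intg B t.
have := intgD (intgD (tame_intg tP i0) (tame_intg tPx i1)) (tame_intg tPy i2).
by congr intg; apply/funext => p; rewrite /test_flux; ring.
Qed.

Lemma test_dt_intg : intg leb3 (fun p => win 0 t p * (u p.1 p.2 * Pt p.1 p.2)).
Proof.
apply: tame_intg tPt _.
exact: (win_intgM (u_win t) (win_bsupp1 0 t (boxind_bsupp B))).
Qed.

Definition defect a b := ip leb2 (u b) (P b) - ip leb2 (u a) (P a)
  - Int leb3 (fun p => win a b p * (u p.1 p.2 * Pt p.1 p.2)) - Int leb3 (fun p => win a b p * test_flux p).

Lemma defectD a b c : 0 <= a -> a <= b -> b <= c -> c <= t -> defect a c = defect a b + defect b c.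
Proof.
move=> a0 ab bc ct; have b0 := le_trans a0 ab; have bt := le_trans bc ct.
have E (h : R * (R * R) -> R) : intg leb3 (fun p => win 0 t p * h p) ->
    Int leb3 (fun p => win a c p * h p) = Int leb3 (fun p => win a b p * h p) + Int leb3 (fun p => win b c p * h p).
  move=> ih; rewrite -(@IntD _ _ _ leb3 _ _ (win_sub a0 bt ih) (win_sub b0 ct ih)).
  by apply: eq_Int => p; rewrite /win (win1D p.1 ab bc) mulrDl.
rewrite /defect (E _ test_dt_intg) (E _ test_flux_intg).
move: (Int leb3 _) (Int leb3 _) (Int leb3 _) => a1 a2 a3; move: (Int leb3 _) => a4; ring.
Qed.

Lemma ip_boxind_bd : exists2 L, 0 <= L & forall s, 0 <= s <= t ->
  ip leb2 (fun z => `|u s z|) (boxind B) <= L.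
Proof.
have [A HA] := u_bd (ltW t0); have sb := bsupp_sq (boxind_bsupp B : bsupp B (boxind B)).
pose m := ip leb2 (boxind B) (boxind B : R * R -> R).
have m0 : 0 <= m by exact: ip_ge0.
have A0 : 0 <= A by apply: (le_trans (ip_ge0 leb2 (u 0))); apply: HA; rewrite lexx ltW.
exists (1 + A * m); first by rewrite addr_ge0 ?mulr_ge0.
move=> s st; have sa : sq leb2 (fun z => `|u s z|).
  apply: (@sq_le _ _ _ leb2 _ (u s)) => //; last by move=> z; rewrite normr_id.
  by apply: measurableT_comp => //; case: (u_sq s).
have h : ip leb2 (fun z => `|u s z|) (fun z => `|u s z|) <= A.
  apply: le_trans (HA s st); rewrite le_eqVlt; apply/orP; left; apply/eqP.
  by apply: eq_Int => z; rewrite -normrM -expr2 ger0_norm// sqr_ge0.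
have := cs_small sa sb h; rewrite -/m; move: (ip leb2 _ _) => x hx; nra.
Qed.

(* The slices of the time derivative need not have compact support in Omega;
   difference quotients of slices of the test function do. *)
Lemma comparison e : 0 < e -> exists C dl, [/\ 0 <= C, 0 < dl & forall a, 0 <= a <= t ->
  exists psi, [/\ Cc_infty Omega psi, [/\ bsupp B psi, bsupp B (dx psi) & bsupp B (dy psi)],
    forall z, [/\ `|psi z| <= C * boxind B z, `|dx psi z| <= C * boxind B z & `|dy psi z| <= C * boxind B z] &
    forall s, 0 <= s <= t -> `|s - a| < dl -> forall z, `|Pt s z - psi z| <= e * boxind B z]].
Proof.
move=> e0; have [sC sM _ _] := sl.
have [_ _ /(_ _ e0)[d d0 Hd]] := tPt.
have [_ [C0 C00 H0] _] := tP; have [_ [C1 C10 H1] _] := tPx; have [_ [C2 C20 H2] _] := tPy.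
pose l := Num.min 1 (d / (2 * t)).
have l0 : 0 < l by rewrite lt_min ltr01 divr_gt0// mulr_gt0.
have l1 : l <= 1 by rewrite ge_min lexx.
have lt : l * t <= d / 2.
  have : l <= d / (2 * t) by rewrite ge_min lexx orbT.
  by rewrite ler_pdivlMr ?mulr_gt0// => h; lra.
pose k := l * t / 3; have k0 : 0 < k by rewrite /k divr_gt0// mulr_gt0.
exists (k^-1 * (2 * (C0 + C1 + C2))), (d / 2); split; first by rewrite mulr_ge0 ?invr_ge0 ?(ltW k0)// mulr_ge0// !addr_ge0 ?ltW.
  by rewrite divr_gt0.
(* [s0] and [s1] are convex combinations of [a] with [t / 3] and [2 * t / 3]. They are interior
   times even when [a] is an end point, and they lie within [l * t <= d / 2] of [a]. *)
move=> a /andP[a0 at']; pose s0 := a + l * (t / 3 - a); pose s1 := s0 + k.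
have sk : s1 - s0 = k by rewrite /s1 addrC addKr.
have s0g : 0 < s0.
  have -> : s0 = (1 - l) * a + l * t / 3 by rewrite /s0; lra.
  by rewrite ltr_wpDl// mulr_ge0// subr_ge0.
have s1t : s1 < t.
  have -> : s1 = t - (1 - l) * (t - a) - l * t / 3 by rewrite /s1 /s0 /k; lra.
  have : 0 <= (1 - l) * (t - a) by rewrite mulr_ge0// subr_ge0.
  have := k0; rewrite /k; lra.
have s01 : s0 < s1 by rewrite -subr_gt0 sk.
have s0t : 0 < s0 < t by rewrite s0g (lt_trans s01).
have s1t' : 0 < s1 < t by rewrite s1t (lt_trans s0g).
have b0 : 0 <= s0 <= t by case/andP: s0t => /ltW -> /ltW ->.
have b1 : 0 <= s1 <= t by case/andP: s1t' => /ltW -> /ltW ->.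
have [D0 x0 y0] := sC s0 s0t; have [D1 x1 y1] := sC s1 s1t'.
have [M1 Q1] := Cc_dxy D1; have [M0 Q0] := Cc_dxy D0.
have := C1cZ k^-1 (C1cD (C1c_le (_ : M1 <= Num.max M0 M1) Q1) (C1c_le (_ : M0 <= Num.max M0 M1) (C1cZ (- 1) Q0))).
rewrite !le_max !lexx orbT => /(_ isT isT) /C1c_dx[E1 E2].
pose psi z := k^-1 * (P s1 z + (- 1) * P s0 z); exists psi.
have ex : dx psi = fun z => k^-1 * (Px s1 z + (- 1) * Px s0 z) by rewrite -x1 -x0 -E1.
have ey : dy psi = fun z => k^-1 * (Py s1 z + (- 1) * Py s0 z) by rewrite -y1 -y0 -E2.
have pD : Cc_infty Omega psi by apply: Cc_inftyZ; apply: Cc_inftyD => //; exact: Cc_inftyZ.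
have bd (Q : R -> R * R -> R) C : 0 < C -> C <= C0 + C1 + C2 ->
    (forall s z, 0 <= s <= t -> `|Q s z| <= C * boxind B z) ->
    forall z, `|k^-1 * (Q s1 z + (- 1) * Q s0 z)| <= k^-1 * (2 * (C0 + C1 + C2)) * boxind B z.
  move=> Cp CC HQ z; rewrite normrM ger0_norm ?invr_ge0 ?(ltW k0)// -mulrA ler_wpM2l ?invr_ge0 ?(ltW k0)//.
  rewrite mulN1r; apply: (le_trans (ler_normB _ _)).
  have := HQ s1 z b1; have := HQ s0 z b0.
  have : C * boxind B z <= (C0 + C1 + C2) * boxind B z.
    by apply: ler_wpM2r => //; rewrite boxindE; case: ifP.
  move: `|Q s1 z| `|Q s0 z| (C * boxind B z) => n1 n2 n3 h1 h2 h3; nra.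
have bs (Q : R -> R * R -> R) : tame_family t B Q -> bsupp B (fun z => k^-1 * (Q s1 z + (- 1) * Q s0 z)).
  move=> tQ; have [m1 [A1 h1] z1] := tame_bsupp tQ b1; have [m2 [A2 h2] z2] := tame_bsupp tQ b0; split.
  - by apply: measurable_funM => //; apply: measurable_funD => //; apply: measurable_funM.
  - exists (k^-1 * (A1 + A2)) => z; rewrite normrM ger0_norm ?invr_ge0 ?(ltW k0)// ler_wpM2l ?invr_ge0 ?(ltW k0)//.
    by rewrite mulN1r; apply: (le_trans (ler_normB _ _)); apply: lerD.
  - by move=> z zB; rewrite z1// z2// mulr0 addr0 mulr0.
split => //.
- by rewrite ex ey; split; exact: bs.
- move=> z; rewrite ex ey; split; [apply: (bd P C0)|apply: (bd Px C1)|apply: (bd Py C2)] => //; lra.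
move=> s st sa z; have [c /andP[c0 c1] E] := sM s0 s1 z (ltW s0g) s01 (ltW s1t).
have -> : psi z = Pt c z by rewrite /psi mulN1r E sk mulrCA mulVf ?mulr1// gt_eqF.
apply: Hd => //; first by rewrite (ltW (lt_trans s0g c0)) (ltW (lt_trans c1 s1t)).
have la : l * a <= l * t by rewrite ler_wpM2l// ltW.
have la0 : 0 <= l * a by rewrite mulr_ge0// ltW.
have e1 : s0 = a + l * t / 3 - l * a by rewrite /s0; lra.
have e2 : s1 = a + 2 * (l * t) / 3 - l * a by rewrite /s1 e1 /k; lra.
have lt0 : 0 < l * t by rewrite mulr_gt0.
move: sa; rewrite !ltr_norml => /andP[q1 q2]; apply/andP; split; lra.
Qed.

(* On a short interval the test function is frozen at an interior time and its
   time derivative is replaced by a difference quotient. *)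
Lemma defect_local : exists2 L, 0 <= L & forall e, 0 < e -> exists2 dl, 0 < dl &
  forall a b, 0 <= a -> a < b -> b <= t -> b - a <= dl ->
  `|defect a b| <= e * Gm B a b + (3 * L + 2) * e * (b - a).
Proof.
have [L L0 HL] := ip_boxind_bd; exists L => // e e0.
have [C [d1 [C0 d10 Hpsi]]] := comparison e0.
have [_ _ /(_ _ e0)[d2 d20 U2]] := tP; have [_ _ /(_ _ e0)[d3 d30 U3]] := tPx.
have [_ _ /(_ _ e0)[d4 d40 U4]] := tPy.
have C1 : 0 < C + 1 by lra.
(* [psi] is a difference quotient, so its bound [C] may be large. The interval is shortened after
   [C] is known, so that [C * Gm] is at most [e] and the pairing with [psi] hardly moves. *)
have [d5 d50 U5] := @Gm_ac _ _ _ _ g_intg B t (e / (C + 1)) (divr_gt0 e0 C1).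
have Ce : C * (e / (C + 1)) <= e.
  by rewrite mulrA ler_pdivrMr// mulrC ler_wpM2l ?(ltW e0)// lerDl.
pose m := Num.min (Num.min d1 d2) (Num.min (Num.min d3 d4) d5).
have m0 : 0 < m by rewrite !lt_min d10 d20 d30 d40 d50.
exists (m / 2); first by rewrite divr_gt0.
move=> a b a0 ab bt bam.
have bm : b - a < m by lra.
have [dd1 dd2 dd3 dd4 dd5] : [/\ b - a < d1, b - a < d2, b - a < d3, b - a < d4 & b - a < d5].
  by move: bm; rewrite !lt_min => /andP[/andP[? ?] /andP[/andP[? ?] ?]]; split.
have at' : 0 <= a <= t by rewrite a0 (le_trans (ltW ab)).
have bt' : 0 <= b <= t by rewrite (le_trans a0 (ltW ab)).
have [psi [pD [bp bpx bpy] hp hd]] := Hpsi a at'.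
pose c := (a + b) / 2.
have [ac cb] : a < c /\ c < b by rewrite /c; lra.
have ct : 0 < c < t by rewrite (le_lt_trans a0 ac) (lt_le_trans cb bt).
have ct' : 0 <= c <= t by case/andP: ct => /ltW -> /ltW ->.
have [sC sM _ _] := sl; have [cD cx cy] := sC c ct.
have bPc := tame_bsupp tP ct'.
have [iPc EPc] := u_eq a0 (ltW ab) cD bPc (eq_ind_r (bsupp B) (tame_bsupp tPx ct') cx) (eq_ind_r (bsupp B) (tame_bsupp tPy ct') cy).
have sQ (Q : R -> R * R -> R) s : tame_family t B Q -> 0 <= s <= t -> sq leb2 (Q s).
  by move=> tQ st; exact: bsupp_sq (tame_bsupp tQ st).
have sp : sq leb2 psi := bsupp_sq bp.
have ipB (h v w : R * R -> R) : sq leb2 h -> sq leb2 v -> sq leb2 w ->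
    ip leb2 h (fun z => v z - w z) = ip leb2 h v - ip leb2 h w.
  by move=> sh sv sw; rewrite ipC ipBl// (ipC leb2 v h) (ipC leb2 w h).
have ipZ (k : R) (h v : R * R -> R) : sq leb2 h -> sq leb2 v -> ip leb2 h (fun z => k * v z) = k * ip leb2 h v.
  by move=> sh sv; rewrite ipC ipZl// (ipC leb2 v h).
have near_psi s : a <= s -> s <= b -> `|ip leb2 (u s) psi - ip leb2 (u a) psi| <= e.
  move=> as' sb; have [ips ->] := u_eq a0 as' pD bp bpx bpy.
  apply: (@le_trans _ _ (C * Gm B a s)).
    by apply: (@flux_small _ _ _ _ g_intg B a s C _ (fun p => psi p.2) (fun p => dx psi p.2) (fun p => dy psi p.2)) => //.
  apply: le_trans Ce; apply: ler_wpM2l => //; apply: U5 => //; first exact: le_trans sb bt.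
  by apply: ltW; apply: le_lt_trans dd5; rewrite lerD2r.
have bsD (v w : R * R -> R) : bsupp B v -> bsupp B w -> bsupp B (fun z => v z - w z).
  move=> [mv [A1 h1] z1] [mw [A2 h2] z2]; split; first exact: measurable_funB.
    by exists (A1 + A2) => z; apply: (le_trans (ler_normB _ _)); exact: lerD.
  by move=> z zB; rewrite z1// z2// subrr.
have step s r s' : 0 <= s' <= t -> a <= s -> s < r -> r <= b ->
    `|ip leb2 (u s') (P r) - ip leb2 (u s') (P s) - (r - s) * ip leb2 (u s') psi| <= (r - s) * (e * L).
  move=> st as' sr rb; have rs0 : 0 <= r - s by rewrite subr_ge0 ltW.
  have rt : 0 <= r <= t by rewrite (le_trans a0 (le_trans as' (ltW sr))) (le_trans rb bt).
  have s0t : 0 <= s <= t by rewrite (le_trans a0 as') (le_trans (ltW sr) (le_trans rb bt)).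
  have bz : bsupp B (fun z => (r - s) * psi z).
    have [mp [A1 h1] z1] := bp; split; first exact: measurable_funM.
      by exists ((r - s) * A1) => z; rewrite normrM ger0_norm// ler_wpM2l.
    by move=> z zB; rewrite z1// mulr0.
  have bw := bsD _ _ (bsD _ _ (tame_bsupp tP rt) (tame_bsupp tP s0t)) bz.
  have -> : ip leb2 (u s') (P r) - ip leb2 (u s') (P s) - (r - s) * ip leb2 (u s') psi =
      ip leb2 (u s') (fun z => P r z - P s z - (r - s) * psi z).
    have h1 := sQ P r tP rt; have h2 := sQ P s tP s0t.
    by rewrite (ipB _ _ _ (u_sq s') (sqB h1 h2) (sqZ _ sp)) (ipB _ _ _ (u_sq s') h1 h2) ipZ.
  have hw z : `|P r z - P s z - (r - s) * psi z| <= (r - s) * e.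
    have [x /andP[sx xr] ->] := sM s r z (le_trans a0 as') sr (le_trans rb bt).
    rewrite [_ * (r - s)]mulrC -mulrBr normrM (ger0_norm rs0) ler_wpM2l//.
    apply: (@le_trans _ _ (e * boxind B z)).
      apply: hd; first by apply/andP; split; [apply: le_trans (ltW sx); exact: le_trans as'|apply: le_trans bt; apply: le_trans rb; exact: ltW].
      apply: (@dist_lt _ a x b) => //; last exact: le_trans (ltW xr) rb.
      exact: le_trans (ltW sx).
    by rewrite boxindE; case: ifP; rewrite ?mulr1// mulr0 ltW.
  apply: (le_trans (ip_box (u_sq s') bw hw)); rewrite -mulrA ler_wpM2l// ler_wpM2l ?(ltW e0)//.
  exact: HL.
have i2 := win_sub a0 bt test_dt_intg; have i3 := win_sub a0 bt test_flux_intg.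
have T1 : `|ip leb2 (u b) (P c) - ip leb2 (u a) (P c) - Int leb3 (fun p => win a b p * test_flux p)| <= e * Gm B a b.
  have iD : intg leb3 (fun p => win a b p * (flux_form g0 g1 g2 (P c) p - test_flux p)).
    by have := intgB iPc i3; congr intg; apply/funext => p; rewrite mulrBr.
  have -> : ip leb2 (u b) (P c) - ip leb2 (u a) (P c) - Int leb3 (fun p => win a b p * test_flux p) =
      Int leb3 (fun p => win a b p * (flux_form g0 g1 g2 (P c) p - test_flux p)).
    by rewrite EPc -(@IntB _ _ _ leb3 _ _ iPc i3); apply: eq_Int => p; rewrite mulrBr.
  apply: (@flux_small _ _ _ _ g_intg B a b e _ (fun p => P c p.2 - P p.1 p.2)
     (fun p => Px c p.2 - Px p.1 p.2) (fun p => Py c p.2 - Py p.1 p.2)) => //; first exact: ltW.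
    by move=> p _; rewrite /flux_form /test_flux cx cy; ring.
  move=> p /andP[ap pb]; have pt : 0 <= p.1 <= t by rewrite (le_trans a0 ap) (le_trans (ltW pb)).
  have cp d : b - a < d -> `|c - p.1| < d by exact: dist_mid.
  by split; [apply: U2|apply: U3|apply: U4] => //; exact: cp.
have T5 : `|Int leb3 (fun p => win a b p * (u p.1 p.2 * Pt p.1 p.2)) - (b - a) * ip leb2 (u a) psi| <= (b - a) * (e * L + e).
  have [ih ->] := win_fubini i2.
  have ic (k : R) : intg leb1 (fun s => win1 a b s * k).
    by have := intgZ k (intg_win1 a b); congr intg; apply/funext => s; rewrite mulrC.
  have Ic (k : R) : Int leb1 (fun s => win1 a b s * k) = (b - a) * k.
    rewrite -(Int_win1 (ltW ab)) mulrC -(IntZ k (intg_win1 a b)).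
    by apply: eq_Int => s; rewrite mulrC.
  rewrite -Ic -(@IntB _ _ _ leb1 _ _ ih (ic _)).
  apply: (le_trans (Int_norm (intgB ih (ic _)))); rewrite -Ic.
  apply: (@Int_le _ _ _ leb1); [exact: intg_norm (intgB ih (ic _))|exact: ic|move=> s].
  rewrite -mulrBr normrM win1E; case: ifP => [/andP[as' sb]|_]; last by rewrite normr0 !mul0r.
  rewrite normr1 !mul1r; have st : 0 <= s <= t by rewrite (le_trans a0 as') (le_trans (ltW sb)).
  rewrite -(subrKA (ip leb2 (u s) psi)); apply: (le_trans (ler_normD _ _)); apply: lerD; last exact: near_psi (ltW sb).
  have sPt := sQ Pt s tPt st.
  rewrite -[Int _ _]/(ip leb2 (u s) (Pt s)) -(ipB _ _ _ (u_sq s) sPt sp).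
  have bw := bsD _ _ (tame_bsupp tPt st) bp.
  apply: (@le_trans _ _ (e * ip leb2 (fun z => `|u s z|) (boxind B))); last by rewrite ler_wpM2l ?(ltW e0)//; exact: HL.
  apply: (ip_box (u_sq s) bw) => z; apply: (@le_trans _ _ (e * boxind B z)).
    by apply: hd => //; exact: (@dist_lt _ a s b) as' (ltW sb) dd1.
  by rewrite boxindE; case: ifP; rewrite ?mulr1// mulr0 ltW.
have T2 := step c b b bt' (ltW ac) cb (lexx b).
have T3 := step a c a at' (lexx a) ac (ltW cb).
have T4 : `|(b - c) * (ip leb2 (u b) psi - ip leb2 (u a) psi)| <= (b - a) * e.
  have bc0 : 0 <= b - c by rewrite subr_ge0 ltW.
  rewrite normrM ger0_norm//; apply: ler_pM => //; last exact: near_psi (ltW ab) (lexx b).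
  by rewrite lerD2l lerN2 ltW.
(* The pieces are: the equation for the slice frozen at [c], with the flux of the moving slice; the
   increments of the slice from [c] to [b] and from [a] to [c], with [psi] as time derivative; the
   change of the pairing with [psi] between [a] and [b]; and the integral of [u Pt] against its
   frozen value. *)
have -> : defect a b = (ip leb2 (u b) (P c) - ip leb2 (u a) (P c) - Int leb3 (fun p => win a b p * test_flux p))
   + (ip leb2 (u b) (P b) - ip leb2 (u b) (P c) - (b - c) * ip leb2 (u b) psi)
   + (ip leb2 (u a) (P c) - ip leb2 (u a) (P a) - (c - a) * ip leb2 (u a) psi)
   + ((b - c) * (ip leb2 (u b) psi - ip leb2 (u a) psi))
   - (Int leb3 (fun p => win a b p * (u p.1 p.2 * Pt p.1 p.2)) - (b - a) * ip leb2 (u a) psi).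
  rewrite /defect; move: (Int leb3 _) (Int leb3 _) => I1 I2.
  move: (ip leb2 (u b) (P b)) (ip leb2 (u b) (P c)) (ip leb2 (u b) psi) (ip leb2 (u a) psi) (ip leb2 (u a) (P c)) (ip leb2 (u a) (P a)) => *; ring.
have eL : 0 <= e * L by rewrite mulr_ge0// ltW.
apply: add_le4 => //.
- by apply: (le_trans T2); apply: ler_wpM2r => //; rewrite lerD2l lerN2 ltW.
- by apply: (le_trans T3); apply: ler_wpM2r => //; rewrite lerD2r ltW.
Qed.

(** The interval is divided into [N] equal parts. The local errors add up to at most [e * W], where
    [W] does not depend on the subdivision and [e] is arbitrary. *)
Lemma defect_eq0 : defect 0 t = 0.
Proof.
have [L L0 HL] := defect_local.
pose W := Gm B 0 t + (3 * L + 2) * t.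
have W0 : 0 <= W by rewrite addr_ge0 ?Gm_ge0// mulr_ge0 ?(ltW t0)//; lra.
suff H e : 0 < e -> `|defect 0 t| <= e * W.
  apply/eqP; rewrite -normr_le0; apply/ler_addgt0Pr => e e0; rewrite add0r.
  have W1 : 0 < W + 1 by lra.
  apply: (le_trans (H _ (divr_gt0 e0 W1))).
  by rewrite mulrAC ler_pdivrMr// ler_wpM2l ?(ltW e0)// lerDl.
move=> e0; have [dl d0 Hd] := HL e e0.
have [N0 hN] := nat_above (t / dl); pose N := N0.+1.
have NR : (0 : R) < N%:R by rewrite ltr0n.
pose h := t / N%:R; have h0 : 0 < h by rewrite divr_gt0.
have hd : h <= dl.
  rewrite /h ler_pdivrMr// mulrC -ler_pdivrMr//; apply: (le_trans hN).
  by rewrite ler_nat /N.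
have tE : t = N%:R * h by rewrite /h mulrCA mulfV ?mulr1// gt_eqF.
have key k : (k <= N)%N -> `|defect 0 (k%:R * h)| <= e * Gm B 0 (k%:R * h) + (3 * L + 2) * e * (k%:R * h).
  elim: k => [_|k IH kN].
    rewrite mul0r /defect subrr sub0r; have w0 (w : R * (R * R) -> R) : Int leb3 (fun p => win 0 0 p * w p) = 0.
      rewrite -[RHS](Int0 leb3); apply: eq_Int => p; rewrite /win win1E; case: ifP; last by rewrite mul0r.
      by move=> /andP[p0]; rewrite ltNge p0.
    by rewrite /Gm !w0 !oppr0 !addr0 normr0 !mulr0 addr0.
  have k1 : k.+1%:R * h = k%:R * h + h by rewrite -[k.+1]addn1 natrD mulrDl mul1r.
  have q0 : 0 <= k%:R * h by rewrite mulr_ge0// ltW.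
  have q1 : k%:R * h < k.+1%:R * h by rewrite k1 ltrDl.
  have q2 : k.+1%:R * h <= t by rewrite tE ler_wpM2r ?(ltW h0)// ler_nat.
  rewrite (defectD (lexx 0) q0 (ltW q1) q2) (GmD g_intg B (lexx 0) q0 (ltW q1)).
  have hh : k.+1%:R * h - k%:R * h = h by rewrite k1 addrC addKr.
  have := Hd _ _ q0 q1 q2; rewrite hh => /(_ hd) h1; have h2 := IH (ltnW kN).
  apply: (le_trans (ler_normD _ _)); rewrite k1 in h1 *; move: h1 h2.
  move: `|_| `|_| (Gm B _ _) (Gm B _ _) => n1 n2 G1 G2 h1 h2.
  by apply: le_trans (lerD h2 h1) _; rewrite le_eqVlt; apply/orP; left; apply/eqP; ring.
have := key N (leqnn N); rewrite -tE /W => /le_trans; apply.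
by rewrite le_eqVlt; apply/orP; left; apply/eqP; ring.
Qed.

End TestArgument.

(** * Norms and integrals of the statement *)

Section Conversions.
Context (R : realType).

Lemma Lnorm_sq d (X : measurableType d) (m : {measure set X -> \bar R}) (h : X -> R) : sq m h ->
  ('N[m]_2%:E[EFin \o h] = (Num.sqrt (ip m h h))%:E)%E.
Proof.
move=> [mh ih]; rewrite unlock.
have -> : (\int[m]_x `|(EFin \o h) x| `^ 2 = (ip m h h)%:E)%E.
  rewrite /ip /Int /Rintegral fineK.
    apply: eq_integral => x _ /=; congr EFin.
    have -> : `|h x| `^ 2 = `|h x| ^+ 2 by exact: (powR_mulrn 2 (normr_ge0 _)).
    by rewrite real_normK ?num_real// expr2.
  under eq_integral do rewrite -expr2.
  exact: integrable_fin_num ih.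
by rewrite poweR_EFin powR12_sqrt// ip_ge0.
Qed.

Lemma Lfun_sq d (X : measurableType d) (m : {measure set X -> \bar R}) (h : X -> R) :
  h \in Lfun m 2%:E <-> sq m h.
Proof.
split=> [hL|sh].
  split; last exact: Lfun2_integrable_sqr.
  by have := sub_Lfun_mfun hL; rewrite inE.
have [mh _] := sh; rewrite inE; apply/andP; split; first by rewrite inE.
by rewrite inE /finite_norm/= Lnorm_sq// ltry.
Qed.

Lemma restrict_id (h : R * R -> R) : (forall z, ~ Omega z -> h z = 0) -> h \_ Omega = h.
Proof.
move=> h0; apply/funext => z; rewrite patchE; case: ifP => // /negbT zO.
by rewrite h0// => zO'; move: zO; rewrite mem_set.
Qed.

Lemma L2_sq (h : R * R -> R) : sq leb2 h -> (forall z, ~ Omega z -> h z = 0) -> L2 h.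
Proof. by move=> sh /restrict_id h0; rewrite /L2 h0; exact/Lfun_sq. Qed.

Lemma L2normE (h : R * R -> R) : sq leb2 h -> (forall z, ~ Omega z -> h z = 0) ->
  L2norm h = (Num.sqrt (ip leb2 h h))%:E.
Proof. by move=> sh /restrict_id h0; rewrite /L2norm h0 Lnorm_sq. Qed.

Lemma L2norm_lt (h : R * R -> R) e : 0 < e -> sq leb2 h -> (forall z, ~ Omega z -> h z = 0) ->
  ip leb2 h h < e ^+ 2 -> (L2norm h < e%:E)%E.
Proof.
move=> e0 sh h0 he; rewrite L2normE// lte_fin.
have <- : Num.sqrt (e ^+ 2) = e by rewrite sqrtr_sqr gtr0_norm.
by rewrite ltr_sqrt// exprn_gt0.
Qed.

Lemma Rint_Omega (F G : R * R -> R) : (forall z, Omega z -> F z = G z) -> (forall z, ~ Omega z -> G z = 0) ->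
  \int[leb2]_(z in Omega) F z = Int leb2 G.
Proof.
move=> FG G0; rewrite Rintegral_mkcond; apply: eq_Int => z; rewrite patchE.
case: ifP => [|/negbT zO]; first by rewrite inE => /FG.
by rewrite G0// => zO'; move: zO; rewrite mem_set.
Qed.

Lemma Rint_time (H : R -> R * R -> R) (G : R * (R * R) -> R) t : intg leb3 (fun p => win 0 t p * G p) ->
  (forall s z, 0 < s < t -> Omega z -> H s z = G (s, z)) ->
  (forall s z, 0 < s < t -> ~ Omega z -> G (s, z) = 0) ->
  \int[leb1]_(s in `]0, t[) \int[leb2]_(z in Omega) H s z = Int leb3 (fun p => win 0 t p * G p).
Proof.
move=> iG HG G0; have [ih ->] := win_fubini iG; pose h s := Int leb2 (fun z => G (s, z)).
have E : (fun s => win1 0 t s * h s) = h \_ `[0, t[%classic.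
  apply/funext => s; rewrite win1E patchE mem_setE in_itv/=.
  by case: ifP; rewrite ?mul1r ?mul0r.
have mI : leb1.-integrable `[0, t[%classic (EFin \o h).
  by apply/integrable_mkcond => //; move: ih; rewrite E /intg -restrict_EFin.
rewrite -/(h _) (_ : Int leb1 _ = \int[leb1]_(s in `[0, t[) h s); last by rewrite Rintegral_mkcond -E.
have mJ : leb1.-integrable `]0, t[%classic (EFin \o h).
  apply: integrableS mI => //; by apply: subset_itv; rewrite bnd_simp.
rewrite -(@Rintegral_itv_obnd_cbnd R 0 (BLeft t) h)//.
apply: eq_Rintegral => s; rewrite inE/= in_itv/= => st.
by apply: Rint_Omega => z zO; [exact: HG|exact: G0].
Qed.

Lemma L2L2_sq t (w : R -> R * R -> R) : sq leb3 (fun p => win 0 t p * w p.1 p.2) ->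
  (forall s z, ~ Omega z -> w s z = 0) -> L2L2 t w.
Proof.
move=> sw w0; apply/Lfun_sq.
have mI : measurable_fun setT (fun p : R * (R * R) => \1_(`]0, t[%classic : set R) p.1 : R).
  by apply: measurableT_comp; [exact: measurable_indic|exact: measurable_fst].
have b1 p : `|\1_(`]0, t[%classic : set R) (p : R * (R * R)).1 : R| <= 1.
  by rewrite indicE; case: (_ \in _); rewrite ?normr1 ?normr0.
have := @sqM_bounded _ _ _ leb3 1 _ _ mI sw b1; congr sq; apply/funext => -[s z] /=.
rewrite indicE mem_setE in_itv/= patchE; have [zO|zO] := pselect (Omega z); last first.
  by rewrite w0// mulr0 mul0r; case: ifP.
case: (boolP (0 < s < t)) => [st|/negbTE st].
  rewrite mem_set; last by split => //; rewrite /= in_itv.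
  by rewrite /win win1E; case/andP: st => /ltW -> ->; rewrite mul1r mulr1.
by rewrite mulr0 memNset// => -[/=]; rewrite in_itv/= st.
Qed.

Lemma LooL2_bound t A (w : R -> R * R -> R) : (forall s, sq leb2 (w s)) ->
  (forall s z, ~ Omega z -> w s z = 0) -> (forall s, 0 < s < t -> ip leb2 (w s) (w s) <= A) ->
  ('N[leb1]_+oo[(fun tau => L2norm (w tau)) \_ `]0%R, t[] < +oo)%E.
Proof.
move=> sw w0 wA; rewrite unlock; case: ifP => // _.
apply: (@le_lt_trans _ _ (Num.sqrt `|A|)%:E); last exact: ltry.
apply/ess_sup_inf.ess_supP/aeW => s /=; rewrite patchE; case: ifP => [|_]; last by rewrite abse0 lee_fin sqrtr_ge0.
rewrite inE/= in_itv/= => st; rewrite (L2normE (sw s) (w0 s)) gee0_abs ?lee_fin ?sqrtr_ge0//.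
by rewrite ler_sqrt ?normr_ge0// (le_trans (wA s st))// ler_norm.
Qed.

Lemma orthogonality_limit (p q a b : R * R -> R) : sq leb2 p -> sq leb2 q -> sq leb2 a -> sq leb2 b ->
  (forall e, 0 < e -> exists v w : R * R -> R, [/\ sq leb2 v, sq leb2 w, ip leb2 v a + ip leb2 w b = 0,
     ip leb2 (fun z => v z - p z) (fun z => v z - p z) <= e & ip leb2 (fun z => w z - q z) (fun z => w z - q z) <= e]) ->
  ip leb2 p a + ip leb2 q b = 0.
Proof.
move=> sp sq' sa sb H; set A := ip leb2 a a; set B := ip leb2 b b.
have A0 : 0 <= A by exact: ip_ge0.
have B0 : 0 <= B by exact: ip_ge0.
have e4 : forall x y e : R, x ^+ 2 <= A * e -> y ^+ 2 <= B * e -> (x + y) ^+ 2 <= 2 * (A + B) * e.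
  move=> x y e hx hy; have := sqr_ge0 (x - y); nra.
apply: (@sqr_le_small_eq0 R _ (2 * (A + B))); first by rewrite mulr_ge0// addr_ge0.
move=> e e0; have [v [w [sv sw E hv hw]]] := H e e0.
have h1 := cs_small (sqB sv sp) sa hv; have h2 := cs_small (sqB sw sq') sb hw.
have := e4 _ _ _ h1 h2; rewrite (ipBl sv sp sa) (ipBl sw sq' sb) -sqrrN.
by congr (_ ^+ 2 <= _); rewrite -[RHS]subr0 -E; ring.
Qed.

(** The approximating test functions serve twice: integration by parts passes to the limit and gives
    the weak gradient, and they witness membership in the closure of the test functions. *)
Lemma H10_approx (a ax ay : R * R -> R) : sq leb2 a -> sq leb2 ax -> sq leb2 ay ->
  (forall z, ~ Omega z -> [/\ a z = 0, ax z = 0 & ay z = 0]) ->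
  (forall e, 0 < e -> exists2 v, Cc_infty Omega v &
     [/\ ip leb2 (fun z => v z - a z) (fun z => v z - a z) <= e,
        ip leb2 (fun z => dx v z - ax z) (fun z => dx v z - ax z) <= e &
        ip leb2 (fun z => dy v z - ay z) (fun z => dy v z - ay z) <= e]) -> H10 a ax ay.
Proof.
move=> s0 s1 s2 out H.
have o0 z : ~ Omega z -> a z = 0 by case/out.
have o1 z : ~ Omega z -> ax z = 0 by case/out.
have o2 z : ~ Omega z -> ay z = 0 by case/out.
have weak (w : R * R) (g : R * R -> R) : sq leb2 g -> (forall z, ~ Omega z -> g z = 0) ->
    (forall psi, Cc_infty Omega psi -> sq leb2 ('D_w psi)) ->
    (forall e, 0 < e -> exists2 v, Cc_infty Omega v & [/\ ip leb2 (fun z => v z - a z) (fun z => v z - a z) <= e &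
       ip leb2 (fun z => 'D_w v z - g z) (fun z => 'D_w v z - g z) <= e]) ->
    (forall v psi, Cc_infty Omega v -> Cc_infty Omega psi -> ip leb2 v ('D_w psi) + ip leb2 ('D_w v) psi = 0) ->
    weak_derivative w a g.
  move=> sg g0 sD Hw parts psi pD; have [sp _ _] := Cc_sq pD; have sdp := sD _ pD.
  rewrite (@Rint_Omega _ (fun z => a z * 'D_w psi z))//; last by move=> z zO; rewrite o0// mul0r.
  rewrite (@Rint_Omega _ (fun z => g z * psi z))//; last by move=> z zO; rewrite g0// mul0r.
  apply/eqP; rewrite -addr_eq0; apply/eqP; apply: orthogonality_limit => // e e0.
  have [v vD [h1 h2]] := Hw e e0; have [sv _ _] := Cc_sq vD.
  by exists v, ('D_w v); split => //; [exact: sD|exact: parts].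
have parts (v psi : R * R -> R) : Cc_infty Omega v -> Cc_infty Omega psi ->
    ip leb2 v (dx psi) + ip leb2 (dx v) psi = 0 /\ ip leb2 v (dy psi) + ip leb2 (dy v) psi = 0.
  move=> vD pD; have [M vC] := Cc_dxy vD; have [N pC] := Cc_dxy pD; have C := C1cM vC pC.
  have [v0 v1 v2] := Cc_sq vD; have [p0 p1 p2] := Cc_sq pD.
  have ID (h k l m : R * R -> R) : sq leb2 h -> sq leb2 k -> sq leb2 l -> sq leb2 m ->
      ip leb2 h k + ip leb2 l m = Int leb2 (fun z => h z * k z + l z * m z).
    by move=> sh sk sl sm; rewrite (IntD (intgM sh sk) (intgM sl sm)).
  split; first by rewrite (ID v (dx psi) (dx v) psi)//; exact: Int_C1c_x C.
  by rewrite (ID v (dy psi) (dy v) psi)//; exact: Int_C1c_y C.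
have w1 : weak_derivative (1, 0) a ax.
  apply: weak => //; first by move=> psi /Cc_sq[_ h _].
    by move=> e /H[v vD [h0 h1 _]]; exists v.
  by move=> v psi vD pD; exact: (proj1 (parts v psi vD pD)).
have w2 : weak_derivative (0, 1) a ay.
  apply: weak => //; first by move=> psi /Cc_sq[_ _ h].
    by move=> e /H[v vD [h0 _ h2]]; exists v.
  by move=> v psi vD pD; exact: (proj2 (parts v psi vD pD)).
split; first exact: (And5 (L2_sq s0 o0) (L2_sq s1 o1) (L2_sq s2 o2) w1 w2).
move=> e e0; have e2 : 0 < e ^+ 2 / 2 by rewrite divr_gt0// exprn_gt0.
have [v vD [h0 h1 h2]] := H _ e2; exists v; have [v0 v1 v2] := Cc_sq vD.
have lt2 : e ^+ 2 / 2 < e ^+ 2 by rewrite ltr_pdivrMr// ltr_pMr ?exprn_gt0// ltr1n.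
have [M vC] := Cc_dxy vD; have [_ _ _ _ vz] := vC.
have vout z : ~ Omega z -> [/\ v z = 0, dx v z = 0 & dy v z = 0].
  by move=> zO; apply: vz; apply/negP => /andP[_].
split => //.
- apply: L2norm_lt => //; [exact: sqB|by move=> z zO; have [-> _ _] := vout z zO; rewrite o0// subr0|exact: le_lt_trans lt2].
- apply: L2norm_lt => //; [exact: (sqB v1 s1)|by move=> z zO; have [_ E _] := vout z zO; rewrite -[LHS]/(dx v z - ax z) E o1// subr0|exact: le_lt_trans lt2].
- apply: L2norm_lt => //; [exact: (sqB v2 s2)|by move=> z zO; have [_ _ E] := vout z zO; rewrite -[LHS]/(dy v z - ay z) E o2// subr0|exact: le_lt_trans lt2].
Qed.

End Conversions.

Lemma dist_max0 (R : realType) (t s d : R) : `|t - s| <= d -> `|Num.max 0 t - Num.max 0 s| <= d.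
Proof.
rewrite !ler_norml => /andP[? ?].
by case: (leP 0 t) => ?; case: (leP 0 s) => ?; apply/andP; split; lra.
Qed.

(** * The limit of the approximations and its properties *)

Section Existence.
Context (R : realType).
Variables (mu alpha beta gamma : R).
Hypotheses (hmu : 0 < mu) (gammaE : gamma = 1 + alpha + beta ^+ 2 / (2 * mu)) (hgamma : 0 < gamma).
Variables (K : R * (R * R) -> R) (v0 : R * R -> R).
Hypotheses (sK : forall b, sq leb3 (fun p => win 0 b p * K p)) (sv0 : sq leb2 v0).

Lemma limit_solution : exists (u : R -> R * R -> R) (ux uy : R * (R * R) -> R),
  [/\ [/\ forall t, sq leb2 (u t), forall t z, ~ Omega z -> u t z = 0,
        measurable_fun setT (fun p : R * (R * R) => u p.1 p.2),
        forall T, [/\ sq leb3 (fun p => win 0 T p * u p.1 p.2), sq leb3 (fun p => win 0 T p * ux p) &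
          sq leb3 (fun p => win 0 T p * uy p)] &
        forall p, ~ Omega p.2 -> ux p = 0 /\ uy p = 0],
    forall T, 0 <= T -> exists A, forall s, 0 <= s <= T -> ip leb2 (u s) (u s) <= A,
    {ae leb1, forall t, 0 <= t -> H10 (u t) (fun z => ux (t, z)) (fun z => uy (t, z))},
    [/\ forall M T, [/\ intg leb3 (fun p => win 0 T p * (g0 u ux alpha beta K p * boxind M p.2)),
          intg leb3 (fun p => win 0 T p * (g1 ux mu p * boxind M p.2)) &
          intg leb3 (fun p => win 0 T p * (g2 u ux uy mu p * boxind M p.2))],
      forall v t, 0 <= t -> Cc_infty Omega v -> ip leb2 (u t) v - ip leb2 v0 v =
        Int leb3 (fun p => win 0 t p * flux_form (g0 u ux alpha beta K) (g1 ux mu) (g2 u ux uy mu) v p) &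
      forall v s t M, 0 <= s -> s <= t -> Cc_infty Omega v -> bsupp M v -> bsupp M (dx v) -> bsupp M (dy v) ->
        intg leb3 (fun p => win s t p * flux_form (g0 u ux alpha beta K) (g1 ux mu) (g2 u ux uy mu) v p) /\
        ip leb2 (u t) v - ip leb2 (u s) v =
        Int leb3 (fun p => win s t p * flux_form (g0 u ux alpha beta K) (g1 ux mu) (g2 u ux uy mu) v p)] &
    (forall T, intg leb3 (fun p => win 0 T p * energy_density u ux uy mu gamma p)) /\
    forall t, 0 < t -> expR (- (2 * gamma * t)) * ip leb2 (u t) (u t)
      + Int leb3 (fun p => win 0 t p * energy_density u ux uy mu gamma p) <= E0 v0 + kh K 0 t].
Proof.
have [f [fD f_orth f_norm f_dense]] := orthonormal_basis R.
have [FF [UF Foo]] := ultraFilterLemma (eventually_filter : ProperFilter \oo).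
have PF : ProperFilter FF by exact: ultra_proper.
have [U [y [Ulin [Ui Usq] Ub Uen [Uy yH y0 Ueq]]]] :=
  approximation hmu gammaE hgamma fD f_orth f_norm sK sv0 UF Foo.
have UD n t : Cc_infty Omega (U n t) by have [c ->] := Ulin n t; exact: lin_Cc.
(* The coefficients are continued to negative times by their initial value, so that they are
   continuous, hence measurable, on the whole line. *)
pose a (t : R) i := y (Num.max 0 t) i.
have ma i : measurable_fun setT (fun t => a t i).
  apply: continuous_measurable_fun => t; apply/cvgrPdist_le => e e0.
  have [L L0 HL] := yH i (Num.max 0 t + 1).
  have L1 : 0 < L + 1 by lra.
  pose dl := Num.min 1 (e ^+ 2 / (L + 1)).
  have d0 : 0 < dl by rewrite lt_min ltr01 divr_gt0// exprn_gt0.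
  have key (s r : R) : 0 <= s -> s <= r -> r <= Num.max 0 t + 1 -> r - s <= dl -> `|y r i - y s i| <= e.
    move=> s0 sr rT rs; apply: norm_le_sqr; first exact: ltW.
    apply: (le_trans (HL s r s0 sr rT)); apply: (@le_trans _ _ (L * (e ^+ 2 / (L + 1)))).
      by apply: ler_wpM2l => //; apply: (le_trans rs); rewrite ge_min lexx orbT.
    by rewrite mulrA ler_pdivrMr// mulrC ler_wpM2l ?sqr_ge0// lerDl.
  near=> s; have st : `|t - s| <= dl by near: s; exists dl => // r; exact: ltW.
  have d1 : dl <= 1 by rewrite ge_min lexx.
  have [h1 h2 h3] : [/\ 0 <= Num.max 0 t, 0 <= Num.max 0 s & `|Num.max 0 t - Num.max 0 s| <= dl].
    by split; rewrite ?le_max ?lexx//; exact: dist_max0.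
  rewrite /a; move: h3; rewrite ler_norml => /andP[h3 h4].
  case: (leP (Num.max 0 s) (Num.max 0 t)) => [le|/ltW le]; first by apply: key => //; lra.
  by rewrite distrC; apply: key => //; lra.
have az t i : f i = (fun=> 0) -> a t i = 0.
  move=> fi; apply/eqP; rewrite -normr_le0; apply/ler_addgt0Pr => e e0.
  have [n /= Hn] := filter_ex (Uy i (Num.max 0 t) e e0).
  have := Hn (Num.max 0 t); rewrite le_max !lexx => /(_ isT).
  rewrite fi (_ : ip _ _ _ = 0); first by rewrite sub0r normrN add0r.
  by rewrite -[RHS](Int0 leb2); apply: eq_Int => z; rewrite mulr0.
have aB t : exists B : R, forall n, \sum_(i < n) a t i ^+ 2 <= B.
  have t0 : 0 <= Num.max 0 t by rewrite le_max lexx.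
  have [A A0 HA] := Ub _ t0; exists (A + 1) => n.
  have [k /= h] := filter_ex (y_liminf fD f_orth f_norm UF Ulin Uy n t0 ltr01).
  apply: (le_trans h); rewrite lerD2r; have [+ _] := HA k; apply.
  by rewrite t0 lexx.
have [u [u_meas u_sq u_a u_sp u_out]] := riesz_fischer fD f_orth f_norm ma az aB.
have aE t : 0 <= t -> a t = y t by move=> t0; apply/funext => i; rewrite /a max_r.
have u_f t i : 0 <= t -> ip leb2 (u t) (f i) = y t i by move=> t0; rewrite u_a aE.
have u_span (t e : R) : 0 <= t -> 0 < e -> exists N, let d z := u t z - lin N (y t) f z in ip leb2 d d <= e.
  by move=> t0 e0; have [N h] := u_sp t e e0; exists N; rewrite -(aE t t0).
have Ub' T : 0 <= T -> exists2 A, 0 <= A & forall n,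
    Int leb1 (fun t => win1 0 T t * (E0 (U n t) + E1 (U n t))) <= A.
  by move=> T0; have [A A0 HA] := Ub T T0; exists A => // n; exact: (proj2 (HA n)).
have [ub [ux [uy [uxy_meas uxy_sq uxy_out ub_hull]]]] := weak_limit UD Usq Ub' Ui UF.
have Uen' (s t e : R) : s < t -> 0 < e -> 0 <= s -> FF [set n |
      expR (- (2 * gamma * t)) * E0 (U n t)
      + Int leb1 (fun r => win1 0 s r * (expR (- (2 * gamma * r)) * (mu * E1 (U n r) + E0 (U n r))))
      <= E0 v0 + kh K 0 t + e] by move=> st e0 s0; exact: Uen.
exists u, ux, uy; split.
- split => //; last by move=> p /uxy_out[_ h1 h2].
  move=> T; have [_ h1 h2] := uxy_sq T.
  exact: (And3 (u_win fD UF Ulin Usq Uy u_meas u_sq u_f u_span uxy_meas uxy_sq ub_hull T) h1 h2).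
- move=> T T0; have [A _ HA] := y_sum fD f_orth f_norm UF Ulin Ub Uy u_sq u_f u_span T0.
  by exists A => s /HA[_].
- have := ae_limit fD UF Ulin Usq Uy u_sq u_f u_span uxy_sq ub_hull.
  apply: ae_imp => t H t0; have [_ s1 s2 _ h] := H t0.
  apply: H10_approx => // z zO; split; first exact: u_out.
    by have [_ -> _] := uxy_out (t, z) zO.
  by have [_ _ ->] := uxy_out (t, z) zO.
- split.
  + exact: (g_intg fD UF Ulin Usq Uy u_meas u_sq u_f u_span uxy_meas uxy_sq ub_hull mu alpha beta sK).
  + move=> v t t0 vD; exact: (limit_equation fD f_orth f_norm f_dense UF Ulin Ui Usq Ub Uy u_meas u_sq u_f u_span uxy_meas uxy_sq ub_hull sK sv0 Ueq t0 vD).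
  + move=> v s t M s0 st vD b0 b1 b2.
    exact: (limit_equation_between fD f_orth f_norm f_dense UF Ulin Ui Usq Ub Uy u_meas u_sq u_f u_span uxy_meas uxy_sq ub_hull sK sv0 Ueq s0 st vD b0 b1 b2).
split=> [T|t t0].
  exact: (dens_intg fD UF Ulin Usq Uy u_meas u_sq u_f u_span uxy_meas uxy_sq ub_hull mu hgamma T).
exact: (energy_le fD f_orth f_norm UF Ulin Ui Usq Ub Uy u_meas u_sq u_f u_span uxy_meas uxy_sq ub_hull hmu hgamma Uen' t0).
Unshelve. all: by end_near.
Qed.

End Existence.

(** * Initial value, weak formulation and energy inequality *)

Section Assembly.
Context (R : realType).
Variables (mu alpha beta gamma : R) (K : R -> R * R -> R) (u0 : R * R -> R).
Variables (Kn : R * (R * R) -> R) (v0 : R * R -> R).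
Hypotheses (KnE : forall s z, 0 < s -> Omega z -> Kn (s, z) = K s z)
  (v0E : forall z, Omega z -> v0 z = u0 z) (v0out : forall z, ~ Omega z -> v0 z = 0)
  (Knout : forall p, ~ Omega p.2 -> Kn p = 0)
  (sK : forall b, sq leb3 (fun p => win 0 b p * Kn p)) (sv0 : sq leb2 v0).
Variables (u : R -> R * R -> R) (ux uy : R * (R * R) -> R).
Hypotheses (u_sq : forall t, sq leb2 (u t)) (u_out : forall t z, ~ Omega z -> u t z = 0)
  (u_win : forall T, sq leb3 (fun p => win 0 T p * u p.1 p.2))
  (ux_win : forall T, sq leb3 (fun p => win 0 T p * ux p))
  (uy_win : forall T, sq leb3 (fun p => win 0 T p * uy p))
  (ux_out : forall p, ~ Omega p.2 -> ux p = 0) (uy_out : forall p, ~ Omega p.2 -> uy p = 0)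
  (u_bd : forall T, 0 <= T -> exists A, forall s, 0 <= s <= T -> ip leb2 (u s) (u s) <= A).

(* [u 0] is only determined up to its products with test functions, so the
   initial value is imposed by hand. *)
Definition with_initial (t : R) : R * R -> R := if t == 0 then v0 else u t.
Local Notation w := with_initial.

Lemma with_initialE t : 0 < t -> w t = u t.
Proof. by move=> t0; rewrite /w gt_eqF. Qed.

Lemma w_sq t : sq leb2 (w t).
Proof. by rewrite /w; case: ifP. Qed.

Lemma w_out t z : ~ Omega z -> w t z = 0.
Proof. by rewrite /w; case: ifP => _; [exact: v0out|exact: u_out]. Qed.

Lemma w_win T : sq leb3 (fun p => win 0 T p * w p.1 p.2).
Proof.
(* Joint measurability has to survive the change at time 0, so the modified function is written as
   [u] times [1 - d] plus the tensor product of [d] and [v0]. *)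
pose d : R -> R := \1_[set 0].
have md : measurable_fun setT d by exact: measurable_indic.
have d1 s : `|d s| <= 1 by rewrite /d indicE; case: (_ \in _); rewrite ?normr1 ?normr0.
have e1 s : `|1 - d s| <= 1.
  by rewrite /d indicE; case: (_ \in _); rewrite ?subrr ?subr0 ?normr1 ?normr0.
have md3 : measurable_fun setT (fun p : R * (R * R) => 1 - d p.1).
  by apply: measurable_funB => //; apply: measurableT_comp => //; exact: measurable_fst.
have s1 := @sqM_bounded _ _ _ leb3 1 _ _ md3 (u_win T) (fun p => e1 p.1).
have s2 := tensor_sq (@sqM_bounded _ _ _ leb1 1 _ _ md (sq_win1 0 T) d1) sv0.
have := sqD s1 s2; congr sq; apply/funext => p; rewrite /w /win /d indicE.
have -> : (p.1 \in [set 0]) = (p.1 == 0) by apply/idP/eqP; rewrite inE.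
by case: (p.1 == 0) => /=; ring.
Qed.

Lemma w_bd T : 0 <= T -> exists A, forall s, 0 <= s <= T -> ip leb2 (w s) (w s) <= A.
Proof.
move=> /u_bd[A HA]; exists (Num.max A (ip leb2 v0 v0)) => s sT.
by rewrite /w le_max; case: ifP; rewrite ?lexx ?orbT// HA.
Qed.

Section WeakFormulation.
Let h0 := g0 u ux alpha beta Kn.
Let h1 := g1 ux mu.
Let h2 := g2 u ux uy mu.
Hypotheses (h_intg : forall M T, [/\ intg leb3 (fun p => win 0 T p * (h0 p * boxind M p.2)),
    intg leb3 (fun p => win 0 T p * (h1 p * boxind M p.2)) &
    intg leb3 (fun p => win 0 T p * (h2 p * boxind M p.2))])
  (u_eqv : forall v t, 0 <= t -> Cc_infty Omega v ->
    ip leb2 (u t) v - ip leb2 v0 v = Int leb3 (fun p => win 0 t p * flux_form h0 h1 h2 v p))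
  (u_eqst : forall v s t M, 0 <= s -> s <= t -> Cc_infty Omega v -> bsupp M v -> bsupp M (dx v) -> bsupp M (dy v) ->
    intg leb3 (fun p => win s t p * flux_form h0 h1 h2 v p) /\
    ip leb2 (u t) v - ip leb2 (u s) v = Int leb3 (fun p => win s t p * flux_form h0 h1 h2 v p)).

Lemma w_eq v s t M : 0 <= s -> s <= t -> Cc_infty Omega v -> bsupp M v -> bsupp M (dx v) -> bsupp M (dy v) ->
  intg leb3 (fun p => win s t p * flux_form h0 h1 h2 v p) /\
  ip leb2 (w t) v - ip leb2 (w s) v = Int leb3 (fun p => win s t p * flux_form h0 h1 h2 v p).
Proof.
move=> s0 st vD b0 b1 b2; have [i E] := u_eqst s0 st vD b0 b1 b2; split => //.
have [t0|t0] := eqVneq t 0.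
  have s00 : s = 0 by apply/eqP; rewrite eq_le s0 -t0 st.
  rewrite t0 s00 subrr -[LHS](Int0 leb3); apply: eq_Int => p; rewrite /win win1E.
  by case: ifP => [/andP[p0]|_]; rewrite ?mul0r// ltNge p0.
have tp : 0 < t by rewrite lt_neqAle eq_sym t0 (le_trans s0).
(* If [s = 0], the value of [w] is [v0], and the equation started from the initial value replaces
   the one between two times. *)
rewrite (with_initialE tp); move: s0; rewrite le_eqVlt => /predU1P[s00|sp]; last by rewrite with_initialE.
by rewrite -s00 /w eqxx; apply: u_eqv => //; exact: ltW.
Qed.

(** Once every integral is rewritten over the whole space with time windows, the weak formulation is
    exactly the vanishing of the defect on [[0, t]]. *)
Lemma weak_solution t phi : 0 < t -> test_function t phi ->
  weak_formulation mu alpha beta u0 K w (fun t z => ux (t, z)) (fun t z => uy (t, z)) t phi.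
Proof.
move=> t0 tphi; have [B [P [Pt [Px [Py [[tP tPt tPx tPy] sl]]]]]] := test_slices t0 tphi.
have D := defect_eq0 h_intg w_sq w_win w_bd w_eq t0 tP tPt tPx tPy sl.
have [sC sM sP sD] := sl.
have Q0 (Q : R -> R * R -> R) s z : tame_family t B Q -> 0 <= s <= t -> ~ Omega z -> Q s z = 0.
  by move=> tQ st zO; have [_ _ q] := tame_bsupp tQ st; apply: q; apply/negP => /andP[_].
have iT := test_dt_intg w_win tPt.
rewrite /weak_formulation.
have ht : 0 <= t <= t by rewrite ltW/=.
have h00 : 0 <= (0 : R) <= t by rewrite lexx ltW.
rewrite (@Rint_Omega _ (fun z => w t z * phi (t, z)) (fun z => w t z * P t z)); first last.
- by move=> z zO; rewrite w_out// mul0r.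
- by move=> z zO; rewrite sP.
rewrite (@Rint_Omega _ (fun z => u0 z * phi (0, z)) (fun z => w 0 z * P 0 z)); first last.
- by move=> z zO; rewrite w_out// mul0r.
- by move=> z zO; rewrite sP// /w eqxx v0E.
rewrite (@Rint_time _ (fun s z => w s z * 'D_(1, (0, 0)) phi (s, z)) (fun p => w p.1 p.2 * Pt p.1 p.2)); first last.
- by move=> s z _ zO; rewrite /= w_out// mul0r.
- by move=> s z st zO; have [-> _ _] := sD s z st zO.
- exact: iT.
have iF := test_flux_intg h_intg tP tPx tPy.
rewrite (@Rint_time _ _ (fun p => - test_flux h0 h1 h2 P Px Py p)); first last.
- move=> s z st zO; have st' : 0 <= s <= t by case/andP: st => /ltW -> /ltW ->.
  by rewrite /test_flux/= !Q0// !mulr0 !addr0 oppr0.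
- move=> s z st zO; have st' : 0 <= s <= t by case/andP: st => /ltW -> /ltW ->.
  have [_ -> ->] := sD s z st zO; rewrite sP// with_initialE; last by case/andP: st.
  rewrite /test_flux /h0 /h1 /h2 /g0 /g1 /g2 /TO3 /TO /= -KnE//; last by case/andP: st.
  rewrite (_ : 0 < z.2 < 1)//.
  move: (T _ z) (ux _) (uy _) (u s z) (P s z) (Px s z) (Py s z) (Kn _) => *; ring.
- by have := intgN iF; congr intg; apply/funext => p; rewrite mulrN.
apply: etrans D; rewrite /defect; congr (_ + _).
by rewrite -(@IntN _ _ _ leb3 _ iF); apply: eq_Int => p; rewrite mulrN.
Qed.

End WeakFormulation.

Hypotheses (mu0 : 0 < mu) (gamma0 : 0 < gamma).
Hypothesis dens_i : forall T, intg leb3 (fun p => win 0 T p * energy_density u ux uy mu gamma p).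
Hypothesis u_en : forall t, 0 < t -> expR (- (2 * gamma * t)) * ip leb2 (u t) (u t)
      + Int leb3 (fun p => win 0 t p * energy_density u ux uy mu gamma p) <= E0 v0 + kh Kn 0 t.

Lemma energy_bound t : 0 < t ->
  energy (fun z => w t z * expR (- gamma * t))
      + 2^-1 * \int[leb1]_(tau in `]0, t[) \int[leb2]_(z in Omega)
          (expR (- (2 * gamma * tau))
           * (mu * (ux (tau, z) ^+ 2 + uy (tau, z) ^+ 2) + w tau z ^+ 2))
      <= energy u0
         + 2^-1 * \int[leb1]_(tau in `]0, t[) \int[leb2]_(z in Omega)
             (K tau z) ^+ 2.
Proof.
move=> t0; have := u_en t0; rewrite /energy.
rewrite (@Rint_Omega _ _ (fun z => expR (- (2 * gamma * t)) * (u t z * u t z))); first last.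
- by move=> z zO; rewrite u_out// !mulr0.
- move=> z zO; rewrite with_initialE//.
  have -> : - (2 * gamma * t) = - gamma * t + - gamma * t by ring.
  by rewrite expRD; ring.
rewrite (@Rint_Omega _ (fun z => u0 z ^+ 2) (fun z => v0 z * v0 z)); first last.
- by move=> z zO; rewrite v0out// mul0r.
- by move=> z zO; rewrite v0E// expr2.
rewrite (@Rint_time _ _ (energy_density u ux uy mu gamma)) //; first last.
- by move=> s z _ zO; rewrite /energy_density /= ux_out// uy_out// u_out//; ring.
- by move=> s z /andP[s0 _] zO; rewrite with_initialE.
have iK : intg leb3 (fun p => win 0 t p * Kn p ^+ 2).
  by have := win_intgM (sK t) (sK t); congr intg; apply/funext => p; rewrite expr2.
rewrite (@Rint_time _ (fun s z => K s z ^+ 2) (fun p => Kn p ^+ 2)) //; first last.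
- by move=> s z _ zO; rewrite Knout// expr0n.
- by move=> s z /andP[s0 _] zO; rewrite KnE.
rewrite IntZ; last exact: intgM.
rewrite -/(kh Kn 0 t) -[Int leb2 (fun z => u t z * u t z)]/(ip leb2 (u t) (u t)) -[Int leb2 (fun z => v0 z * v0 z)]/(E0 v0).
rewrite -!mulrDr => h; apply: ler_wpM2l => //; by rewrite invr_ge0.
Qed.

End Assembly.

Theorem theorem1p2 (R : realType) (mu alpha beta gamma : R)
    (hmu : 0 < mu)
    (gammaE : gamma = 1 + alpha + beta ^+ 2 / (2 * mu))
    (hgamma : 0 < gamma)
    (u0 : R * R -> R) (hu0 : L2 u0)
    (K : R -> R * R -> R) (hK : forall t : R, 0 < t -> L2L2 t K) :
  exists u ux uy : R -> R * R -> R,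
    global_weak_solution mu alpha beta u0 K u ux uy /\
    {ae leb1, forall t : R, 0 < t ->
      energy (fun z => u t z * expR (- gamma * t))
      + 2^-1 * \int[leb1]_(tau in `]0, t[) \int[leb2]_(z in Omega)
          (expR (- (2 * gamma * tau))
           * (mu * (ux tau z ^+ 2 + uy tau z ^+ 2) + u tau z ^+ 2))
      <= energy u0
         + 2^-1 * \int[leb1]_(tau in `]0, t[) \int[leb2]_(z in Omega)
             (K tau z) ^+ 2}.
Proof.
pose v0 : R * R -> R := u0 \_ Omega.
(* [K] is arbitrary outside the strip and at nonpositive times. Setting it to zero there gives one
   function whose product with every time window is measurable on the whole space; time 0 is
   excluded as well, since the windows contain it. *)
pose Kn (p : R * (R * R)) : R := if (0 < p.1) && (0 < p.2.2 < 1) then K p.1 p.2 else 0.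
have sv0 : sq leb2 v0 by exact/Lfun_sq.
have v0E z : Omega z -> v0 z = u0 z by move=> zO; rewrite /v0 patchE mem_set.
have v0out z : ~ Omega z -> v0 z = 0 by move=> zO; rewrite /v0 patchE memNset.
have KnE s z : 0 < s -> Omega z -> Kn (s, z) = K s z.
  by move=> s0 zO; rewrite /Kn /= s0 (_ : 0 < z.2 < 1).
have Knout p : ~ Omega p.2 -> Kn p = 0 by move=> /negP/negbTE zO; rewrite /Kn zO andbF.
have sK b : sq leb3 (fun p => win 0 b p * Kn p).
  have [b0|b0] := ltP 0 b; last first.
    have := sq0 (@leb3 R); congr sq; apply/funext => p; rewrite /win win1E.
    case: ifP => [/andP[p0 pb]|_]; last by rewrite mul0r.
    by have := le_lt_trans p0 (lt_le_trans pb b0); rewrite ltxx.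
  have := (Lfun_sq _ _).1 (hK b b0); congr sq; apply/funext => -[s z].
  rewrite /win win1E /Kn patchE /=.
  have [zO|zO] := boolP (0 < z.2 < 1); last first.
    by rewrite andbF mulr0 memNset// => -[_ /= zO']; move: zO; rewrite zO'.
  have [sb|sb] := boolP (0 < s < b).
    rewrite mem_set; last by split => //; rewrite /= in_itv.
    by case/andP: sb => s0 sb; rewrite (ltW s0) sb s0 mul1r.
  rewrite memNset; last by move=> [/=]; rewrite in_itv/= (negbTE sb).
  case: ifP => [/andP[_ sb']|_]; last by rewrite mul0r.
  by move: sb; rewrite sb' andbT => /negbTE ->; rewrite mulr0.
have [u [ux [uy [[u_sq u_out _ wins out] u_bd u_H10 [gi eqv eqst] [di en]]]]] :=
  limit_solution hmu gammaE hgamma sK sv0.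
have uwin T := let: And3 a _ _ := wins T in a.
have uxwin T := let: And3 _ a _ := wins T in a.
have uywin T := let: And3 _ _ a := wins T in a.
have uxo p : ~ Omega p.2 -> ux p = 0 by case/out.
have uyo p : ~ Omega p.2 -> uy p = 0 by case/out.
pose w := with_initial v0 u.
have w_H10 : {ae leb1, forall t, 0 < t -> H10 (w t) (fun z => ux (t, z)) (fun z => uy (t, z))}.
  apply: ae_imp u_H10 => t H t0; rewrite /w with_initialE//; exact: H (ltW t0).
exists w, (fun t z => ux (t, z)), (fun t z => uy (t, z)); split; last first.
  apply: aeW => t t0.
  exact: (energy_bound KnE v0E v0out Knout sK u_sq u_out uxo uyo di en t0).
have w0 s z : ~ Omega z -> w s z = 0 by exact: w_out.
have ws s : sq leb2 (w s) by exact: w_sq.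
have ww T := w_win sv0 uwin T.
have L2u t : L2L2 t w by apply: L2L2_sq (ww t) _; exact: w0.
split.
- by move=> t _; apply: L2_sq => // z; exact: w0.
- move=> t t0; split.
    have [A HA] := w_bd v0 u_bd (ltW t0).
    split; first exact: L2u.
    by apply: (LooL2_bound ws w0 (A := A)) => s /andP[s0 st]; apply: HA; rewrite !ltW.
  split.
  + exact: L2u.
  + apply: L2L2_sq => [|s z zO]; last exact: uxo.
    by have := uxwin t; congr sq; apply/funext => -[].
  + apply: L2L2_sq => [|s z zO]; last exact: uyo.
    by have := uywin t; congr sq; apply/funext => -[].
  by apply: ae_imp w_H10 => s H /andP[s0 _]; have [] := H s0.
- move=> t phi t0 tphi.
  exact: (weak_solution KnE v0E v0out sv0 u_sq u_out uwin u_bd gi eqv eqst t0 tphi).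
- exact: w_H10.
by apply: aeW => z zO; rewrite /w /with_initial eqxx v0E.
Qed.
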